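(* Let $-iA$ generate a $C_0$-group $(U(s))_{s\in\mathbb{R}}\subseteq\mathcal{L}(X)$ on a Banach space $X$ with property $(\alpha)$, type $p\in[1,2]$ and cotype $q\in[2,\infty)$. Let $\omega>\theta(U)$, and let $\mathcal{A}\subseteq\mathcal{L}(X)$ be the algebra of bounded operators on $X$ that commute with $A$. Then there exists a constant $C\geq0$ such that $$R_{D_A(\frac1p-\frac1q,1),X}\big(\{f(A)\mid f\in RH^\infty(\mathrm{St}_\omega;\mathcal{A}\cap\mathcal{T})\}\big)\leq C\,R_X(\mathcal{T})$$ for each $R$-bounded $\mathcal{T}\subseteq\mathcal{L}(X)$.
   Context: All Banach spaces are complex and nonzero; $\mathcal{L}(Y,X)$ is the space of bounded operators from $Y$ to $X$. Type and cotype: let $(\gamma_k)_{k\in\mathbb{N}}$ be independent standard complex Gaussian random variables. $X$ has type $p\in[1,2]$ if there is $C$ with $(\mathbb{E}\|\sum_{k=1}^n\gamma_kx_k\|^2)^{1/2}\leq C(\sum_{k=1}^n\|x_k\|^p)^{1/p}$ for all $n$ and $x_1,\dots,x_n\in X$; $X$ has cotype $q\in[2,\infty)$ if there is $C$ with $(\sum_{k=1}^n\|x_k\|^q)^{1/q}\leq C(\mathbb{E}\|\sum_{k=1}^n\gamma_kx_k\|^2)^{1/2}$ for all $n$ and $x_1,\dots,x_n\in X$. $R$-boundedness: a Rademacher sequence $(r_k)$ is a sequence of independent random variables uniformly distributed on the complex unit circle. A set $\mathcal{T}\subseteq\mathcal{L}(Y,X)$ is $R$-bounded if there is $C$ with $(\mathbb{E}\|\sum_{k=1}^nr_kT_kx_k\|_X^2)^{1/2}\leq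 C(\mathbb{E}\|\sum_{k=1}^nr_kx_k\|_Y^2)^{1/2}$ for all $n$, $T_1,\dots,T_n\in\mathcal{T}$ and $x_1,\dots,x_n\in Y$; the minimal $C$ is denoted $R_{Y,X}(\mathcal{T})$, and $R_X:=R_{X,X}$. Property $(\alpha)$: with $(r_k),(r_j')$ mutually independent Rademacher sequences, $X$ has property $(\alpha)$ if there is $C$ with $(\mathbb{E}\|\sum_{j,k=1}^mr_kr_j'\alpha_{j,k}x_{j,k}\|^2)^{1/2}\leq C(\mathbb{E}\|\sum_{j,k=1}^mr_kr_j'x_{j,k}\|^2)^{1/2}$ for all $m$, $x_{j,k}\in X$ and $\alpha_{j,k}\in\mathbb{C}$ with $|\alpha_{j,k}|\leq1$ (expectation over both sequences). Group type: $\theta(U):=\inf\{\theta\geq0\mid\exists M\geq1:\|U(s)\|\leq Me^{\theta|s|}\text{ for all }s\in\mathbb{R}\}$. Strip: $\mathrm{St}_\omega:=\{z\in\mathbb{C}\mid|\mathrm{Im}(z)|<\omega\}$ for $\omega>0$. For $\mathcal{S}\subseteq\mathcal{L}(X)$, $RH^\infty(\mathrm{St}_\omega;\mathcal{S})$ is the set of bounded holomorphic functions $f:\mathrm{St}_\omega\to\mathcal{L}(X)$ with values in $\mathcal{S}$ such that $\{f(z)\mid z\in\mathrm{St}_\omega\}$ is $R$-bounded. Operator-valued calculus: let $\omega>\theta(U)$. For bounded holomorphic $g:\mathrm{St}_\omega\to\mathcal{A}$ with $\|g(z)\|\leq C|z|^{-\alpha}$ on $\mathrm{St}_\omega$ for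 some $C\geq0$, $\alpha>1$, set $g(A):=\frac1{2\pi i}\int_{\partial\mathrm{St}_{\omega'}}g(z)(z-A)^{-1}dz\in\mathcal{L}(X)$, with $\omega'\in(\theta(U),\omega)$ and positively oriented boundary. For general bounded holomorphic $f:\mathrm{St}_\omega\to\mathcal{A}$ set $f(A):=e(A)^{-1}(ef)(A)$ with natural domain, where $e(z):=(i\mu-z)^{-2}$ for a real $\mu>\omega$. In the claim, $f(A)$ is regarded as an operator from $D_A(\frac1p-\frac1q,1)$ to $X$ by restriction. Real interpolation: $D_A(\theta,r):=(X,D(A))_{\theta,r}$ is the real interpolation space (K-method) between $X$ and $D(A)$ with graph norm; in particular $D_A(0,1)=\{0\}$. *)

(* Defs.v *)
From HB Require Import structures.
From mathcomp Require Import all_boot all_order all_algebra.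
From mathcomp Require Export complex.
From mathcomp Require Import all_classical all_reals all_analysis.

Set Implicit Arguments.
Unset Strict Implicit.
Unset Printing Implicit Defensive.

Import Order.TTheory GRing.Theory Num.Theory numFieldNormedType.Exports.

Local Open Scope classical_set_scope.
Local Open Scope complex_scope.
Local Open Scope ring_scope.

Section Norms.
Context {R : realType} {X : completeNormedModType R[i]}.

(* The library norm of a complex normed module takes its (real) values in
   R[i]. *)
Definition rnorm (x : X) : R := complex.Re `|x|.

(* A normed space continuously embedded in X is encoded by its norm, extended
   to X by the value +oo; this is X itself. *)
Definition enorm (x : X) : \bar R := (rnorm x)%:E.

Definition bounded_op (T : X -> X) : Prop :=
  linear T /\ exists M : R, forall x, rnorm (T x) <= M * rnorm x.

Definition opnorm (T : X -> X) : R :=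
  sup [set rnorm (T x) | x in [set x | rnorm x <= 1]].

End Norms.

Section RandomSequences.
Context {R : realType} {d : measure_display} {Omega : measurableType d}.
Variable P : probability Omega R.

(* Complex random variables are measurable functions into R * R. *)
Definition toC (u : R * R) : R[i] := u.1 +i* u.2.

Definition mutually_independent {I : eqType}
    (Z : I -> {RV P >-> (R * R)%type}) : Prop :=
  forall (s : seq I) (B : I -> set (R * R)), uniq s ->
    (forall i, measurable (B i)) ->
    P (\big[setI/setT]_(i <- s) (Z i @^-1` B i))
      = (\prod_(i <- s) P (Z i @^-1` B i))%E.

(* Real and imaginary parts are independent centred real Gaussians of variance
   1/2, so that the expectation of the squared modulus is 1. *)
Definition standard_complex_gaussian (Z : {RV P >-> (R * R)%type}) : Prop :=
  forall B : set (R * R), measurable B ->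
    distribution P Z B =
      (normal_prob 0 (Num.sqrt 2)^-1 \x normal_prob 0 (Num.sqrt 2)^-1)%E B.

Definition uniform_on_circle (Z : {RV P >-> (R * R)%type}) : Prop :=
  forall B : set (R * R), measurable B ->
    distribution P Z B =
      uniform_prob (@ltr01 R)
        ((fun t : R => (cos (2 * pi * t), sin (2 * pi * t))) @^-1` B).

Definition gaussian_sequence (g : nat -> {RV P >-> (R * R)%type}) : Prop :=
  mutually_independent g /\ forall k, standard_complex_gaussian (g k).

Definition rademacher {I : eqType} (r : I -> {RV P >-> (R * R)%type}) : Prop :=
  mutually_independent r /\ forall i, uniform_on_circle (r i).

Definition rademacher_pair (r r' : nat -> {RV P >-> (R * R)%type}) : Prop :=
  rademacher (fun i : nat + nat =>
    match i with inl k => r k | inr j => r' j end).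

End RandomSequences.

Section BanachSpaceGeometry.
Context {R : realType} {X : completeNormedModType R[i]}.
Context {d : measure_display} {Omega : measurableType d}.
Context {P : probability Omega R}.
Implicit Types (g r : nat -> {RV P >-> (R * R)%type}).
Local Open Scope ereal_scope.

Definition has_type g (p : R) : Prop :=
  exists C : R, forall (n : nat) (x : 'I_n -> X),
    'N[P]_2%:E[(fun w => enorm (\sum_(k < n) toC (g k w) *: x k)%R)]
      <= (C * (\sum_(k < n) rnorm (x k) `^ p) `^ p^-1)%:E.

Definition has_cotype g (q : R) : Prop :=
  exists C : R, forall (n : nat) (x : 'I_n -> X),
    ((\sum_(k < n) rnorm (x k) `^ q) `^ q^-1)%:E <=
      C%:E * 'N[P]_2%:E[(fun w => enorm (\sum_(k < n) toC (g k w) *: x k)%R)].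

Definition property_alpha r r' : Prop :=
  exists C : R, forall (m : nat) (x : 'I_m -> 'I_m -> X)
      (a : 'I_m -> 'I_m -> R[i]), (forall j k, (`|a j k| <= 1)%R) ->
    'N[P]_2%:E[(fun w => enorm (\sum_(j < m) \sum_(k < m)
        (toC (r k w) * toC (r' j w) * a j k) *: x j k)%R)] <=
    C%:E * 'N[P]_2%:E[(fun w => enorm (\sum_(j < m) \sum_(k < m)
        (toC (r k w) * toC (r' j w)) *: x j k)%R)].

(* Operators from Y to X, with Y given by its extended norm N; only the
   values on Y = {x | N x < +oo} are used. *)
Definition R_bound_const r (N : X -> \bar R) (T : set (X -> X)) (c : R) : Prop :=
  forall (n : nat) (S : 'I_n -> X -> X) (x : 'I_n -> X),
    (forall k, T (S k)) -> (forall k, N (x k) < +oo) ->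
    'N[P]_2%:E[(fun w => enorm (\sum_(k < n) toC (r k w) *: S k (x k))%R)] <=
    c%:E * 'N[P]_2%:E[(fun w => N (\sum_(k < n) toC (r k w) *: x k)%R)].

(* The minimal constant, +oo when there is none. *)
Definition R_bound r (N : X -> \bar R) (T : set (X -> X)) : \bar R :=
  ereal_inf [set c%:E | c in [set c : R | (0 <= c)%R /\ R_bound_const r N T c]].

Definition R_bounded r (T : set (X -> X)) : Prop :=
  T `<=` bounded_op /\ exists c : R, R_bound_const r enorm T c.

End BanachSpaceGeometry.

Arguments has_type {R} X {d Omega P} g p.
Arguments has_cotype {R} X {d Omega P} g q.
Arguments property_alpha {R} X {d Omega P} r r'.

Section Operators.
Context {R : realType} {X : completeNormedModType R[i]}.

(* Unbounded operators on X are given by their graphs. *)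
Implicit Type A : set (X * X).

Definition op_dom A : set X := [set x | exists y, A (x, y)].

Definition op_fun A (x : X) : X := get [set y | A (x, y)].

Definition C0_group (U : R -> X -> X) : Prop :=
  [/\ forall s, bounded_op (U s),
      forall x, U 0 x = x,
      forall s t x, U (s + t) x = U s (U t x) &
      forall x, continuous (U ^~ x)].

Definition generator (U : R -> X -> X) : set (X * X) :=
  [set xy | (s^-1)%:C *: (U s xy.1 - xy.1) @[s --> (0 : R)^'] --> xy.2].

Definition group_type (U : R -> X -> X) : R :=
  inf [set th | 0 <= th /\ exists M : R, 1 <= M /\
                forall s, opnorm (U s) <= M * expR (th * `|s|)].

Definition strip (w : R) : set R[i] := [set z | `|complex.Im z| < w].

Definition holomorphic_on (D : set R[i]) (f : R[i] -> X -> X) : Prop :=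
  forall z, D z -> exists2 L, bounded_op L &
    opnorm (fun x => (u - z)^-1 *: (f u x - f z x) - L x)
      @[u --> (z : R[i]^o)^'] --> (0 : R).

Definition RHinf {d : measure_display} {Omega : measurableType d}
    {P : probability Omega R} (r : nat -> {RV P >-> (R * R)%type})
    (w : R) (S : set (X -> X)) : set (R[i] -> X -> X) :=
  [set f | [/\ forall z, strip w z -> bounded_op (f z) /\ S (f z),
               exists M : R, forall z, strip w z -> opnorm (f z) <= M,
               holomorphic_on (strip w) f &
               R_bounded r [set f z | z in strip w]]].

Definition commutant A : set (X -> X) :=
  [set T | bounded_op T /\ forall x y, A (x, y) -> A (T x, T y)].

(* Riemann integral of an X-valued function over [a, b]. *)
Definition is_riemann_int (h : R -> X) (a b : R) (I : X) : Prop :=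
  forall e : R, 0 < e -> exists2 del : R, 0 < del &
    forall (n : nat) (t xi : nat -> R), t 0%N = a -> t n = b ->
      (forall i, (i < n)%N -> t i <= xi i <= t i.+1) ->
      (forall i, (i < n)%N -> t i.+1 - t i < del) ->
      rnorm (\sum_(i < n) (t i.+1 - t i)%:C *: h (xi i) - I) < e.

Definition riemann_int (h : R -> X) (a b : R) : X :=
  get (is_riemann_int h a b).

(* Only used for absolutely convergent integrals over the real line. *)
Definition line_int (h : R -> X) : X :=
  lim (riemann_int h (- N) N @[N --> +oo]).

Definition resolvent A (z : R[i]) : X -> X :=
  op_fun [set xy | A (xy.2, z *: xy.2 - xy.1)].

(* g(A) for g of decay |z|^-alpha, alpha > 1: the line Im z = - w' is
   travelled from left to right, the line Im z = w' from right to left. *)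
Definition decay_calc A (w' : R) (g : R[i] -> X -> X) (x : X) : X :=
  ((2 * pi)%:C * 'i)^-1 *:
    (line_int (fun s => g (s +i* - w') (resolvent A (s +i* - w') x))
     - line_int (fun s => g (s +i* w') (resolvent A (s +i* w') x))).

Definition reg (mu : R) (z : R[i]) : R[i] := (mu%:C * 'i - z) ^- 2.

(* f(A) = e(A)^-1 (ef)(A), with natural domain, for e = reg mu. *)
Definition op_calc A (w' mu : R) (f : R[i] -> X -> X) : set (X * X) :=
  [set xy | decay_calc A w' (fun z v => reg mu z *: v) xy.2
            = decay_calc A w' (fun z v => reg mu z *: f z v) xy.1].

(* K-functional of the couple (X, D(A)), D(A) with the graph norm. *)
Definition K_functional A (t : R) (x : X) : R :=
  inf [set rnorm (x - a.1) + t * (rnorm a.1 + rnorm a.2) | a in A].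

(* Norm of D_A(th, r) = (X, D(A))_(th, r), r finite. *)
Definition interp_norm A (th r : R) (x : X) : \bar R :=
  ((\int[lebesgue_measure]_(t in `]0%R, +oo[)
      (((t `^ (- th) * K_functional A t x) `^ r / t)%:E)) `^ r^-1)%E.

Definition interp_space A (th r : R) : set X :=
  [set x | (interp_norm A th r x < +oo)%E].

End Operators.

(* Main.v *)
Require Import Defs.
From HB Require Import structures.
From mathcomp Require Import all_boot all_order all_algebra.
From mathcomp Require Import all_classical all_reals all_analysis.
From mathcomp Require Import perm measurable_realfun ring lra.

(* Put S_n = i kappa_n (i kappa_n - A)^-1 with kappa_n = mu 2^n. Then
   x = S_0^2 x + sum_n S_n^2 y_n, where the increments y_n are controlled by the
   K-functional of x at 2^-n, so it suffices to bound the operators f(A) S_n^2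
   by C N^(1/p - 1/q), N = 2^n, uniformly in the R-bounded sense. The function
   f(z) times the regularizer of S_n^2 is the symbol of a convolution against
   the group; cutting R into blocks of length 2 pi N and sampling turns it into
   a Fourier multiplier on N points. The law of a Gaussian vector is invariant
   under the discrete Fourier transform, so type p and cotype q cost N^(1/p)
   and N^(-1/q), while property (alpha) makes the multiplier with R-bounded
   values act on the Fourier side. The interpolation norm of a random sum is
   then recovered from its scales by Kahane's inequality, proved on the sign
   cube by the argument of Latala and Oleszkiewicz. *)

Set Implicit Arguments.
Unset Strict Implicit.
Unset Printing Implicit Defensive.

Import Order.TTheory GRing.Theory Num.Theory numFieldNormedType.Exports.

Local Open Scope classical_set_scope.
Local Open Scope complex_scope.
Local Open Scope ring_scope.

(** The sampling is exact: at frequencies [zeta + 2 pi j] and times [s + a / N] all phases are N-th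
    roots of unity up to unimodular factors absorbed by the multiplier, and the integrals over the
    cells of [zeta] and [s] stay outside. So no aliasing error has to be estimated. The powers of N
    must balance. The discrete multiplier costs N for two unnormalized transforms, N^(1/p) for type
    and N^(1-1/q) for cotype after Hölder. The average over N times and the cell length 1/N give
    back N^-2, the regularizer at height mu N another N^-2, and the normalization of S_n^2 restores
    N^2. What is left is N^(1/p-1/q). The square in S_n^2 makes the sum over frequency blocks
    converge. The resolvent involves infinite times, but on the upper line only positive and on the
    lower line only negative ones, with geometric decay. Kahane's inequality is forced by a
    direction: the triangle inequality over scales leaves a sum of L2 norms, while the interpolation
    norm controls the L2 norm of a sum. L1 norms add up exactly. *)

(** * Reflection of linear combinations *)

Inductive lexp (K : Type) :=
  | LAtom of nat | LZero | LAdd of lexp K & lexp K | LOpp of lexp K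
  | LScale of K & lexp K.
Arguments LAtom {K}. Arguments LZero {K}. Arguments LAdd {K}.
Arguments LOpp {K}. Arguments LScale {K}.

Section LinearExpressions.
Context {K : comNzRingType} {V : lmodType K}.

Fixpoint leval (env : seq V) (e : lexp K) : V :=
  match e with
  | LAtom n => nth 0 env n
  | LZero => 0
  | LAdd a b => leval env a + leval env b
  | LOpp a => - leval env a
  | LScale c a => c *: leval env a
  end.

Fixpoint lcoef (n : nat) (e : lexp K) : K :=
  match e with
  | LAtom m => if eqn m n then 1 else 0
  | LZero => 0
  | LAdd a b => lcoef n a + lcoef n b
  | LOpp a => - lcoef n a
  | LScale c a => c * lcoef n a
  end.

Fixpoint lcoefs_eq (e1 e2 : lexp K) (n : nat) : Prop :=
  match n with
  | 0 => True
  | S m => lcoefs_eq e1 e2 m /\ lcoef m e1 = lcoef m e2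
  end.

Lemma leval_sum env e : leval env e = \sum_(i < size env) lcoef i e *: nth 0 env i.
Proof.
elim: e => [m||a IHa b IHb|a IH|c a IH] /=.
- have [mn|nm] := ltnP m (size env).
    rewrite (bigD1 (Ordinal mn))//= [eqn m m]eqxx scale1r big1 ?addr0// => i im.
    by rewrite ifF ?scale0r//; apply/negbTE; rewrite eqnE eq_sym; exact: im.
  rewrite nth_default// big1// => i _; rewrite ifF ?scale0r//.
  by apply/negbTE; rewrite eqnE gtn_eqF// (leq_trans (ltn_ord i)).
- by rewrite big1// => i _; rewrite scale0r.
- by rewrite IHa IHb -big_split; apply: eq_bigr => i _; rewrite scalerDl.
- by rewrite IH -sumrN; apply: eq_bigr => i _; rewrite scaleNr.
- by rewrite IH scaler_sumr; apply: eq_bigr => i _; rewrite scalerA.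
Qed.

Lemma leval_eq env e1 e2 : lcoefs_eq e1 e2 (size env) -> leval env e1 = leval env e2.
Proof.
move=> h; rewrite !leval_sum; apply: eq_bigr => i _; congr (_ *: _).
move: (nat_of_ord i) (ltn_ord i) => j; elim: (size env) h => // n IH /= [h1 h2].
by rewrite ltnS leq_eqVlt => /orP[/eqP ->|/(IH h1)].
Qed.

End LinearExpressions.

(** The nested [match] on [Set] makes [constr_eq] run inside a tactic that returns a term; its
    failure selects the next branch. Atoms are compared syntactically. *)
Ltac lmem x l :=
  match l with
  | nil => constr:(cons x nil)
  | cons ?y ?t =>
    match constr:(Set) with
    | _ => let _ := match constr:(Set) with _ => constr_eq x y end in l
    | _ => let t' := lmem x t in constr:(cons y t')
    end
  end.
Ltac lidx x l :=
  match l with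
  | cons ?y ?t =>
    match constr:(Set) with
    | _ => let _ := match constr:(Set) with _ => constr_eq x y end in constr:(0%N)
    | _ => let n := lidx x t in constr:(S n)
    end
  end.
Ltac latoms e l :=
  match e with
  | (?a + ?b)%R => let l1 := latoms a l in latoms b l1
  | (- ?a)%R => latoms a l
  | (?c *: ?a)%R => latoms a l
  | 0%R => l
  | _ => lmem e l
  end.
Ltac lreify K e l :=
  match e with
  | (?a + ?b)%R =>
    let a' := lreify K a l in let b' := lreify K b l in constr:(@LAdd K a' b')
  | (- ?a)%R => let a' := lreify K a l in constr:(@LOpp K a')
  | (?c *: ?a)%R => let a' := lreify K a l in constr:(@LScale K c a')
  | 0%R => constr:(@LZero K)
  | _ => let n := lidx e l in constr:(@LAtom K n)
  end.
(* Reduces an equality of linear combinations to the equality of the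
   coefficients of each atom, left to [ring]. *)
Ltac linear_ring_over K :=
  match goal with
  | |- @eq ?T ?a ?b =>
    let l0 := constr:(@nil T) in
    let l1 := latoms a l0 in
    let l := latoms b l1 in
    let a' := lreify K a l in
    let b' := lreify K b l in
    change (leval l a' = leval l b');
    apply: leval_eq; rewrite /lcoefs_eq /lcoef /=; repeat split
  end.
Ltac lin_ring :=
  match goal with
  | R : realType |- _ => linear_ring_over (R[i] : comNzRingType); try ring
  end.

(** * Complex modulus, seminorms, completeness *)

Section ComplexModulus.
Context {R : realType}.
Implicit Types z u : R[i].

Definition cabs z : R := complex.Re `|z|.

Lemma normC_cabs z : `|z| = (cabs z)%:C.
Proof. by rewrite /cabs normc_def. Qed.

Lemma cabsE z : cabs z = Num.sqrt (complex.Re z ^+ 2 + complex.Im z ^+ 2).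
Proof. by rewrite /cabs normc_def. Qed.

Lemma cabs_ge0 z : 0 <= cabs z.
Proof. by rewrite cabsE sqrtr_ge0. Qed.

Lemma cabsM z u : cabs (z * u) = cabs z * cabs u.
Proof.
by apply: (@complexI R); rewrite rmorphM /= -!normC_cabs normrM.
Qed.

Lemma cabs0 : cabs 0 = 0. Proof. by rewrite /cabs normr0. Qed.
Lemma cabs1 : cabs 1 = 1. Proof. by rewrite /cabs normr1. Qed.
Lemma cabsN z : cabs (- z) = cabs z. Proof. by rewrite /cabs normrN. Qed.
Lemma cabsBC z u : cabs (z - u) = cabs (u - z). Proof. by rewrite /cabs distrC. Qed.

Lemma cabsV z : cabs z^-1 = (cabs z)^-1.
Proof.
by apply: (@complexI R); rewrite fmorphV /= -!normC_cabs normfV.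
Qed.

Lemma cabsX z n : cabs (z ^+ n) = cabs z ^+ n.
Proof. by elim: n => [|n IH]; rewrite ?expr0 ?cabs1// !exprS cabsM IH. Qed.

Lemma cabs_eq0 z : (cabs z == 0) = (z == 0).
Proof. by rewrite -(inj_eq (@complexI R)) -normC_cabs normr_eq0. Qed.

Lemma cabs_gt0 z : (0 < cabs z) = (z != 0).
Proof. by rewrite lt_def cabs_eq0 cabs_ge0 andbT. Qed.

Lemma cabsD z u : cabs (z + u) <= cabs z + cabs u.
Proof. by rewrite -lecR rmorphD /= -!normC_cabs ler_normD. Qed.

Lemma cabs_real (a : R) : cabs a%:C = `|a|.
Proof. by rewrite cabsE /= expr0n addr0 sqrtr_sqr. Qed.

Lemma cabs_i : cabs ('i : R[i]) = 1.
Proof. by rewrite cabsE /= expr0n add0r expr1n sqrtr1. Qed.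

Lemma le_Re_cabs z : `|complex.Re z| <= cabs z.
Proof. by rewrite -sqrtr_sqr cabsE ler_sqrt ?lerDl ?sqr_ge0// addr_ge0 ?sqr_ge0. Qed.

Lemma le_Im_cabs z : `|complex.Im z| <= cabs z.
Proof. by rewrite -sqrtr_sqr cabsE ler_sqrt ?lerDr ?sqr_ge0// addr_ge0 ?sqr_ge0. Qed.

Lemma cabs_le_ReIm z : cabs z <= `|complex.Re z| + `|complex.Im z|.
Proof.
rewrite cabsE -[leRHS]ger0_norm ?addr_ge0// -sqrtr_sqr ler_sqrt ?sqr_ge0//.
rewrite sqrrD !real_normK ?num_real// addrAC lerDl.
by rewrite mulrn_wge0// mulr_ge0.
Qed.

Lemma cabs_sqr z : cabs z ^+ 2 = complex.Re z ^+ 2 + complex.Im z ^+ 2.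
Proof. by rewrite cabsE sqr_sqrtr// addr_ge0 ?sqr_ge0. Qed.

End ComplexModulus.

Section Seminorms.
Context {R : realType}.

(** A seminorm on a bare complex vector space, so that one calculus serves [X], the scalars and
    tuples under a Rademacher norm. *)
Definition snorm (V : lmodType R[i]) (rho : V -> R) : Prop :=
  (forall x y, rho (x + y) <= rho x + rho y) /\
  (forall a x, rho (a *: x) = cabs a * rho x).

Section Theory.
Context {V : lmodType R[i]} {rho : V -> R} (h : snorm rho).

Lemma snormD x y : rho (x + y) <= rho x + rho y. Proof. exact: h.1. Qed.
Lemma snormZ a x : rho (a *: x) = cabs a * rho x. Proof. exact: h.2. Qed.
Lemma snorm0 : rho 0 = 0. Proof. by rewrite -(scale0r 0) snormZ cabs0 mul0r. Qed.
Lemma snormN x : rho (- x) = rho x.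
Proof. by rewrite -scaleN1r snormZ cabsN cabs1 mul1r. Qed.
Lemma snormB x y : rho (x - y) <= rho x + rho y.
Proof. by rewrite -(snormN y) snormD. Qed.
Lemma snorm_ge0 x : 0 <= rho x.
Proof. by have := snormB x x; rewrite subrr snorm0; lra. Qed.
Lemma snormBC x y : rho (x - y) = rho (y - x).
Proof. by rewrite -snormN opprB. Qed.
Lemma snorm_sum (I : Type) (s : seq I) (P : pred I) (F : I -> V) :
  rho (\sum_(i <- s | P i) F i) <= \sum_(i <- s | P i) rho (F i).
Proof.
elim/big_rec2: _ => [|i y1 y2 _ le]; first by rewrite snorm0.
by apply: le_trans (snormD _ _) _; rewrite lerD2l.
Qed.
Lemma snorm_le_add x y : rho x <= rho y + rho (x - y).
Proof. by rewrite -{1}(subrK y x) addrC snormD. Qed.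

End Theory.

Lemma snorm_cabs : snorm (cabs : R[i]^o -> R).
Proof. by split=> [x y|a x]; [exact: cabsD|exact: cabsM]. Qed.

End Seminorms.

Section Rnorm.
Context {R : realType} {X : completeNormedModType R[i]}.
Implicit Types x y : X.

Lemma norm_rnorm x : `|x| = (rnorm x)%:C.
Proof. by rewrite RRe_real// ger0_real. Qed.

Lemma snorm_rnorm : snorm (@rnorm R X).
Proof.
split=> [x y|a x].
  by rewrite -lecR rmorphD /= -!norm_rnorm ler_normD.
by apply: (@complexI R); rewrite rmorphM /= -!norm_rnorm -normC_cabs normrZ.
Qed.

Lemma rnorm_ge0 x : 0 <= rnorm x. Proof. exact: (snorm_ge0 snorm_rnorm). Qed.
Lemma rnorm0 : rnorm (0 : X) = 0. Proof. exact: (snorm0 snorm_rnorm). Qed.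
Lemma rnormN x : rnorm (- x) = rnorm x. Proof. exact: (snormN snorm_rnorm). Qed.
Lemma rnormD x y : rnorm (x + y) <= rnorm x + rnorm y.
Proof. exact: (snormD snorm_rnorm). Qed.
Lemma rnormB x y : rnorm (x - y) <= rnorm x + rnorm y.
Proof. exact: (snormB snorm_rnorm). Qed.
Lemma rnormBC x y : rnorm (x - y) = rnorm (y - x).
Proof. exact: (snormBC snorm_rnorm). Qed.
Lemma rnormZ a x : rnorm (a *: x) = cabs a * rnorm x.
Proof. exact: (snormZ snorm_rnorm). Qed.
Lemma rnorm_eq0 x : (rnorm x == 0) = (x == 0).
Proof. by rewrite -(inj_eq (@complexI R)) -norm_rnorm normr_eq0. Qed.
Lemma rnorm_le0 x : rnorm x <= 0 -> x = 0.
Proof. by move=> h; apply/eqP; rewrite -rnorm_eq0 eq_le h rnorm_ge0. Qed.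

Lemma rnorm_small x : (forall e : R, 0 < e -> rnorm x <= e) -> x = 0.
Proof. by move=> h; apply: rnorm_le0; apply/ler_addgt0Pl => e /h; rewrite addr0. Qed.

Lemma cvg_rnormP {T : Type} (F : set_system T) {FF : Filter F} (f : T -> X) (l : X) :
  f @ F --> l <-> forall e : R, 0 < e -> \forall t \near F, rnorm (f t - l) < e.
Proof.
split=> [/cvgrPdist_lt h e e0|h].
  have /h : (0 : R[i]) < e%:C by rewrite ltcR.
  by apply: filterS => t; rewrite norm_rnorm ltcR rnormBC.
apply/cvgrPdist_lt => e; rewrite ltcE /= => /andP[/eqP e1 e0].
have -> : e = (complex.Re e)%:C.
  by case: e e1 e0 => a b /= -> _.
by apply: filterS (h _ e0) => t; rewrite norm_rnorm ltcR rnormBC.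
Qed.

Lemma cvgn_rnormP (f : nat -> X) (l : X) :
  f @ \oo --> l <->
  forall e : R, 0 < e -> exists N, forall n, (N <= n)%N -> rnorm (f n - l) < e.
Proof.
rewrite cvg_rnormP; split=> h e /h; first by case=> N _ hN; exists N.
by case=> N hN; exists N.
Qed.

Lemma rnorm_complete (f : nat -> X) :
  (forall e : R, 0 < e -> exists N, forall m n, (N <= m)%N -> (N <= n)%N ->
     rnorm (f m - f n) < e) ->
  exists l, forall e : R, 0 < e -> exists N, forall n, (N <= n)%N -> rnorm (f n - l) < e.
Proof.
move=> h; suff : cvg (f @ \oo) by move=> /cvg_ex[l /cvgn_rnormP]; exists l.
apply/cauchy_cvgP/cauchy_ballP => e; rewrite ltcE /= => /andP[/eqP e1 e0].
have [N hN] := h _ e0.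
exists ([set f n | n in [set n | (N <= n)%N]], [set f n | n in [set n | (N <= n)%N]]).
  by split; exists N => // n /= hn; exists n.
case=> _ _ /= [[m hm <-] [n hn <-]]; rewrite -ball_normE /ball_ /=.
have -> : e = (complex.Re e)%:C by case: e e1 e0 hN => a b /= -> _.
by rewrite norm_rnorm ltcR; exact: hN.
Qed.

End Rnorm.

(** The local hypothesis at the supremum [x] of the endpoints reachable from [a] shows that [x] is
    reachable, and so is a point beyond it unless [x = b]. This stands in for the compactness of
    [[a, b]] wherever a pointwise choice must become uniform. *)
Lemma cousin {R : realType} (P : R -> R -> Prop) (a b : R) : a <= b ->
  (forall u m v, a <= u -> u <= m -> m <= v -> v <= b -> P u m -> P m v -> P u v) ->
  (forall s, a <= s <= b -> exists2 del, 0 < del & forall u v, a <= u -> v <= b ->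
     u <= s -> s <= v -> v - u < del -> P u v) -> P a b.
Proof.
move=> ab Padd Ploc.
pose S := [set x | a <= x <= b /\ P a x].
have Sa : S a.
  split; first by rewrite lexx.
  have [|del del0 h] := Ploc a; first by rewrite lexx.
  by apply: h => //; rewrite subrr.
have Sub : ubound S b by move=> x [/andP[]].
have hS : has_sup S by split; [exists a|exists b].
set x := sup S.
have xb : x <= b by apply: ge_sup => //; exists a.
have ax : a <= x by apply: ub_le_sup => //; exists b.
have [|del del0 h] := Ploc x; first by rewrite ax.
have [y [/andP[ay yb] Py] xy] : exists2 y, S y & x - del < y.
  by apply: sup_adherent.
have yx : y <= x by apply: ub_le_sup; [exists b|split => //; rewrite ay].
have Pax : P a x.
  have [axe|] := eqVneq a x.
    by rewrite -axe; case: Sa.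
  by move=> _; apply: (Padd _ y) => //; apply: h => //; lra.
pose v := Num.min b (x + del / 2).
have xv : x <= v by rewrite le_min xb /=; lra.
have vb : v <= b by rewrite ge_min lexx.
have Pv : P a v.
  apply: (Padd _ x) => //; apply: h => //.
  have : v <= x + del / 2 by rewrite ge_min lexx orbT.
  lra.
have : v <= x.
  by apply: ub_le_sup; [exists b|split => //; rewrite (le_trans ax xv)].
rewrite ge_min => /orP[bx|]; last by lra.
by move: Pax; have -> : x = b by apply/eqP; rewrite eq_le xb.
Qed.

(** * Vector-valued calculus *)

Section VCalculus.
Context {R : realType} {V : lmodType R[i]} (rho : V -> R) (hr : snorm rho).

(** Little-o form of the derivative, with no division and with weak inequalities: it makes sense for
    a seminorm and passes through seminorm estimates. *)
Definition vder (phi : R -> V) (s : R) (v : V) : Prop :=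
  forall e, 0 < e -> exists2 del, 0 < del & forall t, `|t - s| < del ->
    rho (phi t - phi s - (t - s)%:C *: v) <= e * `|t - s|.

Definition vcont (g : R -> V) (s : R) : Prop :=
  forall e, 0 < e -> exists2 del, 0 < del & forall t, `|t - s| < del ->
    rho (g t - g s) <= e.

Definition rder (G : R -> R) (s : R) (g : R) : Prop :=
  forall e, 0 < e -> exists2 del, 0 < del & forall t, `|t - s| < del ->
    `|G t - G s - (t - s) * g| <= e * `|t - s|.

(** With an additional [e * (v - u)] the inequality is additive over adjacent intervals, and on a
    short interval around [s] it follows by expanding both functions at [s]; [cousin] glues. Neither
    integrals nor completeness enter, so it can serve before primitives exist and in tuple
    spaces. *)
Lemma mean_value_ineq (phi dphi : R -> V) (G dG : R -> R) a b : a <= b ->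
  (forall s, a <= s <= b -> vder phi s (dphi s)) ->
  (forall s, a <= s <= b -> rder G s (dG s)) ->
  (forall s, a <= s <= b -> rho (dphi s) <= dG s) ->
  rho (phi b - phi a) <= G b - G a.
Proof.
move=> ab hphi hG hd; apply/ler_addgt0Pl => e0 e00.
pose e := e0 / (b - a + 1).
have ba1 : 0 < b - a + 1 by lra.
have e_gt0 : 0 < e by rewrite divr_gt0.
suff : rho (phi b - phi a) <= G b - G a + e * (b - a).
  have : e * (b - a) <= e0.
    by rewrite /e -mulrA ler_piMr ?(ltW e00)// mulrC ler_pdivrMr//; lra.
  lra.
apply: (@cousin R (fun u v => rho (phi v - phi u) <= G v - G u + e * (v - u))) => //.
  move=> u m v _ _ _ _ h1 h2.
  have -> : phi v - phi u = (phi v - phi m) + (phi m - phi u).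
    by rewrite addrA subrK.
  have := snormD hr (phi v - phi m) (phi m - phi u).
  have -> : e * (v - u) = e * (v - m) + e * (m - u) by ring.
  lra.
move=> s sab.
have e20 : 0 < e / 2 by lra.
have [d1 d10 h1] := hphi s sab _ e20.
have [d2 d20 h2] := hG s sab _ e20.
exists (Num.min d1 d2); first by rewrite lt_min d10.
move=> u v au vb us sv; rewrite lt_min => /andP[uv1 uv2].
have nu : `|u - s| = s - u by rewrite distrC ger0_norm ?subr_ge0.
have nv : `|v - s| = v - s by rewrite ger0_norm ?subr_ge0.
have A1 : rho (phi v - phi s) <= (v - s) * dG s + e / 2 * (v - s).
  have := h1 v; rewrite nv => /(_ ltac:(lra)) hh.
  have := snorm_le_add hr (phi v - phi s) ((v - s)%:C *: dphi s).
  rewrite snormZ// cabs_real nv => h3.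
  have := ler_wpM2l (_ : 0 <= v - s) (hd s sab); lra.
have A2 : rho (phi s - phi u) <= (s - u) * dG s + e / 2 * (s - u).
  have := h1 u; rewrite nu => /(_ ltac:(lra)) hh.
  have := snorm_le_add hr (phi u - phi s) ((u - s)%:C *: dphi s).
  rewrite snormZ// cabs_real nu (snormBC hr (phi u)) => h3.
  have := ler_wpM2l (_ : 0 <= s - u) (hd s sab); lra.
have := h2 v; rewrite nv => /(_ ltac:(lra)); rewrite ler_distl => /andP[B1 _].
have := h2 u; rewrite nu => /(_ ltac:(lra)); rewrite ler_distl => /andP[_ B2].
have -> : phi v - phi u = (phi v - phi s) + (phi s - phi u).
  by rewrite addrA subrK.
have := snormD hr (phi v - phi s) (phi s - phi u).
have : e * (v - u) = e * (v - s) + e * (s - u) by ring.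
have : e / 2 * (v - s) = e * (v - s) / 2 by ring.
have : e / 2 * (s - u) = e * (s - u) / 2 by ring.
lra.
Qed.

Lemma rder_lin K s : rder (fun t => K * t) s K.
Proof.
move=> e e0; exists 1 => // t _.
by rewrite (_ : _ - _ - _ = 0) ?normr0 ?mulr_ge0 ?(ltW e0)//; ring.
Qed.

Lemma mean_value_const (phi dphi : R -> V) K a b : a <= b ->
  (forall s, a <= s <= b -> vder phi s (dphi s)) ->
  (forall s, a <= s <= b -> rho (dphi s) <= K) ->
  rho (phi b - phi a) <= K * (b - a).
Proof.
move=> ab h1 h2.
have -> : K * (b - a) = K * b - K * a by ring.
by apply: (@mean_value_ineq phi dphi _ (fun=> K)) => // s _; exact: rder_lin.
Qed.

Lemma vderD phi psi s v w : vder phi s v -> vder psi s w ->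
  vder (fun t => phi t + psi t) s (v + w).
Proof.
move=> h1 h2 e e0; have e20 : 0 < e / 2 by lra.
have [d1 d10 H1] := h1 _ e20; have [d2 d20 H2] := h2 _ e20.
exists (Num.min d1 d2) => [|t]; rewrite lt_min ?d10// => /andP[/H1 k1 /H2 k2].
have := snormD hr (phi t - phi s - (t - s)%:C *: v) (psi t - psi s - (t - s)%:C *: w).
rewrite (_ : _ + (_ - _ - _) = phi t + psi t - (phi s + psi s) - (t - s)%:C *: (v + w)); last first.
  by lin_ring.
have : e * `|t - s| = e / 2 * `|t - s| + e / 2 * `|t - s| by field.
lra.
Qed.

Lemma vderZ a phi s v : vder phi s v -> vder (fun t => a *: phi t) s (a *: v).
Proof.
move=> h e e0.
have ha : 0 < e / (cabs a + 1) by rewrite divr_gt0// ltr_wpDl// cabs_ge0.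
have [d d0 H] := h _ ha; exists d => // t /H.
rewrite scalerA (mulrC _ a) -scalerA -!scalerBr snormZ// => k.
apply: le_trans (ler_wpM2l (cabs_ge0 a) k) _.
rewrite mulrA ler_wpM2r// mulrA ler_pdivrMr ?ltr_wpDl ?cabs_ge0//.
have := cabs_ge0 a; nra.
Qed.

Lemma vderB phi psi s v w : vder phi s v -> vder psi s w ->
  vder (fun t => phi t - psi t) s (v - w).
Proof.
move=> h1 h2; have := vderD h1 (vderZ (-1) h2).
rewrite scaleN1r; under [X in vder X]boolp.eq_fun do rewrite scaleN1r; by [].
Qed.

Lemma vder_lin (v : V) s : vder (fun t => t%:C *: v) s v.
Proof.
move=> e e0; exists 1 => // t _; rewrite rmorphB scalerBl subrr snorm0//.
by rewrite mulr_ge0 ?(ltW e0).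
Qed.

Lemma vder_shift phi c s v : vder phi (s + c) v -> vder (fun t => phi (t + c)) s v.
Proof.
move=> h e /h [d d0 H]; exists d => // t ts.
by have := H (t + c); rewrite opprD addrACA subrr addr0; apply.
Qed.

Lemma vder_refl phi s v : vder phi (- s) v -> vder (fun t => phi (- t)) s (- v).
Proof.
move=> h e /h [d d0 H]; exists d => // t ts.
have := H (- t); rewrite -opprD normrN => /(_ ts).
by rewrite rmorphN scaleNr scalerN.
Qed.

Lemma vder_cont phi s v : vder phi s v -> vcont phi s.
Proof.
move=> h e e0; have [d d0 H] := h 1 ltr01.
have k0 : 0 < rho v + 1 by rewrite ltr_wpDl// snorm_ge0.
exists (Num.min d (e / (rho v + 1))); first by rewrite lt_min d0 divr_gt0.
move=> t; rewrite lt_min => /andP[/H k]; rewrite ltr_pdivlMr// => k2.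
have := snorm_le_add hr (phi t - phi s) ((t - s)%:C *: v).
rewrite snormZ// cabs_real; lra.
Qed.

Lemma vcontD g h s : vcont g s -> vcont h s -> vcont (fun t => g t + h t) s.
Proof.
move=> h1 h2 e e0; have e20 : 0 < e / 2 by lra.
have [d1 d10 H1] := h1 _ e20; have [d2 d20 H2] := h2 _ e20.
exists (Num.min d1 d2) => [|t]; rewrite lt_min ?d10// => /andP[/H1 k1 /H2 k2].
have := snormD hr (g t - g s) (h t - h s); rewrite addrACA -opprD; lra.
Qed.

Lemma vcontZ a g s : vcont g s -> vcont (fun t => a *: g t) s.
Proof.
move=> h e e0.
have ha : 0 < e / (cabs a + 1) by rewrite divr_gt0// ltr_wpDl// cabs_ge0.
have [d d0 H] := h _ ha; exists d => // t /H.
rewrite -!scalerBr snormZ// ler_pdivlMr ?ltr_wpDl ?cabs_ge0// => k.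
have := cabs_ge0 a; have := snorm_ge0 hr (g t - g s); nra.
Qed.

Lemma vcont_cst v s : vcont (fun=> v) s.
Proof. by move=> e e0; exists 1 => // t _; rewrite subrr snorm0 ?(ltW e0). Qed.

Lemma vcont_shift g c s : vcont g (s + c) -> vcont (fun t => g (t + c)) s.
Proof.
move=> h e /h [d d0 H]; exists d => // t ts.
by have := H (t + c); rewrite opprD addrACA subrr addr0; apply.
Qed.

Lemma vcont_sum (I : Type) (s0 : seq I) (F : I -> R -> V) s :
  (forall i, vcont (F i) s) -> vcont (fun t => \sum_(i <- s0) F i t) s.
Proof.
move=> h; elim: s0 => [|i s0 IH].
  by under [X in vcont X]boolp.eq_fun do rewrite big_nil; exact: vcont_cst.
by under [X in vcont X]boolp.eq_fun do rewrite big_cons; exact: vcontD.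
Qed.

Lemma vcont_unif (g : R -> V) a b : a <= b -> (forall s, vcont g s) ->
  forall e, 0 < e -> exists2 del, 0 < del &
    forall s t, a <= s <= b -> `|t - s| < del -> rho (g t - g s) <= e.
Proof.
move=> ab hg e e0.
pose P u v := exists2 del, 0 < del &
    forall s t, u <= s <= v -> `|t - s| < del -> rho (g t - g s) <= e.
apply: (@cousin R P a b ab).
  move=> u m v _ um mv _ [d1 d10 h1] [d2 d20 h2].
  exists (Num.min d1 d2) => [|s t /andP[us sv]]; rewrite lt_min ?d10// => /andP[k1 k2].
  by have [sm|/ltW ms] := leP s m; [apply: h1|apply: h2] => //; rewrite ?us ?ms.
move=> s _; have e20 : 0 < e / 2 by lra.
have [d d0 h] := hg s _ e20.
exists (d / 2); first lra.
move=> u v _ _ us sv uv; exists (d / 2); first lra.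
move=> x t /andP[ux xv] tx.
have xs : `|x - s| < d / 2 by rewrite ltr_distl; apply/andP; split; lra.
have k1 := h x ltac:(lra).
have : `|t - s| < d.
  by have := ler_normD (t - x) (x - s); rewrite addrA subrK; lra.
move=> /h k2; have := snormD hr (g t - g s) (g s - g x).
by rewrite addrA subrK (snormBC hr (g s)); lra.
Qed.

Lemma vder0_const (phi : R -> V) : (forall s, vder phi s 0) ->
  forall a b, rho (phi b - phi a) = 0.
Proof.
move=> h; have H a b : a <= b -> rho (phi b - phi a) = 0.
  move=> ab; apply/eqP; rewrite eq_le snorm_ge0// andbT.
  have := @mean_value_const phi (fun=> 0) 0 a b ab (fun s _ => h s).
  by rewrite mul0r; apply => s _; rewrite snorm0.
move=> a b; have [/H//|/ltW/H] := leP a b.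
by rewrite snormBC.
Qed.

End VCalculus.

Local Notation vder_of := vder (only parsing).

Definition mesh {R : realType} (n : nat) : R := n.+1%:R^-1.

Lemma mesh_gt0 {R : realType} n : 0 < mesh n :> R.
Proof. by rewrite invr_gt0 ltr0n. Qed.

Section Integral.
Context {R : realType} {X : completeNormedModType R[i]}.
Local Notation vcont := (vcont (@rnorm R X)).
Local Notation vder := (vder (@rnorm R X)).
Implicit Types (g h : R -> X).
Let hr := @snorm_rnorm R X.

Let fl (n : nat) (t : R) : int := Num.floor (t / mesh n).
Let cnt n u v : nat := `|fl n v - fl n u|%N.
(** Sums over one global grid of step [mesh n], between the cells of the two endpoints: they add up
    exactly over adjacent intervals, and the price is an error of one cell at the ends. *)
Let grid g n u v : X :=
  \sum_(k < cnt n u v) (mesh n)%:C *: g ((fl n u + k%:Z)%:~R * mesh n).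

Let fl_le n u v : u <= v -> fl n u <= fl n v.
Proof. by move=> uv; apply: le_floor; rewrite ler_wpM2r// invr_ge0 ltW// mesh_gt0. Qed.

Let fl_bnd n t : t - mesh n <= (fl n t)%:~R * mesh n <= t.
Proof.
have n0 : 0 < mesh n :> R := mesh_gt0 n.
have h1 := floor_le_tmp (t / mesh n); have h2 := lt_succ_floor (t / mesh n).
rewrite ler_pdivlMr// in h1; rewrite ltr_pdivrMr// in h2.
rewrite intrD mulrDl mul1r in h2; rewrite /fl; apply/andP; split; lra.
Qed.

Let cntE n u v : u <= v -> (cnt n u v)%:R = (fl n v)%:~R - (fl n u)%:~R :> R.
Proof.
move=> uv; rewrite /cnt -intrB natr_absz ger0_norm ?subr_ge0 ?fl_le//.
Qed.

Let grid_add g n u m v : u <= m -> m <= v -> grid g n u v = grid g n u m + grid g n m v.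
Proof.
move=> um mv; rewrite /grid.
have E : cnt n u v = (cnt n u m + cnt n m v)%N.
  apply/eqP; rewrite -(eqr_nat R) natrD !cntE// ?(le_trans um)//; apply/eqP; ring.
rewrite E big_split_ord /=; congr (_ + _); apply: eq_bigr => k _.
congr (_ *: g (_%:~R * _)); rewrite PoszD addrA; congr (_ + _).
by apply: (@intr_inj R); rewrite intrD -pmulrn cntE//; ring.
Qed.

Let grid_close g n u v y e : u <= v -> 0 <= e ->
  (forall x, u - mesh n <= x <= v -> rnorm (g x - y) <= e) ->
  rnorm (grid g n u v - (v - u)%:C *: y)
    <= e * (v - u + mesh n) + mesh n * rnorm y.
Proof.
move=> uv e0 h.
have n0 : 0 < mesh n :> R := mesh_gt0 n.
have /andP[b1 b2] := fl_bnd n u; have /andP[b3 b4] := fl_bnd n v.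
have [m mdef] : exists m, m = (cnt n u v)%:R * mesh n :> R by eexists.
have mE : m = (fl n v)%:~R * mesh n - (fl n u)%:~R * mesh n.
  by rewrite mdef cntE// mulrBl.
have -> : grid g n u v - (v - u)%:C *: y =
   \sum_(k < cnt n u v) (mesh n)%:C *: (g ((fl n u + k%:Z)%:~R * mesh n) - y)
   + (m - (v - u))%:C *: y.
  under eq_bigr do rewrite scalerBr.
  rewrite sumrB sumr_const card_ord -/(grid g n u v).
  have -> : (mesh n)%:C *: y *+ cnt n u v = m%:C *: y.
    by rewrite -scaler_nat scalerA mdef rmorphM /= rmorph_nat.
  by lin_ring.
apply: le_trans (rnormD _ _) _; apply: lerD.
  apply: le_trans (snorm_sum hr _ _ _) _.
  apply: (@le_trans _ _ (\sum_(k < cnt n u v) mesh n * e)).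
    apply: ler_sum => k _; rewrite rnormZ cabs_real ger0_norm ?(ltW n0)//.
    apply: ler_wpM2l; first exact: ltW.
    apply: h; rewrite intrD mulrDl.
    have k1 : 0 <= (k : nat)%:~R * mesh n :> R by rewrite mulr_ge0 ?ler0n ?(ltW n0).
    have k2 : (k : nat)%:~R * mesh n <= m.
      by rewrite mdef ler_pM2r// ler_nat ltnW.
    apply/andP; split; lra.
  rewrite sumr_const card_ord -[X in X <= _]mulr_natl mulrA mulrC ler_wpM2l// -mdef.
  lra.
rewrite rnormZ cabs_real ler_wpM2r ?rnorm_ge0// ler_norml; apply/andP; split; lra.
Qed.

Let inv_small (e : R) : 0 < e -> exists N, forall n, (N <= n)%N -> mesh n < e.
Proof.
move=> e0; exists (Num.truncn e^-1) => n hn.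
rewrite invf_plt ?posrE ?ltr0n//.
apply: lt_le_trans (Num.Theory.truncnS_gt _) _; by rewrite ler_nat ltnS.
Qed.

(** For [cousin] the error is split into [e1 * (v - u)], which adds up over adjacent intervals, and
    a slack [eta], which may be halved at each gluing. On a short interval around [s] both sums are
    close to [(v - u) * g s], and the slack absorbs the end cells. *)
Let grid_cauchy g u v : (forall s, vcont g s) -> u <= v ->
  forall e, 0 < e -> exists N, forall m n, (N <= m)%N -> (N <= n)%N ->
     rnorm (grid g m u v - grid g n u v) < e.
Proof.
move=> hg uv e e0.
pose e1 := e / (v - u + 2).
have e10 : 0 < e1 by rewrite divr_gt0//; lra.
suff H : forall eta, 0 < eta -> exists N, forall m n, (N <= m)%N -> (N <= n)%N ->
     rnorm (grid g m u v - grid g n u v) <= e1 * (v - u) + eta.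
  have [N hN] := H e1 e10; exists N => m n mN nN.
  apply: le_lt_trans (hN m n mN nN) _.
  rewrite -[X in _ + X]mulr1 -mulrDr /e1 mulrAC ltr_pdivrMr; last lra.
  by rewrite ltr_pM2l//; lra.
apply: (@cousin R (fun u v => forall eta, 0 < eta -> exists N, forall m n,
     (N <= m)%N -> (N <= n)%N ->
     rnorm (grid g m u v - grid g n u v) <= e1 * (v - u) + eta)) => //.
  move=> a c b _ ac cb _ h1 h2 eta eta0.
  have eta20 : 0 < eta / 2 by lra.
  have [N1 H1] := h1 _ eta20; have [N2 H2] := h2 _ eta20.
  exists (maxn N1 N2) => m n; rewrite !geq_max => /andP[m1 m2] /andP[n1 n2].
  rewrite !(grid_add _ _ ac cb) opprD addrACA.
  have := H1 m n m1 n1; have := H2 m n m2 n2.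
  have := rnormD (grid g m a c - grid g n a c) (grid g m c b - grid g n c b).
  have : e1 * (b - a) = e1 * (c - a) + e1 * (b - c) by ring.
  lra.
move=> s _.
have e40 : 0 < e1 / 2 by lra.
have [d d0 hd] := hg s _ e40.
exists (d / 2); first lra.
move=> a b _ _ as_ sb ab eta eta0.
have Y0 := rnorm_ge0 (g s).
pose eps := Num.min (d / 2) (eta / (2 * (e1 + rnorm (g s) + 1))).
have den0 : 0 < 2 * (e1 + rnorm (g s) + 1) by lra.
have eps0 : 0 < eps by rewrite lt_min divr_gt0// divr_gt0//.
have [N hN] := inv_small eps0; exists N.
have C n : (N <= n)%N -> rnorm (grid g n a b - (b - a)%:C *: g s) <=
    e1 / 2 * (b - a) + eta / 2.
  move=> /hN; rewrite lt_min => /andP[k1 k2].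
  have := @grid_close g n a b (g s) (e1 / 2) (le_trans as_ sb) (ltW e40).
  have -> : (forall x, a - mesh n <= x <= b -> rnorm (g x - g s) <= e1 / 2) = True.
    apply/propext; split => // _ x /andP[x1 x2]; apply: hd.
    rewrite ltr_distl; apply/andP; split; lra.
  move=> /(_ I) h; apply: (le_trans h).
  rewrite ltr_pdivlMr// in k2.
  have i0 : 0 <= mesh n :> R by rewrite ltW// mesh_gt0.
  have : e1 / 2 * mesh n + mesh n * rnorm (g s) <= eta / 2 by nra.
  lra.
move=> m n /C c1 /C c2.
have := rnormB (grid g m a b - (b - a)%:C *: g s) (grid g n a b - (b - a)%:C *: g s).
rewrite opprB addrA subrK; lra.
Qed.

Let limgrid g u v : X := get [set l : X | forall e : R, 0 < e ->
   exists N, forall n, (N <= n)%N -> rnorm (grid g n u v - l) < e].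

Let limgridP g u v : (forall s, vcont g s) -> u <= v -> forall e, 0 < e ->
   exists N, forall n, (N <= n)%N -> rnorm (grid g n u v - limgrid g u v) < e.
Proof.
move=> hg uv; have [l hl] := rnorm_complete (@grid_cauchy g u v hg uv).
by apply: (@getPex _ [set l : X | forall e : R, 0 < e ->
   exists N, forall n, (N <= n)%N -> rnorm (grid g n u v - l) < e]); exists l.
Qed.

Let limgrid_add g u m v : (forall s, vcont g s) -> u <= m -> m <= v ->
  limgrid g u v = limgrid g u m + limgrid g m v.
Proof.
move=> hg um mv; apply/eqP; rewrite -subr_eq0; apply/eqP/rnorm_small => e e0.
have e30 : 0 < e / 3 by lra.
have [N1 h1] := @limgridP g u v hg (le_trans um mv) _ e30.
have [N2 h2] := @limgridP g u m hg um _ e30.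
have [N3 h3] := @limgridP g m v hg mv _ e30.
pose n := maxn N1 (maxn N2 N3).
have := h1 n (leq_maxl _ _).
have := h2 n (leq_trans (leq_maxl _ _) (leq_maxr _ _)).
have := h3 n (leq_trans (leq_maxr _ _) (leq_maxr _ _)).
rewrite (@grid_add g n u m v um mv).
set A := grid _ _ _ _; set B := grid _ _ _ _.
set l1 := limgrid g u v; set l2 := limgrid g u m; set l3 := limgrid g m v.
move=> k1 k2 k3.
have -> : l1 - (l2 + l3) = - (B + A - l1) + (B - l2) + (A - l3) by lin_ring.
have := rnormD (- (B + A - l1) + (B - l2)) (A - l3).
have := rnormD (- (B + A - l1)) (B - l2); rewrite rnormN; lra.
Qed.

Let limgrid_close g u v y e eta : (forall s, vcont g s) -> u <= v -> 0 <= e -> 0 < eta ->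
  (forall x, u - eta <= x <= v -> rnorm (g x - y) <= e) ->
  rnorm (limgrid g u v - (v - u)%:C *: y) <= e * (v - u).
Proof.
move=> hg uv e0 eta0 h; apply/ler_addgt0Pl => e1 e10.
pose eps := Num.min eta (e1 / (2 * (e + rnorm y + 1))).
have Y0 := rnorm_ge0 y.
have den0 : 0 < 2 * (e + rnorm y + 1) by lra.
have eps0 : 0 < eps by rewrite lt_min eta0 divr_gt0.
have [N1 h1] := inv_small eps0.
have e120 : 0 < e1 / 2 by lra.
have [N2 h2] := limgridP hg uv e120.
pose n := maxn N1 N2.
have := h1 n (leq_maxl _ _); rewrite lt_min => /andP[k1 k2].
have := h2 n (leq_maxr _ _).
have := @grid_close g n u v y e uv e0.
have -> : (forall x, u - mesh n <= x <= v -> rnorm (g x - y) <= e) = True.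
  apply/propext; split => // _ x /andP[x1 x2]; apply: h; apply/andP; split; lra.
move=> /(_ I) h3.
rewrite ltr_pdivlMr// in k2.
have i0 : 0 <= mesh n :> R by rewrite ltW// mesh_gt0.
have : e * mesh n + mesh n * rnorm y <= e1 / 2 by nra.
have := rnormD (grid g n u v - (v - u)%:C *: y) (limgrid g u v - grid g n u v).
rewrite [rnorm (limgrid g u v - _)]rnormBC.
have -> : grid g n u v - (v - u)%:C *: y + (limgrid g u v - grid g n u v) =
   limgrid g u v - (v - u)%:C *: y by lin_ring.
lra.
Qed.

Lemma exists_primitive g : (forall s, vcont g s) -> exists phi, forall s, vder phi s (g s).
Proof.
move=> hg.
pose phi t := if 0 <= t then limgrid g 0 t else - limgrid g t 0.
have gg t : limgrid g t t = 0.
  have := @limgrid_add g t t t hg (lexx _) (lexx _).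
  by move/esym/eqP; rewrite -subr_eq0 addrK => /eqP.
have D u v : u <= v -> phi v - phi u = limgrid g u v.
  move=> uv; rewrite /phi; case: (leP 0 u) => u0.
    rewrite (le_trans u0 uv) (@limgrid_add g 0 u v)//.
    by rewrite addrAC subrr add0r.
  case: (leP 0 v) => v0.
    by rewrite (@limgrid_add g u 0 v) ?(ltW u0)// opprK addrC.
  by rewrite (@limgrid_add g u v 0) ?(ltW v0)// opprK addrC addrK.
exists phi => s e e0.
have [d d0 hd] := hg s _ e0.
exists (d / 2); first lra.
move=> t ts.
have [st|/ltW st] := leP s t.
  rewrite D// [`|t - s|]ger0_norm ?subr_ge0// in ts *.
  apply: (@limgrid_close _ _ _ _ _ (d / 2)) => //; [exact: ltW|lra|].
  move=> x /andP[x1 x2]; apply: hd; rewrite ltr_distl; apply/andP; split; lra.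
rewrite -[phi t - phi s]opprB D// [`|t - s|]distrC [`|s - t|]ger0_norm ?subr_ge0//.
have -> : - limgrid g t s - (t - s)%:C *: g s = - (limgrid g t s - (s - t)%:C *: g s).
  by lin_ring.
rewrite rnormN; apply: (@limgrid_close _ _ _ _ _ (d / 2)) => //; [exact: ltW|lra|].
rewrite distrC ger0_norm ?subr_ge0// in ts.
move=> x /andP[x1 x2]; apply: hd; rewrite ltr_distl; apply/andP; split; lra.
Qed.

End Integral.

Section LinearMaps.
Context {R : realType} {X : completeNormedModType R[i]}.
Implicit Types T : X -> X.

Lemma linear_mapD T : linear T -> {morph T : x y / x + y}.
Proof. by move=> h x y; have := h 1 x y; rewrite !scale1r. Qed.
Lemma linear_map0 T : linear T -> T 0 = 0.
Proof. by move=> h; have := h (-1) 0 0; rewrite addr0 scaler0 scaleN1r addNr. Qed.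
Lemma linear_mapZ T : linear T -> forall a x, T (a *: x) = a *: T x.
Proof. by move=> h a x; have := h a x 0; rewrite (linear_map0 h) !addr0. Qed.
Lemma linear_mapN T : linear T -> forall x, T (- x) = - T x.
Proof. by move=> h x; rewrite -scaleN1r linear_mapZ// scaleN1r. Qed.
Lemma linear_mapB T : linear T -> forall x y, T (x - y) = T x - T y.
Proof. by move=> h x y; rewrite linear_mapD// linear_mapN. Qed.
Lemma linear_map_sum T (I : Type) (s : seq I) (P : pred I) (F : I -> X) : linear T ->
  T (\sum_(i <- s | P i) F i) = \sum_(i <- s | P i) T (F i).
Proof.
by move=> h; apply: (big_morph T); [exact: linear_mapD|exact: linear_map0].
Qed.

Lemma bounded_opP T : bounded_op T ->
  exists2 M, 0 <= M & forall x, rnorm (T x) <= M * rnorm x.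
Proof.
move=> [_ [M h]]; exists (Num.max M 0) => [|x]; first by rewrite le_max lexx orbT.
by apply: le_trans (h x) _; rewrite ler_wpM2r ?rnorm_ge0// le_max lexx.
Qed.

Lemma vder_op T phi s v : bounded_op T -> vder (@rnorm R X) phi s v ->
  vder (@rnorm R X) (T \o phi) s (T v).
Proof.
move=> hT h e e0; have [M M0 hM] := bounded_opP hT; have [lT _] := hT.
have e1 : 0 < e / (M + 1) by rewrite divr_gt0// ltr_wpDl.
have [d d0 H] := h _ e1; exists d => // t /H k.
rewrite /= -linear_mapZ// -!linear_mapB//.
apply: le_trans (hM _) _; apply: le_trans (ler_wpM2l M0 k) _.
rewrite mulrA ler_wpM2r// mulrA ler_pdivrMr ?ltr_wpDl//; nra.
Qed.

Lemma vcont_op T g s : bounded_op T -> vcont (@rnorm R X) g s ->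
  vcont (@rnorm R X) (T \o g) s.
Proof.
move=> hT h e e0; have [M M0 hM] := bounded_opP hT; have [lT _] := hT.
have e1 : 0 < e / (M + 1) by rewrite divr_gt0// ltr_wpDl.
have [d d0 H] := h _ e1; exists d => // t /H k.
rewrite /= -linear_mapB//.
apply: le_trans (hM _) _; apply: le_trans (ler_wpM2l M0 k) _.
rewrite mulrA ler_pdivrMr ?ltr_wpDl//; nra.
Qed.

End LinearMaps.

Section IntegralTheory.
Context {R : realType} {X : completeNormedModType R[i]}.
Local Notation vcont := (vcont (@rnorm R X)).
Local Notation vder := (vder (@rnorm R X)).
Implicit Types (g h : R -> X).
Let hr := @snorm_rnorm R X.

(** The integral [vint] is an increment of a chosen primitive, so additivity needs no hypothesis and
    the rules of integration are rules of differentiation. Agreement with the Riemann integral of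
    the statement is proved once, in [vint_riemann]. *)
Definition prim g : R -> X := get [set phi | forall s, vder phi s (g s)].
Definition vint g a b : X := prim g b - prim g a.

Lemma primP g : (forall s, vcont g s) -> forall s, vder (prim g) s (g s).
Proof.
move=> /exists_primitive[phi hphi].
by apply: (@getPex _ [set phi | forall s, vder phi s (g s)]); exists phi.
Qed.

Lemma vintE g phi a b : (forall s, vcont g s) -> (forall s, vder phi s (g s)) ->
  vint g a b = phi b - phi a.
Proof.
move=> hg hphi.
have h s : vder (fun t => prim g t - phi t) s 0.
  by rewrite -(subrr (g s)); apply: vderB => //; exact: primP.
have /eqP := vder0_const hr h a b.
rewrite rnorm_eq0 /vint => /eqP k; apply/eqP; rewrite -subr_eq0 -k; apply/eqP.
by lin_ring.
Qed.

Lemma vint_add g a b c : vint g a b + vint g b c = vint g a c.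
Proof. by rewrite /vint addrC addrA subrK. Qed.

Lemma vint_id g a : vint g a a = 0. Proof. by rewrite /vint subrr. Qed.

Lemma vint_leG g G dG a b : (forall s, vcont g s) -> a <= b ->
  (forall s, a <= s <= b -> rder G s (dG s)) ->
  (forall s, a <= s <= b -> rnorm (g s) <= dG s) ->
  rnorm (vint g a b) <= G b - G a.
Proof.
move=> hg ab hG hd; apply: (mean_value_ineq hr ab (dphi := g) _ hG hd) => s _.
exact: primP.
Qed.

Lemma vint_le g K a b : (forall s, vcont g s) -> a <= b ->
  (forall s, a <= s <= b -> rnorm (g s) <= K) -> rnorm (vint g a b) <= K * (b - a).
Proof.
move=> hg ab; apply: (mean_value_const hr ab (dphi := g)) => s _; exact: primP.
Qed.

Lemma vintD g h a b : (forall s, vcont g s) -> (forall s, vcont h s) ->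
  vint (fun s => g s + h s) a b = vint g a b + vint h a b.
Proof.
move=> hg hh; rewrite (@vintE _ (fun t => prim g t + prim h t)).
- by rewrite /vint; lin_ring.
- by move=> s; exact: vcontD.
- by move=> s; apply: vderD => //; exact: primP.
Qed.

Lemma vintZ c g a b : (forall s, vcont g s) ->
  vint (fun s => c *: g s) a b = c *: vint g a b.
Proof.
move=> hg; rewrite (@vintE _ (fun t => c *: prim g t)).
- by rewrite /vint; lin_ring.
- by move=> s; exact: vcontZ.
- by move=> s; apply: vderZ => //; exact: primP.
Qed.

Lemma vintB g h a b : (forall s, vcont g s) -> (forall s, vcont h s) ->
  vint (fun s => g s - h s) a b = vint g a b - vint h a b.
Proof.
move=> hg hh; rewrite -scaleN1r -vintZ// -vintD//; last by move=> s; exact: vcontZ.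
by congr vint; apply/funext => s; rewrite scaleN1r.
Qed.

Lemma vint_sum (I : Type) (s0 : seq I) (F : I -> R -> X) a b :
  (forall i s, vcont (F i) s) ->
  vint (fun s => \sum_(i <- s0) F i s) a b = \sum_(i <- s0) vint (F i) a b.
Proof.
move=> h; elim: s0 => [|i s0 IH].
  rewrite big_nil (@vintE _ (fun=> 0)) ?subrr//.
    by move=> s; under [X in vcont X]boolp.eq_fun do rewrite big_nil; exact: vcont_cst.
  move=> s e e0; exists 1 => // t _.
  by rewrite big_nil subrr scaler0 subrr rnorm0 mulr_ge0 ?(ltW e0).
rewrite big_cons -IH -vintD//; first by congr vint; apply/funext => s; rewrite big_cons.
by move=> s; exact: vcont_sum.
Qed.

Lemma vint_op T g a b : bounded_op T -> (forall s, vcont g s) ->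
  vint (fun s => T (g s)) a b = T (vint g a b).
Proof.
move=> hT hg; rewrite (@vintE _ (T \o prim g)).
- by rewrite /vint /= linear_mapB//; case: hT.
- by move=> s; exact: (@vcont_op R X T g).
- by move=> s; apply: (@vder_op R X T (prim g)) => //; exact: primP.
Qed.

Lemma vint_shift g c a b : (forall s, vcont g s) ->
  vint (fun s => g (s + c)) a b = vint g (a + c) (b + c).
Proof.
move=> hg; rewrite (@vintE _ (fun t => prim g (t + c)))//.
- by move=> s; exact: vcont_shift.
- by move=> s; apply: vder_shift; exact: primP.
Qed.

Lemma vint_cst v a b : vint (fun=> v) a b = (b - a)%:C *: v.
Proof.
rewrite (@vintE _ (fun t => t%:C *: v)).
- by lin_ring.
- by move=> s; exact: vcont_cst.
- by move=> s; exact: vder_lin.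
Qed.

Lemma vint_close g h K a b : (forall s, vcont g s) -> (forall s, vcont h s) -> a <= b ->
  (forall s, a <= s <= b -> rnorm (g s - h s) <= K) ->
  rnorm (vint g a b - vint h a b) <= K * (b - a).
Proof.
move=> hg hh ab H; rewrite -vintB//; apply: vint_le => // s.
under [X in vcont X]boolp.eq_fun do rewrite -scaleN1r.
by apply: vcontD => //; exact: vcontZ.
Qed.

Lemma vint_riemann g a b : (forall s, vcont g s) -> a <= b ->
  is_riemann_int g a b (vint g a b).
Proof.
move=> hg ab e e0.
pose e1 := e / (b - a + 1).
have e10 : 0 < e1 by rewrite divr_gt0//; lra.
have [del del0 hdel] := vcont_unif hr ab hg e10.
exists del => // n t xi ta tb hxi hmesh.
have tmono i : (i < n)%N -> t i <= t i.+1.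
  by move=> /hxi/andP[]; exact: le_trans.
have ati i : (i <= n)%N -> a <= t i.
  elim: i => [|i IH] hi; first by rewrite ta.
  by apply: le_trans (IH (ltnW hi)) (tmono _ hi).
have tib i : (i <= n)%N -> t i <= b.
  move=> /subnK; move: (n - i)%N => k; elim: k i => [|k IH] i; first by rewrite add0n => ->; rewrite tb.
  move=> kn; apply: le_trans (tmono i _) (IH i.+1 _); last by rewrite addnS -addSn.
  by rewrite -kn addSn ltnS leq_addl.
have tele : vint g a b = \sum_(i < n) vint g (t i) (t i.+1).
  rewrite -ta -tb; elim: n {tb hxi hmesh tmono ati tib} => [|n IH]; first by rewrite big_ord0 vint_id.
  by rewrite big_ord_recr /= -IH vint_add.
rewrite tele -sumrB.
apply: (@le_lt_trans _ _ (\sum_(i < n) e1 * (t i.+1 - t i))).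
  apply: le_trans (snorm_sum hr _ _ _) _; apply: ler_sum => i _.
  rewrite rnormBC -vint_cst; apply: vint_close => //.
  - by move=> s; exact: vcont_cst.
  - exact: tmono.
  move=> s /andP[s1 s2]; have /andP[x1 x2] := hxi i (ltn_ord i).
  have m1 := hmesh i (ltn_ord i).
  apply: hdel.
    rewrite (le_trans (ati i (ltnW (ltn_ord i))) x1) /=.
    by rewrite (le_trans x2)// tib.
  rewrite ltr_distl; apply/andP; split; lra.
rewrite -mulr_sumr.
have -> : \sum_(i < n) (t i.+1 - t i) = b - a.
  by rewrite -(big_mkord xpredT (fun i => t i.+1 - t i)) telescope_sumr// ta tb.
by rewrite /e1 mulrAC ltr_pdivrMr ?ltr_pM2l//; lra.
Qed.

Lemma riemann_uniq g a b I1 I2 : a <= b ->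
  is_riemann_int g a b I1 -> is_riemann_int g a b I2 -> I1 = I2.
Proof.
move=> ab h1 h2; apply/eqP; rewrite -subr_eq0; apply/eqP/rnorm_small => e e0.
have e20 : 0 < e / 2 by lra.
have [d1 d10 H1] := h1 _ e20; have [d2 d20 H2] := h2 _ e20.
pose d := Num.min d1 d2.
have d0 : 0 < d by rewrite lt_min d10.
pose n := (Num.truncn ((b - a) / d)).+1.
have n0 : (0 : R) < n%:R by rewrite ltr0n.
pose t (i : nat) := a + i%:R * ((b - a) / n%:R).
have step i : t i.+1 - t i = (b - a) / n%:R.
  by rewrite /t -natr1; ring.
have stepd : (b - a) / n%:R < d.
  rewrite ltr_pdivrMr// mulrC -ltr_pdivrMr//; exact: Num.Theory.truncnS_gt.
have st0 : 0 <= (b - a) / n%:R by rewrite divr_ge0 ?subr_ge0.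
have ta : t 0%N = a by rewrite /t mul0r addr0.
have tn : t n = b by rewrite /t mulrCA divff ?gt_eqF// mulr1 addrC subrK.
have ht i : (i < n)%N -> t i <= t i <= t i.+1.
  by move=> _; rewrite lexx /= -subr_ge0 step.
move: stepd; rewrite lt_min => /andP[s1 s2].
have k1 := H1 n t t ta tn ht (fun i _ => eq_ind_r (fun x => x < d1) s1 (step i)).
have k2 := H2 n t t ta tn ht (fun i _ => eq_ind_r (fun x => x < d2) s2 (step i)).
have := rnormB (\sum_(i < n) (t i.+1 - t i)%:C *: g (t i) - I2)
   (\sum_(i < n) (t i.+1 - t i)%:C *: g (t i) - I1).
set S := \sum_(i < n) _ in k1 k2 *.
have -> : S - I2 - (S - I1) = I1 - I2 by lin_ring.
lra.
Qed.

Lemma riemann_intE g a b : (forall s, vcont g s) -> a <= b ->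
  riemann_int g a b = vint g a b.
Proof.
move=> hg ab; have h := vint_riemann hg ab.
apply: (riemann_uniq ab _ h).
by apply: (@getPex _ (is_riemann_int g a b)); exists (vint g a b).
Qed.

(** Symmetric limits, as in [line_int]. Continuity is included because it is what identifies
    [riemann_int] with [vint]. *)
Definition is_lint g (L : X) : Prop :=
  (forall s, vcont g s) /\
  forall e, 0 < e -> exists K, forall N, K <= N -> rnorm (vint g (- N) N - L) <= e.

Lemma line_intE g L : is_lint g L -> line_int g = L.
Proof.
move=> [hg hL]; apply: cvg_lim => //; apply/cvg_rnormP => e e0.
have e20 : 0 < e / 2 by lra.
have [K hK] := hL _ e20.
near=> N; rewrite riemann_intE//.
  have : rnorm (vint g (- N) N - L) <= e / 2 by apply: hK; near: N; apply: nbhs_pinfty_ge; exact: num_real.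
  lra.
have : 0 <= N by near: N; apply: nbhs_pinfty_ge; exact: num_real.
lra.
Unshelve. all: by end_near. Qed.

Lemma is_lint_uniq g L1 L2 : is_lint g L1 -> is_lint g L2 -> L1 = L2.
Proof. by move=> /line_intE <- /line_intE <-. Qed.

Lemma is_lintD g h L M : is_lint g L -> is_lint h M -> is_lint (fun s => g s + h s) (L + M).
Proof.
move=> [cg hg] [ch hh]; split; first by move=> s; exact: vcontD.
move=> e e0; have e20 : 0 < e / 2 by lra.
have [K1 h1] := hg _ e20; have [K2 h2] := hh _ e20.
exists (Num.max K1 K2) => N; rewrite ge_max => /andP[/h1 k1 /h2 k2].
rewrite vintD// opprD addrACA.
by have := rnormD (vint g (- N) N - L) (vint h (- N) N - M); lra.
Qed.

Lemma is_lintZ c g L : is_lint g L -> is_lint (fun s => c *: g s) (c *: L).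
Proof.
move=> [cg hg]; split; first by move=> s; exact: vcontZ.
move=> e e0; have c0 : 0 < cabs c + 1 by rewrite ltr_wpDl// cabs_ge0.
have e10 : 0 < e / (cabs c + 1) by rewrite divr_gt0.
have [K h1] := hg _ e10; exists K => N /h1.
rewrite vintZ// -scalerBr rnormZ ler_pdivlMr// => k.
have := rnorm_ge0 (vint g (- N) N - L); nra.
Qed.

Lemma is_lintB g h L M : is_lint g L -> is_lint h M -> is_lint (fun s => g s - h s) (L - M).
Proof.
move=> hg /(is_lintZ (-1)) hh.
by have := is_lintD hg hh; under boolp.eq_fun do rewrite scaleN1r; rewrite scaleN1r.
Qed.

Lemma is_lint0 : is_lint (fun=> 0) 0.
Proof.
split; first by move=> s; exact: vcont_cst.
by move=> e e0; exists 0 => N _; rewrite vint_cst scaler0 subrr rnorm0 ltW.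
Qed.

Lemma is_lint_sum (I : Type) (s0 : seq I) (F : I -> R -> X) (L : I -> X) :
  (forall i, is_lint (F i) (L i)) ->
  is_lint (fun s => \sum_(i <- s0) F i s) (\sum_(i <- s0) L i).
Proof.
move=> h; elim: s0 => [|i s0 IH].
  by rewrite big_nil; under boolp.eq_fun do rewrite big_nil; exact: is_lint0.
by rewrite big_cons; under boolp.eq_fun do rewrite big_cons; exact: is_lintD.
Qed.

Lemma is_lint_op T g L : bounded_op T -> is_lint g L -> is_lint (fun s => T (g s)) (T L).
Proof.
move=> hT [cg hg]; split; first by move=> s; exact: (@vcont_op R X T g).
move=> e e0; have [M M0 hM] := bounded_opP hT.
have c0 : 0 < M + 1 by rewrite ltr_wpDl.
have e10 : 0 < e / (M + 1) by rewrite divr_gt0.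
have [K h1] := hg _ e10; exists K => N /h1.
rewrite vint_op// -linear_mapB; last by case: hT.
rewrite ler_pdivlMr// => k; apply: le_trans (hM _) _.
have := rnorm_ge0 (vint g (- N) N - L); nra.
Qed.

Lemma rder_is_derive (G : R -> R) (s g : R) : is_derive s (1 : R) G g -> rder G s g.
Proof.
move=> [h1 h2] e e0.
have := h1; rewrite /derivable => /(cvgP _)/= h3.
have : (h^-1 *: ((G \o shift s) (h *: (1 : R)) - G s)) @[h --> (0 : R)^'] --> g.
  by rewrite -h2.
move=> /cvgrPdist_lt/(_ _ e0) [d /= d0 hd].
exists d => // t ts; have [->|tns] := eqVneq t s.
  by rewrite !subrr mul0r subr0 normr0 mulr0.
have ts0 : t - s != 0 by rewrite subr_eq0.
have := hd (t - s); rewrite /= sub0r normrN => /(_ ts ts0).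
rewrite /shift /= /GRing.scale /= mulr1 subrK => /ltW h.
have -> : G t - G s - (t - s) * g = - ((t - s) * (g - (t - s)^-1 * (G t - G s))).
  by rewrite mulrBr mulVKf//; ring.
by rewrite normrN normrM mulrC ler_wpM2r.
Qed.

Lemma rder_atan (K a s : R) : 0 < a ->
  rder (fun t => K * atan (t / a)) s (K * a / (s ^+ 2 + a ^+ 2)).
Proof.
move=> a0.
have hat : rder (@atan R) (s / a) (1 + (s / a) ^+ 2)^-1.
  by apply: rder_is_derive; apply: DeriveDef; rewrite ?derivable_atan// -derive1E derive1_atan.
move=> e e0.
have k0 : 0 < e * a / (`|K| + 1) by rewrite divr_gt0 ?mulr_gt0// ltr_wpDl.
have [d d0 hd] := hat _ k0.
exists (d * a); first by rewrite mulr_gt0.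
move=> t ts; have := hd (t / a); rewrite -mulrBl normrM [`|a^-1|]gtr0_norm ?invr_gt0//.
rewrite ltr_pdivrMr// => /(_ ts) h.
have den : s ^+ 2 + a ^+ 2 != 0 by rewrite gt_eqF// ltr_wpDl ?sqr_ge0// exprn_gt0.
have -> : K * atan (t / a) - K * atan (s / a) - (t - s) * (K * a / (s ^+ 2 + a ^+ 2))
  = K * (atan (t / a) - atan (s / a) - (t - s) / a * (1 + (s / a) ^+ 2)^-1).
  have -> : (1 + (s / a) ^+ 2)^-1 = a ^+ 2 * (s ^+ 2 + a ^+ 2)^-1.
    rewrite -(divff (lt0r_neq0 (exprn_gt0 2 a0))) expr_div_n -mulrDl invf_div.
    by rewrite [s ^+ 2 + _]addrC.
  move: (s ^+ 2 + a ^+ 2)^-1 => D; field; exact: lt0r_neq0.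
rewrite normrM; apply: le_trans (ler_wpM2l (normr_ge0 K) h) _.
have -> : `|K| * (e * a / (`|K| + 1) * (`|t - s| / a)) = `|K| / (`|K| + 1) * (e * `|t - s|).
  by field; rewrite (gt_eqF a0) gt_eqF// ltr_wpDl.
rewrite ler_piMl ?mulr_ge0 ?(ltW e0)// ler_pdivrMr ?ltr_wpDl//; lra.
Qed.

Lemma vint_atan g K a u v : 0 < a -> 0 <= K -> (forall s, vcont g s) -> u <= v ->
  (forall s, rnorm (g s) <= K / (s ^+ 2 + a ^+ 2)) ->
  rnorm (vint g u v) <= K / a * (atan (v / a) - atan (u / a)).
Proof.
move=> a0 K0 cg uv hg; rewrite mulrBr.
apply: (@vint_leG _ (fun t => K / a * atan (t / a)) (fun s => K / (s ^+ 2 + a ^+ 2))) => // s _.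
have := @rder_atan (K / a) a s a0.
by rewrite divfK// gt_eqF.
Qed.

(** The majorant has the primitive [K / a * atan (s / a)], whose total increase [K / a * pi] bounds
    the integral and whose tails give the Cauchy property. *)
Lemma is_lint_exists g K a : 0 < a -> 0 <= K -> (forall s, vcont g s) ->
  (forall s, rnorm (g s) <= K / (s ^+ 2 + a ^+ 2)) ->
  exists2 L, is_lint g L & rnorm L <= K / a * pi.
Proof.
move=> a0 K0 cg hg.
have Ka : 0 <= K / a by rewrite divr_ge0// ltW.
have atlim e : 0 < e -> exists2 T, 0 < T & forall t, T <= t -> K / a * (pi / 2 - atan (t / a)) <= e.
  move=> e0.
  have e10 : 0 < e / (K / a + 1) by rewrite divr_gt0// ltr_wpDl.
  have /cvgrPdist_lt/(_ _ e10)[T [_ hT]] := @cvgy_atan R.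
  exists (Num.max 1 ((T + 1) * a)); first by rewrite lt_max ltr01.
  move=> t; rewrite ge_max => /andP[_]; rewrite -ler_pdivlMr// => ht.
  have := hT (t / a) ltac:(lra); rewrite ger0_norm; last first.
    by rewrite subr_ge0 ltW// atan_ltpi2.
  rewrite ltr_pdivlMr ?ltr_wpDl// => h.
  have := @atan_ltpi2 R (t / a); nra.
have diff N M : 0 <= N -> N <= M ->
    rnorm (vint g (- M) M - vint g (- N) N) <= 2 * (K / a * (pi / 2 - atan (N / a))).
  move=> N0 NM.
  have -> : vint g (- M) M - vint g (- N) N = vint g (- M) (- N) + vint g N M.
    rewrite -(vint_add g (- M) (- N)) -(vint_add g (- N) N M); lin_ring.
  apply: le_trans (rnormD _ _) _.
  have h1 := @vint_atan g K a (- M) (- N) a0 K0 cg ltac:(lra) hg.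
  have h2 := @vint_atan g K a N M a0 K0 cg NM hg.
  have h3 := @atan_ltpi2 R (M / a).
  rewrite !mulNr !atanN in h1.
  have h4 : K / a * atan (M / a) <= K / a * (pi / 2) by rewrite ler_wpM2l// ltW.
  lra.
have [L hL] : exists l, forall e, 0 < e -> exists N, forall n, (N <= n)%N ->
    rnorm (vint g (- n%:R) n%:R - l) < e.
  apply: (@rnorm_complete R X (fun n => vint g (- n%:R) n%:R)) => e e0.
  have e50 : 0 < e / 5 by lra.
  have [T T0 hT] := atlim _ e50.
  pose N := (Num.truncn T).+1.
  have NT : T <= N%:R by rewrite ltW// Num.Theory.truncnS_gt.
  have C n : (N <= n)%N -> rnorm (vint g (- n%:R) n%:R - vint g (- N%:R) N%:R) <= 2 * (e / 5).
    move=> Nn; apply: le_trans (diff _ _ (ler0n _ _) _) _; first by rewrite ler_nat.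
    have := hT _ NT; lra.
  exists N => m n /C c1 /C c2.
  set A := vint g (- N%:R) _ in c1 c2 *.
  have := rnormB (vint g (- m%:R) m%:R - A) (vint g (- n%:R) n%:R - A).
  set u := vint g (- m%:R) m%:R in c1 *; set v := vint g (- n%:R) n%:R in c2 *.
  have -> : u - A - (v - A) = u - v by lin_ring.
  lra.
have lint : is_lint g L.
  split => // e e0; have e40 : 0 < e / 4 by lra.
  have [T T0 hT] := atlim _ e40.
  have e20 : 0 < e / 2 by lra.
  have [N0 hN0] := hL _ e40.
  exists T => N TN.
  pose n := maxn N0 (Num.truncn N).+1.
  have h1 := hN0 n (leq_maxl _ _).
  have Nn : N <= n%:R.
    apply: le_trans (ltW (Num.Theory.truncnS_gt N)) _; by rewrite ler_nat leq_maxr.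
  have h2 := diff N n%:R ltac:(lra) Nn.
  have h3 := hT N TN.
  have := rnormB (vint g (- n%:R) n%:R - L) (vint g (- n%:R) n%:R - vint g (- N) N).
  have -> : vint g (- n%:R) n%:R - L - (vint g (- n%:R) n%:R - vint g (- N) N) =
     vint g (- N) N - L by lin_ring.
  lra.
exists L => //; apply/ler_addgt0Pl => e e0.
have [N hN] := hL _ e0.
have := hN N (leqnn N) => h1.
have h2 := @vint_atan g K a (- N%:R) N%:R a0 K0 cg (le_trans _ (ler0n _ _)) hg.
have {}h2 := h2 ltac:(by rewrite oppr_le0).
have := snorm_le_add hr L (vint g (- N%:R) N%:R); rewrite (rnormBC L).
rewrite mulNr atanN opprK in h2.
have h3 := @atan_ltpi2 R (N%:R / a).
have : K / a * (atan (N%:R / a) + atan (N%:R / a)) <= K / a * pi by rewrite ler_wpM2l//; lra.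
lra.
Qed.

End IntegralTheory.

Section TupleIntegral.
Context {R : realType} {X : completeNormedModType R[i]} {n : nat}.
Variables (N : ('I_n -> X) -> R) (hN : snorm N) (B : R).
Hypothesis NB : forall x, N x <= B * \sum_k rnorm (x k).

(** Minkowski's integral inequality for the norm [N] of tuples, read off from the mean value
    inequality in the space of tuples: no measurability in the parameter is involved. [NB] turns
    coordinatewise derivatives into a derivative for [N]. *)
Lemma tuple_vint_le (g : 'I_n -> R -> X) K a b :
  (forall k s, vcont (@rnorm R X) (g k) s) -> a <= b ->
  (forall s, a <= s <= b -> N (fun k => g k s) <= K) ->
  N (fun k => vint (g k) a b) <= K * (b - a).
Proof.
move=> hg ab hK.
apply: (@mean_value_const R ('I_n -> X) N hN (fun t k => prim (g k) t)
   (fun t k => g k t) K a b ab _ hK) => s _ e e0.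
have B0 : 0 <= Num.max B 0 by rewrite le_max lexx orbT.
pose e1 := e / ((Num.max B 0 + 1) * (n%:R + 1)).
have e10 : 0 < e1 by rewrite divr_gt0// mulr_gt0// ltr_wpDl.
have /= H k := primP (hg k) s e10.
pose P (k : 'I_n) del := 0 < del /\ forall t, `|t - s| < del ->
   rnorm (prim (g k) t - prim (g k) s - (t - s)%:C *: g k s) <= e1 * `|t - s|.
have /choice[f hf] : forall k, exists del, P k del.
  by move=> k; have [d d0 hd] := H k; exists d.
exists (\big[Num.min/1]_k f k).
  by apply: (big_ind (fun x => 0 < x)) => // [x y x0 y0|k _]; [rewrite lt_min x0|case: (hf k)].
move=> t ts; apply: le_trans (NB _) _.
have S0 : 0 <= \sum_k rnorm (prim (g k) t - prim (g k) s - (t - s)%:C *: g k s).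
  by apply: sumr_ge0 => k _; exact: rnorm_ge0.
apply: (@le_trans _ _ (Num.max B 0 * (\sum_(k < n) e1 * `|t - s|))).
  apply: le_trans (_ : Num.max B 0 * \sum_k rnorm (prim (g k) t - prim (g k) s - (t - s)%:C *: g k s) <= _).
    by rewrite ler_wpM2r// le_max lexx.
  rewrite ler_wpM2l//; apply: ler_sum => k _; have [_] := hf k; apply.
  apply: lt_le_trans ts _; rewrite (bigD1 k)//=; by rewrite ge_min lexx.
rewrite sumr_const card_ord -[X in _ * X]mulr_natl !mulrA ler_wpM2r//.
rewrite /e1 ?mulrA ler_pdivrMr ?mulr_gt0 ?ltr_wpDl//.
have n0 : 0 <= n%:R :> R by [].
have := ltW e0; move: (Num.max B 0) B0 => B1 B10; have := mulr_ge0 B10 n0; nra.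
Qed.

End TupleIntegral.

(** * Cauchy's theorem in horizontal strips *)

Section Cauchy.
Context {R : realType} {X : completeNormedModType R[i]}.
Local Notation vcont := (vcont (@rnorm R X)).
Local Notation vder := (vder (@rnorm R X)).
Implicit Types (F G : R[i] -> X).
Let hr := @snorm_rnorm R X.

Definition cder F (z : R[i]) (L : X) : Prop :=
  forall e, 0 < e -> exists2 del, 0 < del & forall u, cabs (u - z) < del ->
    rnorm (F u - F z - (u - z) *: L) <= e * cabs (u - z).

Definition ccont F (z : R[i]) : Prop :=
  forall e, 0 < e -> exists2 del, 0 < del & forall u, cabs (u - z) < del ->
    rnorm (F u - F z) <= e.

Lemma cder_cont F z L : cder F z L -> ccont F z.
Proof.
move=> h e e0; have [d d0 H] := h 1 ltr01.
have k0 : 0 < rnorm L + 1 by rewrite ltr_wpDl// rnorm_ge0.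
exists (Num.min d (e / (rnorm L + 1))); first by rewrite lt_min d0 divr_gt0.
move=> t; rewrite lt_min => /andP[/H k]; rewrite ltr_pdivlMr// => k2.
have := snorm_le_add hr (F t - F z) ((t - z) *: L).
rewrite rnormZ; lra.
Qed.

Lemma ccont_hor F c s : (forall z, ccont F z) -> vcont (fun s => F (s +i* c)) s.
Proof.
move=> h e /(h (s +i* c))[d d0 H]; exists d => // t ts; apply: H.
by rewrite cabsE /= subrr expr0n addr0 sqrtr_sqr.
Qed.

Lemma ccont_ver F a t : (forall z, ccont F z) -> vcont (fun t => F (a +i* t)) t.
Proof.
move=> h e /(h (a +i* t))[d d0 H]; exists d => // s ts; apply: H.
by rewrite cabsE /= subrr expr0n add0r sqrtr_sqr.
Qed.

Definition rect F a b c d : X :=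
  vint (fun s => F (s +i* c)) a b - vint (fun s => F (s +i* d)) a b
  + 'i *: (vint (fun t => F (b +i* t)) c d - vint (fun t => F (a +i* t)) c d).

Lemma rect_splitx F a m b c d : rect F a b c d = rect F a m c d + rect F m b c d.
Proof.
rewrite /rect -(vint_add _ a m b) -(vint_add (fun s => F (s +i* d)) a m b).
by lin_ring.
Qed.

Lemma rect_splity F a b c m d : rect F a b c d = rect F a b c m + rect F a b m d.
Proof.
rewrite /rect -(vint_add _ c m d) -(vint_add (fun t => F (a +i* t)) c m d).
by lin_ring.
Qed.

Lemma vder_sqr (L : X) s : vder (fun t => (t ^+ 2 / 2)%:C *: L) s (s%:C *: L).
Proof.
move=> e e0; have k0 : 0 < rnorm L + 1 by rewrite ltr_wpDl// rnorm_ge0.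
exists (e / (rnorm L + 1)); first by rewrite divr_gt0.
move=> t; rewrite ltr_pdivlMr// => ts.
have -> : (t ^+ 2 / 2)%:C *: L - (s ^+ 2 / 2)%:C *: L - (t - s)%:C *: (s%:C *: L) =
   (((t - s) ^+ 2 / 2)%:C) *: L.
  rewrite scalerA -!scalerBl -rmorphM -!rmorphB /=; by congr (_%:C *: _); field.
rewrite rnormZ cabs_real normrM normrX [`|2^-1|]ger0_norm ?invr_ge0//.
have := rnorm_ge0 L; have := normr_ge0 (t - s); nra.
Qed.

Lemma vint_affine (v L : X) a b :
  vint (fun s => v + s%:C *: L) a b = (b - a)%:C *: v + ((b ^+ 2 - a ^+ 2) / 2)%:C *: L.
Proof.
rewrite (@vintE _ _ _ (fun t => t%:C *: v + (t ^+ 2 / 2)%:C *: L)).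
- by lin_ring.
- move=> s; apply: vcontD => //; first exact: vcont_cst.
  exact: (vder_cont hr (vder_lin hr L s)).
- by move=> s; apply: vderD => //; [exact: vder_lin|exact: vder_sqr].
Qed.

Lemma rect_affine (v L : X) a b c d : rect (fun z => v + z *: L) a b c d = 0.
Proof.
rewrite /rect.
have H (y : R) : (fun s : R => v + (s +i* y) *: L) = (fun s => (v + (y*i) *: L) + s%:C *: L).
  apply/funext => s; rewrite -addrA -scalerDl; congr (_ + _ *: _).
  by apply/eqP; rewrite eq_complex /= add0r addr0 !eqxx.
have V (x : R) : (fun t : R => v + (x +i* t) *: L) = (fun t => (v + x%:C *: L) + t%:C *: ('i *: L)).
  apply/funext => t; rewrite -addrA scalerA -scalerDl; congr (_ + _ *: _).
  by apply/eqP; rewrite eq_complex /= !mul0r !mulr0 !mulr1 subr0 !addr0 add0r !eqxx.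
rewrite !H !V !vint_affine.
have E (y : R) : (y*i) = 'i * y%:C :> R[i].
  by apply/eqP; rewrite eq_complex /= !mul0r !mul1r subr0 add0r !eqxx.
rewrite !E; lin_ring.
Qed.

Lemma rect_le F K a b c d : (forall z, ccont F z) -> a <= b -> c <= d ->
  (forall z, a <= complex.Re z <= b -> c <= complex.Im z <= d -> rnorm (F z) <= K) ->
  rnorm (rect F a b c d) <= K * (2 * (b - a + (d - c))).
Proof.
move=> cF ab cd hK.
have h1 y : c <= y <= d -> rnorm (vint (fun s => F (s +i* y)) a b) <= K * (b - a).
  move=> hy; apply: vint_le => // [s|s hs]; first exact: ccont_hor.
  exact: hK.
have h2 x : a <= x <= b -> rnorm (vint (fun t => F (x +i* t)) c d) <= K * (d - c).
  move=> hx; apply: vint_le => // [s|s hs]; first exact: ccont_ver.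
  exact: hK.
have := h1 c; rewrite lexx cd => /(_ isT) H1.
have := h1 d; rewrite lexx cd => /(_ isT) H2.
have := h2 a; rewrite lexx ab => /(_ isT) H3.
have := h2 b; rewrite lexx ab => /(_ isT) H4.
rewrite /rect.
set A := vint _ a b in H1 *; set B := vint _ a b in H2 *.
set C := vint _ c d in H4 *; set D := vint _ c d in H3 *.
have := rnormD (A - B) ('i *: (C - D)); rewrite rnormZ cabs_i mul1r.
have := rnormB A B; have := rnormB C D; lra.
Qed.

Lemma rectB F G a b c d : (forall z, ccont F z) -> (forall z, ccont G z) ->
  rect (fun z => F z - G z) a b c d = rect F a b c d - rect G a b c d.
Proof.
move=> cF cG; rewrite /rect !vintB; try (by move=> s; exact: ccont_hor);
  try (by move=> s; exact: ccont_ver); by lin_ring.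
Qed.

Lemma ccont_affine (v L : X) z : ccont (fun z => v + z *: L) z.
Proof.
apply: (@cder_cont _ _ L) => e e0; exists 1 => // u _.
have -> : v + u *: L - (v + z *: L) - (u - z) *: L = 0 by lin_ring.
by rewrite rnorm0 mulr_ge0 ?(ltW e0)// cabs_ge0.
Qed.

Lemma ccontB F G z : ccont F z -> ccont G z -> ccont (fun z => F z - G z) z.
Proof.
move=> h1 h2 e e0; have e20 : 0 < e / 2 by lra.
have [d1 d10 H1] := h1 _ e20; have [d2 d20 H2] := h2 _ e20.
exists (Num.min d1 d2) => [|t]; rewrite lt_min ?d10// => /andP[/H1 k1 /H2 k2].
have := rnormB (F t - F z) (G t - G z).
have -> : F t - F z - (G t - G z) = F t - G t - (F z - G z) by lin_ring.
lra.
Qed.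

Let half_step (x y t v v' : R) : x + v <= t -> v = v' + v' -> y <= x + v' -> y + v' <= t.
Proof. lra. Qed.

Let dist_le_width (x y m v : R) : m <= x <= m + v -> m <= y <= m + v -> `|x - y| <= v.
Proof. by move=> /andP[? ?] /andP[? ?]; rewrite ler_distl; apply/andP; split; lra. Qed.

(** Goursat's bisection: some quarter always keeps a quarter of the integral, and the nested
    quarters meet at a point where the affine part of [F] integrates to zero. Differentiability is
    relative to the closed rectangle, because the clamped functions used later may fail to be
    differentiable across its horizontal edges. *)
Lemma goursat F a b c d : a <= b -> c <= d -> (forall z, ccont F z) ->
  (forall z, a <= complex.Re z <= b -> c <= complex.Im z <= d -> exists L,
    forall e, 0 < e -> exists2 del, 0 < del & forall u,
    a <= complex.Re u <= b -> c <= complex.Im u <= d -> cabs (u - z) < del ->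
    rnorm (F u - F z - (u - z) *: L) <= e * cabs (u - z)) ->
  rect F a b c d = 0.
Proof.
move=> ab cd cF hF; apply/eqP; rewrite -rnorm_eq0; apply/negPn/negP => I0.
pose w n : R := (b - a) / 2 ^+ n; pose h n : R := (d - c) / 2 ^+ n.
have p0 n : (0 : R) < 2 ^+ n by rewrite exprn_gt0.
have w0 n : 0 <= w n by apply: divr_ge0; [rewrite subr_ge0|exact: ltW].
have h0 n : 0 <= h n by apply: divr_ge0; [rewrite subr_ge0|exact: ltW].
have wS n : w n = w n.+1 + w n.+1 by rewrite /w exprS; field; rewrite gt_eqF.
have hS n : h n = h n.+1 + h n.+1 by rewrite /h exprS; field; rewrite gt_eqF.
pose Q n (p : R * R) := rect F p.1 (p.1 + w n) p.2 (p.2 + h n).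
(* Half of the initial value, so that the strict inequality [bad] holds at the start. *)
pose kap := rnorm (rect F a b c d) / 2.
have kap0 : 0 < kap by rewrite divr_gt0// lt_def I0 rnorm_ge0.
pose bad n p := kap / 4 ^+ n < rnorm (Q n p).
pose inn n (p : R * R) := [/\ a <= p.1, p.1 + w n <= b, c <= p.2 & p.2 + h n <= d].
pose step n (p q : R * R) := p.1 <= q.1 <= p.1 + w n.+1 /\ p.2 <= q.2 <= p.2 + h n.+1.
have next n p : exists q, bad n p -> inn n p -> [/\ bad n.+1 q, inn n.+1 q & step n p q].
  have [[bp ip]|] := pselect (bad n p /\ inn n p); last by move=> np; exists p => b1 b2; case: np.
  case: ip => i1 i2 i3 i4.
  have W := w0 n.+1; have H := h0 n.+1; have WS := wS n; have HS := hS n.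
  pose q1 := p; pose q2 := (p.1 + w n.+1, p.2); pose q3 := (p.1, p.2 + h n.+1).
  pose q4 := (p.1 + w n.+1, p.2 + h n.+1).
  have E : Q n p = Q n.+1 q1 + Q n.+1 q2 + (Q n.+1 q3 + Q n.+1 q4).
    rewrite /Q /= HS WS (addrA p.1) (addrA p.2) (@rect_splity F _ _ _ (p.2 + h n.+1)).
    rewrite (@rect_splitx F p.1 (p.1 + w n.+1) _ p.2).
    by rewrite (@rect_splitx F p.1 (p.1 + w n.+1) _ (p.2 + h n.+1)).
  have : ~ (~ bad n.+1 q1 /\ ~ bad n.+1 q2 /\ ~ bad n.+1 q3 /\ ~ bad n.+1 q4).
    move=> [/negP b1 [/negP b2 [/negP b3 /negP b4]]].
    rewrite -!leNgt in b1 b2 b3 b4; move: bp; rewrite /bad E.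
    have := rnormD (Q n.+1 q1 + Q n.+1 q2) (Q n.+1 q3 + Q n.+1 q4).
    have := rnormD (Q n.+1 q1) (Q n.+1 q2); have := rnormD (Q n.+1 q3) (Q n.+1 q4).
    have -> : kap / 4 ^+ n = 4 * (kap / 4 ^+ n.+1).
      by rewrite exprS; field; rewrite gt_eqF// exprn_gt0.
    lra.
  have T q : p.1 <= q.1 <= p.1 + w n.+1 -> p.2 <= q.2 <= p.2 + h n.+1 -> bad n.+1 q ->
     exists q, bad n p -> inn n p -> [/\ bad n.+1 q, inn n.+1 q & step n p q].
    move=> /andP[s1 s2] /andP[s3 s4] bq; exists q => _ _; split => //.
      by split; [exact: le_trans i1 s1|exact: half_step i2 WS s2|
                 exact: le_trans i3 s3|exact: half_step i4 HS s4].
    by rewrite /step s1 s2 s3 s4.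
  have [B1|/negP B1] := boolP (bad n.+1 q1).
    by move=> _; apply: (T q1); rewrite //= ?lerDl ?lexx ?W ?H.
  have [B2|/negP B2] := boolP (bad n.+1 q2).
    by move=> _; apply: (T q2); rewrite //= ?lerDl ?lexx ?W ?H.
  have [B3|/negP B3] := boolP (bad n.+1 q3).
    by move=> _; apply: (T q3); rewrite //= ?lerDl ?lexx ?W ?H.
  have [B4|/negP B4] := boolP (bad n.+1 q4).
    by move=> _; apply: (T q4); rewrite //= ?lerDl ?lexx ?W ?H.
  by case.
have /choice[nx hnx] : forall np : nat * (R * R), exists q, bad np.1 np.2 -> inn np.1 np.2 ->
    [/\ bad np.1.+1 q, inn np.1.+1 q & step np.1 np.2 q] by move=> [n p]; exact: next.
pose fix sq n := if n is m.+1 then nx (m, sq m) else (a, c).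
have S n : bad n (sq n) /\ inn n (sq n).
  elim: n => [|n [b1 i1]].
    split.
      rewrite /bad /Q /= expr0 /w /h !expr0 !divr1 [a + _]addrC [c + _]addrC !subrK.
      by rewrite /kap ltr_pdivrMr// ltr_pMr ?ltr1n// lt_def I0 rnorm_ge0.
    by rewrite /inn /= /w /h !expr0 !divr1 [a + _]addrC [c + _]addrC !subrK !lexx.
  by have [] := hnx (n, sq n) b1 i1.
have St n : step n (sq n) (sq n.+1).
  by have [b1 i1] := S n; have [] := hnx (n, sq n) b1 i1.
have sq0 : sq 0%N = (a, c) by [].
clearbody sq.
have nest n k : (sq n).1 <= (sq (n + k)%N).1 /\ (sq (n + k)%N).1 + w (n + k)%N <= (sq n).1 + w n
   /\ (sq n).2 <= (sq (n + k)%N).2 /\ (sq (n + k)%N).2 + h (n + k)%N <= (sq n).2 + h n.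
  elim: k => [|k [IH1 [IH2 [IH3 IH4]]]]; first by (rewrite addn0; split; [|split; [|split]]; exact: lexx).
  rewrite addnS; have [/andP[s1 s2] /andP[s3 s4]] := St (n + k)%N.
  split; first exact: le_trans IH1 s1.
  split; first exact: half_step IH2 (wS _) s2.
  by split; [exact: le_trans IH3 s3|exact: half_step IH4 (hS _) s4].
have nest2 n m : (sq m).1 <= (sq n).1 + w n /\ (sq m).2 <= (sq n).2 + h n.
  have := nest n (m - n)%N; have := nest m (n - m)%N.
  have [mn|/ltnW nm] := leqP m n.
    rewrite subnKC// => -[A [_ [B _]]] _.
    by split; [apply: le_trans A _|apply: le_trans B _]; rewrite lerDl.
  rewrite (subnKC nm) => _ [_ [A [_ B]]].
  by split; [apply: le_trans A|apply: le_trans B]; rewrite lerDl.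
pose Sx := [set (sq n).1 | n in setT]; pose Sy := [set (sq n).2 | n in setT].
have bx n : (sq n).1 <= sup Sx <= (sq n).1 + w n.
  apply/andP; split.
    apply: ub_le_sup; last by exists n.
    by exists ((sq 0%N).1 + w 0) => _ [m _ <-]; case: (nest2 0%N m).
  apply: ge_sup; first by exists (sq 0%N).1; exists 0%N.
  by move=> _ [m _ <-]; case: (nest2 n m).
have by_ n : (sq n).2 <= sup Sy <= (sq n).2 + h n.
  apply/andP; split.
    apply: ub_le_sup; last by exists n.
    by exists ((sq 0%N).2 + h 0) => _ [m _ <-]; case: (nest2 0%N m).
  apply: ge_sup; first by exists (sq 0%N).2; exists 0%N.
  by move=> _ [m _ <-]; case: (nest2 n m).
pose z := sup Sx +i* sup Sy.
have w00 : w 0 = b - a by rewrite /w expr0 divr1.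
have h00 : h 0 = d - c by rewrite /h expr0 divr1.
have [||L hL] := hF z.
- by rewrite /z /=; have := bx 0%N; rewrite sq0 /= w00 [a + _]addrC subrK.
- by rewrite /z /=; have := by_ 0%N; rewrite sq0 /= h00 [c + _]addrC subrK.
pose l := b - a + (d - c).
have l0 : 0 <= l by rewrite addr_ge0 ?subr_ge0.
pose e := kap / (2 * l ^+ 2 + 1).
have den : 0 < 2 * l ^+ 2 + 1 by rewrite ltr_wpDl// mulr_ge0// sqr_ge0.
have e0 : 0 < e by rewrite divr_gt0.
have [del del0 hdel] := hL e e0.
have [n hn] : exists n, l / 2 ^+ n < del.
  exists (Num.truncn (l / del)).+1; rewrite ltr_pdivrMr// mulrC -ltr_pdivrMr//.
  apply: lt_le_trans (Num.Theory.truncnS_gt _) _; rewrite -natrX ler_nat.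
  exact/ltnW/ltn_expl.
have [bn [i1 i2 i3 i4]] := S n.
have W := w0 n; have H := h0 n.
have wh : w n + h n = l / 2 ^+ n by rewrite /w /h -mulrDl.
pose G u := F z - z *: L + u *: L.
have cG u : ccont G u by exact: ccont_affine.
have EQ : Q n (sq n) = rect (fun u => F u - G u) (sq n).1 ((sq n).1 + w n) (sq n).2 ((sq n).2 + h n).
  by rewrite rectB// /G rect_affine subr0.
have : rnorm (Q n (sq n)) <= (e * (l / 2 ^+ n)) * (2 * (l / 2 ^+ n)).
  rewrite EQ; have := @rect_le (fun u => F u - G u) (e * (l / 2 ^+ n)) (sq n).1
     ((sq n).1 + w n) (sq n).2 ((sq n).2 + h n).
  rewrite (addrC (sq n).1) (addrC (sq n).2) !addrK wh; apply => //.
  - by move=> u; exact: ccontB.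
  - by rewrite lerDr.
  - by rewrite lerDr.
  rewrite (addrC (w n)) (addrC (h n)) => u u12 u34; have [/andP[u1 u2] /andP[u3 u4]] := conj u12 u34.
  have -> : F u - G u = F u - F z - (u - z) *: L by rewrite /G; lin_ring.
  have cu : cabs (u - z) <= l / 2 ^+ n.
    apply: le_trans (cabs_le_ReIm _) _; rewrite -wh; case: u u12 u34 {u1 u2 u3 u4} => p q /= u12 u34.
    by apply: lerD; [exact: dist_le_width u12 (bx n)|exact: dist_le_width u34 (by_ n)].
  apply: le_trans (hdel u _ _ _) _.
  - by rewrite (le_trans i1 u1) (le_trans u2 i2).
  - by rewrite (le_trans i3 u3) (le_trans u4 i4).
  - exact: le_lt_trans cu hn.
  by rewrite ler_wpM2l// ltW.
move: bn; rewrite /bad => bn k.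
have : kap / 4 ^+ n < e * (l / 2 ^+ n) * (2 * (l / 2 ^+ n)) by exact: lt_le_trans bn k.
have -> : e * (l / 2 ^+ n) * (2 * (l / 2 ^+ n)) = e * (2 * l ^+ 2) / 4 ^+ n.
  have -> : (4 : R) ^+ n = 2 ^+ n * 2 ^+ n by rewrite -exprMn; congr (_ ^+ n); ring.
  by field; rewrite gt_eqF.
rewrite ltr_pM2r ?invr_gt0 ?exprn_gt0//.
by rewrite /e mulrAC ltr_pdivlMr// ltr_pM2l// gtrDl ltr10.
Qed.

(** Projection onto a closed strip. It is a contraction, so composing with it extends a function
    continuous on the strip to one continuous on the plane, as the integrals require. *)
Definition clampI (c d : R) (z : R[i]) : R[i] :=
  complex.Re z +i* Num.max c (Num.min d (complex.Im z)).

Lemma clampI_lip c d z u : c <= d -> cabs (clampI c d u - clampI c d z) <= cabs (u - z).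
Proof.
case: z u => x y [x' y'] cd; rewrite !cabsE /= ler_sqrt ?addr_ge0 ?sqr_ge0//.
rewrite lerD2l -(real_normK (num_real (_ - _))) -[leRHS](real_normK (num_real _)).
rewrite lerXn2r ?nnegrE//.
case: (leP d y') => h1; case: (leP d y) => h2; rewrite ?(max_r cd) ?subrr ?normr0//;
  try (case: (leP c y') => h3); try (case: (leP c y) => h4);
  case: (ler0P (y' - y)) => h5; rewrite ?subrr ?normr0; try lra;
  rewrite ler_norml; apply/andP; split; lra.
Qed.

Lemma clampI_id c d z : c <= complex.Im z <= d -> clampI c d z = z.
Proof.
case: z => x y /= /andP[cy yd]; rewrite /clampI /=; congr (_ +i* _).
by rewrite min_r// max_r.
Qed.

Lemma clampI_in c d z : c <= d -> c <= complex.Im (clampI c d z) <= d.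
Proof. by move=> cd; rewrite /= le_max lexx /= ge_max cd ge_min lexx. Qed.

Lemma strip_shift_le F K A c d : 0 < A -> 0 <= K -> c <= d ->
  (forall z, c <= complex.Im z <= d -> exists L, cder F z L) ->
  (forall z, c <= complex.Im z <= d -> rnorm (F z) <= K / (complex.Re z ^+ 2 + A ^+ 2)) ->
  exists L, is_lint (fun s => F (s +i* c)) L /\ is_lint (fun s => F (s +i* d)) L.
Proof.
move=> A0 K0 cd dF bF.
pose G z := F (clampI c d z).
have cG z : ccont G z.
  move=> e e0; have [L hL] := dF _ (clampI_in z cd).
  have [del del0 hdel] := cder_cont hL e0; exists del => // u uz; apply: hdel.
  exact: le_lt_trans (clampI_lip _ _ cd) uz.
have GF z : c <= complex.Im z <= d -> G z = F z by move=> hz; rewrite /G clampI_id.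
have lc y : c <= y <= d -> exists2 L, is_lint (fun s => F (s +i* y)) L & rnorm L <= K / A * pi.
  move=> hy; apply: is_lint_exists => // s; last by have := bF (s +i* y) hy.
  by have := ccont_hor y s cG; under [X in vcont X]boolp.eq_fun do rewrite GF//.
have [L hL _] := lc c ltac:(by rewrite lexx cd).
have [M hM _] := lc d ltac:(by rewrite lexx cd).
exists L; split => //; suff -> : L = M by [].
apply/eqP; rewrite -subr_eq0; apply/eqP/rnorm_small => e e0.
have e30 : 0 < e / 3 by lra.
have [N1 h1] := hL.2 _ e30; have [N2 h2] := hM.2 _ e30.
(* The vertical sides contribute at most [K * (d - c) / N ^+ 2] each. As [N >= 1], one factor [N]
   may be dropped, and the last term of the maximum makes this at most [e / 6]. *)
pose N := Num.max (Num.max N1 N2) (Num.max 1 (6 * (K * (d - c)) / e)).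
have {}h1 := h1 N ltac:(by rewrite !le_max lexx).
have {}h2 := h2 N ltac:(by rewrite !le_max lexx orbT).
have N3 : 1 <= N by rewrite !le_max lexx !orbT.
have N4 : 6 * (K * (d - c)) / e <= N by rewrite !le_max lexx !orbT.
have := @goursat G (- N) N c d ltac:(lra) cd cG.
have -> : (forall z, - N <= complex.Re z <= N -> c <= complex.Im z <= d -> exists L,
    forall e, 0 < e -> exists2 del, 0 < del & forall u,
    - N <= complex.Re u <= N -> c <= complex.Im u <= d -> cabs (u - z) < del ->
    rnorm (G u - G z - (u - z) *: L) <= e * cabs (u - z)) = True.
  apply/propext; split => // _ z _ hz; have [l hl] := dF z hz; exists l => e1 /hl[del d0 hdel].
  by exists del => // u _ hu uz; rewrite !GF//; exact: hdel.
move=> /(_ I); rewrite /rect.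
have Ec : (fun s => G (s +i* c)) = (fun s => F (s +i* c)).
  by apply/funext => s; rewrite GF//= lexx cd.
have Ed : (fun s => G (s +i* d)) = (fun s => F (s +i* d)).
  by apply/funext => s; rewrite GF//= lexx cd.
rewrite Ec Ed.
have side x : `|x| = N -> rnorm (vint (fun t => G (x +i* t)) c d) <= e / 6.
  move=> xN; apply: le_trans (_ : K / (N ^+ 2 + A ^+ 2) * (d - c) <= _).
    apply: vint_le => // t; first exact: ccont_ver.
    move=> ht; rewrite GF//; apply: le_trans (bF _ _) _ => //=.
    by rewrite -(real_normK (num_real x)) xN.
  have NA : 0 < N ^+ 2 + A ^+ 2 by rewrite ltr_wpDl ?sqr_ge0// exprn_gt0.
  rewrite mulrAC ler_pdivrMr//.
  rewrite ler_pdivrMr// in N4.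
  have : N * e <= (N ^+ 2 + A ^+ 2) * e.
    rewrite ler_wpM2r ?(ltW e0)//; have := sqr_ge0 A; nra.
  lra.
have s1 := side (- N) ltac:(by rewrite normrN ger0_norm//; lra).
have s2 := side N ltac:(by rewrite ger0_norm//; lra).
set a1 := vint _ (- N) N in h1 *; set a2 := vint _ (- N) N in h2 *.
set b1 := vint _ c d in s2 *; set b2 := vint _ c d in s1 * => E.
have -> : L - M = (a2 - M) - (a1 - L) + (a1 - a2) by lin_ring.
have -> : a1 - a2 = - ('i *: (b1 - b2)).
  by apply/eqP; rewrite -subr_eq0 opprK; apply/eqP.
have := rnormD (a2 - M - (a1 - L)) (- ('i *: (b1 - b2))).
rewrite rnormN rnormZ cabs_i mul1r.
have := rnormB (a2 - M) (a1 - L); have := rnormB b1 b2; lra.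
Qed.

Lemma strip_shift F K A c d : 0 < A -> 0 <= K ->
  (forall z, Num.min c d <= complex.Im z <= Num.max c d -> exists L, cder F z L) ->
  (forall z, Num.min c d <= complex.Im z <= Num.max c d ->
     rnorm (F z) <= K / (complex.Re z ^+ 2 + A ^+ 2)) ->
  exists L, is_lint (fun s => F (s +i* c)) L /\ is_lint (fun s => F (s +i* d)) L.
Proof.
move=> A0 K0; have [cd|dc] := leP c d => h1 h2; first exact: (strip_shift_le A0 K0 cd).
have [L [l1 l2]] := strip_shift_le A0 K0 (ltW dc) h1 h2.
by exists L.
Qed.

(* Pushing the line to infinity, where the bound [K / T * pi] tends to 0. *)
Lemma lint_vanish F K c : 0 <= K ->
  (forall T, 1 <= T -> exists d,
    [/\ (forall z, Num.min c d <= complex.Im z <= Num.max c d -> exists L, cder F z L),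
     (exists2 A, 0 < A & forall z, Num.min c d <= complex.Im z <= Num.max c d ->
       rnorm (F z) <= K / (complex.Re z ^+ 2 + A ^+ 2)) &
     forall s, rnorm (F (s +i* d)) <= K / (s ^+ 2 + T ^+ 2)]) ->
  is_lint (fun s => F (s +i* c)) 0.
Proof.
move=> K0 h.
have [d0 [h1 [A A0 h2] _]] := h 1 (lexx _).
have [L [hL _]] := strip_shift A0 K0 h1 h2.
suff -> : 0 = L by [].
apply/esym/rnorm_small => e e0.
have pi0 : 0 < pi :> R by exact: pi_gt0.
pose T := Num.max 1 (K * pi / e).
have T1 : 1 <= T by rewrite le_max lexx.
have [d [k1 [B B0 k2] k3]] := h T T1.
have [M [hM hM']] := strip_shift B0 K0 k1 k2.
rewrite (is_lint_uniq hL hM).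
have T0 : 0 < T by lra.
have [M' hM'' bM] := is_lint_exists T0 K0 hM'.1 k3.
rewrite (is_lint_uniq hM' hM''); apply: le_trans bM _.
rewrite mulrAC ler_pdivrMr// (mulrC e) -ler_pdivrMr//.
by rewrite le_max lexx orbT.
Qed.

End Cauchy.

(** * Groups and resolvents *)

Section OperatorNorm.
Context {R : realType} {X : completeNormedModType R[i]}.
Implicit Types T : X -> X.

Lemma opnorm_has_sup T : bounded_op T ->
  has_sup [set rnorm (T x) | x in [set x | rnorm x <= 1]].
Proof.
move=> hT; have [M M0 hM] := bounded_opP hT; split.
  by exists (rnorm (T 0)); exists 0 => //=; rewrite rnorm0.
exists M => _ [x /= x1 <-]; apply: le_trans (hM x) _.
by rewrite -[leRHS]mulr1 ler_wpM2l.
Qed.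

Lemma opnorm_ge0 T : bounded_op T -> 0 <= opnorm T.
Proof.
move=> hT; apply: ub_le_sup; first by case: (opnorm_has_sup hT).
exists 0; first by rewrite /= rnorm0.
by rewrite linear_map0 ?rnorm0//; case: hT.
Qed.

Lemma le_opnorm T : bounded_op T -> forall x, rnorm (T x) <= opnorm T * rnorm x.
Proof.
move=> hT x; have [->|x0] := eqVneq x 0.
  by rewrite linear_map0 ?rnorm0 ?mulr0//; case: hT.
have nx : 0 < rnorm x by rewrite lt_def rnorm_eq0 x0 rnorm_ge0.
rewrite -ler_pdivrMr//.
have -> : rnorm (T x) / rnorm x = rnorm (T ((rnorm x)^-1%:C *: x)).
  rewrite linear_mapZ; last by case: hT.
  by rewrite rnormZ cabs_real ger0_norm ?invr_ge0 ?rnorm_ge0// mulrC.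
apply: ub_le_sup; first by case: (opnorm_has_sup hT).
exists ((rnorm x)^-1%:C *: x) => //=.
by rewrite rnormZ cabs_real ger0_norm ?invr_ge0 ?rnorm_ge0// mulVf ?gt_eqF.
Qed.

Lemma opnorm_le T K : bounded_op T -> 0 <= K -> (forall x, rnorm (T x) <= K * rnorm x) ->
  opnorm T <= K.
Proof.
move=> hT K0 h; apply: ge_sup; first by case: (opnorm_has_sup hT).
move=> _ [x /= x1 <-]; apply: le_trans (h x) _.
by rewrite -[leRHS]mulr1 ler_wpM2l.
Qed.

Lemma bounded_op_comp S T : bounded_op S -> bounded_op T -> bounded_op (S \o T).
Proof.
move=> hS hT; have [M M0 hM] := bounded_opP hS; have [K K0 hK] := bounded_opP hT.
split=> [a x y /=|].
  by rewrite (linear_mapD hT.1) (linear_mapZ hT.1) (linear_mapD hS.1) (linear_mapZ hS.1).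
by exists (M * K) => x /=; apply: le_trans (hM _) _; rewrite -mulrA ler_wpM2l.
Qed.

Lemma bounded_op_id : bounded_op (fun x : X => x).
Proof. by split=> //; exists 1 => x; rewrite mul1r. Qed.

Lemma bounded_opZ c T : bounded_op T -> bounded_op (fun x => c *: T x).
Proof.
move=> hT; have [M M0 hM] := bounded_opP hT; split=> [a x y /=|].
  by rewrite (linear_mapD hT.1) (linear_mapZ hT.1); lin_ring.
by exists (cabs c * M) => x; rewrite rnormZ -mulrA ler_wpM2l ?cabs_ge0.
Qed.

Lemma bounded_opD S T : bounded_op S -> bounded_op T -> bounded_op (fun x => S x + T x).
Proof.
move=> hS hT; have [M M0 hM] := bounded_opP hS; have [K K0 hK] := bounded_opP hT.
split=> [a x y /=|].
  rewrite (linear_mapD hT.1) (linear_mapZ hT.1) (linear_mapD hS.1) (linear_mapZ hS.1).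
  by lin_ring.
exists (M + K) => x; rewrite mulrDl; apply: le_trans (rnormD _ _) _; exact: lerD.
Qed.

Lemma bounded_op_sum (I : Type) (s : seq I) (T : I -> X -> X) :
  (forall i, bounded_op (T i)) -> bounded_op (fun x => \sum_(i <- s) T i x).
Proof.
move=> h; elim: s => [|i s IH].
  under boolp.eq_fun do rewrite big_nil.
  by split; [move=> a x y; rewrite scaler0 addr0|exists 0 => x; rewrite rnorm0 mul0r].
by under boolp.eq_fun do rewrite big_cons; exact: bounded_opD.
Qed.

(* Sokal's gliding hump: one of [x + v], [x - v] is mapped at least as far
   from 0 as [v]. *)
Lemma uniform_boundedness (I : Type) (T : I -> X -> X) : (forall i, bounded_op (T i)) ->
  (forall x, exists M, forall i, rnorm (T i x) <= M) ->
  exists2 M, 0 <= M & forall i x, rnorm (T i x) <= M * rnorm x.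
Proof.
move=> hT hpt; apply: contrapT => hno.
(* The n-th step has length [3 ^- n] and moves the image under the n-th operator to distance at
   least [2 / 3 * 3 ^- n] times its norm; all later steps change it by at most [1 / 2 * 3 ^- n]
   times that norm. The difference [1 / 6] is larger than [n] thanks to the factor 6. *)
have big n : exists i, 6 * n%:R * 3 ^+ n < opnorm (T i).
  apply: contrapT => /forallNP hn; apply: hno; exists (6 * n%:R * 3 ^+ n).
    by rewrite mulr_ge0// ?mulr_ge0// exprn_ge0.
  move=> i x; apply: le_trans (le_opnorm (hT i) x) _.
  by rewrite ler_wpM2r ?rnorm_ge0// leNgt; apply/negP/hn.
have /choice[ix hix] := big.
have p3 n : (0 : R) < 3 ^+ n by rewrite exprn_gt0.
have near n : exists v, rnorm v <= (3 ^+ n)^-1 /\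
    2 / 3 * (3 ^+ n)^-1 * opnorm (T (ix n)) <= rnorm (T (ix n) v).
  have o0 : 0 < opnorm (T (ix n)).
    apply: le_lt_trans (hix n); by rewrite mulr_ge0// ?mulr_ge0// exprn_ge0.
  have [|_ [x /= x1 <-] hx] := @sup_adherent _ _ (opnorm (T (ix n)) / 3) _ (opnorm_has_sup (hT (ix n))).
    by rewrite divr_gt0.
  exists ((3 ^+ n)^-1%:C *: x).
  rewrite rnormZ cabs_real ger0_norm ?invr_ge0 ?(ltW (p3 n))//; split.
    by rewrite -[leRHS]mulr1 ler_wpM2l ?invr_ge0 ?(ltW (p3 n)).
  rewrite (linear_mapZ (hT _).1) rnormZ cabs_real ger0_norm ?invr_ge0 ?(ltW (p3 n))//.
  rewrite -/(opnorm (T (ix n))) in hx.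
  have hx2 : 2 / 3 * opnorm (T (ix n)) <= rnorm (T (ix n) x) by lra.
  have i0 : 0 <= (3 ^+ n)^-1 :> R by rewrite invr_ge0 ltW.
  by have := ler_wpM2l i0 hx2; rewrite mulrA (mulrC _ (2 / 3)).
have /choice[v hv] := near.
pose sg n x : X := if rnorm (T (ix n) (v n)) <= rnorm (T (ix n) (x + v n)) then v n else - v n.
have sgP n x : rnorm (T (ix n) (v n)) <= rnorm (T (ix n) (x + sg n x)).
  rewrite /sg; case: ifPn => //; rewrite -ltNge => h.
  have := rnormB (T (ix n) (x + v n)) (T (ix n) (x - v n)).
  have -> : T (ix n) (x + v n) - T (ix n) (x - v n) = 2%:R *: T (ix n) (v n).
    rewrite (linear_mapD (hT _).1) (linear_mapB (hT _).1) scaler_nat mulr2n; lin_ring.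
  rewrite rnormZ (_ : cabs 2%:R = 2%:R :> R); first lra.
  by rewrite -(rmorph_nat (real_complex R)) cabs_real ger0_norm.
have sgN n x : rnorm (sg n x) <= (3 ^+ n)^-1.
  by rewrite /sg; case: ifP => _; rewrite ?rnormN; case: (hv n).
pose fix x n : X := if n is m.+1 then x m + sg m (x m) else 0.
have xS m : x m.+1 = x m + sg m (x m) by [].
clearbody x.
have tail n k : rnorm (x (n + k)%N - x n) <= 3 / 2 * ((3 ^+ n)^-1 - (3 ^+ (n + k))^-1).
  elim: k => [|k IH]; first by rewrite addn0 !subrr rnorm0 mulr0.
  rewrite addnS xS addrAC; apply: le_trans (rnormD _ _) _.
  have := sgN (n + k)%N (x (n + k)%N).
  have -> : (3 ^+ (n + k).+1)^-1 = (3 ^+ (n + k))^-1 / 3 :> R by rewrite exprS; field; rewrite gt_eqF.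
  lra.
have tail' n m : (n <= m)%N -> rnorm (x m - x n) <= 3 / 2 * (3 ^+ n)^-1.
  move=> nm; have := tail n (m - n)%N; rewrite subnKC// => h; apply: le_trans h _.
  have : 0 <= (3 ^+ m)^-1 :> R by rewrite invr_ge0 ltW.
  lra.
have small e : 0 < e -> exists N, forall n, (N <= n)%N -> (3 ^+ n)^-1 < e :> R.
  move=> e0; exists (Num.truncn e^-1).+1 => n hn; rewrite invf_plt ?posrE//.
  apply: lt_le_trans (Num.Theory.truncnS_gt _) _; rewrite -natrX ler_nat.
  exact: leq_trans hn (ltnW (ltn_expl _ _)).
have [l hl] : exists l, forall e, 0 < e -> exists N, forall n, (N <= n)%N -> rnorm (x n - l) < e.
  apply: rnorm_complete => e e0; have e30 : 0 < e / 3 by lra.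
  have [N hN] := small _ e30; exists N => m n Nm Nn.
  have := tail' N m Nm; have := tail' N n Nn; have := hN N (leqnn _).
  have := rnormB (x m - x N) (x n - x N).
  have -> : x m - x N - (x n - x N) = x m - x n by lin_ring.
  lra.
have [M hM] := hpt l.
pose n := (Num.truncn M).+1.
have nM : M < n%:R := Num.Theory.truncnS_gt M.
have lx : rnorm (l - x n.+1) <= 1 / 2 * (3 ^+ n)^-1.
  apply/ler_addgt0Pl => e e0; have [N hN] := hl _ e0.
  have := hN (maxn N n.+1) (leq_maxl _ _); have := tail' n.+1 (maxn N n.+1) (leq_maxr _ _).
  have := rnormB (x (maxn N n.+1) - x n.+1) (x (maxn N n.+1) - l).
  have -> : x (maxn N n.+1) - x n.+1 - (x (maxn N n.+1) - l) = l - x n.+1 by lin_ring.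
  have -> : (3 ^+ n.+1)^-1 = (3 ^+ n)^-1 / 3 :> R by rewrite exprS; field; rewrite gt_eqF.
  lra.
have := hM (ix n); have := hix n; have := (hv n).2; have := sgP n (x n); rewrite -xS.
have := le_opnorm (hT (ix n)) (l - x n.+1).
rewrite (linear_mapB (hT _).1) => h1 h2 h3 h4 h5.
have o0 := opnorm_ge0 (hT (ix n)).
have h6 := ler_wpM2l o0 lx.
have h7 := snorm_le_add snorm_rnorm (T (ix n) (x n.+1)) (T (ix n) l).
rewrite rnormBC in h7.
have h8 : n%:R < 1 / 6 * ((3 ^+ n)^-1 * opnorm (T (ix n))).
  have := ltr_pM2l (_ : 0 < (3 ^+ n)^-1) (6 * n%:R * 3 ^+ n) (opnorm (T (ix n))).
  rewrite invr_gt0 p3 => /(_ isT); rewrite h4 => /idP.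
  have -> : (3 ^+ n)^-1 * (6 * n%:R * 3 ^+ n) = 6 * n%:R :> R by field; rewrite gt_eqF.
  lra.
have E : 2 / 3 * (3 ^+ n)^-1 * opnorm (T (ix n)) = 2 / 3 * ((3 ^+ n)^-1 * opnorm (T (ix n))) by rewrite mulrA.
have E2 : opnorm (T (ix n)) * (1 / 2 * (3 ^+ n)^-1) = 1 / 2 * ((3 ^+ n)^-1 * opnorm (T (ix n))) by ring.
rewrite E in h3; rewrite E2 in h6; move: ((3 ^+ n)^-1 * _) h8 h3 h6 => q; lra.
Qed.

End OperatorNorm.

(** * The complex exponential *)

Section ComplexExponential.
Context {R : realType}.
Implicit Types (z w : R[i]) (s t a b : R).

Definition cexp w : R[i] :=
  (expR (complex.Re w) * cos (complex.Im w)) +i* (expR (complex.Re w) * sin (complex.Im w)).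

Lemma cexpD z w : cexp (z + w) = cexp z * cexp w.
Proof.
case: z w => a b [c d]; apply/eqP; rewrite eq_complex /= expRD cosD sinD.
by apply/andP; split; apply/eqP; ring.
Qed.

Lemma cexp0 : cexp 0 = 1.
Proof. by rewrite /cexp /= expR0 cos0 sin0 mulr0 mulr1. Qed.

Lemma cabs_cexp w : cabs (cexp w) = expR (complex.Re w).
Proof.
by rewrite cabsE /= !exprMn -mulrDr cos2Dsin2 mulr1 sqrtr_sqr ger0_norm ?expR_ge0.
Qed.

Lemma rder_sin s : rder (@sin R) s (cos s).
Proof. exact: rder_is_derive. Qed.

Lemma rder_le (f df : R -> R) (K a b : R) : a <= b ->
  (forall s, a <= s <= b -> rder f s (df s)) ->
  (forall s, a <= s <= b -> `|df s| <= K) -> `|f b - f a| <= K * (b - a).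
Proof.
move=> ab h1 h2; have := @mean_value_const R R[i]^o cabs snorm_cabs
  (fun t => (f t)%:C) (fun t => (df t)%:C) K a b ab.
rewrite -rmorphB cabs_real; apply=> s hs; last by rewrite cabs_real h2.
move=> e /(h1 s hs)[d d0 hd]; exists d => // t /hd.
by rewrite /GRing.scale /= -rmorphM -!rmorphB cabs_real.
Qed.

Lemma abs_sin_le b : `|sin b| <= `|b|.
Proof.
wlog b0 : b / 0 <= b.
  move=> h; have [/h//|/ltW b0] := leP 0 b.
  by rewrite -normrN -sinN -[leRHS]normrN h// oppr_ge0.
have := @rder_le (@sin R) (@cos R) 1 0 b b0 (fun s _ => rder_sin s).
rewrite sin0 !subr0 mul1r (ger0_norm b0); apply=> s _.
by rewrite ler_norml cos_geN1 cos_le1.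
Qed.

Lemma cos_bound b : `|cos b - 1| <= b ^+ 2 / 2.
Proof.
have -> : cos b - 1 = - (2 * sin (b / 2) ^+ 2).
  have {1}-> : b = b / 2 + b / 2 by lra.
  by rewrite cosD; have := cos2Dsin2 (b / 2); lra.
rewrite normrN ger0_norm; last by apply: mulr_ge0 => //; exact: sqr_ge0.
have := abs_sin_le (b / 2); rewrite -(real_normK (num_real (sin _))) => h.
have : `|sin (b / 2)| ^+ 2 <= `|b / 2| ^+ 2 by rewrite lerXn2r ?nnegrE.
rewrite (real_normK (num_real (b / 2))) exprMn; lra.
Qed.

Lemma sin_bound b : `|b| <= 1 -> `|sin b - b| <= b ^+ 2.
Proof.
wlog b0 : b / 0 <= b.
  move=> h; have [/h//|/ltW b0 b1] := leP 0 b.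
  have -> : sin b - b = - (sin (- b) - (- b)) by rewrite sinN; lra.
  by rewrite normrN -(sqrrN b) h ?oppr_ge0// normrN.
rewrite (ger0_norm b0) => b1.
have := @rder_le (fun t => sin t - t) (fun t => cos t - 1) (b ^+ 2 / 2) 0 b b0.
rewrite sin0 !subr0 => h; apply: le_trans (h _ _) _.
- move=> s _ e /(rder_sin s)[d d0 hd]; exists d => // t /hd.
  by have -> : sin t - t - (sin s - s) - (t - s) * (cos s - 1) = sin t - sin s - (t - s) * cos s by ring.
- move=> s /andP[s0 sb]; apply: le_trans (cos_bound s) _.
  by rewrite ler_pM2r ?invr_gt0// lerXn2r ?nnegrE.
- nra.
Qed.

Lemma exp_bound a : `|a| <= 1 / 2 -> `|expR a - 1 - a| <= 2 * a ^+ 2.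
Proof.
rewrite ler_norml => /andP[a1 a2]; rewrite ger0_norm; last first.
  by have := expR_ge1Dx a; lra.
have h := expR_ge1Dx (- a); rewrite expRN in h.
have e0 := expR_gt0 a.
have : expR a * (1 - a) <= 1.
  by have := ler_wpM2l (ltW e0) h; rewrite divff// gt_eqF.
nra.
Qed.

Lemma cexp_taylor w : cabs w <= 1 / 2 -> cabs (cexp w - 1 - w) <= 8 * cabs w ^+ 2.
Proof.
move=> w1; have := le_Re_cabs w; have := le_Im_cabs w; rewrite cabs_sqr.
case: w w1 => a b /= w1 hb ha.
have a1 : `|a| <= 1 / 2 by lra.
have b1 : `|b| <= 1 by lra.
apply: le_trans (cabs_le_ReIm _) _; rewrite /= !subr0.
have h1 := exp_bound a1; have h2 := cos_bound b; have h3 := sin_bound b1; have h4 := abs_sin_le b.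
have e2 : expR a <= 2.
  have : a ^+ 2 <= 1 / 4 by rewrite -(real_normK (num_real a)); have := normr_ge0 a; nra.
  by move: h1 a1; rewrite !ler_norml => /andP[_ k1] /andP[_ k2]; lra.
have e0 := expR_gt0 a.
have k1 : `|expR a * cos b - 1 - a| <= 2 * a ^+ 2 + b ^+ 2.
  have -> : expR a * cos b - 1 - a = (expR a - 1 - a) + expR a * (cos b - 1) by ring.
  apply: le_trans (ler_normD _ _) _; rewrite normrM (gtr0_norm e0).
  have := ler_pM (ltW e0) (normr_ge0 _) e2 h2; lra.
have k2 : `|expR a * sin b - b| <= b ^+ 2 + 2 * `|a| * `|b|.
  have -> : expR a * sin b - b = (expR a - 1) * sin b + (sin b - b) by ring.
  apply: le_trans (ler_normD _ _) _; rewrite normrM.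
  have k3 : `|expR a - 1| <= 2 * `|a|.
    have := ler_normD (expR a - 1 - a) a; rewrite subrK => k; apply: le_trans k _.
    have : 2 * a ^+ 2 <= `|a|.
      rewrite -(real_normK (num_real a)); have := normr_ge0 a; nra.
    lra.
  have := ler_pM (normr_ge0 _) (normr_ge0 _) k3 h4; lra.
have := sqr_ge0 (`|a| - `|b|); rewrite sqrrB !real_normK ?num_real// -[_ *+ 2]mulr_natr.
have := sqr_ge0 a; have := sqr_ge0 b; lra.
Qed.

Definition ce s z : R[i] := cexp ('i * s%:C * z).

Lemma ceD s t z : ce (s + t) z = ce s z * ce t z.
Proof. by rewrite /ce -cexpD rmorphD /= mulrDr mulrDl. Qed.

Lemma ceDz s z w : ce s (z + w) = ce s z * ce s w.
Proof. by rewrite /ce -cexpD mulrDr. Qed.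

Lemma ce0 z : ce 0 z = 1.
Proof. by rewrite /ce mulr0 mul0r cexp0. Qed.

Lemma cabs_ce s z : cabs (ce s z) = expR (- (s * complex.Im z)).
Proof. by rewrite cabs_cexp; case: z => a b /=; congr expR; ring. Qed.

Lemma vder_ce s z : vder (cabs : R[i]^o -> R) (ce ^~ z) s ('i * z * ce s z).
Proof.
move=> e e0; pose C := cabs (ce s z) * (8 * cabs z ^+ 2) + 1.
have C0 : 0 < C by rewrite ltr_wpDl// mulr_ge0 ?cabs_ge0// mulr_ge0// sqr_ge0.
have z1 : 0 < 2 * (cabs z + 1) by have := cabs_ge0 z; lra.
exists (Num.min (2 * (cabs z + 1))^-1 (e / C)); first by rewrite lt_min invr_gt0 z1 divr_gt0.
move=> t; rewrite lt_min => /andP[h1 h2].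
pose w := 'i * (t - s)%:C * z.
have cw : cabs w = `|t - s| * cabs z by rewrite /w !cabsM cabs_i mul1r cabs_real.
have w1 : cabs w <= 1 / 2.
  rewrite cw; have : `|t - s| * (2 * (cabs z + 1)) <= 1.
    by rewrite -ler_pdivlMr// div1r ltW.
  have := cabs_ge0 z; have := normr_ge0 (t - s); nra.
have -> : ce t z - ce s z - (t - s)%:C *: ('i * z * ce s z) = ce s z * (cexp w - 1 - w).
  rewrite -{1}(subrK s t) addrC ceD /ce /w /GRing.scale /=; ring.
rewrite cabsM; apply: le_trans (ler_wpM2l (cabs_ge0 _) (cexp_taylor w1)) _.
rewrite cw exprMn; rewrite ltr_pdivlMr// in h2.
have -> : cabs (ce s z) * (8 * (`|t - s| ^+ 2 * cabs z ^+ 2)) =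
   (cabs (ce s z) * (8 * cabs z ^+ 2)) * `|t - s| * `|t - s| by ring.
rewrite ler_wpM2r//; have := normr_ge0 (t - s); rewrite /C in h2; nra.
Qed.

End ComplexExponential.

Section ScalarProductRule.
Context {R : realType} {V : lmodType R[i]} (rho : V -> R) (hr : snorm rho).

Lemma vder_scale (a : R -> R[i]) (y : R -> V) s (a' : R[i]) v :
  vder (cabs : R[i]^o -> R) a s a' -> vder rho y s v ->
  vder rho (fun t => a t *: y t) s (a' *: y s + a s *: v).
Proof.
move=> ha hy e e0.
have ca := vder_cont snorm_cabs ha.
have Y0 := snorm_ge0 hr (y s); have V0 := snorm_ge0 hr v; have A0 := cabs_ge0 (a s).
pose e1 := e / (rho (y s) + (cabs (a s) + 1) + rho v + 1).
have den : 0 < rho (y s) + (cabs (a s) + 1) + rho v + 1 by lra.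
have e10 : 0 < e1 by rewrite divr_gt0.
have [d1 d10 h1] := ha _ e10; have [d2 d20 h2] := hy _ e10.
have [d3 d30 h3] := ca _ e10; have [d4 d40 h4] := ca _ ltr01.
exists (Num.min (Num.min d1 d2) (Num.min d3 d4)); first by rewrite !lt_min d10 d20 d30.
move=> t; rewrite !lt_min => /andP[/andP[/h1 k1 /h2 k2] /andP[/h3 k3 /h4 k4]].
have -> : a t *: y t - a s *: y s - (t - s)%:C *: (a' *: y s + a s *: v) =
   (a t - a s - (t - s)%:C * a') *: y s + a t *: (y t - y s - (t - s)%:C *: v)
   + (t - s)%:C *: ((a t - a s) *: v) by lin_ring.
apply: le_trans (snormD hr _ _) _; apply: le_trans (lerD (snormD hr _ _) (lexx _)) _.
rewrite !snormZ// cabs_real.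
have A1 : cabs (a t) <= cabs (a s) + 1.
  by have := snorm_le_add snorm_cabs (a t) (a s); rewrite /= in k4 *; lra.
have m1 := ler_wpM2r Y0 k1.
have m2 := ler_pM (cabs_ge0 _) (snorm_ge0 hr _) A1 k2.
have m3 := ler_wpM2r V0 k3.
have m4 := ler_wpM2l (normr_ge0 (t - s)) m3.
have E : e = e1 * (rho (y s) + (cabs (a s) + 1) + rho v + 1) by rewrite /e1 divfK// gt_eqF.
have T0 := normr_ge0 (t - s).
have : 0 <= e1 * `|t - s| by rewrite mulr_ge0// ltW.
rewrite [in X in _ -> _ <= X]E /GRing.scale /= in k1 m1 *; nra.
Qed.

Lemma vder_uniq (phi : R -> V) s v w : vder rho phi s v -> vder rho phi s w -> rho (v - w) = 0.
Proof.
move=> h1 h2; apply/eqP; rewrite eq_le snorm_ge0// andbT.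
apply/ler_addgt0Pl => e e0; rewrite addr0.
have e20 : 0 < e / 2 by lra.
have [d1 d10 k1] := h1 _ e20; have [d2 d20 k2] := h2 _ e20.
pose d := Num.min d1 d2 / 2.
have d0 : 0 < d by rewrite divr_gt0// lt_min d10.
have dm : d < Num.min d1 d2 by rewrite /d ltr_pdivrMr// ltr_pMr ?ltr1n// lt_min d10.
have ds : `|s + d - s| = d by rewrite addrC addKr gtr0_norm.
move: dm; rewrite lt_min -{1 2}ds => /andP[/k1 m1 /k2 m2].
have := snormB hr (phi (s + d) - phi s - (s + d - s)%:C *: w) (phi (s + d) - phi s - (s + d - s)%:C *: v).
have -> : phi (s + d) - phi s - (s + d - s)%:C *: w - (phi (s + d) - phi s - (s + d - s)%:C *: v)
  = d%:C *: (v - w) by lin_ring.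
rewrite snormZ// cabs_real (gtr0_norm d0) => h.
rewrite ds in m1 m2.
rewrite -(ler_pM2l d0); lra.
Qed.

End ScalarProductRule.

(** * Growth of the group, resolvents of its generator *)

Section GroupGrowth.
Context {R : realType} {X : completeNormedModType R[i]}.
Variable U : R -> X -> X.
Hypothesis hU : C0_group U.

Lemma group_vcont x s : vcont (@rnorm R X) (U ^~ x) s.
Proof.
case: hU => _ _ _ hc e e0.
have /cvg_rnormP/(_ e e0) := hc x s.
move=> /nbhs_ballP[d /= d0 hd]; exists d => // t ts.
by apply/ltW/hd; rewrite /ball /= distrC.
Qed.

(** Strong continuity bounds every orbit on [[-1, 1]], hence the operators by uniform boundedness.
    For other times [s] is divided by the integer just above [|s|], which costs one factor [M]
    besides the exponential. *)
Lemma group_exp_bound : exists th M, [/\ 0 <= th, 1 <= M &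
  forall s x, rnorm (U s x) <= M * expR (th * `|s|) * rnorm x].
Proof.
case: (hU) => hb h0 hD _.
have [M0 M00 hM0] : exists2 M, 0 <= M & forall (s : {s : R | -1 <= s <= 1}) x,
    rnorm (U (proj1_sig s) x) <= M * rnorm x.
  apply: uniform_boundedness => [s|x]; first exact: hb.
  suff [M hM] : exists M, forall s, -1 <= s <= 1 -> rnorm (U s x) <= M.
    by exists M => -[s hs]; exact: hM.
  apply: (@cousin R (fun u v => exists M, forall s, u <= s <= v -> rnorm (U s x) <= M)).
  - lra.
  - move=> u m v _ um mv _ [M1 h1] [M2 h2]; exists (Num.max M1 M2) => s /andP[us sv].
    rewrite le_max; have [sm|/ltW ms] := leP s m.
      by rewrite h1 ?us.
    by rewrite h2 ?orbT ?ms.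
  - move=> s _; have [d d0 hd] := group_vcont x s ltr01.
    exists d => // u v _ _ us sv uv; exists (rnorm (U s x) + 1) => t /andP[ut tv].
    have := hd t; rewrite ltr_distl => /(_ _)/=.
    have -> : (s - d < t < s + d) = true by apply/andP; split; lra.
    move=> /(_ isT) k; have := snorm_le_add snorm_rnorm (U t x) (U s x); lra.
pose M := Num.max M0 1.
have M1 : 1 <= M by rewrite le_max lexx orbT.
have M0' : 0 < M by lra.
have hM s x : -1 <= s <= 1 -> rnorm (U s x) <= M * rnorm x.
  move=> hs; apply: le_trans (hM0 (exist _ s hs) x) _.
  by rewrite ler_wpM2r ?rnorm_ge0// le_max lexx.
have pw n s x : -1 <= s <= 1 -> rnorm (U (n%:R * s) x) <= M ^+ n * rnorm x.
  move=> hs; elim: n => [|n IH]; first by rewrite mul0r h0 expr0 mul1r.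
  rewrite -natr1 mulrDl mul1r addrC hD exprS -mulrA.
  by apply: le_trans (hM _ _ hs) _; rewrite ler_wpM2l// ltW.
exists (ln M), M; split => //; first exact: ln_ge0.
move=> s x; pose n := (Num.truncn `|s|).+1.
have n0 : (0 : R) < n%:R by rewrite ltr0n.
have hsn : `|s| < n%:R := Num.Theory.truncnS_gt `|s|.
have -> : s = n%:R * (s / n%:R) by rewrite mulrCA divff ?mulr1// gt_eqF.
apply: le_trans (pw n _ x _) _.
  by rewrite -ler_norml normrM normfV (gtr0_norm n0) ler_pdivrMr// mul1r ltW.
rewrite mulrCA divff ?mulr1 ?gt_eqF// ler_wpM2r ?rnorm_ge0//.
rewrite exprS ler_wpM2l ?(ltW M0')//.
rewrite -{1}[M]lnK ?posrE// -expRM_natr ler_expR ler_wpM2l ?ln_ge0//.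
by rewrite Num.Theory.truncn_le.
Qed.

Lemma group_type_lt w : group_type U < w -> exists th M,
  [/\ 0 <= th, th < w, 1 <= M & forall s x, rnorm (U s x) <= M * expR (th * `|s|) * rnorm x].
Proof.
move=> hw; case: (hU) => hb _ _ _.
pose S := [set th : R | 0 <= th /\ exists M : R, 1 <= M /\
                forall s, opnorm (U s) <= M * expR (th * `|s|)].
have hS : has_inf S.
  split; last by exists 0 => x [].
  have [th [M [th0 M1 h]]] := group_exp_bound; exists th; split => //.
  exists M; split => // s; apply: opnorm_le => //.
  by rewrite mulr_ge0 ?expR_ge0//; lra.
have e0 : 0 < w - inf S by rewrite subr_gt0.
have [th [th0 [M [M1 h]]] hth] := inf_adherent e0 hS.
exists th, M; split => //; first by move: hth; rewrite addrC subrK.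
move=> s x; apply: le_trans (le_opnorm (hb s) x) _.
by rewrite ler_wpM2r ?rnorm_ge0.
Qed.

End GroupGrowth.

Section Resolvent.
Context {R : realType} {X : completeNormedModType R[i]}.
Variable U : R -> X -> X.
Hypothesis hU : C0_group U.
Variable A : set (X * X).
Hypothesis hA : forall x y : X, A (x, y) <-> generator U (x, - 'i *: y).
Variables (th M : R).
Hypotheses (th0 : 0 <= th) (M1 : 1 <= M).
Hypothesis hM : forall s x, rnorm (U s x) <= M * expR (th * `|s|) * rnorm x.

Local Notation vcont := (vcont (@rnorm R X)).
Local Notation vder := (vder (@rnorm R X)).
Let hr := @snorm_rnorm R X.

Lemma groupB s : bounded_op (U s). Proof. by case: hU. Qed.
Lemma group0 x : U 0 x = x. Proof. by case: hU. Qed.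
Lemma groupD s t x : U (s + t) x = U s (U t x). Proof. by case: hU. Qed.
Lemma groupC s t x : U s (U t x) = U t (U s x).
Proof. by rewrite -!groupD addrC. Qed.

Lemma generatorP x v : generator U (x, v) <-> vder (U ^~ x) 0 v.
Proof.
rewrite /generator /=; split.
  move=> /cvg_rnormP h e e0; have [d /= d0 hd] := h e e0.
  exists d => // t; rewrite subr0 => td; have [->|t0] := eqVneq t 0.
    by rewrite subrr scale0r subr0 rnorm0 normr0 mulr0.
  have := hd t; rewrite /ball /= sub0r normrN => /(_ td t0) k.
  have tC : t%:C != 0 :> R[i] by rewrite (inj_eq (@complexI R)).
  have -> : U t x - U 0 x - t%:C *: v = t%:C *: ((t^-1)%:C *: (U t x - x) - v).
    by rewrite scalerBr scalerA fmorphV mulfV// scale1r group0.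
  by rewrite rnormZ cabs_real mulrC ler_wpM2r// ltW.
move=> h; apply/cvg_rnormP => e e0; have e20 : 0 < e / 2 by lra.
have [d d0 hd] := h _ e20; exists d => // t; rewrite /ball /= sub0r normrN => td t0.
have := hd t; rewrite subr0 => /(_ td) k.
have tC : t%:C != 0 :> R[i] by rewrite (inj_eq (@complexI R)).
have -> : (t^-1)%:C *: (U t x - x) - v = (t^-1)%:C *: (U t x - U 0 x - t%:C *: v).
  by rewrite group0 [in RHS]scalerBr scalerA fmorphV mulVf// scale1r.
rewrite rnormZ cabs_real normfV mulrC ltr_pdivrMr ?normr_gt0//.
apply: le_lt_trans k _; rewrite ltr_pM2r ?normr_gt0//; lra.
Qed.

Lemma AP x y : A (x, y) <-> vder (U ^~ x) 0 (- 'i *: y).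
Proof. by rewrite hA generatorP. Qed.

Lemma vder_group x y s : A (x, y) -> vder (U ^~ x) s (U s (- 'i *: y)).
Proof.
move=> /AP h; have h1 := vder_op (groupB s) h.
have h2 : vder (fun t => (U s \o U ^~ x) (t + - s)) s (U s (- 'i *: y)).
  by apply: vder_shift; rewrite subrr.
move: h2; congr vder_of.
by apply/funext => t /=; rewrite -groupD addrC subrK.
Qed.

Lemma A_uniq x y y' : A (x, y) -> A (x, y') -> y = y'.
Proof.
move=> /AP h /AP h'; have /eqP := vder_uniq hr h h'.
rewrite rnorm_eq0 -scalerBr scaler_eq0 oppr_eq0 subr_eq0 => /orP[|/eqP//].
by rewrite eq_complex /= oner_eq0 andbF.
Qed.

Lemma A_lin a x y x' y' : A (x, y) -> A (x', y') -> A (a *: x + x', a *: y + y').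
Proof.
move=> /AP h /AP h'; apply/AP.
have -> : - 'i *: (a *: y + y') = a *: (- 'i *: y) + - 'i *: y' by lin_ring.
have -> : (U ^~ (a *: x + x')) = (fun t => a *: U t x + U t x').
  by apply/funext => t; rewrite (linear_mapD (groupB t).1) (linear_mapZ (groupB t).1).
by apply: vderD => //; exact: vderZ.
Qed.

Lemma A_0 : A (0, 0).
Proof.
apply/AP; rewrite scaler0 => e e0; exists 1 => // t _.
by rewrite !(linear_map0 (groupB _).1) subrr scaler0 subrr rnorm0 mulr_ge0 ?(ltW e0).
Qed.

Lemma A_Z a x y : A (x, y) -> A (a *: x, a *: y).
Proof. by move=> h; have := A_lin a h A_0; rewrite !addr0. Qed.

Lemma A_D x y x' y' : A (x, y) -> A (x', y') -> A (x + x', y + y').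
Proof. by move=> h h'; have := A_lin 1 h h'; rewrite !scale1r. Qed.

Lemma A_U s x y : A (x, y) -> A (U s x, U s y).
Proof.
move=> /AP h; apply/AP; have := vder_op (groupB s) h.
rewrite (linear_mapZ (groupB s).1); congr vder_of.
by apply/funext => t /=; rewrite groupC.
Qed.

(** As [-i A] generates the group, this is [exp (i h (z - A))]. Integrating it from 0 to [h] gives
    [Phi], with [(z - A) Phi h z = i (1 - qop h z)]: a truncated Laplace transform that is entire in
    [z]. *)
Definition qop h z x : X := ce h z *: U h x.
Definition Phi h z x : X := vint (fun s => ce s z *: U s x) 0 h.

Lemma qopB h z : bounded_op (qop h z).
Proof. exact/bounded_opZ/groupB. Qed.

Lemma qop_add s t z x : qop (s + t) z x = qop s z (qop t z x).
Proof. by rewrite /qop (linear_mapZ (groupB s).1) scalerA ceD groupD. Qed.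

Lemma qop0 z x : qop 0 z x = x. Proof. by rewrite /qop ce0 group0 scale1r. Qed.

Lemma qop_vcont z x s : vcont (fun s => qop s z x) s.
Proof.
have h1 := vder_ce s z; have ca := vder_cont snorm_cabs h1.
have cU := group_vcont hU x s => e e0.
have Y0 := rnorm_ge0 (U s x); have A0 := cabs_ge0 (ce s z).
pose e1 := e / (rnorm (U s x) + (cabs (ce s z) + 1)).
have den : 0 < rnorm (U s x) + (cabs (ce s z) + 1) by lra.
have e10 : 0 < e1 by rewrite divr_gt0.
have [d1 d10 k1] := ca _ e10; have [d2 d20 k2] := cU _ e10; have [d3 d30 k3] := ca _ ltr01.
exists (Num.min d1 (Num.min d2 d3)); first by rewrite !lt_min d10 d20.
move=> t; rewrite !lt_min => /and3P[/k1 m1 /k2 m2 /k3 m3].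
rewrite /qop.
have -> : ce t z *: U t x - ce s z *: U s x = (ce t z - ce s z) *: U s x + ce t z *: (U t x - U s x).
  by lin_ring.
apply: le_trans (rnormD _ _) _; rewrite !rnormZ.
have A1 : cabs (ce t z) <= cabs (ce s z) + 1.
  by have := snorm_le_add snorm_cabs (ce t z) (ce s z); rewrite /= in m3 *; lra.
have n1 := ler_wpM2r Y0 m1.
have n2 := ler_pM (cabs_ge0 _) (rnorm_ge0 _) A1 m2.
have E : e = e1 * (rnorm (U s x) + (cabs (ce s z) + 1)) by rewrite /e1 divfK// gt_eqF.
rewrite [in X in _ <= X]E mulrDr; rewrite /= in n1; lra.
Qed.

(** Applying [U t] shifts the window of integration to [[t, h + t]] and multiplies by [ce (- t) z].
    The orbit of [Phi h z x] is therefore differentiable for every [x], through the end points and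
    this factor. *)
Lemma Phi_A h z x : A (Phi h z x, z *: Phi h z x - 'i *: (x - qop h z x)).
Proof.
apply/AP.
pose g s := qop s z x.
have cg s : vcont g s by exact: qop_vcont.
have shift t : U t (Phi h z x) = ce (- t) z *: (prim g (h + t) - prim g t).
  rewrite /Phi -(@vint_op _ _ (U t) _ _ _ (groupB t))//.
  have -> : (fun s => U t (ce s z *: U s x)) = (fun s => ce (- t) z *: g (s + t)).
    apply/funext => s; rewrite (linear_mapZ (groupB t).1) -groupD /g /qop scalerA -ceD.
    by rewrite [s + t]addrC addKr.
  rewrite vintZ; last by move=> s; exact: vcont_shift.
  by rewrite vint_shift// /vint add0r.
have -> : U ^~ (Phi h z x) = (fun t => ce (- t) z *: (prim g (h + t) - prim g t)).
  by apply/funext => t; rewrite shift.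
have d1 : vder_of (cabs : R[i]^o -> R) (fun t => ce (- t) z) 0 (- ('i * z)).
  by have := vder_ce (- 0) z => /vder_refl; rewrite oppr0 ce0 mulr1; apply; exact: snorm_cabs.
have d2 : vder (fun t => prim g (h + t)) 0 (g h).
  have : vder (fun t => prim g (t + h)) 0 (g h).
    by apply: vder_shift; rewrite add0r; exact: primP.
  by congr vder_of; apply/funext => t; rewrite addrC.
have d3 := vderB hr d2 (primP cg 0).
have := vder_scale hr d1 d3; rewrite oppr0 ce0 scale1r addr0 /=.
congr vder_of.
rewrite -/(vint g 0 h) -/(Phi h z x) {2}/g qop0 /g -/(qop h z x).
move: (Phi h z x) (qop h z x) => P q.
have -> : - 'i *: (z *: P - 'i *: (x - q)) = - ('i * z) *: P + ('i * 'i) *: (x - q) by lin_ring.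
by rewrite -expr2 sqr_i; lin_ring.
Qed.

Lemma Phi_inv h z y y' : A (y, y') -> Phi h z (z *: y - y') = 'i *: (y - qop h z y).
Proof.
move=> hy.
have D s : vder (fun s => - 'i *: qop s z y) s (ce s z *: U s (z *: y - y')).
  have := vderZ hr (- 'i) (vder_scale hr (vder_ce s z) (vder_group s hy)).
  congr vder_of.
  rewrite (linear_mapZ (groupB s).1) (linear_mapB (groupB s).1) (linear_mapZ (groupB s).1).
  set a := U s y; set b := U s y'; rewrite scalerDr !scalerA.
  have ii : - 'i * 'i = 1 :> R[i] by rewrite mulNr -expr2 sqr_i opprK.
  have e1 : - 'i * ('i * z * ce s z) = ce s z * z :> R[i] by rewrite !mulrA ii mul1r mulrC.
  have e2 : - 'i * ce s z * - 'i = - ce s z :> R[i].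
    by rewrite -mulrA mulrCA mulrN -mulNr opprK -expr2 sqr_i mulrN1.
  by rewrite e1 e2; lin_ring.
rewrite /Phi (vintE _ _ _ D); last by move=> s; exact: qop_vcont.
by rewrite qop0; lin_ring.
Qed.

Lemma neumann (Q : X -> X) rho : bounded_op Q -> 0 <= rho < 1 ->
  (forall x, rnorm (Q x) <= rho * rnorm x) ->
  forall x, exists2 y, y - Q y = x & rnorm y <= (1 - rho)^-1 * rnorm x.
Proof.
move=> hQ /andP[r0 r1] hq x.
pose s n := \sum_(k < n) iter k Q x.
have it k : rnorm (iter k Q x) <= rho ^+ k * rnorm x.
  elim: k => [|k IH]; first by rewrite expr0 mul1r.
  by rewrite iterS exprS -mulrA; apply: le_trans (hq _) _; rewrite ler_wpM2l.
have R1 : 0 < 1 - rho by rewrite subr_gt0.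
have tail n k : rnorm (s (n + k)%N - s n) <= (1 - rho)^-1 * rnorm x * (rho ^+ n - rho ^+ (n + k)).
  elim: k => [|k IH]; first by rewrite addn0 !subrr rnorm0 mulr0.
  rewrite addnS {1}/s big_ord_recr /= -/(s (n + k)%N) addrAC.
  apply: le_trans (rnormD _ _) _; apply: le_trans (lerD IH (it _)) _.
  have -> : rho ^+ (n + k) * rnorm x = (1 - rho)^-1 * rnorm x * (rho ^+ (n + k) - rho ^+ (n + k).+1).
    by rewrite [in RHS]exprS; field; rewrite gt_eqF.
  by rewrite -mulrDr addrA subrK.
have tail' n m : (n <= m)%N -> rnorm (s m - s n) <= (1 - rho)^-1 * rnorm x * rho ^+ n.
  move=> nm; have := tail n (m - n)%N; rewrite subnKC// => h; apply: le_trans h _.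
  rewrite ler_wpM2l ?mulr_ge0 ?invr_ge0 ?(ltW R1) ?rnorm_ge0//.
  by have := exprn_ge0 m r0; lra.
have small e : 0 < e -> exists N, forall n, (N <= n)%N -> (1 - rho)^-1 * rnorm x * rho ^+ n < e.
  move=> e0; set C := (1 - rho)^-1 * rnorm x.
  have C0 : 0 <= C by rewrite mulr_ge0 ?invr_ge0 ?(ltW R1) ?rnorm_ge0.
  have e10 : 0 < e / (C + 1) by rewrite divr_gt0// ltr_wpDl.
  have : rho ^+ n @[n --> \oo] --> (0 : R) by apply: cvg_expr; rewrite ger0_norm.
  move=> /cvgrPdist_lt/(_ _ e10)[N _ hN]; exists N => n /hN.
  rewrite sub0r normrN ger0_norm ?exprn_ge0// ltr_pdivlMr ?ltr_wpDl// => k.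
  have := exprn_ge0 n r0; nra.
have [y hy] : exists l, forall e, 0 < e -> exists N, forall n, (N <= n)%N -> rnorm (s n - l) < e.
  apply: rnorm_complete => e e0; have e20 : 0 < e / 2 by lra.
  have [N hN] := small _ e20; exists N => m n Nm Nn.
  have := tail' N m Nm; have := tail' N n Nn; have := hN N (leqnn _).
  have := rnormB (s m - s N) (s n - s N).
  have -> : s m - s N - (s n - s N) = s m - s n by lin_ring.
  lra.
have sS n : s n.+1 = x + Q (s n).
  rewrite /s big_ord_recl (linear_map_sum _ _ _ hQ.1) /=; congr (_ + _).
exists y.
  apply/eqP; rewrite -subr_eq0; apply/eqP/rnorm_small => e e0.
  have e20 : 0 < e / 2 by lra.
  have [N hN] := hy _ e20.
  have h1 := hN N (leqnn _); have h2 := hN N.+1 (leqnSn _).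
  have -> : y - Q y - x = Q (s N - y) - (s N.+1 - y).
    by rewrite (linear_mapB hQ.1) sS; lin_ring.
  have := rnormB (Q (s N - y)) (s N.+1 - y); have := hq (s N - y).
  have := rnorm_ge0 (s N - y); nra.
apply/ler_addgt0Pl => e e0; have [N hN] := hy _ e0.
have := hN N (leqnn _); have := tail' 0%N N (leq0n _).
rewrite /s big_ord0 subr0 expr0 mulr1 -/(s N).
have := snorm_le_add hr y (s N); rewrite (rnormBC y); lra.
Qed.

Let M0 : 0 < M. Proof. by move: M1; lra. Qed.

Lemma qop_le h z x : rnorm (qop h z x) <= M * expR (th * `|h| - h * complex.Im z) * rnorm x.
Proof.
rewrite /qop rnormZ cabs_ce expRD; apply: le_trans (ler_wpM2l (expR_ge0 _) (hM h x)) _.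
by rewrite !mulrA [expR _ * M]mulrC -!mulrA; rewrite (mulrCA (expR (- _))).
Qed.

(** For [h] large and of the sign of [Im z] the operator [qop h z] has norm at most 1/2, so
    [1 - qop h z] is inverted by a Neumann series and [- i Phi h z] after this inverse is the
    resolvent. A finite time thus suffices, and the bound is uniform in [z]. *)
Lemma resolvent_exists y0 : th < y0 -> exists2 C, 0 <= C & forall z, y0 <= `|complex.Im z| ->
  forall x, exists2 y, A (y, z *: y - x) & rnorm y <= C * rnorm x.
Proof.
move=> hy0.
(* The time at which [M * exp (- L (y0 - th))] equals 1/2. *)
pose L := ln (2 * M) / (y0 - th).
have yt : 0 < y0 - th by rewrite subr_gt0.
have l0 : 0 <= ln (2 * M) by apply: ln_ge0; move: M1; lra.
have L0 : 0 <= L by rewrite divr_ge0// ltW.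
exists (2 * M * L); first by apply: mulr_ge0 => //; apply: mulr_ge0 => //; exact: ltW.
move=> z hz x.
pose h : R := if 0 <= complex.Im z then L else - L.
have hh t : 0 <= t -> th * `|if 0 <= complex.Im z then t else - t|
    - (if 0 <= complex.Im z then t else - t) * complex.Im z <= - (t * (y0 - th)).
  move=> t0; move: hz; have [z0|z0] := leP 0 (complex.Im z); rewrite ?normrN (ger0_norm t0).
    rewrite (ger0_norm z0) => hz; nra.
  rewrite (ltr0_norm z0) => hz; nra.
have q2 v : rnorm (qop h z v) <= 1 / 2 * rnorm v.
  apply: le_trans (qop_le h z v) _; rewrite ler_wpM2r ?rnorm_ge0//.
  have : expR (th * `|h| - h * complex.Im z) <= (2 * M)^-1.
    apply: le_trans (_ : expR (- ln (2 * M)) <= _).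
      rewrite ler_expR; apply: le_trans (hh L L0) _.
      by rewrite /L divfK// gt_eqF.
    by rewrite expRN lnK// posrE mulr_gt0.
  by move=> k; have := ler_wpM2l (ltW M0) k; rewrite invfM mulrCA divff ?gt_eqF// mulr1; lra.
have hf : 0 <= (1 / 2 : R) < 1 by apply/andP; split; lra.
have [w hw wx] := neumann (qopB h z) hf q2 x.
exists (- 'i *: Phi h z w).
  have := A_Z (- 'i) (Phi_A h z w); rewrite hw.
  move: (Phi h z w) => P.
  have -> : - 'i *: (z *: P - 'i *: x) = z *: (- 'i *: P) + ('i * 'i) *: x by lin_ring.
  by rewrite -expr2 sqr_i scaleN1r.
rewrite rnormZ cabsN cabs_i mul1r.
have bnd s : 0 <= s -> rnorm (qop (if 0 <= complex.Im z then s else - s) z w) <= M * rnorm w.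
  move=> s0; apply: le_trans (qop_le _ _ _) _; rewrite ler_wpM2r ?rnorm_ge0//.
  rewrite -[leRHS]mulr1 ler_wpM2l ?(ltW M0)// -expR0 ler_expR.
  by apply: le_trans (hh s s0) _; rewrite oppr_le0 mulr_ge0// ltW.
have : rnorm (Phi h z w) <= M * rnorm w * L.
  rewrite /Phi /h; move: bnd; case: ifP => z0 bnd.
    rewrite -[in leRHS](subr0 L); apply: vint_le => //; first by move=> s; exact: qop_vcont.
    by move=> s /andP[s0 _]; exact: bnd.
  have -> : vint (fun s => ce s z *: U s w) 0 (- L) = - vint (fun s => ce s z *: U s w) (- L) 0.
    by rewrite /vint opprB.
  rewrite rnormN -[in leRHS](opprK L) -[in leRHS](sub0r (- L)).
  apply: vint_le; [by move=> s; exact: qop_vcont|by rewrite oppr_le0|].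
  by move=> s /andP[_ s0]; rewrite -[s]opprK; apply: bnd; rewrite oppr_ge0.
have : rnorm w <= 2 * rnorm x by apply: le_trans wx _; rewrite (_ : (1 - 1 / 2)^-1 = 2)//; field.
move=> k1 k2; apply: le_trans k2 _.
have -> : 2 * M * L * rnorm x = M * L * (2 * rnorm x) by ring.
by rewrite mulrAC ler_wpM2l// mulr_ge0// ltW.
Qed.

(** The difference [v] satisfies [A v = z v], hence is fixed by every [qop s z]; at a suitable time
    this operator has norm at most 1/2. *)
Lemma resolvent_uniq z y y' x : th < `|complex.Im z| -> A (y, z *: y - x) ->
  A (y', z *: y' - x) -> y = y'.
Proof.
move=> hz h h'; apply/eqP; rewrite -subr_eq0; apply/eqP.
set v := y - y'.
have hv : A (v, z *: v).
  have := A_D h (A_Z (-1) h'); rewrite scaleN1r; congr (A (_, _)).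
  by rewrite /v; lin_ring.
have fixq s : qop s z v = v.
  have := Phi_inv s z hv; rewrite subrr.
  have -> : Phi s z 0 = 0.
    rewrite /Phi; have -> : (fun s0 => ce s0 z *: U s0 (0 : X)) = fun=> 0.
      by apply/funext => t; rewrite (linear_map0 (groupB t).1) scaler0.
    by rewrite vint_cst scaler0.
  move=> /esym/eqP; rewrite scaler_eq0 subr_eq0 => /orP[|/eqP//].
  by rewrite eq_complex /= oner_eq0 andbF.
pose D := `|complex.Im z| - th.
have D0 : 0 < D by rewrite subr_gt0.
have l0 : 0 <= ln (2 * M) by apply: ln_ge0; move: M1; lra.
pose L := ln (2 * M) / D.
have L0 : 0 <= L by rewrite divr_ge0// ltW.
pose s : R := if 0 <= complex.Im z then L else - L.
have := qop_le s z v; rewrite fixq => hq.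
have : expR (th * `|s| - s * complex.Im z) = (2 * M)^-1.
  rewrite -[in RHS](lnK (_ : 2 * M \is Num.pos)) ?posrE ?mulr_gt0// -expRN; congr expR.
  have -> : ln (2 * M) = L * D by rewrite /L divfK// gt_eqF.
  rewrite /s /D; have [z0|z0] := leP 0 (complex.Im z); rewrite ?normrN (ger0_norm L0).
    by rewrite (ger0_norm z0); ring.
  by rewrite (ltr0_norm z0); ring.
move=> E; rewrite E invfM mulrCA divff ?gt_eqF// mulr1 in hq.
apply: rnorm_le0; have := rnorm_ge0 v; lra.
Qed.

Lemma resolventP z x : th < `|complex.Im z| -> A (resolvent A z x, z *: resolvent A z x - x).
Proof.
move=> hz; have [C _ h] := resolvent_exists hz.
have [y hy _] := h z (lexx _) x.
rewrite /resolvent /op_fun.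
by apply: (@getPex _ [set y0 | A (y0, z *: y0 - x)]); exists y.
Qed.

Lemma resolventE z x y : th < `|complex.Im z| -> A (y, z *: y - x) -> resolvent A z x = y.
Proof. by move=> hz hy; apply: (resolvent_uniq hz (resolventP x hz) hy). Qed.

Lemma resolvent_bound y0 : th < y0 -> exists2 C, 0 <= C & forall z, y0 <= `|complex.Im z| ->
  forall x, rnorm (resolvent A z x) <= C * rnorm x.
Proof.
move=> hy; have [C C0 h] := resolvent_exists hy; exists C => // z hz x.
have [y hy' yb] := h z hz x; rewrite (resolventE _ hy')//; exact: lt_le_trans hy hz.
Qed.

Lemma resolvent_lin z : th < `|complex.Im z| -> linear (resolvent A z).
Proof.
move=> hz a x y; apply: resolventE => //.
have := A_lin a (resolventP x hz) (resolventP y hz); congr (A (_, _)); lin_ring.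
Qed.

Lemma resolventB z : th < `|complex.Im z| -> bounded_op (resolvent A z).
Proof.
move=> hz; split; first exact: resolvent_lin.
by have [C _ h] := resolvent_bound hz; exists C => x; exact: h.
Qed.

Lemma resolvent_id z u x : th < `|complex.Im z| -> th < `|complex.Im u| ->
  resolvent A z x - resolvent A u x = (u - z) *: resolvent A u (resolvent A z x).
Proof.
move=> hz hu; apply/eqP; rewrite subr_eq addrC -subr_eq; apply/eqP.
rewrite -(linear_mapZ (resolvent_lin hu)).
apply/esym/eqP; rewrite eq_sym subr_eq; apply/eqP.
rewrite -(linear_mapD (resolvent_lin hu)).
apply/esym/resolventE => //.
have := resolventP x hz; congr (A (_, _)); lin_ring.
Qed.

Lemma resolvent_eq0 z x : th < `|complex.Im z| -> resolvent A z x = 0 -> x = 0.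
Proof.
move=> hz h; have := resolventP x hz; rewrite h scaler0 sub0r => h1.
by have /eqP := A_uniq h1 A_0; rewrite oppr_eq0 => /eqP.
Qed.

Lemma resolvent_A z x y : th < `|complex.Im z| -> A (x, y) -> resolvent A z (z *: x - y) = x.
Proof.
by move=> hz h; apply: resolventE => //; rewrite opprB addrC subrK.
Qed.

Lemma resolvent_comm z T x : th < `|complex.Im z| -> commutant A T ->
  T (resolvent A z x) = resolvent A z (T x).
Proof.
move=> hz [[lT _] hT]; apply/esym/resolventE => //.
by have := hT _ _ (resolventP x hz); rewrite (linear_mapB lT) (linear_mapZ lT).
Qed.

Lemma commutant_U s : commutant A (U s).
Proof. by split; [exact: groupB|move=> x y; exact: A_U]. Qed.

Lemma commutant_res z : th < `|complex.Im z| -> commutant A (resolvent A z).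
Proof.
move=> hz; split; first exact: resolventB.
move=> x y hxy; have h1 := resolventP x hz; have h2 := resolventP y hz.
have E : z *: resolvent A z x - x = resolvent A z y.
  have := resolvent_A hz hxy.
  rewrite (linear_mapB (resolvent_lin hz)) (linear_mapZ (resolvent_lin hz)) => E.
  by rewrite -{2}E opprB addrC subrK.
by rewrite -E.
Qed.

Lemma resolventC z u x : th < `|complex.Im z| -> th < `|complex.Im u| ->
  resolvent A z (resolvent A u x) = resolvent A u (resolvent A z x).
Proof. by move=> hz hu; rewrite (resolvent_comm _ hu (commutant_res hz)). Qed.

(* [U (- s) (T (U s x))] has zero derivative for [x] in the domain. *)
Lemma commutant_group s T x : commutant A T -> T (U s x) = U s (T x).
Proof.
move=> hT; have [bT cT] := hT.
have D x0 y0 : A (x0, y0) -> T (U s x0) = U s (T x0).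
  move=> hx.
  have dz t : vder (fun t => U (- t) (T (U t x0))) t 0.
    have h1 := A_U t hx; have h2 := cT _ _ h1.
    set v := U t x0 in h1 h2; set v' := U t y0 in h1 h2.
    have k1 := vder_op bT ((AP _ _).1 h1); have k2 := (AP _ _).1 h2.
    have k3 := vderB hr k1 k2; rewrite (linear_mapZ bT.1) subrr in k3.
    have E r : U (- r) (T (U r x0)) - U (- t) (T (U t x0)) =
        U (- r) (T (U (r - t) v) - U (r - t) (T v)).
      rewrite (linear_mapB (groupB _).1) -(groupD (- r)) addrA addNr sub0r.
      by rewrite /v -(groupD (r - t)) subrK.
    move=> e e0.
    pose K := M * expR (th * (`|t| + 1)).
    have K0 : 0 < K by rewrite mulr_gt0 ?expR_gt0.
    have e10 : 0 < e / K by rewrite divr_gt0.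
    have [d d0 hd] := k3 _ e10.
    exists (Num.min d 1); first by rewrite lt_min d0 ltr01.
    move=> r; rewrite lt_min => /andP[rd r1].
    rewrite scaler0 subr0 E; apply: le_trans (hM _ _) _.
    have := hd (r - t); rewrite subr0 => /(_ rd).
    rewrite /= !group0 subrr subr0 scaler0 subr0 mulrAC ler_pdivlMr// => k.
    apply: le_trans k; rewrite mulrC ler_wpM2l ?rnorm_ge0// ler_wpM2l ?(ltW M0)//.
    rewrite ler_expR ler_wpM2l// normrN.
    have := ler_normD (r - t) t; rewrite subrK; lra.
  have /eqP := vder0_const hr dz 0 s.
  rewrite rnorm_eq0 subr_eq0 oppr0 !group0 => /eqP E.
  by rewrite -E -groupD subrr group0.
(* Passage from the domain to all of [X]: the resolvent at this point is injective, maps into the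
   domain and commutes with both [T] and [U s]. *)
pose z : R[i] := 0 +i* (th + 1).
have hz : th < `|complex.Im z| by rewrite (_ : complex.Im z = th + 1)// ger0_norm ?addr_ge0// ltrDl ltr01.
apply/eqP; rewrite -subr_eq0; apply/eqP/(resolvent_eq0 hz).
rewrite (linear_mapB (resolvent_lin hz)) -(resolvent_comm _ hz hT).
rewrite -!(resolvent_comm _ hz (commutant_U s)) -(resolvent_comm _ hz hT).
by rewrite (D _ _ (resolventP x hz)) subrr.
Qed.

End Resolvent.

(** * Line integrals and the functional calculus *)

Section ReIm.
Context {R : realType}.
Implicit Types z u : R[i].

Lemma ReB z u : complex.Re (z - u) = complex.Re z - complex.Re u.
Proof. by case: z u => a b []. Qed.
Lemma ImB z u : complex.Im (z - u) = complex.Im z - complex.Im u.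
Proof. by case: z u => a b []. Qed.
Lemma ReN z : complex.Re (- z) = - complex.Re z. Proof. by case: z. Qed.
Lemma ImN z : complex.Im (- z) = - complex.Im z. Proof. by case: z. Qed.

End ReIm.

Section ComplexDerivative.
Context {R : realType} {V : lmodType R[i]} (rho : V -> R) (hr : snorm rho).
Implicit Types (F G : R[i] -> V) (c : R[i] -> R[i]).

(** [cder] for an arbitrary seminorm, so that scalar factors and vectors share one product rule. *)
Definition gcder F (z : R[i]) (L : V) : Prop :=
  forall e, 0 < e -> exists2 del, 0 < del & forall u, cabs (u - z) < del ->
    rho (F u - F z - (u - z) *: L) <= e * cabs (u - z).

Lemma gcder_quadratic F z L C del : 0 < del -> 0 <= C ->
  (forall u, cabs (u - z) < del -> rho (F u - F z - (u - z) *: L) <= C * cabs (u - z) ^+ 2) ->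
  gcder F z L.
Proof.
move=> d0 C0 h e e0; have C1 : 0 < C + 1 by rewrite ltr_wpDl.
exists (Num.min del (e / (C + 1))); first by rewrite lt_min d0 divr_gt0.
move=> u; rewrite lt_min ltr_pdivlMr// => /andP[/h k1 k2].
apply: le_trans k1 _; rewrite expr2 mulrA ler_wpM2r ?cabs_ge0//.
have := cabs_ge0 (u - z); nra.
Qed.

Lemma gcder_cst v z : gcder (fun=> v) z 0.
Proof.
move=> e e0; exists 1 => // u _.
by rewrite subrr scaler0 subrr snorm0// mulr_ge0 ?(ltW e0) ?cabs_ge0.
Qed.

Lemma gcderD F G z L K : gcder F z L -> gcder G z K -> gcder (fun u => F u + G u) z (L + K).
Proof.
move=> h1 h2 e e0; have e20 : 0 < e / 2 by lra.
have [d1 d10 H1] := h1 _ e20; have [d2 d20 H2] := h2 _ e20.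
exists (Num.min d1 d2) => [|u]; rewrite lt_min ?d10// => /andP[/H1 k1 /H2 k2].
have := snormD hr (F u - F z - (u - z) *: L) (G u - G z - (u - z) *: K).
have -> : F u - F z - (u - z) *: L + (G u - G z - (u - z) *: K) =
   F u + G u - (F z + G z) - (u - z) *: (L + K) by lin_ring.
have : e * cabs (u - z) = e / 2 * cabs (u - z) + e / 2 * cabs (u - z) by field.
lra.
Qed.

Lemma gcder_cont F z L : gcder F z L -> forall e, 0 < e -> exists2 del, 0 < del &
  forall u, cabs (u - z) < del -> rho (F u - F z) <= e.
Proof.
move=> h e e0; have [d d0 H] := h 1 ltr01.
have k0 : 0 < rho L + 1 by rewrite ltr_wpDl// snorm_ge0.
exists (Num.min d (e / (rho L + 1))); first by rewrite lt_min d0 divr_gt0.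
move=> t; rewrite lt_min => /andP[/H k]; rewrite ltr_pdivlMr// => k2.
have := snorm_le_add hr (F t - F z) ((t - z) *: L).
rewrite snormZ//; lra.
Qed.

End ComplexDerivative.

Section ComplexProductRule.
Context {R : realType} {V : lmodType R[i]} (rho : V -> R) (hr : snorm rho).
Implicit Types (F G : R[i] -> V) (c : R[i] -> R[i]).

Lemma gcder_scale c F z (c' : R[i]) L : gcder (cabs : R[i]^o -> R) c z c' ->
  gcder rho F z L -> gcder rho (fun u => c u *: F u) z (c' *: F z + c z *: L).
Proof.
move=> ha hy e e0.
have ca := gcder_cont snorm_cabs ha.
have Y0 := snorm_ge0 hr (F z); have V0 := snorm_ge0 hr L; have A0 := cabs_ge0 (c z).
pose e1 := e / (rho (F z) + (cabs (c z) + 1) + rho L + 1).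
have den : 0 < rho (F z) + (cabs (c z) + 1) + rho L + 1 by lra.
have e10 : 0 < e1 by rewrite divr_gt0.
have [d1 d10 h1] := ha _ e10; have [d2 d20 h2] := hy _ e10.
have [d3 d30 h3] := ca _ e10; have [d4 d40 h4] := ca _ ltr01.
exists (Num.min (Num.min d1 d2) (Num.min d3 d4)); first by rewrite !lt_min d10 d20 d30.
move=> u; rewrite !lt_min => /andP[/andP[/h1 k1 /h2 k2] /andP[/h3 k3 /h4 k4]].
have -> : c u *: F u - c z *: F z - (u - z) *: (c' *: F z + c z *: L) =
   (c u - c z - (u - z) * c') *: F z + c u *: (F u - F z - (u - z) *: L)
   + (u - z) *: ((c u - c z) *: L) by lin_ring.
apply: le_trans (snormD hr _ _) _; apply: le_trans (lerD (snormD hr _ _) (lexx _)) _.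
rewrite !snormZ//.
have A1 : cabs (c u) <= cabs (c z) + 1.
  by have := snorm_le_add snorm_cabs (c u) (c z); rewrite /= in k4 *; lra.
have m1 := ler_wpM2r Y0 k1.
have m2 := ler_pM (cabs_ge0 _) (snorm_ge0 hr _) A1 k2.
have m3 := ler_wpM2r V0 k3.
have m4 := ler_wpM2l (cabs_ge0 (u - z)) m3.
have E : e = e1 * (rho (F z) + (cabs (c z) + 1) + rho L + 1) by rewrite /e1 divfK// gt_eqF.
have T0 := cabs_ge0 (u - z).
have : 0 <= e1 * cabs (u - z) by rewrite mulr_ge0// ltW.
rewrite [in X in _ -> _ <= X]E /GRing.scale /= in k1 m1 *; nra.
Qed.

Definition sdiff c z := exists c' : R[i]^o, gcder (cabs : R[i]^o -> R) c z c'.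

Lemma sdiff_inv (a z : R[i]) : a != z -> sdiff (fun u => (a - u)^-1) z.
Proof.
move=> az; exists ((a - z)^-1 * (a - z)^-1 : R[i]^o).
have D0 : 0 < cabs (a - z) by rewrite cabs_gt0 subr_eq0.
apply: (@gcder_quadratic _ _ _ _ _ _ (2 * (cabs (a - z))^-1 ^+ 3) (cabs (a - z) / 2)).
- by rewrite divr_gt0.
- by rewrite mulr_ge0// exprn_ge0// invr_ge0 cabs_ge0.
move=> u hu.
have h : cabs (a - z) / 2 <= cabs (a - u).
  by have := cabsD (a - u) (u - z); rewrite addrA subrK; lra.
have au0 : 0 < cabs (a - u) by apply: lt_le_trans h; rewrite divr_gt0.
have E : (a - u)^-1 - (a - z)^-1 - (u - z) *: ((a - z)^-1 * (a - z)^-1 : R[i]^o) =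
    (u - z) ^+ 2 * ((a - z)^-1 ^+ 2 * (a - u)^-1).
  rewrite /GRing.scale /=; field.
  by rewrite -!cabs_eq0 !gt_eqF.
rewrite E cabsM cabsX cabsM cabsX !cabsV mulrC ler_wpM2r ?exprn_ge0 ?cabs_ge0//.
have -> : 2 * (cabs (a - z))^-1 ^+ 3 = (cabs (a - z))^-1 ^+ 2 * (cabs (a - z) / 2)^-1.
  by field; rewrite gt_eqF.
rewrite ler_wpM2l ?exprn_ge0 ?invr_ge0 ?cabs_ge0//.
by rewrite lef_pV2// posrE divr_gt0.
Qed.

Lemma sdiff_ce s z : sdiff (ce s) z.
Proof.
exists ('i * s%:C * ce s z : R[i]^o).
pose C := cabs (ce s z) * (8 * s ^+ 2).
apply: (@gcder_quadratic _ _ _ _ _ _ C (2 * (`|s| + 1))^-1).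
- by rewrite invr_gt0; have := normr_ge0 s; lra.
- by rewrite mulr_ge0 ?cabs_ge0// mulr_ge0// sqr_ge0.
move=> u hu; have s0 := normr_ge0 s.
pose w := 'i * s%:C * (u - z).
have cw : cabs w = `|s| * cabs (u - z) by rewrite /w !cabsM cabs_i mul1r cabs_real.
have w1 : cabs w <= 1 / 2.
  have z1 : 0 < 2 * (`|s| + 1) by lra.
  rewrite cw; have : cabs (u - z) * (2 * (`|s| + 1)) <= 1.
    by rewrite -ler_pdivlMr// div1r ltW.
  have := cabs_ge0 (u - z); nra.
have -> : ce s u - ce s z - (u - z) *: ('i * s%:C * ce s z : R[i]^o) = ce s z * (cexp w - 1 - w).
  rewrite -{1}(subrK z u) addrC ceDz /w /ce /GRing.scale /=; ring.
rewrite cabsM; apply: le_trans (ler_wpM2l (cabs_ge0 _) (cexp_taylor w1)) _.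
rewrite cw exprMn real_normK ?num_real// /C; by rewrite le_eqVlt; apply/orP; left; apply/eqP; ring.
Qed.

End ComplexProductRule.

Section VectorHolomorphy.
Context {R : realType} {X : completeNormedModType R[i]}.
Implicit Types (F G : R[i] -> X) (c : R[i] -> R[i]).
Let hr := @snorm_rnorm R X.

Definition cdiff F z := exists L, cder F z L.

Lemma cdiff_cst v z : cdiff (fun=> v) z.
Proof. by exists 0; exact: (gcder_cst hr). Qed.

Lemma cdiffD F G z : cdiff F z -> cdiff G z -> cdiff (fun u => F u + G u) z.
Proof. by move=> [L hL] [K hK]; exists (L + K); exact: (gcderD hr). Qed.

Lemma cdiff_scale c F z : sdiff c z -> cdiff F z -> cdiff (fun u => c u *: F u) z.
Proof.
by move=> [c' hc] [L hL]; exists (c' *: F z + c z *: L); exact: (gcder_scale hr).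
Qed.

Lemma sdiff_cst (a z : R[i]) : sdiff (fun=> a) z.
Proof. by exists 0; exact: (gcder_cst snorm_cabs). Qed.

Lemma cdiffZ a F z : cdiff F z -> cdiff (fun u => a *: F u) z.
Proof. exact/cdiff_scale/sdiff_cst. Qed.

Lemma cdiff_sum (I : Type) (s : seq I) (F : I -> R[i] -> X) z :
  (forall i, cdiff (F i) z) -> cdiff (fun u => \sum_(i <- s) F i u) z.
Proof.
move=> h; elim: s => [|i s IH].
  by under boolp.eq_fun do rewrite big_nil; exact: cdiff_cst.
by under boolp.eq_fun do rewrite big_cons; exact: cdiffD.
Qed.

Lemma cdiff_op T F z : bounded_op T -> cdiff F z -> cdiff (fun u => T (F u)) z.
Proof.
move=> hT [L hL]; exists (T L) => e e0; have [M M0 hM] := bounded_opP hT.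
have e1 : 0 < e / (M + 1) by rewrite divr_gt0// ltr_wpDl.
have [d d0 H] := hL _ e1; exists d => // t /H k.
rewrite -(linear_mapZ hT.1) -!(linear_mapB hT.1).
apply: le_trans (hM _) _; apply: le_trans (ler_wpM2l M0 k) _.
rewrite mulrA ler_wpM2r ?cabs_ge0// mulrA ler_pdivrMr ?ltr_wpDl//; nra.
Qed.

Lemma sdiff_reg (k : R) z : complex.Im z != k -> sdiff (reg k) z.
Proof.
move=> hz; have az : k%:C * 'i != z.
  by apply: contra hz => /eqP <-; rewrite /= !mul0r mulr1 addr0.
have [c hc] := sdiff_inv az.
exists (c * (k%:C * 'i - z)^-1 + (k%:C * 'i - z)^-1 * c : R[i]^o).
have := gcder_scale (snorm_cabs) hc hc; congr gcder.
by apply/funext => u; rewrite /reg /GRing.scale /= -expr2 exprVn.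
Qed.

Lemma cabs_reg (k : R) (z : R[i]) :
  cabs (reg k z) = (complex.Re z ^+ 2 + (k - complex.Im z) ^+ 2)^-1.
Proof.
rewrite /reg cabsV cabsX cabs_sqr; case: z => x y /=; congr (_^-1).
by rewrite mulr0 !mul0r mulr1 addr0 subr0 sub0r sqrrN.
Qed.

Lemma cabs_reg_le (k a : R) (z : R[i]) : 0 < a -> a <= `|k - complex.Im z| ->
  cabs (reg k z) <= (complex.Re z ^+ 2 + a ^+ 2)^-1.
Proof.
move=> a0 h; rewrite cabs_reg -(real_normK (num_real (k - _))).
rewrite lef_pV2 ?posrE ?ltr_wpDl ?sqr_ge0 ?exprn_gt0 ?(lt_le_trans a0 h)//.
by rewrite lerD2l lerXn2r ?nnegrE// ltW.
Qed.

Lemma line_lint F y K a : 0 < a -> 0 <= K -> (forall s, cdiff F (s +i* y)) ->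
  (forall s, rnorm (F (s +i* y)) <= K / (s ^+ 2 + a ^+ 2)) ->
  exists2 L, is_lint (fun s => F (s +i* y)) L & rnorm L <= K / a * pi.
Proof.
move=> a0 K0 dF bF; apply: is_lint_exists => // s e e0.
have [L hL] := dF s; have [d d0 hd] := cder_cont hL e0.
exists d => // t ts; apply: hd.
by rewrite cabsE /= subrr expr0n addr0 sqrtr_sqr.
Qed.

Lemma vcont_scale (a : R -> R[i]) (y : R -> X) s :
  vcont (cabs : R[i]^o -> R) a s -> vcont (@rnorm R X) y s ->
  vcont (@rnorm R X) (fun t => a t *: y t) s.
Proof.
move=> ca cU e e0.
have Y0 := rnorm_ge0 (y s); have A0 := cabs_ge0 (a s).
pose e1 := e / (rnorm (y s) + (cabs (a s) + 1)).
have den : 0 < rnorm (y s) + (cabs (a s) + 1) by lra.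
have e10 : 0 < e1 by rewrite divr_gt0.
have [d1 d10 k1] := ca _ e10; have [d2 d20 k2] := cU _ e10; have [d3 d30 k3] := ca _ ltr01.
exists (Num.min d1 (Num.min d2 d3)); first by rewrite !lt_min d10 d20.
move=> t; rewrite !lt_min => /and3P[/k1 m1 /k2 m2 /k3 m3].
have -> : a t *: y t - a s *: y s = (a t - a s) *: y s + a t *: (y t - y s) by lin_ring.
apply: le_trans (rnormD _ _) _; rewrite !rnormZ.
have A1 : cabs (a t) <= cabs (a s) + 1.
  by have := snorm_le_add snorm_cabs (a t) (a s); rewrite /= in m3 *; lra.
have n1 := ler_wpM2r Y0 m1.
have n2 := ler_pM (cabs_ge0 _) (rnorm_ge0 _) A1 m2.
have E : e = e1 * (rnorm (y s) + (cabs (a s) + 1)) by rewrite /e1 divfK// gt_eqF.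
rewrite [in X in _ <= X]E mulrDr; rewrite /= in n1; lra.
Qed.

End VectorHolomorphy.

Section Calculus.
Context {R : realType} {X : completeNormedModType R[i]}.
Variable U : R -> X -> X.
Hypothesis hU : C0_group U.
Variable A : set (X * X).
Hypothesis hA : forall x y : X, A (x, y) <-> generator U (x, - 'i *: y).
Variables (th M : R).
Hypotheses (th0 : 0 <= th) (M1 : 1 <= M).
Hypothesis hM : forall s x, rnorm (U s x) <= M * expR (th * `|s|) * rnorm x.
Variables (w' w : R).
Hypotheses (thw : th < w') (ww : w' < w).

Let hr := @snorm_rnorm R X.
Let M0 : 0 < M. Proof. by move: M1; lra. Qed.
Let w'0 : 0 < w'. Proof. by move: th0 thw; lra. Qed.
Local Notation res := (resolvent A).
Local Notation resP := (resolventP hU hA M1 hM).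

Lemma res_cdiff x z : th < `|complex.Im z| -> cdiff (fun u => res u x) z.
Proof.
move=> hz; pose y0 := (th + `|complex.Im z|) / 2.
have hy0 : th < y0 by rewrite /y0; lra.
have [C C0 hC] := resolvent_bound hU hA M1 hM hy0.
exists (- res z (res z x)).
have d0 : 0 < (`|complex.Im z| - th) / 2 by lra.
have nearIm u : cabs (u - z) < (`|complex.Im z| - th) / 2 -> y0 <= `|complex.Im u|.
  move=> h; have := le_Im_cabs (u - z); rewrite ImB => k.
  have := ler_normD (complex.Im z - complex.Im u) (complex.Im u).
  rewrite subrK (distrC (complex.Im z)) /y0; lra.
apply: (@gcder_quadratic _ _ (@rnorm R X) _ _ _ (C ^+ 3 * rnorm x) ((`|complex.Im z| - th) / 2)) => //.
  by rewrite mulr_ge0 ?exprn_ge0 ?rnorm_ge0.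
move=> u hu; have yu := nearIm u hu; have hu2 := lt_le_trans hy0 yu.
have yz : y0 <= `|complex.Im z| by rewrite /y0; lra.
have E v : res u v - res z v = (z - u) *: res z (res u v) by exact: (resolvent_id hU hA M1 hM).
have -> : res u x - res z x - (u - z) *: - res z (res z x) =
   (u - z) ^+ 2 *: res z (res u (res z x)).
  have lz := resolvent_lin hU hA M1 hM hz.
  have -> : res u x - res z x - (u - z) *: - res z (res z x) =
     (u - z) *: (res z (res z x) - res z (res u x)).
    by rewrite E; lin_ring.
  rewrite -(linear_mapB lz) -[res z x - _]opprB E -scaleNr opprB.
  rewrite (linear_mapZ lz) scalerA -expr2; congr (_ *: _).
  by congr res; exact: (resolventC hU hA M1 hM).
rewrite rnormZ cabsX mulrC ler_wpM2r ?exprn_ge0 ?cabs_ge0//.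
apply: le_trans (hC _ yz _) _; rewrite exprS -mulrA ler_wpM2l//.
apply: le_trans (hC _ yu _) _; rewrite exprS expr1 -mulrA ler_wpM2l//.
exact: hC.
Qed.

Lemma qop_cdiff_vec s F z : cdiff F z -> cdiff (fun u => qop U s u (F u)) z.
Proof.
by move=> h; apply: cdiff_scale; [exact: sdiff_ce|apply: cdiff_op => //; exact: groupB].
Qed.

Lemma Phi_cdiff h x z : 0 <= h -> cdiff (fun u => Phi U h u x) z.
Proof.
move=> h0.
pose g s := ('i * s%:C * ce s z) *: U s x.
have ci s : vcont (cabs : R[i]^o -> R) (fun s => 'i * s%:C) s.
  by have := @vder_cont R R[i]^o cabs snorm_cabs _ _ _ (vderZ snorm_cabs 'i (vder_lin snorm_cabs (1 : R[i]^o) s));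
     congr vcont; apply/funext => t; rewrite /GRing.scale /= mulr1.
have cg s : vcont (@rnorm R X) g s.
  have -> : g = fun s => ('i * s%:C) *: qop U s z x.
    by apply/funext => t; rewrite /g /qop scalerA.
  by apply: vcont_scale => //; exact: qop_vcont.
have [K hK] : exists K, forall s, 0 <= s <= h -> cabs (ce s z) * rnorm (U s x) <= K.
  exists (expR (h * `|complex.Im z|) * (M * expR (th * h) * rnorm x)) => s /andP[s0 sh].
  apply: ler_pM; rewrite ?cabs_ge0 ?rnorm_ge0//.
    rewrite cabs_ce ler_expR -mulrN; apply: le_trans (ler_norm _) _.
    by rewrite normrM normrN (ger0_norm s0) ler_wpM2r.
  apply: le_trans (hM _ _) _; rewrite ler_wpM2r ?rnorm_ge0// ler_wpM2l ?(ltW M0)//.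
  by rewrite ler_expR ler_wpM2l// ger0_norm.
exists (vint g 0 h).
have K0 : 0 <= K.
  by apply: le_trans (hK 0 _); rewrite ?mulr_ge0 ?cabs_ge0 ?rnorm_ge0// lexx.
apply: (@gcder_quadratic _ _ (@rnorm R X) _ _ _ (8 * h ^+ 3 * K) (2 * (h + 1))^-1).
- by rewrite invr_gt0; lra.
- by rewrite mulr_ge0// mulr_ge0// exprn_ge0.
move=> u hu.
have cu v : forall s, vcont (@rnorm R X) (fun s => ce s v *: U s x) s by move=> s; exact: qop_vcont.
have cz s : vcont (@rnorm R X) (fun s => (u - z) *: g s) s by exact: (vcontZ hr).
rewrite /Phi -vintZ// -vintB// -vintB//; last first.
  by move=> s; have := vcontD hr (cu u s) (vcontZ hr (-1) (cu z s)); under boolp.eq_fun do rewrite scaleN1r.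
have -> : 8 * h ^+ 3 * K * cabs (u - z) ^+ 2 = 8 * h ^+ 2 * K * cabs (u - z) ^+ 2 * (h - 0) by ring.
apply: vint_le => //.
  move=> s; apply: vcontD => //.
    by have := vcontD hr (cu u s) (vcontZ hr (-1) (cu z s)); under boolp.eq_fun do rewrite scaleN1r.
  by have := vcontZ hr (-1) (cz s); under boolp.eq_fun do rewrite scaleN1r.
move=> s /[dup] shs /andP[s0 sh].
pose v := 'i * s%:C * (u - z).
have -> : ce s u *: U s x - ce s z *: U s x - (u - z) *: g s = (ce s z * (cexp v - 1 - v)) *: U s x.
  rewrite /g scalerA -!scalerBl; congr (_ *: _).
  rewrite -{1}(subrK z u) addrC ceDz /v /ce; ring.
have cv : cabs v = s * cabs (u - z) by rewrite /v !cabsM cabs_i mul1r cabs_real ger0_norm.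
have v1 : cabs v <= 1 / 2.
  rewrite cv; have : cabs (u - z) * (2 * (h + 1)) <= 1.
    by rewrite -ler_pdivlMr ?div1r ?(ltW hu)//; lra.
  have := cabs_ge0 (u - z); nra.
rewrite rnormZ cabsM mulrAC.
have k1 := cexp_taylor v1; rewrite cv exprMn in k1.
have := ler_pM (mulr_ge0 (cabs_ge0 (ce s z)) (rnorm_ge0 (U s x))) (cabs_ge0 _) (hK s shs) k1.
move=> k2; apply: le_trans k2 _.
have s2 : s ^+ 2 <= h ^+ 2 by rewrite lerXn2r ?nnegrE.
have -> : 8 * h ^+ 2 * K * cabs (u - z) ^+ 2 = K * (8 * (h ^+ 2 * cabs (u - z) ^+ 2)) by ring.
rewrite ler_wpM2l// ler_wpM2l// ler_wpM2r// exprn_ge0// cabs_ge0//.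
Qed.

Lemma PhiD s t z x : Phi U (s + t) z x = Phi U s z x + qop U s z (Phi U t z x).
Proof.
rewrite /Phi -(vint_add _ 0 s); congr (_ + _).
have cq v : vcont (@rnorm R X) (fun s => ce s z *: U s x) v by exact: qop_vcont.
rewrite -(@vint_op _ _ (qop U s z) _ _ _ (qopB hU s z))//.
have -> : (fun s0 => qop U s z (ce s0 z *: U s0 x)) = (fun s0 => ce (s0 + s) z *: U (s0 + s) x).
  by apply/funext => r; rewrite -/(qop U r z x) -(qop_add hU) addrC.
by rewrite (@vint_shift _ _ (fun s => ce s z *: U s x))// add0r addrC.
Qed.

Lemma Phi0 z x : Phi U 0 z x = 0. Proof. exact: vint_id. Qed.

Lemma PhiN h z x : Phi U (- h) z x = - qop U (- h) z (Phi U h z x).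
Proof. by apply/eqP; rewrite -addr_eq0 -PhiD addNr Phi0. Qed.

Lemma Phi_sum n h z x : Phi U (n%:R * h) z x = \sum_(k < n) qop U (k%:R * h) z (Phi U h z x).
Proof.
elim: n => [|n IH]; first by rewrite mul0r Phi0 big_ord0.
by rewrite big_ord_recr /= -IH -PhiD -natr1 mulrDl mul1r.
Qed.

Lemma res_qop t z x : th < `|complex.Im z| ->
  qop U t z (res z x) = res z x + 'i *: Phi U t z x.
Proof.
move=> hz; have := Phi_inv hU hA t z (resP x hz).
rewrite opprB addrC subrK => ->; rewrite scalerA -expr2 sqr_i scaleN1r opprB addrC.
by rewrite subrK.
Qed.

(** The qualitative content of [RHinf]: values in the commutant, uniform boundedness, derivatives in
    operator norm. The constant [K] serves the convergence of integrals; the estimates that are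
    uniform in [f] come from R-boundedness. *)
Definition good K (f : R[i] -> X -> X) : Prop :=
  0 <= K /\ forall z, strip w z ->
  [/\ commutant A (f z), forall x, rnorm (f z x) <= K * rnorm x &
   exists2 L, bounded_op L & forall e, 0 < e -> exists2 del, 0 < del & forall u,
     strip w u -> cabs (u - z) < del -> forall x,
     rnorm (f u x - f z x - (u - z) *: L x) <= e * cabs (u - z) * rnorm x].

Lemma good_id : good 1 (fun _ x => x).
Proof.
split => // z hz; split; first by split => //; exact: bounded_op_id.
- by move=> x; rewrite mul1r.
- exists (fun=> 0); first by split; [move=> a x y; rewrite scaler0 addr0|exists 0 => x; rewrite rnorm0 mul0r].
  move=> e e0; exists 1 => // u _ _ x.
  by rewrite subrr scaler0 subr0 rnorm0 mulr_ge0 ?rnorm_ge0// mulr_ge0 ?(ltW e0) ?cabs_ge0.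
Qed.

Lemma good_cdiff K f F z : good K f -> strip w z -> cdiff F z -> cdiff (fun u => f u (F u)) z.
Proof.
move=> [K0 hf] hz [L hL].
have [[bz _] _ [D hD hder]] := hf z hz.
have [N N0 hN] := bounded_opP hD.
exists (D (F z) + f z L) => e e0.
have cF := gcder_cont hr hL.
have Y0 := rnorm_ge0 (F z).
pose e1 := e / (rnorm (F z) + 1 + K + N + 1).
have den : 0 < rnorm (F z) + 1 + K + N + 1 by lra.
have e10 : 0 < e1 by rewrite divr_gt0.
have [d1 d10 h1] := hder _ e10; have [d2 d20 h2] := hL _ e10.
have [d3 d30 h3] := cF _ e10; have [d4 d40 h4] := cF _ ltr01.
have gap : 0 < w - `|complex.Im z| by rewrite subr_gt0.
exists (Num.min (Num.min d1 d2) (Num.min (Num.min d3 d4) (w - `|complex.Im z|))).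
  by rewrite !lt_min d10 d20 d30 d40.
move=> u; rewrite !lt_min => /andP[/andP[u1 /h2 k2] /andP[/andP[/h3 k3 /h4 k4] u5]].
have su : strip w u.
  rewrite /strip /=; have := le_Im_cabs (u - z); rewrite ImB => k.
  have := ler_normD (complex.Im u - complex.Im z) (complex.Im z); rewrite subrK; lra.
have k1 := h1 u su u1.
have [[bu _] bdu _] := hf u su.
have -> : f u (F u) - f z (F z) - (u - z) *: (D (F z) + f z L) =
   (f u (F u) - f z (F u) - (u - z) *: D (F u)) + (u - z) *: (D (F u - F z))
   + f z (F u - F z - (u - z) *: L).
  rewrite !(linear_mapB bz.1) (linear_mapZ bz.1) (linear_mapB hD.1); lin_ring.
apply: le_trans (rnormD _ _) _; apply: le_trans (lerD (rnormD _ _) (lexx _)) _.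
rewrite rnormZ.
have T0 := cabs_ge0 (u - z).
have m1 : rnorm (f u (F u) - f z (F u) - (u - z) *: D (F u)) <= e1 * cabs (u - z) * (rnorm (F z) + 1).
  apply: le_trans (k1 _) _; apply: ler_wpM2l; first by rewrite mulr_ge0// ltW.
  by have := snorm_le_add hr (F u) (F z); lra.
have m2 : rnorm (D (F u - F z)) <= N * e1 by apply: le_trans (hN _) _; rewrite ler_wpM2l.
have m3 : rnorm (f z (F u - F z - (u - z) *: L)) <= K * (e1 * cabs (u - z)).
  have [_ bdz _] := hf z hz; apply: le_trans (bdz _) _; by rewrite ler_wpM2l.
have m4 := ler_wpM2l T0 m2.
have E : e = e1 * (rnorm (F z) + 1 + K + N + 1) by rewrite /e1 divfK// gt_eqF.
have : 0 <= e1 * cabs (u - z) by rewrite mulr_ge0// ltW.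
rewrite [in X in _ -> _ <= X]E; nra.
Qed.

(* The integral over the positively oriented boundary of the strip, without
   the factor 1 / (2 pi i). *)
Definition is_pint (Y : R[i] -> X) (L : X) : Prop :=
  exists L1 L2, [/\ is_lint (fun s => Y (s +i* - w')) L1, is_lint (fun s => Y (s +i* w')) L2 &
    L = L1 - L2].

Lemma is_pint_uniq Y L L' : is_pint Y L -> is_pint Y L' -> L = L'.
Proof.
move=> [L1 [L2 [h1 h2 ->]]] [K1 [K2 [k1 k2 ->]]].
by rewrite (is_lint_uniq h1 k1) (is_lint_uniq h2 k2).
Qed.

Lemma is_pintD Y Z L K : is_pint Y L -> is_pint Z K -> is_pint (fun z => Y z + Z z) (L + K).
Proof.
move=> [L1 [L2 [h1 h2 ->]]] [K1 [K2 [k1 k2 ->]]].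
by exists (L1 + K1), (L2 + K2); split; [exact: is_lintD|exact: is_lintD|lin_ring].
Qed.

Lemma is_pintZ c Y L : is_pint Y L -> is_pint (fun z => c *: Y z) (c *: L).
Proof.
move=> [L1 [L2 [h1 h2 ->]]].
by exists (c *: L1), (c *: L2); split; [exact: is_lintZ|exact: is_lintZ|lin_ring].
Qed.

Lemma is_pint_op T Y L : bounded_op T -> is_pint Y L -> is_pint (fun z => T (Y z)) (T L).
Proof.
move=> hT [L1 [L2 [h1 h2 ->]]]; exists (T L1), (T L2).
split; [exact: (@is_lint_op _ _ T _ _ hT)|exact: (@is_lint_op _ _ T _ _ hT)|].
by rewrite (linear_mapB hT.1).
Qed.

Lemma eq_is_pint Y Z L : (forall z, `|complex.Im z| = w' -> Y z = Z z) -> is_pint Y L -> is_pint Z L.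
Proof.
move=> h [L1 [L2 [h1 h2 ->]]]; exists L1, L2; split => //.
  by move: h1; congr is_lint; apply/funext => s; apply: h; rewrite /= normrN gtr0_norm.
by move: h2; congr is_lint; apply/funext => s; apply: h; rewrite /= gtr0_norm.
Qed.

Lemma pint_cauchy Y K a : 0 < a -> 0 <= K ->
  (forall z, `|complex.Im z| <= w' -> cdiff Y z) ->
  (forall z, `|complex.Im z| <= w' -> rnorm (Y z) <= K / (complex.Re z ^+ 2 + a ^+ 2)) ->
  is_pint Y 0.
Proof.
move=> a0 K0 h1 h2.
have W : - w' <= w' by move: w'0; lra.
have [L [l1 l2]] := @strip_shift_le R X Y K a (- w') w' a0 K0 W
   (fun z hz => h1 z ltac:(by rewrite ler_norml)) (fun z hz => h2 z ltac:(by rewrite ler_norml)).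
by exists L, L; split => //; rewrite subrr.
Qed.

Lemma line_strip z : `|complex.Im z| <= w' -> strip w z.
Proof. by move=> h; apply: le_lt_trans h ww. Qed.

Lemma reg_le k z : w' < k -> `|complex.Im z| <= w' ->
  cabs (reg k z) <= (complex.Re z ^+ 2 + (k - w') ^+ 2)^-1.
Proof.
move=> wk; rewrite ler_norml => /andP[_ hz]; apply: cabs_reg_le; first by rewrite subr_gt0.
by rewrite ger0_norm; lra.
Qed.

Lemma reg_good_bound k K f v B : w' < k -> good K f ->
  (forall z, `|complex.Im z| <= w' -> rnorm (v z) <= B) ->
  forall z, `|complex.Im z| <= w' ->
  rnorm (reg k z *: f z (v z)) <= K * B / (complex.Re z ^+ 2 + (k - w') ^+ 2).
Proof.
move=> wk [K0 hf] hv z hz; rewrite rnormZ mulrC.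
have [_ bz _] := hf z (line_strip hz).
apply: ler_pM; rewrite ?rnorm_ge0 ?cabs_ge0 ?reg_le//.
by apply: le_trans (bz _) _; rewrite ler_wpM2l// hv.
Qed.

Local Notation ik k := ((k : R)%:C * 'i : R[i]).

Lemma Im_ik k : complex.Im (ik k) = k.
Proof. by rewrite /= mul0r mulr1 addr0. Qed.

Lemma ik_out k : w' < k -> th < `|complex.Im (ik k)|.
Proof. by move=> h; rewrite Im_ik ger0_norm; move: thw w'0 h; lra. Qed.

Lemma pint_exists Y K a : 0 < a -> 0 <= K ->
  (forall z, `|complex.Im z| = w' -> cdiff Y z) ->
  (forall z, `|complex.Im z| = w' -> rnorm (Y z) <= K / (complex.Re z ^+ 2 + a ^+ 2)) ->
  exists2 L, is_pint Y L & rnorm L <= 2 * (K / a * pi).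
Proof.
move=> a0 K0 h1 h2.
have e1 s : `|complex.Im (s +i* - w' : R[i])| = w' by rewrite /= normrN gtr0_norm.
have e2 s : `|complex.Im (s +i* w' : R[i])| = w' by rewrite /= gtr0_norm.
have [L1 l1 b1] := line_lint a0 K0 (fun s => h1 _ (e1 s)) (fun s => h2 _ (e1 s)).
have [L2 l2 b2] := line_lint a0 K0 (fun s => h1 _ (e2 s)) (fun s => h2 _ (e2 s)).
exists (L1 - L2); first by exists L1, L2.
by have := rnormB L1 L2; lra.
Qed.

Lemma res_good_cdiff k K f x z : w' < k -> good K f -> `|complex.Im z| = w' ->
  cdiff (fun z => reg k z *: f z (res z x)) z.
Proof.
move=> wk gf hz; apply: cdiff_scale.
  by apply: sdiff_reg; apply/eqP => E; move: hz wk; rewrite E => <-; rewrite ltNge ler_norm.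
apply: (good_cdiff gf); first by apply: line_strip; rewrite hz.
by apply: res_cdiff; rewrite hz.
Qed.

Lemma Dint_exists k K f : w' < k -> good K f -> exists2 C, 0 <= C & forall x, exists2 L,
  is_pint (fun z => reg k z *: f z (res z x)) L & rnorm L <= C * rnorm x.
Proof.
move=> wk gf; have [C C0 hC] := resolvent_bound hU hA M1 hM thw.
have k0 : 0 < k - w' by rewrite subr_gt0.
have K0 := gf.1.
exists (2 * (K * C / (k - w') * pi)).
  by rewrite mulr_ge0// mulr_ge0 ?pi_ge0// divr_ge0 ?mulr_ge0 ?(ltW k0).
move=> x.
have [| | | |L hL bL] := @pint_exists (fun z => reg k z *: f z (res z x)) (K * (C * rnorm x)) (k - w').
- exact: k0.
- by rewrite mulr_ge0// mulr_ge0 ?rnorm_ge0.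
- by move=> z hz; exact: res_good_cdiff gf hz.
- move=> z hz; rewrite rnormZ mulrC.
  have sz : strip w z by apply: line_strip; rewrite hz.
  have [_ bz _] := gf.2 z sz.
  apply: ler_pM; rewrite ?rnorm_ge0 ?cabs_ge0 ?reg_le ?hz//.
  by apply: le_trans (bz _) _; rewrite ler_wpM2l// hC// hz.
exists L => //; apply: le_trans bL _; rewrite le_eqVlt; apply/orP; left; apply/eqP.
by field; rewrite gt_eqF.
Qed.

Definition Dc k f x : X := decay_calc A w' (fun z v => reg k z *: f z v) x.

Lemma two_pi_i_neq0 : (2 * pi)%:C * 'i != 0 :> R[i].
Proof.
rewrite mulf_neq0//; last by rewrite eq_complex /= oner_eq0 andbF.
by rewrite (inj_eq (@complexI R)) mulf_neq0// gt_eqF// pi_gt0.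
Qed.

Lemma DcE k f x L : is_pint (fun z => reg k z *: f z (res z x)) L ->
  Dc k f x = ((2 * pi)%:C * 'i)^-1 *: L.
Proof.
by move=> [L1 [L2 [h1 h2 ->]]]; rewrite /Dc /decay_calc (line_intE h1) (line_intE h2).
Qed.

Lemma DcP k K f x : w' < k -> good K f ->
  is_pint (fun z => reg k z *: f z (res z x)) (((2 * pi)%:C * 'i) *: Dc k f x).
Proof.
move=> wk gf; have [C _ h] := Dint_exists wk gf; have [L hL _] := h x.
by rewrite (DcE hL) scalerA mulfV ?two_pi_i_neq0// scale1r.
Qed.

Lemma scale_two_pi_i_inj : injective (fun x : X => ((2 * pi)%:C * 'i : R[i]) *: x).
Proof. by apply: scalerI; exact: two_pi_i_neq0. Qed.

Lemma Dc_bounded k K f : w' < k -> good K f -> bounded_op (Dc k f).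
Proof.
move=> wk gf; split.
  move=> a x y; apply: scale_two_pi_i_inj.
  apply: (is_pint_uniq (DcP _ wk gf)).
  have := is_pintD (is_pintZ a (DcP x wk gf)) (DcP y wk gf).
  set c := _ * 'i; rewrite (_ : a *: (c *: _) + c *: _ = c *: (a *: Dc k f x + Dc k f y)); last by lin_ring.
  apply: eq_is_pint => z hz.
  have hz2 : th < `|complex.Im z| by rewrite hz.
  have [[bz _] _ _] := gf.2 z (line_strip (eq_ind_r (fun v => v <= w') (lexx w') hz)).
  rewrite (linear_mapD (resolvent_lin hU hA M1 hM hz2)) (linear_mapZ (resolvent_lin hU hA M1 hM hz2)).
  by rewrite (linear_mapD bz.1) (linear_mapZ bz.1); lin_ring.
have [C C0 h] := Dint_exists wk gf.
exists (cabs ((2 * pi)%:C * 'i)^-1 * C) => x; have [L hL bL] := h x.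
by rewrite (DcE hL) rnormZ -mulrA ler_wpM2l ?cabs_ge0.
Qed.

Lemma Dc_comm k K f T x : w' < k -> good K f -> commutant A T ->
  (forall z y, strip w z -> T (f z y) = f z (T y)) -> T (Dc k f x) = Dc k f (T x).
Proof.
move=> wk gf [bT cT] hT; apply: scale_two_pi_i_inj.
rewrite /= -(linear_mapZ bT.1); apply: is_pint_uniq (DcP _ wk gf).
have := is_pint_op bT (DcP x wk gf); apply: eq_is_pint => z hz.
have sz : strip w z by apply: line_strip; rewrite hz.
rewrite (linear_mapZ bT.1) hT// (resolvent_comm hU hA M1 hM)//; last by rewrite hz.
Qed.

Lemma lint_atan k (v : X) : 0 < k ->
  is_lint (fun s => ((s ^+ 2 + k ^+ 2)^-1)%:C *: v) ((pi / k)%:C *: v).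
Proof.
move=> k0.
have D s : vder (@rnorm R X) (fun t => (k^-1 * atan (t / k))%:C *: v) s (((s ^+ 2 + k ^+ 2)^-1)%:C *: v).
  have h := @rder_atan R k^-1 k s k0.
  rewrite mulVf ?gt_eqF// mul1r in h.
  move=> e e0; have v0 : 0 < rnorm v + 1 by rewrite ltr_wpDl// rnorm_ge0.
  have e10 : 0 < e / (rnorm v + 1) by rewrite divr_gt0.
  have [d d0 hd] := h _ e10; exists d => // t /hd k1.
  rewrite scalerA -!scalerBl -!rmorphM -!rmorphB rnormZ cabs_real.
  have := ler_wpM2r (rnorm_ge0 v) k1; move=> k2; apply: le_trans k2 _.
  rewrite mulrAC ler_wpM2r// mulrAC ler_pdivrMr//; have := rnorm_ge0 v; nra.
have cg s : vcont (@rnorm R X) (fun s => ((s ^+ 2 + k ^+ 2)^-1)%:C *: v) s.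
  apply: vcont_scale; last exact: vcont_cst.
  move=> e e0.
  have p0 (r : R) : 0 < r ^+ 2 + k ^+ 2 by rewrite ltr_wpDl ?sqr_ge0// exprn_gt0.
  have : continuous_at s (fun s : R => (s ^+ 2 + k ^+ 2)^-1).
    apply: cvgV; first by rewrite gt_eqF.
    by apply: cvgD; [exact: exprn_continuous|exact: cvg_cst].
  move=> /cvgrPdist_lt/(_ _ e0)[d /= d0 hd]; exists d => // t ts.
  rewrite -rmorphB cabs_real distrC ltW//; apply: hd.
  by rewrite /ball /= distrC.
split => // e e0; have v0 : 0 < rnorm v + 1 by rewrite ltr_wpDl// rnorm_ge0.
have e10 : 0 < e * k / (2 * (rnorm v + 1)) by rewrite divr_gt0 ?mulr_gt0.
have /cvgrPdist_lt/(_ _ e10)[T [_ hT]] := @cvgy_atan R.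
exists ((T + 1) * k) => N; rewrite -ler_pdivlMr// => hN.
have := hT (N / k) ltac:(lra); rewrite ger0_norm; last by rewrite subr_ge0 ltW// atan_ltpi2.
move=> k1; rewrite (vintE _ _ cg D) -!scalerBl rnormZ -rmorphB -rmorphB cabs_real mulNr atanN.
have -> : k^-1 * atan (N / k) - k^-1 * - atan (N / k) - pi / k = - (2 * (k^-1 * (pi / 2 - atan (N / k)))).
  by field; rewrite gt_eqF.
have a0 : 0 <= pi / 2 - atan (N / k) by rewrite subr_ge0 ltW// atan_ltpi2.
rewrite normrN ger0_norm; last by rewrite mulr_ge0// mulr_ge0 ?invr_ge0 ?(ltW k0).
rewrite ltr_pdivlMr ?mulr_gt0// in k1.
have -> : 2 * (k^-1 * (pi / 2 - atan (N / k))) * rnorm v = ((pi / 2 - atan (N / k)) * (2 * rnorm v)) / k by ring.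
by rewrite ler_pdivrMr//; nra.
Qed.

(** Partial fractions: the resolvent identity solved for the product. *)
Lemma res_twice k z y : w' < k -> th < `|complex.Im z| -> z != ik k ->
  let B := res (ik k) in
  res z (B y) = (ik k - z)^-1 *: (res z y - B y) /\
  res z (B (B y)) = (ik k - z)^-1 *: ((ik k - z)^-1 *: (res z y - B y) - B (B y)).
Proof.
move=> wk hz zk B.
have h v : res z (B v) = (ik k - z)^-1 *: (res z v - B v).
  rewrite /B (resolvent_id hU hA M1 hM v hz (ik_out wk)) scalerA mulVf; last first.
    by rewrite subr_eq0 eq_sym.
  by rewrite scale1r (resolventC hU hA M1 hM _ hz (ik_out wk)).
by rewrite (h (B y)) !h.
Qed.

Lemma two_pi_cancel (a b c : R[i]) : a != 0 -> b != 0 -> c != 0 ->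
  (2 * b * c)^-1 * (b / a * (2 * (a * c))) = 1.
Proof.
move=> a0 b0 c0; have t0 : (2 : R[i]) != 0 by rewrite pnatr_eq0.
have -> : b / a * (2 * (a * c)) = (a^-1 * a) * (2 * b * c) by ring.
by rewrite mulVf// mul1r mulVf// !mulf_neq0.
Qed.

(** The lower line can be pushed down to infinity and contributes 0. The upper line lies between the
    pole [a] and the spectrum, so its integrand is split: [T1] has its only pole above the line and
    is pushed down, [T3] has its singularities below and is pushed up, and the scalar multiple [T2]
    of [v], with poles at [a] and [- a], is moved to the real axis, where its integral is an
    arctangent. *)
Lemma Dc_id k y : w' < k -> Dc k (fun _ v => v) y = res (ik k) (res (ik k) y).
Proof.
move=> wk; set a := ik k; set B := res a; set v := B (B y).
have [C C0 hC] := resolvent_bound hU hA M1 hM thw.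
have k0 : 0 < k by move: w'0 wk; lra.
have kw0 : 0 < k - w' by rewrite subr_gt0.
(* [w2] is [(1 - 2 a B)^2 y], that is [((- a - A) B)^2 y]: it trades the double pole at [a] for one
   at [- a]. *)
pose w1 := (2 * a) *: v - B y; pose w2 := (4 * a ^+ 2) *: v - (4 * a) *: B y + y.
pose T1 z := reg k z *: B y.
pose T2 z := (a - z)^-1 *: ((- a - z)^-1 *: (- (2 * a) *: v)).
pose T3 z := reg (- k) z *: (w1 + res z w2).
have Ima : complex.Im a = k by exact: Im_ik.
have reg_a u : reg k u = (a - u)^-1 ^+ 2 by rewrite /reg exprVn.
have reg_ma u : reg (- k) u = (- a - u)^-1 ^+ 2 by rewrite /reg exprVn /a rmorphN mulNr.
have decomp s : reg k (s +i* w') *: res (s +i* w') y = T1 (s +i* w') + T2 (s +i* w') + T3 (s +i* w').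
  set z := s +i* w'.
  have Imz : complex.Im z = w' by [].
  have hz : th < `|complex.Im z| by rewrite Imz gtr0_norm.
  have za : z != a by apply/eqP => E; move: wk; rewrite -Ima -E Imz ltxx.
  have zma : z != - a.
    by apply/eqP => E; move: w'0; rewrite -Imz E ImN Ima; move: k0; lra.
  have [r1 r2] := res_twice y wk hz za; rewrite -/a -/B -/v in r1 r2.
  have lz := resolvent_lin hU hA M1 hM hz.
  rewrite /T1 /T2 /T3 /w1 reg_a reg_ma.
  have D1 : a - z != 0 by rewrite subr_eq0 eq_sym.
  have D2 : - a - z != 0 by rewrite subr_eq0 eq_sym.
  rewrite [res z w2](_ : _ = (4 * a ^+ 2) *: res z v - (4 * a) *: res z (B y) + res z y); last first.
    by rewrite /w2 (linear_mapD lz) (linear_mapB lz) !(linear_mapZ lz).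
  rewrite r1 r2; lin_ring; by field; rewrite D1 D2.
have K0 v0 : 0 <= rnorm (v0 : X) by exact: rnorm_ge0.
have L1 : is_lint (fun s => T1 (s +i* w')) 0.
  apply: (@lint_vanish _ _ T1 (rnorm (B y))) => // T T1'.
  exists (- T); have mn : Num.max w' (- T) = w' by rewrite max_l//; move: w'0; lra.
  rewrite mn; split.
  - move=> z /andP[_ hz]; apply: cdiff_scale; last exact: cdiff_cst.
    by apply: sdiff_reg; rewrite lt_eqF//; lra.
  - exists (k - w') => // z /andP[_ hz]; rewrite rnormZ mulrC ler_wpM2l//.
    by apply: cabs_reg_le => //; rewrite ger0_norm; lra.
  - move=> s; rewrite rnormZ mulrC ler_wpM2l//.
    by apply: (@cabs_reg_le R k T (s +i* - T)); rewrite /= ?ger0_norm; lra.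
have L3 : is_lint (fun s => T3 (s +i* w')) 0.
  have B3 z : w' <= complex.Im z -> rnorm (w1 + res z w2) <= rnorm w1 + C * rnorm w2.
    move=> hz; apply: le_trans (rnormD _ _) _; rewrite lerD2l; apply: hC.
    by apply: le_trans hz (ler_norm _).
  have B30 : 0 <= rnorm w1 + C * rnorm w2 by rewrite addr_ge0 ?mulr_ge0.
  apply: (@lint_vanish _ _ T3 (rnorm w1 + C * rnorm w2)) => // T T1'.
  exists (w' + T); have mn : Num.min w' (w' + T) = w' by rewrite min_l//; lra.
  rewrite mn; split.
  - move=> z /andP[hz _]; apply: cdiff_scale.
      by apply: sdiff_reg; rewrite gt_eqF//; move: w'0; lra.
    apply: cdiffD; first exact: cdiff_cst.
    by apply: res_cdiff; apply: lt_le_trans thw _; apply: le_trans hz (ler_norm _).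
  - exists k => // z /andP[hz _]; rewrite rnormZ mulrC.
    apply: ler_pM; rewrite ?cabs_ge0 ?B3//.
    by apply: cabs_reg_le => //; rewrite ler0_norm; move: w'0; lra.
  - move=> s; rewrite rnormZ mulrC.
    apply: ler_pM; rewrite ?cabs_ge0//; first by apply: B3 => /=; lra.
    by apply: (@cabs_reg_le R (- k) T (s +i* (w' + T))); rewrite /= ?ler0_norm; move: w'0; lra.
have L2 : is_lint (fun s => T2 (s +i* w')) ((pi / k)%:C *: ((2 * a) *: - v)).
  have [L [l0 l1]] : exists L, is_lint (fun s => T2 (s +i* 0)) L /\ is_lint (fun s => T2 (s +i* w')) L.
    apply: (@strip_shift_le _ _ T2 (rnorm (- (2 * a) *: v)) (k - w')) => //; first exact: ltW.
      move=> z /andP[z0 zw].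
      apply: cdiff_scale; first by apply: sdiff_inv; apply/eqP => E; move: zw; rewrite -E Ima; lra.
      apply: cdiff_scale; last exact: cdiff_cst.
      apply: sdiff_inv; apply/eqP => E; move: z0; rewrite -E ImN Ima; lra.
    move=> z /andP[z0 zw]; rewrite !rnormZ mulrCA mulrA mulrC -!rnormZ.
    rewrite ler_wpM2l// -cabsM -invfM cabsV.
    have p0 : 0 < complex.Re z ^+ 2 + (k - w') ^+ 2 by rewrite ltr_wpDl ?sqr_ge0 ?exprn_gt0.
    have q1 : complex.Re z ^+ 2 + (k - w') ^+ 2 <= cabs (a - z) ^+ 2.
      rewrite cabs_sqr ReB ImB Ima.
      have -> : complex.Re a = 0 by rewrite /a /= mulr0 mul0r subr0.
      by rewrite sub0r sqrrN lerD2l lerXn2r ?nnegrE//; lra.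
    have q2 : complex.Re z ^+ 2 + (k - w') ^+ 2 <= cabs (- a - z) ^+ 2.
      rewrite cabs_sqr ReB ImB ReN ImN Ima -(sqrrN (- k - _)).
      have -> : complex.Re a = 0 by rewrite /a /= mulr0 mul0r subr0.
      by rewrite oppr0 sub0r (sqrrN (complex.Re z)) lerD2l lerXn2r ?nnegrE//; move: w'0; lra.
    have c1 : 0 < cabs (a - z) by rewrite lt_def cabs_ge0 andbT; apply/eqP => E; move: q1; rewrite E expr0n /= leNgt p0.
    have c2 : 0 < cabs (- a - z) by rewrite lt_def cabs_ge0 andbT; apply/eqP => E; move: q2; rewrite E expr0n /= leNgt p0.
    rewrite lef_pV2 ?posrE ?cabsM ?mulr_gt0//.
    by have [h|/ltW h] := leP (cabs (a - z)) (cabs (- a - z)); nra.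
  suff -> : (pi / k)%:C *: ((2 * a) *: - v) = L by [].
  apply: is_lint_uniq l0.
  have := lint_atan ((2 * a) *: - v) k0; congr is_lint; apply/funext => s.
  rewrite /T2 !scalerA scalerN -scaleNr; congr (_ *: _).
  have a2 : a ^+ 2 = - (k ^+ 2)%:C by rewrite /a exprMn sqr_i mulrN1 rmorphXn.
  have -> : (s +i* 0) = s%:C by [].
  have -> : ((s ^+ 2 + k ^+ 2)^-1)%:C = (s%:C ^+ 2 - a ^+ 2)^-1.
    by rewrite a2 opprK fmorphV rmorphD !rmorphXn.
  have d1 : a - s%:C != 0.
    by rewrite subr_eq0; apply: contraTneq k0 => E; rewrite -Ima E /= ltxx.
  have d2 : - a - s%:C != 0.
    by rewrite subr_eq0; apply: contraTneq k0 => E; rewrite -Ima -[a]opprK E /= oppr0 ltxx.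
  have -> : (a - s%:C)^-1 / (- a - s%:C) * - (2 * a) = ((a - s%:C) * (- a - s%:C))^-1 * - (2 * a).
    by rewrite invfM mulrA.
  have -> : (a - s%:C) * (- a - s%:C) = s%:C ^+ 2 - a ^+ 2 by ring.
  by rewrite mulrN.
have Lup := is_lintD (is_lintD L1 L2) L3.
have {}Lup : is_lint (fun s => reg k (s +i* w') *: res (s +i* w') y) ((pi / k)%:C *: ((2 * a) *: - v)).
  move: Lup; rewrite addr0 add0r; congr is_lint; apply/funext => s; exact/esym/decomp.
have Llow : is_lint (fun s => reg k (s +i* - w') *: res (s +i* - w') y) 0.
  have bnd z : complex.Im z <= - w' -> rnorm (res z y) <= C * rnorm y.
    by move=> hz; apply: hC; rewrite ler0_norm; move: w'0; lra.
  apply: (@lint_vanish _ _ (fun z => reg k z *: res z y) (C * rnorm y)); first by rewrite mulr_ge0.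
  move=> T T1'; exists (- w' - T); have mn : Num.max (- w') (- w' - T) = - w' by rewrite max_l//; lra.
  rewrite mn; split.
  - move=> z /andP[_ hz]; apply: cdiff_scale.
      by apply: sdiff_reg; rewrite lt_eqF//; move: w'0; lra.
    by apply: res_cdiff; rewrite ler0_norm; move: w'0 thw; lra.
  - exists k => // z /andP[_ hz]; rewrite rnormZ mulrC.
    apply: ler_pM; rewrite ?cabs_ge0 ?bnd//.
    by apply: cabs_reg_le => //; rewrite ger0_norm; move: w'0; lra.
  - move=> s; rewrite rnormZ mulrC.
    apply: ler_pM; rewrite ?cabs_ge0//; first by apply: bnd => /=; lra.
    by apply: (@cabs_reg_le R k T (s +i* (- w' - T))); rewrite /= ?ger0_norm; move: w'0; lra.
rewrite (@DcE k (fun _ v => v) y (0 - (pi / k)%:C *: ((2 * a) *: - v))); last by exists 0, ((pi / k)%:C *: ((2 * a) *: - v)).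
rewrite sub0r -!scalerN opprK !scalerA -[RHS]scale1r; congr (_ *: _).
rewrite /a; have kC : k%:C != 0 :> R[i] by rewrite (inj_eq (@complexI R)) gt_eqF.
have piC : pi%:C != 0 :> R[i] by rewrite (inj_eq (@complexI R)) gt_eqF// pi_gt0.
have iC : 'i != 0 :> R[i] by rewrite eq_complex /= oner_eq0 andbF.
have -> : (2 * pi)%:C = 2 * pi%:C :> R[i] by rewrite rmorphM /= rmorph_nat.
have -> : (pi / k)%:C = pi%:C / k%:C :> R[i] by rewrite fmorph_div.
by move: kC piC iC; exact: two_pi_cancel.
Qed.

Lemma inv_ik_le k z : w' < k -> `|complex.Im z| <= w' -> cabs (ik k - z)^-1 <= (k - w')^-1.
Proof.
move=> wk; rewrite ler_norml => /andP[_ hz].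
have k0 : 0 < k - w' by rewrite subr_gt0.
have h : k - w' <= cabs (ik k - z).
  apply: le_trans (le_Im_cabs _); rewrite ImB Im_ik.
  by rewrite ger0_norm; lra.
rewrite cabsV lef_pV2 ?posrE//; exact: lt_le_trans h.
Qed.

Lemma in_strip_neq k z : w' < k -> `|complex.Im z| <= w' -> z != ik k.
Proof.
move=> wk hz; apply/eqP => E; move: hz; rewrite E Im_ik ger0_norm; move: w'0 wk; lra.
Qed.

(** By [res_twice] the integrand on the right and the one with two regularizers differ by terms in
    which no [res z] is left. These are holomorphic across the strip and integrate to zero. The
    outcome is symmetric in [k] and [k2], whence [Dc_swap]. *)
Lemma Dc_res k k2 K f y : w' < k -> w' < k2 -> good K f ->
  is_pint (fun z => (reg k z * reg k2 z) *: f z (res z y))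
    (((2 * pi)%:C * 'i) *: Dc k f (res (ik k2) (res (ik k2) y))).
Proof.
move=> wk wk2 gf; set B := res (ik k2).
have K0 := gf.1.
have kw0 : 0 < k - w' by rewrite subr_gt0.
have kw2 : 0 < k2 - w' by rewrite subr_gt0.
have neq z : `|complex.Im z| <= w' -> complex.Im z != k /\ complex.Im z != k2.
  by rewrite ler_norml => /andP[_ hz]; split; rewrite lt_eqF//; lra.
have P1 : is_pint (fun z => reg k z *: f z (reg k2 z *: B y)) 0.
  apply: (@pint_cauchy _ (K * ((k2 - w') ^- 2 * rnorm (B y))) (k - w')) => //.
  - by rewrite mulr_ge0// mulr_ge0 ?rnorm_ge0// invr_ge0 exprn_ge0// ltW.
  - move=> z hz; have [n1 n2] := neq z hz; apply: cdiff_scale; first exact: sdiff_reg.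
    apply: (good_cdiff gf); first exact: line_strip.
    by apply: cdiff_scale; [exact: sdiff_reg|exact: cdiff_cst].
  - apply: reg_good_bound gf _ => // z hz; rewrite rnormZ ler_wpM2r ?rnorm_ge0//.
    by rewrite /reg -exprVn cabsX -exprVn lerXn2r ?nnegrE ?cabs_ge0 ?invr_ge0 ?(ltW kw2) ?inv_ik_le.
have P2 : is_pint (fun z => reg k z *: f z ((ik k2 - z)^-1 *: B (B y))) 0.
  apply: (@pint_cauchy _ (K * ((k2 - w')^-1 * rnorm (B (B y)))) (k - w')) => //.
  - by rewrite mulr_ge0// mulr_ge0 ?rnorm_ge0// invr_ge0 ltW.
  - move=> z hz; have [n1 n2] := neq z hz; apply: cdiff_scale; first exact: sdiff_reg.
    apply: (good_cdiff gf); first exact: line_strip.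
    by apply: cdiff_scale; [apply: sdiff_inv; rewrite eq_sym in_strip_neq|exact: cdiff_cst].
  - apply: reg_good_bound gf _ => // z hz; rewrite rnormZ ler_wpM2r ?rnorm_ge0//.
    exact: inv_ik_le.
have := is_pintD (is_pintD (DcP (B (B y)) wk gf) P1) P2.
rewrite !addr0; apply: eq_is_pint => z hz.
have hz1 : `|complex.Im z| <= w' by rewrite hz.
have hz2 : th < `|complex.Im z| by rewrite hz.
have [[bz _] _ _] := gf.2 z (line_strip hz1).
have [_ ->] := res_twice y wk2 hz2 (in_strip_neq wk2 hz1).
rewrite -/B !(linear_mapZ bz.1) !(linear_mapB bz.1) !(linear_mapZ bz.1) (linear_mapB bz.1).
have -> : reg k2 z = (ik k2 - z)^-1 ^+ 2 by rewrite /reg exprVn.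
by lin_ring.
Qed.

Lemma Dc_swap k k2 K f y : w' < k -> w' < k2 -> good K f ->
  Dc k f (res (ik k2) (res (ik k2) y)) = Dc k2 f (res (ik k) (res (ik k) y)).
Proof.
move=> wk wk2 gf; apply: scale_two_pi_i_inj.
apply: is_pint_uniq (Dc_res y wk wk2 gf) _.
by have := Dc_res y wk2 wk gf; apply: eq_is_pint => z _; rewrite mulrC.
Qed.

Lemma Dc_res_comm k k2 K f y : w' < k -> w' < k2 -> good K f ->
  res (ik k2) (Dc k f y) = Dc k f (res (ik k2) y).
Proof.
move=> wk wk2 gf; apply: (Dc_comm _ wk gf).
  exact: (commutant_res hU hA M1 hM (ik_out wk2)).
move=> z v sz; have [cz _ _] := gf.2 z sz.
by rewrite -(resolvent_comm hU hA M1 hM v (ik_out wk2) cz).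
Qed.

(** On the range of the squared resolvent at [ik k], f(A) is an absolutely convergent integral with
    the regularizer of height [k]. The regularizer of height [mu] from the definition cancels by
    [Dc_swap]. *)
Lemma op_calc_val mu k K f y : w' < k -> w' < mu -> good K f ->
  op_calc A w' mu f (res (ik k) (res (ik k) y), Dc k f y).
Proof.
move=> wk wmu gf; rewrite /op_calc /= -/(Dc mu (fun _ v => v) (Dc k f y)) -/(Dc mu f _).
by rewrite Dc_id// !(Dc_res_comm _ wk wmu gf) (Dc_swap _ wk wmu gf).
Qed.

Lemma op_calc_uniq mu f x y y' : w' < mu -> op_calc A w' mu f (x, y) ->
  op_calc A w' mu f (x, y') -> y = y'.
Proof.
move=> wmu; rewrite /op_calc /= => <-; rewrite -/(Dc mu (fun _ v => v) y) -/(Dc mu (fun _ v => v) y').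
rewrite !Dc_id// => h; apply/eqP; rewrite -subr_eq0; apply/eqP.
have hb := ik_out wmu; have lb := resolvent_lin hU hA M1 hM hb.
apply: (resolvent_eq0 hU hA M1 hM hb); apply: (resolvent_eq0 hU hA M1 hM hb).
by rewrite !(linear_mapB lb) h subrr.
Qed.

Section Representation.
Variables (k K : R) (f : R[i] -> X -> X) (N : nat).
Hypotheses (wk : w' < k) (gf : good K f) (N0 : (0 < N)%N).

(** Average over the sampling times [t + b / N]. Once the frequency is cut into cells, these times
    produce the second discrete Fourier transform. *)
Definition avg (t : R) (z : R[i]) (v : X) : X :=
  (N%:R^-1)%:C *: \sum_(b < N) qop U (t + b%:R / N%:R) z v.

(** The part of the convolution kernel near time [t]: a unit window, averaged over N shifts by less
    than 1. [Lker] integrates it against [f] along a line. *)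
Definition Wker t z x := avg t z (Phi U 1 z x).

Definition Lker y t x : X :=
  line_int (fun s => reg k (s +i* y) *: f (s +i* y) (Wker t (s +i* y) x)).

Let NR : (0 : R) < N%:R. Proof. by rewrite ltr0n. Qed.

Lemma frac_bound (b : 'I_N) : 0 <= (b%:R / N%:R : R) <= 1.
Proof.
rewrite divr_ge0 ?ler0n//= ler_pdivrMr// mul1r ler_nat ltnW//.
Qed.

Lemma avg_bound t z v B : (forall b : 'I_N, rnorm (qop U (t + b%:R / N%:R) z v) <= B) ->
  rnorm (avg t z v) <= B.
Proof.
move=> h; rewrite /avg rnormZ cabs_real ger0_norm ?invr_ge0 ?ler0n// mulrC ler_pdivrMr//.
apply: le_trans (snorm_sum hr _ _ _) _; apply: le_trans (ler_sum _ (fun b _ => h b)) _.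
by rewrite sumr_const card_ord mulr_natr.
Qed.

Lemma avgD t z u v : avg t z (u + v) = avg t z u + avg t z v.
Proof.
rewrite /avg -scalerDr -big_split; congr (_ *: _); apply: eq_bigr => b _.
exact: linear_mapD (qopB hU _ _).1 _ _.
Qed.

Lemma avgZ t z c v : avg t z (c *: v) = c *: avg t z v.
Proof.
rewrite /avg; have -> : \sum_(b < N) qop U (t + b%:R / N%:R) z (c *: v) =
    c *: \sum_(b < N) qop U (t + b%:R / N%:R) z v.
  by rewrite scaler_sumr; apply: eq_bigr => b _; exact: linear_mapZ (qopB hU _ _).1 _ _.
by lin_ring.
Qed.

Lemma avg_sum t z (I : Type) (s : seq I) (F : I -> X) :
  avg t z (\sum_(i <- s) F i) = \sum_(i <- s) avg t z (F i).
Proof.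
apply: (big_morph (avg t z)) => [u v|]; first exact: avgD.
by have := avgZ t z 0 0; rewrite !scale0r.
Qed.

Lemma avg_qop t s z v : avg t z (qop U s z v) = avg (t + s) z v.
Proof.
rewrite /avg; congr (_ *: _); apply: eq_bigr => b _.
by rewrite -(qop_add hU) addrAC.
Qed.

Lemma avg_cdiff t F z : cdiff F z -> cdiff (fun u => avg t u (F u)) z.
Proof.
move=> h; apply: cdiffZ; apply: cdiff_sum => b; exact: qop_cdiff_vec.
Qed.

Lemma qop_strip_le s z v c : `|complex.Im z| <= w' -> `|s| <= c ->
  rnorm (qop U s z v) <= M * expR ((th + w') * c) * rnorm v.
Proof.
move=> hz hs; apply: le_trans (qop_le hM _ _ _) _.
rewrite ler_wpM2r ?rnorm_ge0// ler_wpM2l ?(ltW M0)// ler_expR.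
have : - (s * complex.Im z) <= `|s| * w'.
  apply: le_trans (ler_norm _) _; rewrite normrN normrM ler_wpM2l//.
have := normr_ge0 s; move: th0 w'0; nra.
Qed.

Lemma Phi_strip_le h z x : 0 <= h <= 1 -> `|complex.Im z| <= w' ->
  rnorm (Phi U h z x) <= M * expR (th + w') * rnorm x.
Proof.
move=> /andP[h0 h1] hz.
have H : rnorm (Phi U h z x) <= M * expR ((th + w') * 1) * rnorm x * (h - 0).
  apply: vint_le => //; first by move=> s; exact: qop_vcont.
  by move=> s /andP[s0 sh]; apply: qop_strip_le => //; rewrite ger0_norm//; lra.
apply: le_trans H _; rewrite mulr1 subr0 -[leRHS]mulr1.
by rewrite ler_wpM2l// mulr_ge0 ?rnorm_ge0// mulr_ge0 ?expR_ge0 ?(ltW M0).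
Qed.

Lemma Wker_bound t : exists2 B, 0 <= B & forall z x, `|complex.Im z| <= w' ->
  rnorm (Wker t z x) <= B * rnorm x.
Proof.
exists (M * expR ((th + w') * (`|t| + 1)) * (M * expR (th + w'))).
  by rewrite !mulr_ge0 ?expR_ge0 ?(ltW M0).
move=> z x hz; apply: avg_bound => b.
apply: le_trans (@qop_strip_le _ z _ (`|t| + 1) hz _) _.
  have /andP[b0 b1] := frac_bound b.
  apply: le_trans (ler_normD _ _) _; rewrite lerD2l ger0_norm//.
rewrite -[leRHS]mulrA ler_wpM2l ?mulr_ge0 ?expR_ge0 ?(ltW M0)//.
by apply: Phi_strip_le; rewrite ?ler01 ?lexx.
Qed.

Lemma line_good_lint y v B : `|y| <= w' -> 0 <= B ->
  (forall s, cdiff v (s +i* y)) -> (forall s, rnorm (v (s +i* y)) <= B) ->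
  exists2 L, is_lint (fun s => reg k (s +i* y) *: f (s +i* y) (v (s +i* y))) L &
    rnorm L <= K * B / (k - w') * pi.
Proof.
move=> hy B0 dv bv; have kw : 0 < k - w' by rewrite subr_gt0.
apply: (@line_lint _ _ (fun z => reg k z *: f z (v z)) y) => //.
- by rewrite mulr_ge0// gf.1.
- move=> s; apply: cdiff_scale; last by apply: (good_cdiff gf) => //; exact: (@line_strip (s +i* y)).
  apply: sdiff_reg; rewrite /= lt_eqF//; apply: le_lt_trans wk; apply: le_trans hy; exact: ler_norm.
- move=> s; rewrite rnormZ mulrC.
  have [_ bz _] := gf.2 (s +i* y) (@line_strip (s +i* y) hy).
  apply: ler_pM; rewrite ?rnorm_ge0 ?cabs_ge0//.
    by apply: le_trans (bz _) _; rewrite ler_wpM2l// gf.1.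
  exact: (@reg_le k (s +i* y)).
Qed.

Lemma Wker_cdiff t x z : cdiff (fun u => Wker t u x) z.
Proof. by apply: avg_cdiff; exact: Phi_cdiff. Qed.

Lemma Lker_lint y t x : `|y| <= w' ->
  is_lint (fun s => reg k (s +i* y) *: f (s +i* y) (Wker t (s +i* y) x)) (Lker y t x).
Proof.
move=> hy; have [B B0 hB] := Wker_bound t.
have [|||L hL _] := @line_good_lint y (fun z => Wker t z x) (B * rnorm x) hy.
- by rewrite mulr_ge0 ?rnorm_ge0.
- by move=> s; exact: Wker_cdiff.
- by move=> s; exact: hB.
by rewrite /Lker (line_intE hL).
Qed.

(** By [res_qop], shifting [res z x] by a time changes it by a multiple of [Phi], which is entire in
    [z] and bounded on the strip, so the two lines cancel. Averaging over times is therefore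
    free. *)
Lemma avg_res_pint x : is_pint (fun z => reg k z *: f z (avg 0 z (res z x)))
  (((2 * pi)%:C * 'i) *: Dc k f x).
Proof.
pose v z := (N%:R^-1)%:C *: \sum_(b < N) ('i *: Phi U (b%:R / N%:R) z x).
have P0 : is_pint (fun z => reg k z *: f z (v z)) 0.
  pose B := M * expR (th + w') * rnorm x.
  have B0 : 0 <= B by rewrite !mulr_ge0 ?expR_ge0 ?(ltW M0) ?rnorm_ge0.
  apply: (@pint_cauchy _ (K * B) (k - w') _ (mulr_ge0 gf.1 B0)); first by rewrite subr_gt0.
    move=> z hz; apply: cdiff_scale.
      by apply: sdiff_reg; rewrite lt_eqF//; apply: le_lt_trans wk; apply: le_trans hz; exact: ler_norm.
    apply: (good_cdiff gf); first exact: line_strip.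
    apply: cdiffZ; apply: cdiff_sum => b; apply: cdiffZ.
    by apply: Phi_cdiff; case/andP: (frac_bound b).
  apply: reg_good_bound gf _ => // z hz.
  rewrite /v rnormZ cabs_real ger0_norm ?invr_ge0 ?ler0n// mulrC ler_pdivrMr//.
  apply: le_trans (snorm_sum hr _ _ _) _.
  apply: (@le_trans _ _ (\sum_(b < N) B)); last by rewrite sumr_const card_ord mulr_natr.
  apply: ler_sum => b _; rewrite rnormZ cabs_i mul1r.
  by apply: Phi_strip_le => //; exact: frac_bound.
have := is_pintD (DcP x wk gf) P0; rewrite addr0; apply: eq_is_pint => z hz.
have sz : strip w z by apply: line_strip; rewrite hz.
have [[bz _] _ _] := gf.2 z sz.
rewrite -scalerDr -(linear_mapD bz.1); congr (_ *: f z _).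
have NC : (N%:R : R)%:C != 0 :> R[i] by rewrite (inj_eq (@complexI R)) gt_eqF.
have {1}-> : res z x = (N%:R^-1)%:C *: \sum_(b < N) res z x.
  by rewrite sumr_const card_ord -(scaler_nat N (res z x)) -(rmorph_nat (real_complex R) N) scalerA fmorphV mulVf// scale1r.
rewrite /v -scalerDr -big_split /avg; congr (_ *: _); apply: eq_bigr => b _ /=.
by rewrite add0r res_qop// hz.
Qed.

Lemma Phi_nat n z x : Phi U n%:R z x = \sum_(l < n) qop U l%:R z (Phi U 1 z x).
Proof.
have := Phi_sum n 1 z x; rewrite mulr1 => ->; apply: eq_bigr => l _.
by rewrite mulr1.
Qed.

Lemma avg_Phi n z x : avg 0 z (Phi U n%:R z x) = \sum_(l < n) Wker l%:R z x.
Proof.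
by rewrite Phi_nat avg_sum; apply: eq_bigr => l _; rewrite avg_qop add0r.
Qed.

Lemma avg_PhiN n z x : avg 0 z (Phi U (- n%:R) z x) = - \sum_(l < n) Wker (- l.+1%:R) z x.
Proof.
rewrite PhiN -scaleN1r avgZ scaleN1r; congr (- _).
rewrite Phi_nat avg_qop add0r avg_sum (reindex_inj rev_ord_inj) /=.
apply: eq_bigr => l _; rewrite avg_qop /Wker.
have -> // : - n%:R + (n - l.+1)%:R = - l.+1%:R :> R.
by rewrite natrB ?ltn_ord//; ring.
Qed.

Let resC : exists2 C, 0 <= C & forall z, w' <= `|complex.Im z| ->
  forall x, rnorm (res z x) <= C * rnorm x.
Proof. by have [C C0 hC] := resolvent_bound hU hA M1 hM thw; exists C. Qed.

(** [res_qop] replaces the resolvent by a [Phi] over finite time plus a remainder transported by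
    that time. Positive times on the upper line and negative ones on the lower make the remainder
    decay, as [w' > th]. Cutting the time interval into unit windows turns [Phi] into the sums of
    [Lker]. *)
Lemma represent : exists2 C, 0 <= C & forall x L,
  rnorm (((2 * pi)%:C * 'i) *: Dc k f x
    - ('i *: (\sum_(l < L.+1) Lker w' l%:R x) + 'i *: \sum_(l < L.+1) Lker (- w') (- l.+1%:R) x))
    <= C * expR ((th - w') * L%:R) * rnorm x.
Proof.
have [C1 C10 hC1] := resC.
have kw : 0 < k - w' by rewrite subr_gt0.
exists (2 * (K * (M * C1) / (k - w') * pi)).
  by rewrite !mulr_ge0 ?invr_ge0 ?(ltW kw) ?(ltW M0) ?pi_ge0 ?gf.1.
move=> x L; set E := expR _.
pose B := M * E * (C1 * rnorm x).
have B0 : 0 <= B by rewrite !mulr_ge0 ?(ltW M0) ?expR_ge0 ?rnorm_ge0.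
have decay y t s : `|y| = w' -> (forall b : 'I_N, th * `|t + b%:R / N%:R| - (t + b%:R / N%:R) * y
     <= (th - w') * L%:R) -> rnorm (avg t (s +i* y) (res (s +i* y) x)) <= B.
  move=> hy h; apply: avg_bound => b; apply: le_trans (qop_le hM _ _ _) _.
  apply: ler_pM; rewrite ?rnorm_ge0 ?mulr_ge0 ?expR_ge0 ?(ltW M0)//.
    by rewrite ler_wpM2l ?(ltW M0)// ler_expR; exact: h.
  by apply: hC1; rewrite /= hy.
have rdiff y t s : `|y| = w' -> cdiff (fun z => avg t z (res z x)) (s +i* y).
  by move=> hy; apply: avg_cdiff; apply: res_cdiff; rewrite /= hy.
have nw : `|- w'| = w' by rewrite normrN ger0_norm// ltW.
have pw : `|w'| = w' by rewrite ger0_norm// ltW.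
have [L1 [L2 [l1 l2 ->]]] := avg_res_pint x.
have L0 : (0 : R) <= L%:R by rewrite ler0n.
(* The times [- (L + 1) + b / N] come as close to 0 as [- L]; hence [L + 1] windows but only [L] in
   the exponent of the error. *)
have [RL rl bl] : exists2 Q, is_lint (fun s => reg k (s +i* - w') *: f (s +i* - w')
    (avg (- L.+1%:R) (s +i* - w') (res (s +i* - w') x))) Q & rnorm Q <= K * B / (k - w') * pi.
  apply: (@line_good_lint (- w') (fun z => avg (- L.+1%:R) z (res z x)) B); rewrite ?nw//.
    by move=> s; exact: rdiff.
  move=> s; apply: decay => // b; have /andP[b0 b1] := frac_bound b.
  rewrite ler0_norm; last by rewrite -natr1; lra.
  rewrite -natr1; move: thw; nra.
have [RU ru bu] : exists2 Q, is_lint (fun s => reg k (s +i* w') *: f (s +i* w')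
    (avg L.+1%:R (s +i* w') (res (s +i* w') x))) Q & rnorm Q <= K * B / (k - w') * pi.
  apply: (@line_good_lint w' (fun z => avg L.+1%:R z (res z x)) B); rewrite ?pw//.
    by move=> s; exact: rdiff.
  move=> s; apply: decay => // b; have /andP[b0 b1] := frac_bound b.
  rewrite ger0_norm; last by rewrite -natr1; lra.
  rewrite -natr1; move: thw; nra.
have le_of (y : R) : `|y| = w' -> `|y| <= w' by move=> ->.
have fl y s : `|y| = w' -> linear (f (s +i* y)).
  by move=> hy; have [[[lf _] _] _ _] := gf.2 (s +i* y) (@line_strip (s +i* y) (le_of _ hy)).
have EL : L1 = RL + 'i *: \sum_(l < L.+1) Lker (- w') (- l.+1%:R) x.
  have S := is_lintD rl (is_lintZ 'i (is_lint_sum (index_enum 'I_L.+1)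
    (fun l : 'I_L.+1 => Lker_lint (- l.+1%:R) x (le_of _ nw)))).
  apply: is_lint_uniq l1 _; move: S; congr is_lint; apply/funext => s.
  have lf := fl (- w') s nw; set z := s +i* - w' in lf *.
  have hz : th < `|complex.Im z| by rewrite /= nw.
  have -> : avg 0 z (res z x) = avg (- L.+1%:R) z (res z x) + 'i *: \sum_(l < L.+1) Wker (- l.+1%:R) z x.
    have E0 : res z x = qop U (- L.+1%:R) z (res z x) + (- 'i) *: Phi U (- L.+1%:R) z x.
      by rewrite res_qop// scaleNr addrK.
    by rewrite [in LHS]E0 avgD avg_qop avgZ add0r avg_PhiN; lin_ring.
  rewrite (linear_mapD lf) (linear_mapZ lf 'i) (linear_map_sum _ _ _ lf).
  by rewrite -scaler_sumr scalerDr; congr (_ + _); rewrite !scalerA mulrC.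
have EU : L2 = RU - 'i *: \sum_(l < L.+1) Lker w' l%:R x.
  have S := is_lintB ru (is_lintZ 'i (is_lint_sum (index_enum 'I_L.+1)
    (fun l : 'I_L.+1 => Lker_lint l%:R x (le_of _ pw)))).
  apply: is_lint_uniq l2 _; move: S; congr is_lint; apply/funext => s.
  have lf := fl w' s pw; set z := s +i* w' in lf *.
  have hz : th < `|complex.Im z| by rewrite /= pw.
  have -> : avg 0 z (res z x) = avg L.+1%:R z (res z x) - 'i *: \sum_(l < L.+1) Wker l%:R z x.
    have E0 : res z x = qop U L.+1%:R z (res z x) + (- 'i) *: Phi U L.+1%:R z x.
      by rewrite res_qop// scaleNr addrK.
    by rewrite [in LHS]E0 avgD avg_qop avgZ add0r avg_Phi; lin_ring.
  rewrite (linear_mapB lf) (linear_mapZ lf 'i) (linear_map_sum _ _ _ lf).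
  by rewrite -scaler_sumr scalerBr; congr (_ - _); rewrite !scalerA mulrC.
rewrite EL EU.
have -> : RL + 'i *: \sum_(l < L.+1) Lker (- w') (- l.+1%:R) x - (RU - 'i *: \sum_(l < L.+1) Lker w' l%:R x) -
   ('i *: (\sum_(l < L.+1) Lker w' l%:R x) + 'i *: \sum_(l < L.+1) Lker (- w') (- l.+1%:R) x) = RL - RU.
  by lin_ring.
apply: le_trans (rnormB _ _) _; apply: le_trans (lerD bl bu) _.
by rewrite le_eqVlt; apply/orP; left; apply/eqP; rewrite /B; ring.
Qed.

End Representation.

Lemma good_of_RH {d : measure_display} {Omega : measurableType d}
    {P : probability Omega R} (r : nat -> {RV P >-> (R * R)%type}) (T : set (X -> X)) f :
  RHinf r w (commutant A `&` T) f -> exists K, good K f.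
Proof.
move=> [hf [K hK] holo _]; exists (Num.max K 0); split; first by rewrite le_max lexx orbT.
move=> z sz; have [bz [cz _]] := hf z sz; split => //.
  move=> x; apply: le_trans (le_opnorm bz _) _; rewrite ler_wpM2r ?rnorm_ge0//.
  by rewrite le_max hK.
have [L bL hL] := holo z sz; exists L => // e e0.
have /cvgrPdist_lt /(_ _ e0) := hL.
rewrite near_withinE => /nbhs_ballP[d0 /= d00 hd].
exists (complex.Re d0).
  by move: d00; rewrite ltcE /= => /andP[].
move=> u su uz x; have [->|nuz] := eqVneq u z.
  by rewrite !subrr scale0r subrr rnorm0 cabs0 mulr0 mul0r.
have [bu _] := hf u su.
have bD : bounded_op (fun x => (u - z)^-1 *: (f u x - f z x) - L x).
  have := bounded_opD (bounded_opZ (u - z)^-1 (bounded_opD bu (bounded_opZ (-1) bz))) (bounded_opZ (-1) bL).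
  by congr bounded_op; apply/funext => y; rewrite !scaleN1r.
have : opnorm (fun x => (u - z)^-1 *: (f u x - f z x) - L x) < e.
  have := hd u _ nuz; rewrite sub0r normrN ger0_norm ?opnorm_ge0//; apply.
  have -> : d0 = (complex.Re d0)%:C.
    by move: d00; rewrite ltcE /= => /andP[/eqP E _]; apply/eqP; rewrite eq_complex /= eqxx E eqxx.
  by rewrite /ball /= distrC normC_cabs ltcR.
move=> he; have := le_opnorm bD x => hx.
have -> : f u x - f z x - (u - z) *: L x = (u - z) *: ((u - z)^-1 *: (f u x - f z x) - L x).
  by rewrite scalerBr scalerA mulfV ?scale1r// subr_eq0.
rewrite rnormZ; apply: le_trans (ler_wpM2l (cabs_ge0 _) hx) _.
by rewrite mulrA [e * _]mulrC ler_wpM2r ?rnorm_ge0// ler_wpM2l ?cabs_ge0// ltW.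
Qed.

End Calculus.

Lemma measurable_bigcup_count {d} {T : measurableType d} (Q : countType) (F : Q -> set T) :
  (forall q, measurable (F q)) -> measurable (\bigcup_q F q).
Proof.
move=> mF; have -> : \bigcup_q F q = \bigcup_n (if unpickle n is Some q then F q else set0).
  apply/seteqP; split=> [t [q _ Ft]|t [n _]]; first by exists (pickle q); rewrite ?pickleK.
  by case: unpickle => // q Ft; exists q.
by apply: bigcupT_measurable => n; case: unpickle.
Qed.

(** * Gaussian random vectors *)

Section RandomSums.
Context {R : realType} {X : lmodType R[i]}.

(** No sigma-algebra on [X] is involved. The norm is the infimum of the countably many functions
    [h q], one for each rational choice of coefficients together with its error term, so the sets
    where it is less than [a] are countable unions. *)
Lemma measurable_snorm_sum {d} {T : measurableType d} (rho : X -> R) (I : finType)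
    (c : I -> T -> R * R) (x : I -> X) : snorm rho ->
  (forall k, measurable_fun setT (c k)) ->
  measurable_fun setT (fun t => rho (\sum_k toC (c k t) *: x k)).
Proof.
move=> hr mc; pose f t := rho (\sum_k toC (c k t) *: x k).
pose h (q : {ffun I -> rat * rat}) t : R :=
  rho (\sum_k toC (ratr (q k).1, ratr (q k).2) *: x k)
  + \sum_k (`|(c k t).1 - ratr (q k).1| + `|(c k t).2 - ratr (q k).2|) * rho (x k).
have mh q : measurable_fun setT (h q).
  apply: measurable_funD => //; apply: measurable_sum => k.
  apply: measurable_funM => //; apply: measurable_funD.
    apply: measurableT_comp => //; apply: measurable_funB => //.
    by apply: measurableT_comp => //; exact: measurable_fst.
  apply: measurableT_comp => //; apply: measurable_funB => //.
  by apply: measurableT_comp => //; exact: measurable_snd.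
have fh q t : f t <= h q t.
  apply: le_trans (snorm_le_add hr _ (\sum_k toC (ratr (q k).1, ratr (q k).2) *: x k)) _.
  rewrite /h lerD2l -sumrB; apply: le_trans (snorm_sum hr _ _ _) _.
  apply: ler_sum => k _; rewrite -scalerBl snormZ//; apply: ler_wpM2r; first exact: snorm_ge0.
  by apply: le_trans (cabs_le_ReIm _) _; rewrite /toC /=.
have hf t e : 0 < e -> exists q, h q t < f t + e.
  move=> e0; pose S := \sum_k rho (x k).
  have S0 : 0 <= S by apply: sumr_ge0 => k _; exact: snorm_ge0.
  pose del := e / (4 * (S + 1)).
  have d0 : 0 < del by rewrite divr_gt0// mulr_gt0// ltr_wpDl.
  have /choice[q hq] (k : I) : exists q : rat * rat,
      `|(c k t).1 - ratr q.1| <= del /\ `|(c k t).2 - ratr q.2| <= del.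
    have ap (a : R) : exists q, `|a - ratr q| <= del.
      have [|q] := @rat_in_itvoo R (a - del) (a + del); first by lra.
      rewrite in_itv /= => /andP[q1 q2]; exists q; rewrite ler_norml; lra.
    by have [q1 h1] := ap (c k t).1; have [q2 h2] := ap (c k t).2; exists (q1, q2).
  exists [ffun k => q k].
  have D : \sum_k (`|(c k t).1 - ratr (q k).1| + `|(c k t).2 - ratr (q k).2|) * rho (x k)
      <= 2 * del * S.
    rewrite mulr_sumr; apply: ler_sum => k _; apply: ler_wpM2r; first exact: snorm_ge0.
    by have [] := hq k; lra.
  have E : 2 * del * S + 2 * del * S < e.
    have : e = 4 * del * (S + 1) by rewrite /del; field; rewrite gt_eqF// ltr_wpDl.
    by nra.
  rewrite /h; under eq_bigr do rewrite ffunE.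
  under [X in _ + X < _]eq_bigr do rewrite ffunE.
  have := snorm_le_add hr (\sum_k toC (ratr (q k).1, ratr (q k).2) *: x k) (\sum_k toC (c k t) *: x k).
  rewrite -sumrB.
  have : rho (\sum_k (toC (ratr (q k).1, ratr (q k).2) *: x k - toC (c k t) *: x k)) <= 2 * del * S.
    apply: le_trans D; apply: le_trans (snorm_sum hr _ _ _) _.
    apply: ler_sum => k _; rewrite -scalerBl snormZ//; apply: ler_wpM2r; first exact: snorm_ge0.
    rewrite cabsBC; by apply: le_trans (cabs_le_ReIm _) _; rewrite /toC /=.
  rewrite -/(f t); lra.
move=> mD; apply: (measurability _ (RGenInftyO.measurableE R)) => //.
move=> _ [_ [a ->] <-]; rewrite setTI.
have -> : (fun t => rho (\sum_k toC (c k t) *: x k)) @^-1` `]-oo, a[ =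
    \bigcup_(q : {ffun I -> rat * rat}) (h q @^-1` `]-oo, a[).
  apply/seteqP; split=> [t /=|t [q _] /=]; rewrite !in_itv /=.
    rewrite -/(f t) -subr_gt0 => /(hf t)[q hq]; exists q => //=.
    by rewrite in_itv /=; apply: lt_le_trans hq _; rewrite addrC subrK.
  by apply: le_lt_trans; exact: fh.
apply: measurable_bigcup_count => q.
by rewrite -[_ @^-1` _]setTI; apply: mh => //; exact: measurable_itv.
Qed.

End RandomSums.

(** * Rotation invariance of the planar normal law *)

Section Density.
Context {d} {T : measurableType d} {R : realType}.
Variables (m mu : {measure set T -> \bar R}) (h : T -> R).
Hypotheses (mh : measurable_fun setT h) (h0 : forall x, 0 <= h x).
Hypothesis mE : forall A, measurable A -> m A = (\int[mu]_(x in A) (h x)%:E)%E.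
Import HBNNSimple.
Local Open Scope ereal_scope.

Let density_nnsfun (f : {nnsfun T >-> R}) :
  \int[m]_x (f x)%:E = \int[mu]_x ((f x)%:E * (h x)%:E).
Proof.
under [LHS]eq_integral do rewrite fimfunE -fsumEFin//.
rewrite [LHS]ge0_integral_fsum//; last 2 first.
- by move=> r; exact/measurable_EFinP/measurableT_comp.
- by move=> n x _; rewrite EFinM nnfun_muleindic_ge0.
under [RHS]eq_integral.
  move=> x _; rewrite fimfunE -fsumEFin// ge0_mule_fsuml; last first.
    by move=> r; rewrite EFinM nnfun_muleindic_ge0.
  over.
rewrite [RHS]ge0_integral_fsum//; last 2 first.
- move=> r; apply: emeasurable_funM; last exact/measurable_EFinP.
  by apply/measurable_EFinP/measurableT_comp.
- by move=> n x _; apply: mule_ge0; [rewrite EFinM nnfun_muleindic_ge0|rewrite lee_fin].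
apply: eq_fsbigr => r _.
have mA : measurable (f @^-1` [set r]) by [].
rewrite integralZl_indic_nnsfun//= integral_indic// setIT mE// integral_mkcond.
have [r0|r0] := ltP r 0%R.
  rewrite preimage_nnfun0// [X in r%:E * X](_ : _ = 0).
    by rewrite mule0; apply/esym/integral0_eq => x _; rewrite indic0 mulr0 mul0e.
  by apply: integral0_eq => x _; rewrite patch_set0.
rewrite -ge0_integralZl//; first 1 last.
- by apply/(measurable_restrictT _ mA).1/measurable_funTS/measurable_EFinP.
- by move=> x _; rewrite patchE; case: ifP => // _; rewrite lee_fin.
- by apply: eq_integral => x _; rewrite patchE indicE; case: ifP => _;
    rewrite ?mulr1 ?mulr0 ?mule0 ?mul0e.
Qed.

Lemma integral_density (f : T -> \bar R) : measurable_fun setT f -> (forall x, 0 <= f x) ->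
  \int[m]_x f x = \int[mu]_x (f x * (h x)%:E).
Proof.
move=> mf f0; pose f_ := nnsfun_approx measurableT mf.
have cf x : (f_ n x)%:E @[n --> \oo] --> f x by apply: cvg_nnsfun_approx.
have nd x : {homo (fun n => (f_ n x)%:E) : a b / (a <= b)%N >-> a <= b}.
  by move=> a b ab; rewrite lee_fin; exact/lefP/nd_nnsfun_approx.
transitivity (limn (fun n => \int[m]_x (f_ n x)%:E)).
  rewrite -monotone_convergence//=.
  - by apply: eq_integral => x _; apply/esym/cvg_lim.
  - by move=> n; exact/measurable_EFinP.
  - by move=> n x _; rewrite lee_fin.
under eq_fun do rewrite density_nnsfun.
rewrite -monotone_convergence//=.
- apply: eq_integral => x _; apply/cvg_lim => //.
  by apply: cvgeZr => //; exact: cf.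
- by move=> n; apply: emeasurable_funM; exact/measurable_EFinP.
- by move=> n x _; rewrite mule_ge0 ?lee_fin.
- by move=> x _ a b ab; apply: lee_wpmul2r; [rewrite lee_fin|exact: nd].
Qed.

End Density.

(* Lebesgue measure lives on a copy of R whose sigma-algebra has another
   display; [lam] and [nrm] are the library measures on R itself. *)
Section RealMeasures.
Context {R : realType}.

Definition lam (A : set R) : \bar R := @lebesgue_measure R A.
Let lam0 : lam set0 = 0%E. Proof. exact: (@measure0 _ _ _ (@lebesgue_measure R)). Qed.
Let lam_ge0 A : (0 <= lam A)%E. Proof. exact: (@measure_ge0 _ _ _ (@lebesgue_measure R)). Qed.
Let lam_additive : semi_sigma_additive lam.
Proof. exact: (@measure_semi_sigma_additive _ _ _ (@lebesgue_measure R)). Qed.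
HB.instance Definition _ := isMeasure.Build _ _ _ lam lam0 lam_ge0 lam_additive.
Let lam_sigma_finite : sigma_finite setT lam.
Proof. exact: (sigma_finiteT (@lebesgue_measure R)). Qed.
HB.instance Definition _ := @Measure_isSigmaFinite.Build _ _ _ lam lam_sigma_finite.

Definition nrm (A : set R) : \bar R := normal_prob (0 : R) (Num.sqrt 2)^-1 A.
Let nrm0 : nrm set0 = 0%E. Proof. exact: (@measure0 _ _ _ (normal_prob (0 : R) (Num.sqrt 2)^-1)). Qed.
Let nrm_ge0 A : (0 <= nrm A)%E. Proof. exact: (@measure_ge0 _ _ _ (normal_prob (0 : R) (Num.sqrt 2)^-1)). Qed.
Let nrm_additive : semi_sigma_additive nrm.
Proof. exact: (@measure_semi_sigma_additive _ _ _ (normal_prob (0 : R) (Num.sqrt 2)^-1)). Qed.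
HB.instance Definition _ := isMeasure.Build _ _ _ nrm nrm0 nrm_ge0 nrm_additive.
Let nrmT : nrm setT = 1%E.
Proof. exact: (@probability_setT _ _ _ (normal_prob (0 : R) (Num.sqrt 2)^-1)). Qed.
HB.instance Definition _ := @Measure_isProbability.Build _ _ _ nrm nrmT.

Let idTR : measurableTypeR R -> R := idfun.
Let m_idTR : measurable_fun setT idTR. Proof. by move=> _ A mA; rewrite setTI. Qed.

Lemma integral_copy (m : {measure set (measurableTypeR R) -> \bar R}) (m' : {measure set R -> \bar R})
  (D : set R) (f : R -> \bar R) : (forall A, measurable A -> m' A = m A) -> measurable D -> measurable_fun D f ->
  (forall x, 0 <= f x)%E -> (\int[m]_(x in D) f x = \int[m']_(x in D) f x)%E.
Proof.
move=> mm mD mf f0.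
have := ge0_integral_pushforward m_idTR m mD mf (fun x _ => f0 x).
by move=> <-; apply: eq_measure_integral => A mA _; rewrite mm.
Qed.

Lemma lam_unique (m : {measure set R -> \bar R}) : (forall X, ocitv X -> lam X = m X) ->
  forall A, measurable A -> lam A = m A.
Proof.
move=> h A mA; pose m' : set (measurableTypeR R) -> \bar R := m.
have a0 : m' set0 = 0%E by exact: measure0.
have a1 B : (0 <= m' B)%E by exact: measure_ge0.
have a2 : semi_sigma_additive m' by exact: (@measure_semi_sigma_additive _ _ _ m).
pose mm := isMeasure.Build _ _ _ m' a0 a1 a2.
pose M' : {measure set (measurableTypeR R) -> \bar R} := HB.pack m' mm.
exact: (@lebesgue_measure_unique R M').
Qed.

Lemma nrm_density A : measurable A -> nrm A = (\int[lam]_(x in A) (normal_pdf 0 (Num.sqrt 2)^-1 x)%:E)%E.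
Proof.
move=> mA; apply: integral_copy => //.
  by apply/measurable_EFinP/measurable_funTS; exact: measurable_normal_pdf.
by move=> x; rewrite lee_fin normal_pdf_ge0.
Qed.

Lemma nrm_prod (B : set (R * R)) : measurable B ->
  (normal_prob (0 : R) (Num.sqrt 2)^-1 \x normal_prob (0 : R) (Num.sqrt 2)^-1)%E B = (nrm \x nrm)%E B.
Proof.
move=> mB; rewrite /product_measure1; apply: integral_copy => //.
exact: measurable_fun_xsection.
Qed.

End RealMeasures.

Section GaussianRotation.
Context {R : realType}.
Local Notation mu := (@lam R).
Local Open Scope ereal_scope.

Lemma lebesgue_translation (c : R) (A : set R) : measurable A ->
  mu A = mu ((fun x : R => (x + c)%R) @^-1` A).
Proof.
move=> mA.
have mf : measurable_fun setT (fun x : R => (x + c)%R) by exact: measurable_funD.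
rewrite -[RHS]/(pushforward mu (fun x : R => (x + c)%R) A).
apply: lam_unique => // _ [[a b] _ <-] /=.
rewrite /pushforward.
have -> : (fun x : R => (x + c)%R) @^-1` `]a, b]%classic = `](a - c)%R, (b - c)%R]%classic.
  by apply/seteqP; split => x /=; rewrite !in_itv /= ltrBlDr lerBrDr.
rewrite /lam !lebesgue_measure_itv /= !lte_fin ltrD2r; case: ifP => // _.
by rewrite -!EFinB; congr (_%:E); ring.
Qed.

Lemma integral_translation (c : R) (f : R -> \bar R) : measurable_fun setT f ->
  (forall x, 0 <= f x) -> \int[mu]_x f (x + c)%R = \int[mu]_x f x.
Proof.
move=> mf f0.
have mt : measurable_fun setT (fun x : R => (x + c)%R) by exact: measurable_funD.
have := ge0_integral_pushforward mt mu measurableT mf (fun x _ => f0 x).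
rewrite preimage_setT /comp => <-; apply: eq_measure_integral => A mA _.
exact/esym/lebesgue_translation.
Qed.

Definition dint (h : R * R -> \bar R) : \bar R := \int[mu]_u \int[mu]_v h (u, v).

Lemma dint_swap (h : R * R -> \bar R) : measurable_fun setT h -> (forall x, 0 <= h x) ->
  dint h = \int[mu]_v \int[mu]_u h (u, v).
Proof. by move=> mh h0; exact: fubini_tonelli. Qed.

Lemma dint_shear1 (a : R) (h : R * R -> \bar R) : measurable_fun setT h ->
  (forall x, 0 <= h x) -> dint (fun z => h ((z.1 + a * z.2)%R, z.2)) = dint h.
Proof.
move=> mh h0.
have ms : measurable_fun setT (fun z : R * R => ((z.1 + a * z.2)%R, z.2)).
  apply: measurable_fun_pair => //; apply: measurable_funD => //.
  by apply: measurable_funM.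
have -> := dint_swap (measurableT_comp mh ms) (fun=> h0 _).
have -> := dint_swap mh h0; apply: eq_integral => v _ /=.
have mf : measurable_fun setT (fun u : R => h (u, v)) by exact: measurable_fun_pair1.
exact: (integral_translation _ mf (fun=> h0 _)).
Qed.

Lemma dint_shear2 (a : R) (h : R * R -> \bar R) : measurable_fun setT h ->
  (forall x, 0 <= h x) -> dint (fun z => h (z.1, (z.2 + a * z.1)%R)) = dint h.
Proof.
move=> mh h0; apply: eq_integral => u _ /=.
have mf : measurable_fun setT (fun v : R => h (u, v)) by exact: measurable_fun_pair2.
exact: (integral_translation _ mf (fun=> h0 _)).
Qed.

(* A rotation is a product of three shears. *)
Lemma three_shears (c s u v a : R) : (c ^+ 2 + s ^+ 2 = 1 -> c != -1 -> a = - s / (1 + c) ->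
  c * u - s * v = u + a * v + a * (v + s * (u + a * v)) /\
  s * u + c * v = v + s * (u + a * v))%R.
Proof.
move=> cs c1 ->; have d : (1 + c != 0)%R by rewrite addrC -[1%R]opprK subr_eq0.
have s2 : (s * s = (1 + c) * (1 - c))%R by lra.
have as_ : (- s / (1 + c) * s = c - 1)%R.
  by rewrite mulrAC mulNr s2 -mulrN mulrC mulKf//; ring.
have ac : (- s / (1 + c) * (1 + c) = - s)%R by rewrite divfK.
move: as_ ac; move: (- s / (1 + c))%R => b as_ ac.
split; last first.
  have -> : (v + s * (u + b * v) = v + s * u + (b * s) * v)%R by ring.
  by rewrite as_; ring.
have -> : (u + b * v + b * (v + s * (u + b * v)) = u + (b * s) * u + (b + b + (b * s) * b) * v)%R by ring.
rewrite as_; have -> : (b + b + (c - 1) * b = b * (1 + c))%R by ring.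
by rewrite ac; ring.
Qed.

Lemma dint_rotation (c s : R) (h : R * R -> \bar R) : measurable_fun setT h ->
  (forall x, 0 <= h x) -> (c ^+ 2 + s ^+ 2 = 1)%R -> (c != -1)%R ->
  dint (fun z => h ((c * z.1 - s * z.2)%R, (s * z.1 + c * z.2)%R)) = dint h.
Proof.
move=> mh h0 cs c1; pose a : R := (- s / (1 + c))%R.
have m1 : measurable_fun setT (fun z : R * R => h ((z.1 + a * z.2)%R, z.2)).
  apply: measurableT_comp => //; apply: measurable_fun_pair => //.
  by apply: measurable_funD => //; exact: measurable_funM.
have m2 : measurable_fun setT (fun z : R * R => h ((z.1 + a * (z.2 + s * z.1))%R, (z.2 + s * z.1)%R)).
  have m3 : measurable_fun setT (fun z : R * R => (z.1, (z.2 + s * z.1)%R)).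
    apply: measurable_fun_pair => //.
    by apply: measurable_funD => //; exact: measurable_funM.
  exact: (measurableT_comp m1 m3).
rewrite -(dint_shear1 a mh h0) -(dint_shear2 s m1 (fun=> h0 _)) -(dint_shear1 a m2 (fun=> h0 _)).
congr dint; apply/funext => z /=.
by have [-> ->] := three_shears z.1 z.2 cs c1 (erefl a).
Qed.

Local Notation N := (@nrm R).

Let s : R := (Num.sqrt 2)^-1%R.
Let gauss2 (z : R * R) : R := (normal_peak s * normal_peak s * expR (- (z.1 ^+ 2 + z.2 ^+ 2)))%R.

Lemma integral_normal2 (f : R * R -> \bar R) : measurable_fun setT f -> (forall x, 0 <= f x) ->
  \int[N \x N]_z f z = dint (fun z => f z * (gauss2 z)%:E).
Proof.
move=> mf f0.
have s0 : (s != 0)%R by rewrite invr_eq0 sqrtr_eq0 -ltNge.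
have s2 : (s ^+ 2 *+ 2 = 1)%R by rewrite exprVn sqr_sqrtr// -mulr_natr mulVf.
have pdfE x : (normal_pdf 0 s x = normal_peak s * expR (- x ^+ 2))%R.
  by rewrite normal_pdfE// /normal_fun subr0 s2 divr1.
have dens (g : R -> \bar R) : measurable_fun setT g -> (forall x, 0 <= g x) ->
    \int[N]_x g x = \int[mu]_x (g x * (normal_pdf 0 s x)%:E).
  move=> mg g0; apply: (integral_density (h := normal_pdf 0 s)) => //.
  - exact: measurable_normal_pdf.
  - by move=> x; exact: normal_pdf_ge0.
  - exact: nrm_density.
rewrite fubini_tonelli1// dens; first 1 last.
- exact: measurable_fun_fubini_tonelli_F.
- by move=> x; exact: integral_ge0.
rewrite /dint; apply: eq_integral => u _; rewrite /fubini_F.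
have mu1 : measurable_fun setT (fun v : R => f (u, v)) by exact: measurable_fun_pair2.
rewrite (dens _ mu1 (fun=> f0 _)).
rewrite -ge0_integralZr//=; last 3 first.
- apply: emeasurable_funM; first exact: measurable_fun_pair2.
  by apply/measurable_EFinP; exact: measurable_normal_pdf.
- by move=> v _; rewrite mule_ge0 ?lee_fin ?normal_pdf_ge0.
- by rewrite lee_fin normal_pdf_ge0.
apply: eq_integral => v _; rewrite -muleA -EFinM; congr (_ * _%:E)%E.
by rewrite !pdfE /gauss2 /= opprD expRD; ring.
Qed.

Lemma normal2_rotation (c s0 : R) (f : R * R -> \bar R) : measurable_fun setT f ->
  (forall x, 0 <= f x) -> (c ^+ 2 + s0 ^+ 2 = 1)%R ->
  \int[N \x N]_z f ((c * z.1 - s0 * z.2)%R, (s0 * z.1 + c * z.2)%R) = \int[N \x N]_z f z.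
Proof.
(* For the rotation by pi the shear parameter [- s / (1 + c)] is undefined; this rotation is the
   square of a quarter turn. *)
wlog c1 : c s0 f / (c != -1)%R.
  move=> H mf f0 cs; have [c1|] := eqVneq c (-1)%R; last by move=> c1; exact: H.
  have s00 : s0 = 0%R by move: cs; rewrite c1 sqrrN expr1n; nra.
  have z1 : (0 != -1 :> R)%R by rewrite eq_sym oppr_eq0 oner_eq0.
  have e1 : (0 ^+ 2 + 1 ^+ 2 = 1 :> R)%R by rewrite expr0n expr1n add0r.
  rewrite -(H 0%R 1%R f z1 mf f0 e1).
  have mg : measurable_fun setT (fun z : R * R => f ((0 * z.1 - 1 * z.2)%R, (1 * z.1 + 0 * z.2)%R)).
    apply: measurableT_comp => //; apply: measurable_fun_pair.
      by apply: measurable_funB; apply: measurable_funM.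
    by apply: measurable_funD; apply: measurable_funM.
  rewrite -(H 0%R 1%R _ z1 mg _ e1)//=; apply: eq_integral => z _; congr f.
  by rewrite c1 s00; congr (_, _); ring.
move=> mf f0 cs; have mg : measurable_fun setT (fun z : R * R => f ((c * z.1 - s0 * z.2)%R, (s0 * z.1 + c * z.2)%R)).
  apply: measurableT_comp => //; apply: measurable_fun_pair.
    by apply: measurable_funB; apply: measurable_funM.
  by apply: measurable_funD; apply: measurable_funM.
have mG : measurable_fun setT gauss2.
  apply: measurable_funM => //; apply: measurableT_comp => //; apply: measurableT_comp => //.
  by apply: measurable_funD; apply: measurable_funX.
have G0 z : (0 <= gauss2 z)%R by rewrite /gauss2 !mulr_ge0 ?normal_peak_ge0 ?expR_ge0.
rewrite (integral_normal2 mg (fun=> f0 _)) (integral_normal2 mf f0).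
have mh : measurable_fun setT (fun z => f z * (gauss2 z)%:E).
  by apply: emeasurable_funM => //; exact/measurable_EFinP.
have h0 z : 0 <= f z * (gauss2 z)%:E by rewrite mule_ge0 ?lee_fin.
rewrite -(dint_rotation mh h0 cs c1); congr dint; apply/funext => -[u v] /=.
rewrite /gauss2 /=.
have -> : ((c * u - s0 * v) ^+ 2 + (s0 * u + c * v) ^+ 2 = (c ^+ 2 + s0 ^+ 2) * (u ^+ 2 + v ^+ 2))%R by ring.
by rewrite cs mul1r.
Qed.

End GaussianRotation.

(** * Independence and integration over one variable at a time *)

Section FreshCopy.
Context {R : realType} {d d' : measure_display} {Omega : measurableType d} {S : measurableType d'}.
Variables (P : probability Omega R) (Y : Omega -> S) (mY : measurable_fun setT Y).
Variables (nu : probability S R) (G : set (set Omega)) (C : set (set S)).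
Hypotheses (Gm : G `<=` measurable) (GI : setI_closed G) (GT : G setT).
Hypotheses (Cm : @measurable _ S = <<s C >>) (CI : setI_closed C) (CT : C setT).
Hypothesis PYnu : forall A B, G A -> C B -> P (A `&` Y @^-1` B) = (P A * nu B)%E.
Local Open Scope ereal_scope.

Let Pfin A : measurable A -> P A \is a fin_num.
Proof. by move=> mA; exact: fin_num_measure. Qed.

Let mYB B : measurable B -> measurable (Y @^-1` B).
Proof. by move=> mB; rewrite -[_ @^-1` _]setTI; exact: mY. Qed.

Let nufin B : measurable B -> nu B \is a fin_num.
Proof.
move=> mB; rewrite ge0_fin_numE//; apply: le_lt_trans (ltry 1%R); rewrite -(probability_setT nu).
by apply: le_measure; rewrite ?inE//; exact: measurableT.
Qed.

Let scaled d0 (T : measurableType d0) (m : {measure set T -> \bar R}) (c : \bar R) :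
  0 <= c -> c \is a fin_num -> {m' : {measure set T -> \bar R} | forall A, m' A = c * m A}.
Proof.
move=> c0 fc; have r0 : (0 <= fine c)%R by exact: fine_ge0.
by exists (mscale (NngNum r0) m) => A; rewrite -[in RHS](fineK fc).
Qed.

Let indep_box A B : G A -> measurable B -> P (A `&` Y @^-1` B) = P A * nu B.
Proof.
move=> GA mB; have mA := Gm GA.
have [m2 m2E] := @scaled _ _ nu (P A) (measure_ge0 _ _) (Pfin mA).
pose m1 := pushforward (mrestr P mA) Y.
have m1E D : m1 D = P (A `&` Y @^-1` D) by rewrite /m1 /pushforward /mrestr setIC.
rewrite -m1E -m2E; apply: (measure_unique C (fun=> setT)) => //.
- by rewrite bigcup_const.
- by move=> D CD; rewrite m2E -PYnu// -m1E.
- by move=> k; change (m1 setT < +oo); rewrite m1E preimage_setT setIT ltey_eq Pfin.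
Qed.

Let indep_sigma A B : <<s G >> A -> measurable B -> P (A `&` Y @^-1` B) = P A * nu B.
Proof.
move=> GA mB; have [m2 m2E] := @scaled _ _ P (nu B) (measure_ge0 _ _) (nufin mB).
pose m1 := mrestr P (mYB mB).
rewrite muleC -m2E -[LHS]/(m1 A); apply: (g_sigma_algebra_measure_unique G _ (fun=> setT)) => //.
- by rewrite bigcup_const.
- by move=> D GD; rewrite m2E muleC -indep_box.
- by move=> k; change (m1 setT < +oo); rewrite /m1 /mrestr setTI ltey_eq Pfin//; exact: mYB.
Qed.

Local Notation TG := (g_sigma_algebraType G).
Let iota : Omega -> TG := idfun.
Let m_iota : measurable_fun setT iota.
Proof.
move=> _ A mA; rewrite setTI; move: A mA.
exact: (smallest_sub (@sigma_algebra_measurable _ Omega) Gm).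
Qed.

(** In its first argument [F] is measurable for the sigma-algebra generated by [G], of which [Y] is
    independent, so the joint law is the product of the restriction of [P] with [nu] and Tonelli's
    theorem applies. Independence is known on two pi-systems and extended in one variable after the
    other. *)
Lemma fresh_copy (F : TG * S -> \bar R) : measurable_fun setT F -> (forall z, 0 <= F z) ->
  \int[P]_w F (w, Y w) = \int[P]_w \int[nu]_z F (w, z).
Proof.
move=> mF F0.
pose iF : {mfun Omega >-> TG} := HB.pack iota (isMeasurableFun.Build _ _ _ _ iota m_iota).
pose W w : TG * S := (iota w, Y w).
have mW : measurable_fun setT W by exact: measurable_fun_pair.
pose PG : probability TG R := distribution P iF.
pose WF : {mfun Omega >-> (TG * S)%type} := HB.pack W (isMeasurableFun.Build _ _ _ _ W mW).
pose PW : probability (TG * S)%type R := distribution P WF.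
have E A : measurable A -> (PG \x nu) A = PW A.
  by apply: product_measure_unique => B D mB mD; exact: indep_sigma.
rewrite -[LHS]/(\int[P]_w (F \o W) w).
have := ge0_integral_pushforward mW P measurableT mF (fun z _ => F0 z).
rewrite preimage_setT => <-.
transitivity (\int[PG \x nu]_z F z).
  by apply: eq_measure_integral => A mA _; exact/esym/E.
rewrite fubini_tonelli1//.
have := ge0_integral_pushforward m_iota P measurableT
  (measurable_fun_fubini_tonelli_F (m2 := nu) F mF F0) (fun z _ => integral_ge0 _ (fun u _ => F0 _)).
by rewrite preimage_setT => <-.
Qed.

End FreshCopy.

Section IndependentFamily.
Context {R : realType} {d d' : measure_display} {Omega : measurableType d} {S : measurableType d'}.
Context {I : finType}.
Variables (P : probability Omega R) (Z : I -> Omega -> S) (mZ : forall i, measurable_fun setT (Z i)).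
Variables (nu : probability S R).
Local Open Scope ereal_scope.

Definition iid := forall B : I -> set S, (forall i, measurable (B i)) ->
  P (\bigcap_i (Z i @^-1` B i)) = \prod_i nu (B i).

(* Events determined by the variables whose index is not in D. *)
Definition others (D : pred I) : set (set Omega) :=
  [set A | exists B : I -> set S, [/\ forall i, measurable (B i), forall i, D i -> B i = setT &
     A = \bigcap_i (Z i @^-1` B i)]].

Lemma others_T D : others D setT.
Proof.
by exists (fun=> setT); split => //; apply/seteqP; split.
Qed.

Lemma others_I D : setI_closed (others D).
Proof.
move=> _ _ [B [mB BT ->]] [B' [mB' BT' ->]].
exists (fun i => B i `&` B' i); split.
- by move=> i; exact: measurableI.
- by move=> i Di; rewrite BT// BT'// setIT.
- by rewrite -bigcapI.
Qed.

Lemma others_measurable D : others D `<=` measurable.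
Proof.
move=> _ [B [mB _ ->]]; apply: fin_bigcap_measurable => // i _.
by rewrite -[_ @^-1` _]setTI; exact: mZ.
Qed.

Lemma others_var D i : ~~ D i -> measurable_fun setT (Z i : g_sigma_algebraType (others D) -> S).
Proof.
move=> Di _ A mA; rewrite setTI; apply: sub_sigma_algebra.
exists (fun j => if j == i then A else setT); split.
- by move=> j; case: eqP => // _; exact: measurableT.
- by move=> j Dj; case: eqP => // ji; rewrite -ji Dj in Di.
- apply/seteqP; split=> [w Aw j _ /=|w /(_ i Logic.I)/=]; last by rewrite eqxx.
  by case: eqP => // ->.
Qed.

Hypothesis hZ : iid.

Lemma iid_split (D : pred I) (A : set Omega) (B : I -> set S) : others D A ->
  (forall i, measurable (B i)) -> (forall i, ~~ D i -> B i = setT) ->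
  P (A `&` \bigcap_i (Z i @^-1` B i)) = P A * \prod_(i | D i) nu (B i).
Proof.
move=> [B' [mB' BT' ->]] mB BT; rewrite -bigcapI.
rewrite (_ : \bigcap_i _ = \bigcap_i (Z i @^-1` (B' i `&` B i))); last by [].
rewrite !hZ//; last by move=> i; exact: measurableI.
rewrite (bigID D) /= [X in _ = X * _](bigID D) /=.
rewrite [X in _ = X * _ * _]big1 ?mul1e; last by move=> i Di; rewrite BT' ?probability_setT.
rewrite muleC; congr (_ * _); apply: eq_bigr => i Di.
  by rewrite BT// setIT.
by rewrite BT'// setTI.
Qed.

End IndependentFamily.

Lemma measurable_snorm_affine {R : realType} {X : lmodType R[i]} {d} {T : measurableType d}
    (rho : X -> R) (I : finType) (c : I -> T -> R * R) (x : I -> X) (y : X) : snorm rho ->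
  (forall k, measurable_fun setT (c k)) ->
  measurable_fun setT (fun t => rho (y + \sum_k toC (c k t) *: x k)).
Proof.
move=> hr mc.
have := @measurable_snorm_sum _ _ _ T rho (option I)
  (fun k t => if k is Some k then c k t else (1, 0)) (fun k => if k is Some k then x k else y) hr _.
under [fun t => rho (\sum_(k : option I) _)]boolp.eq_fun => t.
  rewrite (bigD1 None)//= (reindex_omap Some id)//=; last by case.
  rewrite [X in _ + X](_ : _ = \sum_k toC (c k t) *: x k); last first.
    by apply: eq_bigl => k; rewrite eqxx.
  rewrite (_ : toC (1, 0) = 1) ?scale1r//; over.
by apply; case.
Qed.

Section RandomVectors.
Context {R : realType} {X : lmodType R[i]} {d : measure_display} {Omega : measurableType d}.
Context {I : finType}.
Variables (P : probability Omega R) (rho : X -> R) (hr : snorm rho).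
Local Open Scope ereal_scope.

Definition Esum (phi : R -> R) (Z : I -> Omega -> (R * R)%type) (x : I -> X) : \bar R :=
  \int[P]_w (phi (rho (\sum_i toC (Z i w) *: x i)))%:E.

Variables (phi : R -> R) (mphi : measurable_fun setT phi) (phi0 : forall t, (0 <= phi t)%R).

Lemma Esum_fresh (Z : I -> Omega -> (R * R)%type) (nu : probability (R * R)%type R) a x :
  (forall i, measurable_fun setT (Z i)) -> iid P Z nu ->
  Esum phi Z x = \int[P]_w \int[nu]_z
    (phi (rho (\sum_(i | i != a) toC (Z i w) *: x i + toC z *: x a)))%:E.
Proof.
move=> mZ hZ.
pose F (z : g_sigma_algebraType (others Z (pred1 a)) * (R * R)%type) : \bar R :=
  (phi (rho (\sum_i toC (if i == a then z.2 else Z i z.1) *: x i)))%:E.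
have mF : measurable_fun setT F.
  apply/measurable_EFinP; apply: (measurableT_comp mphi).
  apply: measurable_snorm_sum => // i; case: eqP => [_|/eqP ia]; first exact: measurable_snd.
  apply: (measurableT_comp (f := Z i : g_sigma_algebraType (others Z (pred1 a)) -> (R * R)%type)).
    exact: others_var.
  exact: measurable_fst.
have FE w z : F (w, z) = (phi (rho (\sum_(i | i != a) toC (Z i w) *: x i + toC z *: x a)))%:E.
  rewrite /F /= (bigD1 a)//= eqxx addrC; congr (phi (rho (_ + _)))%:E.
  by apply: eq_bigr => i /negbTE ->.
transitivity (\int[P]_w F (w, Z a w)).
  by apply: eq_integral => w _; rewrite FE [in LHS](bigD1 a)//= addrC.
have -> := @fresh_copy _ _ _ _ _ P (Z a) (mZ a) nu _ measurable
  (others_measurable mZ (D := pred1 a)) (others_I (D := pred1 a)) _ _ _ _ _ F mF.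
- by apply: eq_integral => w _; apply: eq_integral => z _; rewrite FE.
- exact: others_T.
- by rewrite smallest_id//; exact: sigma_algebra_measurable.
- by move=> A B; exact: measurableI.
- exact: measurableT.
- move=> A B oA mB.
  pose BB i := if i == a then B else setT.
  have := @iid_split _ _ _ _ _ _ _ _ nu hZ (pred1 a) A BB oA.
  rewrite big_pred1_eq /BB eqxx => <-.
  - congr (P (_ `&` _)); apply/seteqP; split=> [w /= Bw j _ /=|w /(_ a Logic.I)/=].
      by case: eqP => // ->.
    by rewrite eqxx.
  - by move=> i; case: eqP => // _; exact: measurableT.
  - by move=> i; rewrite /= => /negbTE ->.
- by move=> z; rewrite lee_fin.
Qed.

End RandomVectors.

Section Flips.
Context {R : realType} {X : lmodType R[i]} {d : measure_display} {Omega : measurableType d}.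
Context {I : finType}.
Variables (P : probability Omega R) (rho : X -> R) (hr : snorm rho).
Variables (phi : R -> R) (mphi : measurable_fun setT phi) (phi0 : forall t, (0 <= phi t)%R).
Local Open Scope ereal_scope.

(** The half turn exchanges the two halves of the period. The end point 1, which the closed interval
    counts in addition, is null. *)
Let half (A : set R) : measurable A -> (forall t, A (t + 1)%R <-> A t) ->
  lam (A `&` `[0%R, 1%R]) = lam ((fun t => (t + 2^-1)%R) @^-1` A `&` `[0%R, 1%R]).
Proof.
move=> mA pA.
have mI (i : interval R) : measurable [set` i] by exact: measurable_itv.
have split3 (B : set R) : measurable B -> lam (B `&` `[0%R, 1%R]) =
   lam (B `&` `[0%R, 2^-1%R[) + lam (B `&` `[2^-1%R, 1%R[).
  move=> mB.
  have -> : B `&` `[0%R, 1%R] = ((B `&` `[0%R, 2^-1%R[) `|` (B `&` `[2^-1%R, 1%R[)) `|` (B `&` `[1%R, 1%R]).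
    rewrite -!setIUr; congr (_ `&` _); apply/seteqP; split=> t /=; rewrite !in_itv /=; last by lra.
    move=> h; have [h1|h1] := ltP t 2^-1%R; first by left; left; lra.
    have [h2|h2] := ltP t 1%R; first by left; right; lra.
    by right; lra.
  have addU (C D : set R) : measurable C -> measurable D -> C `&` D = set0 ->
      lam (C `|` D) = lam C + lam D by move=> mC mD; exact: measureU.
  rewrite addU; [|by apply: measurableU; exact: measurableI|exact: measurableI|]; last first.
    by apply/seteqP; split=> // t [[[_]|[_]]] /=; rewrite in_itv /= => h1 [_ /=]; rewrite in_itv /=; lra.
  rewrite (addU (B `&` _)); [|exact: measurableI|exact: measurableI|]; last first.
    by apply/seteqP; split=> // t [[_ /=]]; rewrite in_itv /= => h1 [_ /=]; rewrite in_itv /=; lra.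
  rewrite (_ : lam (B `&` `[1%R, 1%R]) = 0) ?adde0//.
  apply/eqP; rewrite eq_le measure_ge0 andbT.
  apply: (@le_trans _ _ (lam `[1%R, 1%R])).
    by apply: le_measure; rewrite ?inE//; exact: measurableI.
  by rewrite /lam lebesgue_measure_itv /= ltxx.
have mt (c : R) (B : set R) : measurable B -> measurable ((fun t => (t + c)%R) @^-1` B).
  move=> mB; rewrite -[_ @^-1` _]setTI.
  have m : measurable_fun setT (fun t : R => (t + c)%R) by exact: measurable_funD.
  exact: m.
rewrite !split3//; last exact: mt.
rewrite addeC; congr (_ + _).
  rewrite (lebesgue_translation 2^-1%R); last exact: measurableI.
  congr lam; apply/seteqP; split=> t /= [h]; rewrite !in_itv /= => h1; split=> //; lra.
rewrite (lebesgue_translation (- 2^-1)%R); last exact: measurableI.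
have e t : (t - 2^-1 + 1 = t + 2^-1 :> R)%R by field.
congr lam; apply/seteqP; split=> t /= [h]; rewrite !in_itv /= => h1; split; try lra.
  by rewrite -e; apply/pA.
by apply/pA; rewrite e.
Qed.

Let circ (t : R) : (R * R)%type := (cos (2 * pi * t), sin (2 * pi * t)).

Lemma circle_half_turn (Z : {RV P >-> (R * R)%type}) (B : set (R * R)%type) : uniform_on_circle Z -> measurable B ->
  distribution P Z ((fun z : (R * R)%type => (- z.1, - z.2)%R) @^-1` B) = distribution P Z B.
Proof.
move=> uZ mB.
have mN : measurable_fun setT (fun z : (R * R)%type => (- z.1, - z.2)%R).
  by apply: measurable_fun_pair; apply: measurableT_comp.
have mc : measurable_fun setT circ.
  apply: measurable_fun_pair; apply: continuous_measurable_fun; move=> t;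
    apply: continuous_comp; try exact: mulrl_continuous; [exact: continuous_cos|exact: continuous_sin].
have mNB : measurable ((fun z : (R * R)%type => (- z.1, - z.2)%R) @^-1` B).
  by rewrite -[_ @^-1` _]setTI; exact: mN.
have mcB D : measurable D -> measurable (circ @^-1` D).
  by move=> mD; rewrite -[_ @^-1` _]setTI; exact: mc.
have uE A : measurable A -> uniform_prob (@ltr01 R) A = lam (A `&` `[0%R, 1%R]).
  move=> mA; rewrite /uniform_prob integral_uniform_pdf.
  rewrite (eq_integral (fun=> 1)); last first.
    by move=> x; rewrite inE => -[_ /=]; rewrite in_itv /= /uniform_pdf => ->; rewrite subr0 invr1.
  rewrite integral_cst ?mul1e//.
  by apply: measurableI => //; exact: measurable_itv.
rewrite !uZ//.
have m1 := mcB _ mB; have m2 := mcB _ mNB.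
rewrite (uE _ m2) (uE _ m1).
rewrite [RHS]half; [|exact: mcB|]; last first.
  move=> t; rewrite /= /circ mulrDr mulr1.
  have -> : (2 * pi = pi *+ 2 :> R)%R by rewrite mulr_natl.
  by rewrite cosD2pi sinD2pi.
congr (lam (_ `&` _)); apply/funext => t /=; congr B; rewrite /circ.
have -> : (2 * pi * (t + 2^-1) = 2 * pi * t + pi :> R)%R by field.
by rewrite cosDpi sinDpi.
Qed.

Lemma Esum_flip (Z : I -> {RV P >-> (R * R)%type}) a x :
  iid P Z (distribution P (Z a)) -> uniform_on_circle (Z a) ->
  Esum P rho phi Z (fun i => if i == a then (- x i)%R else x i) = Esum P rho phi Z x.
Proof.
move=> hZ uZ; have mZ i : measurable_fun setT (Z i) by [].
rewrite !(Esum_fresh hr mphi phi0 a _ mZ hZ); apply: eq_integral => w _.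
rewrite eqxx; under eq_integral do under eq_bigr => i /negbTE ia do rewrite ia.
set y := (\sum_(i | i != a) _)%R.
pose F (z : (R * R)%type) : \bar R := (phi (rho (y + toC z *: x a)))%:E.
have mF : measurable_fun setT F.
  apply/measurable_EFinP; apply: (measurableT_comp mphi).
  have := measurable_snorm_affine (c := fun (_ : 'I_1) (z : (R * R)%type) => z) (fun _ : 'I_1 => x a) y hr (fun _ => @measurable_id _ _ setT).
  by congr (measurable_fun _ _); apply/funext => t; rewrite big_ord1.
have mN : measurable_fun setT (fun z : (R * R)%type => (- z.1, - z.2)%R).
  by apply: measurable_fun_pair; apply: measurableT_comp.
have := ge0_integral_pushforward mN (distribution P (Z a)) measurableT mF (fun z _ => lee_tofin (phi0 _)).
rewrite preimage_setT => E.
transitivity (\int[distribution P (Z a)]_z F (- z.1, - z.2)%R).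
  apply: eq_integral => z _; rewrite /F; congr (phi (rho (y + _)))%:E.
  by rewrite scalerN -scaleNr; congr (_ *: _); apply/eqP; rewrite eq_complex /= !eqxx.
rewrite -[LHS]E; apply: eq_measure_integral => A mA _.
exact: circle_half_turn.
Qed.

End Flips.

Section GaussianPair.
Context {R : realType}.
Local Open Scope ereal_scope.

Definition nrm2 : set (R * R)%type -> \bar R := @nrm R \x @nrm R.
Let nrm2_0 : nrm2 set0 = 0. Proof. exact: measure0. Qed.
Let nrm2_ge0 A : 0 <= nrm2 A. Proof. exact: measure_ge0. Qed.
Let nrm2_additive : semi_sigma_additive nrm2.
Proof. exact: measure_semi_sigma_additive. Qed.
HB.instance Definition _ := isMeasure.Build _ _ _ nrm2 nrm2_0 nrm2_ge0 nrm2_additive.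

Lemma nrm2_box (A B : set R) : measurable A -> measurable B ->
  nrm2 (A `*` B) = nrm A * nrm B.
Proof. exact: product_measure1E. Qed.

Let nrm2_T : nrm2 setT = 1.
Proof.
have e1 : nrm setT = 1 :> \bar R by exact: (probability_setT (@nrm R)).
by rewrite -setXTT nrm2_box ?e1 ?mule1//; exact: measurableT.
Qed.
HB.instance Definition _ := @Measure_isProbability.Build _ _ _ nrm2 nrm2_T.

Lemma nrm2_rotation (c s : R) (f : R * R -> \bar R) : measurable_fun setT f ->
  (forall x, 0 <= f x) -> (c ^+ 2 + s ^+ 2 = 1)%R ->
  \int[nrm2]_z f ((c * z.1 - s * z.2)%R, (s * z.1 + c * z.2)%R) = \int[nrm2]_z f z.
Proof. exact: normal2_rotation. Qed.

End GaussianPair.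

Section GaussianFamily.
Context {R : realType} {X : lmodType R[i]} {d : measure_display} {Omega : measurableType d}.
Context {I : finType}.
Variables (P : probability Omega R) (rho : X -> R) (hr : snorm rho).
Variables (phi : R -> R) (mphi : measurable_fun setT phi) (phi0 : forall t, (0 <= phi t)%R).
Variables (xi : I -> Omega -> R) (mxi : forall i, measurable_fun setT (xi i)).
Hypothesis hxi : iid P xi nrm.
Local Open Scope ereal_scope.
Local Notation Z := (fun i w => (xi i w, 0%R)).

Definition rotate (a b : I) (c s : R) (x : I -> X) (i : I) : X :=
  (if i == a then c%:C *: x a + s%:C *: x b
   else if i == b then - s%:C *: x a + c%:C *: x b else x i)%R.

Lemma Esum_pair a b x : a != b ->
  Esum P rho phi Z x = \int[P]_w \int[nrm2]_z
    (phi (rho (\sum_(i | (i != a) && (i != b)) (xi i w)%:C *: x i + z.1%:C *: x a + z.2%:C *: x b)))%:E.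
Proof.
move=> ab; pose D : pred I := pred2 a b.
pose F (z : g_sigma_algebraType (others xi D) * (R * R)%type) : \bar R :=
  (phi (rho (\sum_i toC ((if i == a then z.2.1 else if i == b then z.2.2 else xi i z.1), 0%R) *: x i)))%:E.
have mF : measurable_fun setT F.
  apply/measurable_EFinP; apply: (measurableT_comp mphi).
  apply: measurable_snorm_sum => // i; apply: measurable_fun_pair => //.
  case: eqP => [_|/eqP ia]; first by apply: measurableT_comp => //; exact: measurable_fst.
  case: eqP => [_|/eqP ib]; first by apply: measurableT_comp => //; exact: measurable_snd.
  apply: (measurableT_comp (f := xi i : g_sigma_algebraType (others xi D) -> R)).
    by apply: others_var; rewrite /D /= negb_or ia.
  exact: measurable_fst.
have FE w z : F (w, z) = (phi (rho (\sum_(i | (i != a) && (i != b)) (xi i w)%:C *: x i + z.1%:C *: x a + z.2%:C *: x b)))%:E.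
  rewrite /F /= (bigD1 a)//= (bigD1 b) 1?eq_sym//= !eqxx (negbTE (_ : b != a)) 1?eq_sym//.
  rewrite addrA addrC addrA; congr (phi (rho (_ + _ + _)))%:E.
  by apply: eq_bigr => i /andP[/negbTE -> /negbTE ->].
transitivity (\int[P]_w F (w, (xi a w, xi b w))).
  apply: eq_integral => w _; rewrite FE; congr (phi (rho _))%:E.
  by rewrite (bigD1 a)//= (bigD1 b) 1?eq_sym//= addrA addrC addrA.
have mY : measurable_fun setT (fun w => (xi a w, xi b w)) by exact: measurable_fun_pair.
pose boxes : set (set (R * R)) := [set A `*` B | A in measurable & B in measurable].
have -> := @fresh_copy _ _ _ _ _ P _ mY (@nrm2 R) _ boxes
  (others_measurable mxi (D := D)) (others_I (D := D)) _ _ _ _ _ F mF.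
- by apply: eq_integral => w _; apply: eq_integral => z _; rewrite FE.
- exact: others_T.
- by rewrite measurable_prod_measurableType.
- move=> _ _ [A mA [B mB <-]] [A' mA' [B' mB' <-]]; rewrite -setXI.
  by exists (A `&` A'); [exact: measurableI|exists (B `&` B') => //; exact: measurableI].
- by exists setT => //; exists setT => //; rewrite setXTT.
- move=> A _ oA [B mB [B' mB' <-]].
  pose BB i := if i == a then B else if i == b then B' else setT.
  have := @iid_split _ _ _ _ _ _ _ _ (@nrm R) hxi D A BB oA.
  rewrite (bigD1 a) /D /= ?eqxx// (bigD1 b) /= ?eqxx ?orbT 1?eq_sym//= big_pred0; last first.
    by move=> i; case: (i == a) => //; case: (i == b).
  rewrite mule1 /BB !eqxx (negbTE (_ : b != a)) 1?eq_sym// nrm2_box// => <-.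
  - congr (P (_ `&` _)); apply/seteqP; split=> [w /= [Bw Bw'] j _ /=|w /= h].
      by case: eqP => [->//|_]; case: eqP => [->|].
    by split; [have := h a Logic.I|have := h b Logic.I]; rewrite /= ?eqxx// (negbTE (_ : b != a)) 1?eq_sym.
  - by move=> i; case: eqP => // _; case: eqP.
  - by move=> i; rewrite negb_or => /andP[/negbTE -> /negbTE ->].
- by move=> z; rewrite lee_fin.
Qed.

(** Integrating first over the pair [(xi a, xi b)], the rotation of the vectors is moved onto this
    pair, whose law is rotation invariant. *)
Lemma Esum_rotate a b c s x : a != b -> (c ^+ 2 + s ^+ 2 = 1)%R ->
  Esum P rho phi Z (rotate a b c s x) = Esum P rho phi Z x.
Proof.
move=> ab cs; have ba : (b == a) = false by rewrite eq_sym (negbTE ab).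
rewrite !(Esum_pair _ ab); apply: eq_integral => w _.
set y := (\sum_(i | _ && _) _ *: x i)%R.
have -> : (\sum_(i | (i != a) && (i != b)) (xi i w)%:C *: rotate a b c s x i = y)%R.
  by apply: eq_bigr => i /andP[/negbTE ia /negbTE ib]; rewrite /rotate ia ib.
pose F (z : (R * R)%type) : \bar R := (phi (rho (y + z.1%:C *: x a + z.2%:C *: x b)))%:E.
have mF : measurable_fun setT F.
  apply/measurable_EFinP; apply: (measurableT_comp mphi).
  have := measurable_snorm_affine (c := fun (k : bool) (z : (R * R)%type) => ((if k then z.1 else z.2), 0%R))
    (fun k : bool => if k then x a else x b) y hr.
  under [fun t => rho (y + _)]boolp.eq_fun do rewrite big_bool /= addrA.
  by apply; case; apply: measurable_fun_pair.
rewrite -[RHS](nrm2_rotation (c := c) (s := s) mF (fun=> phi0 _) cs).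
apply: eq_integral => z _; rewrite /F; congr (phi (rho _))%:E.
rewrite /rotate !eqxx ba /=.
rewrite rmorphB rmorphD !rmorphM; lin_ring.
Qed.

End GaussianFamily.

Section IndependenceToIid.
Context {R : realType} {d : measure_display} {Omega : measurableType d}.
Variable P : probability Omega R.
Local Open Scope ereal_scope.

Lemma independent_iid {I : eqType} {J : finType} (Z : I -> {RV P >-> (R * R)%type}) (h : J -> I)
    (nu : probability (R * R)%type R) :
  injective h -> mutually_independent Z ->
  (forall i B, measurable B -> distribution P (Z i) B = nu B) ->
  iid P (fun j => Z (h j)) nu.
Proof.
move=> hI iZ lZ B mB.
pose BB i := if [pick j | h j == i] is Some j then B j else setT.
have BBE j : BB (h j) = B j.
  by rewrite /BB; case: pickP => [k /eqP/hI -> //|/(_ j)]; rewrite eqxx.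
have mBB i : measurable (BB i) by rewrite /BB; case: pickP => // *; exact: measurableT.
have := iZ [seq h j | j <- index_enum J] BB; rewrite map_inj_uniq// index_enum_uniq => /(_ isT mBB).
rewrite !big_map => E.
have -> : \bigcap_i (Z (h i) @^-1` B i) = \big[setI/setT]_(i : J) (Z (h i) @^-1` BB (h i)).
  rewrite -bigcap_seq; apply/seteqP; split=> [w hw j _|w hw j _]; first by rewrite BBE; exact: hw.
  by have := hw j; rewrite /= mem_index_enum BBE => /(_ isT).
rewrite E; apply: eq_bigr => j _; by rewrite BBE; exact: lZ.
Qed.

Lemma gaussian_iid (g : nat -> {RV P >-> (R * R)%type}) n : gaussian_sequence g ->
  iid P (fun (k : 'I_n * bool) w => if k.2 then (g k.1 w).2 else (g k.1 w).1) (@nrm R).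
Proof.
move=> [ig lg] B mB.
have lZ i A : measurable A -> distribution P (g i) A = @nrm2 R A.
  by move=> mA; rewrite lg// nrm_prod.
have := independent_iid (@ord_inj n) ig lZ.
pose C (j : 'I_n) := B (j, false) `*` B (j, true).
have mC j : measurable (C j) by exact: measurableX.
move=> /(_ C mC); rewrite (_ : \bigcap_j _ = \bigcap_(k : 'I_n * bool) ((fun w => if k.2 then (g k.1 w).2 else (g k.1 w).1) @^-1` B k)).
  move=> ->; transitivity (\prod_(i < n) \prod_(b : bool) @nrm R (B (i, b))).
    by apply: eq_bigr => j _; rewrite [LHS]nrm2_box// big_bool /= muleC.
  by rewrite pair_bigA; apply: eq_bigr => -[].
apply/seteqP; split=> w h.
  by move=> -[j []] _ /=; have [] := h j Logic.I.
by move=> j _; split; [exact: (h (j, false) Logic.I)|exact: (h (j, true) Logic.I)].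
Qed.

Lemma circle_cabs (Z : {RV P >-> (R * R)%type}) : uniform_on_circle Z ->
  {ae P, forall w, cabs (toC (Z w)) = 1%R}.
Proof.
move=> uZ; pose B := [set z : (R * R)%type | (z.1 ^+ 2 + z.2 ^+ 2 != 1)%R].
have mB : measurable B.
  have mf : measurable_fun setT (fun z : (R * R)%type => (z.1 ^+ 2 + z.2 ^+ 2)%R).
    by apply: measurable_funD; apply: measurable_funX.
  rewrite (_ : B = (fun z : (R * R)%type => (z.1 ^+ 2 + z.2 ^+ 2)%R) @^-1` (~` [set 1%R])).
    by rewrite -[_ @^-1` _]setTI; apply: mf => //; exact: measurableC.
  by apply/seteqP; split=> z /= /eqP.
exists (Z @^-1` B); split.
- by rewrite -[_ @^-1` _]setTI; exact: measurable_funP.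
- rewrite -[LHS]/(distribution P Z B) uZ// (_ : _ @^-1` B = set0) ?measure0//.
  by apply/seteqP; split=> // t; rewrite /B /= cos2Dsin2 eqxx.
- move=> w /= h; rewrite /B /=; apply/eqP => e; apply: h.
  by rewrite cabsE /= e sqrtr1.
Qed.

End IndependenceToIid.

Section GaussianInvariance.
Context {R : realType} {X : completeNormedModType R[i]}.
Context {d : measure_display} {Omega : measurableType d} (P : probability Omega R).
Variables (g : nat -> {RV P >-> (R * R)%type}) (hg : gaussian_sequence g).
Local Notation sqr := (fun t : R => t ^+ 2).
Let hr := @snorm_rnorm R X.
Let msqr : measurable_fun setT sqr. Proof. exact: exprn_measurable. Qed.

Definition Psi m (x : nat -> X) : \bar R :=
  Esum P (@rnorm R X) sqr (fun (j : 'I_m) => g j) (fun j => x j).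

Let xi m (k : 'I_m * bool) w : R := if k.2 then (g k.1 w).2 else (g k.1 w).1.
Let cplx m (x : nat -> X) (k : 'I_m * bool) : X := if k.2 then 'i *: x k.1 else x k.1.

Let mxi m k : measurable_fun setT (@xi m k).
Proof. by rewrite /xi; case: k => j [] /=; apply: measurableT_comp. Qed.

Let PsiE m x : Psi m x = Esum P (@rnorm R X) sqr (fun k w => (@xi m k w, 0)) (@cplx m x).
Proof.
rewrite /Psi /Esum; apply: eq_integral => w _; congr ((rnorm _ ^+ 2)%:E).
rewrite -(pair_big_dep xpredT (fun _ _ => true)
  (fun i b => toC (@xi m (i, b) w, 0) *: @cplx m x (i, b))) /=.
apply: eq_bigr => j _; rewrite big_bool /= /xi /cplx /= scalerA -scalerDl; congr (_ *: _).
by apply/eqP; rewrite eq_complex /=; apply/andP; split; apply/eqP; ring.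
Qed.

Lemma Psi_ext m x y : (forall j, (j < m)%N -> x j = y j) -> Psi m x = Psi m y.
Proof. by move=> h; congr Esum; apply/funext => j; exact: h. Qed.

(** With real Gaussians, a phase on [x a] is a rotation of the two vectors [x a] and [i x a]
    attached to the real and imaginary part of [g a]. *)
Lemma Psi_phase m a z x : (a < m)%N -> cabs z = 1 ->
  Psi m (fun j => if j == a then z *: x a else x j) = Psi m x.
Proof.
move=> am z1; pose a' := Ordinal am.
rewrite !PsiE -(Esum_rotate hr msqr (fun t => sqr_ge0 t) (@mxi m) (gaussian_iid hg)
  (a := (a', false)) (b := (a', true)) (c := complex.Re z) (s := complex.Im z) (cplx x));
  [|by rewrite xpair_eqE eqxx|by rewrite -cabs_sqr z1 expr1n].
congr Esum; apply/funext => -[j b]; rewrite /cplx /rotate /= !xpair_eqE -!val_eqE /=.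
have [->|_] := eqVneq (val j) a; last by case: b.
case: z z1 => u v _; case: b => /=; rewrite !scalerA -!scalerDl; congr (_ *: _);
  by apply/eqP; rewrite eq_complex /=; apply/andP; split; apply/eqP; ring.
Qed.

(** Two real rotations by the same angle, one for the real and one for the imaginary parts. *)
Lemma Psi_givens m a b (c s : R) x : (a < m)%N -> (b < m)%N -> a != b -> c ^+ 2 + s ^+ 2 = 1 ->
  Psi m (fun j => if j == a then c%:C *: x a + s%:C *: x b
    else if j == b then - s%:C *: x a + c%:C *: x b else x j) = Psi m x.
Proof.
move=> am bm ab cs; pose a' := Ordinal am; pose b' := Ordinal bm.
have rot t := Esum_rotate hr msqr (fun t => sqr_ge0 t) (@mxi m) (gaussian_iid hg)
  (a := (a', t)) (b := (b', t)) (c := c) (s := s).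
have ab' t : (a', t) != (b', t) by rewrite xpair_eqE -val_eqE /= (negbTE ab).
have e1 := rot true (rotate (a', false) (b', false) c s (cplx x)) (ab' _ _) cs.
have e2 := rot false (cplx x) (ab' _ _) cs.
rewrite !PsiE -[RHS]e2 -[RHS]e1.
congr Esum; apply/funext => -[j t]; rewrite /cplx /rotate /= !xpair_eqE -!val_eqE /=.
have ba : (b == a) = false by rewrite eq_sym (negbTE ab).
have [->|ja] := eqVneq (val j) a; case: t => /=; rewrite ?(negbTE ab) ?ba ?eqxx //=.
- by rewrite ?andbF /=; lin_ring.
- have [_|_] := eqVneq (val j) b => //=; by rewrite ?andbF /=; lin_ring.
- by case: (_ == b).
Qed.

End GaussianInvariance.

(** * The fast Fourier transform of a Gaussian vector *)

Section FourierTransform.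
Context {R : realType}.

Definition uroot (n t : nat) : R[i] := cexp ('i * (2 * pi * t%:R / (2 ^ n)%:R)%:C).

Lemma cabs_root n t : cabs (uroot n t) = 1.
Proof. by rewrite cabs_cexp /= !mul0r mulr0 subr0 expR0. Qed.

Lemma rootD n s t : uroot n (s + t) = uroot n s * uroot n t.
Proof.
by rewrite /uroot -cexpD; congr cexp; rewrite natrD mulrDr mulrDl rmorphD mulrDr.
Qed.

Lemma root_double n t : uroot n.+1 (t.*2) = uroot n t.
Proof.
rewrite /uroot; congr (cexp ('i * _%:C)); rewrite -muln2 expnS natrM (natrM _ 2).
by field; rewrite pnatr_eq0 expn_eq0.
Qed.

Lemma root_half n : uroot n.+1 (2 ^ n) = - 1.
Proof.
rewrite /uroot (_ : 2 * pi * (2 ^ n)%:R / (2 ^ n.+1)%:R = pi :> R); last first.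
  by rewrite expnS natrM; field; rewrite pnatr_eq0 expn_eq0.
have -> : 'i * pi%:C = 0 +i* pi :> R[i] by apply/eqP; rewrite eq_complex /=; apply/andP; split; apply/eqP; ring.
by rewrite /cexp /= expR0 cospi sinpi mulr0 mul1r; apply/eqP; rewrite eq_complex /=; apply/andP; split; apply/eqP; ring.
Qed.

Lemma root_full n t : uroot n (2 ^ n * t) = 1.
Proof.
elim: t => [|t IH]; first by rewrite muln0 /uroot mulr0 mul0r mulr0 cexp0.
rewrite mulnS rootD IH mulr1 -root_double -addnn rootD root_half; ring.
Qed.

Lemma sum_double (V : nmodType) (N : nat) (f : nat -> V) :
  \sum_(j < N.*2) f j = \sum_(j < N) (f j.*2 + f j.*2.+1).
Proof.
elim: N => [|N IH]; first by rewrite !big_ord0.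
by rewrite doubleS !big_ord_recr /= IH addrA.
Qed.

Context {V : lmodType R[i]}.
Definition dft n (x : nat -> V) (k : nat) : V := \sum_(j < 2 ^ n) uroot n (j * k) *: x j.

Lemma dft_low n x k : dft n.+1 x k =
  dft n (fun j => x j.*2) k + uroot n.+1 k *: dft n (fun j => x j.*2.+1) k.
Proof.
rewrite /dft expnS mul2n (sum_double _ (fun j => uroot n.+1 (j * k) *: x j)) big_split /=.
congr (_ + _).
  by apply: eq_bigr => j _; rewrite -doubleMl root_double.
rewrite scaler_sumr; apply: eq_bigr => j _.
by rewrite mulSn -doubleMl rootD root_double scalerA.
Qed.

Lemma dft_periodic n x k : dft n x (k + 2 ^ n) = dft n x k.
Proof.
by apply: eq_bigr => j _; rewrite mulnDr rootD [(j * 2 ^ n)%N]mulnC root_full mulr1.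
Qed.

Lemma dft_high n x k : dft n.+1 x (k + 2 ^ n) =
  dft n (fun j => x j.*2) k - uroot n.+1 k *: dft n (fun j => x j.*2.+1) k.
Proof.
by rewrite dft_low !dft_periodic rootD root_half mulrN1 scaleNr.
Qed.

(** Bit reversal: the slot in which the in-place radix-two transform leaves frequency [k]. *)
Fixpoint bitrev n k : nat :=
  match n with
  | 0 => k
  | m.+1 => if (k < 2 ^ m)%N then (bitrev m k).*2 else (bitrev m (k - 2 ^ m)%N).*2.+1
  end.

Lemma bitrev_lt n k : (k < 2 ^ n)%N -> (bitrev n k < 2 ^ n)%N.
Proof.
elim: n k => [|n IH] k //= hk; rewrite expnS mul2n; case: ifP => [/IH h|/negbT h].
  by rewrite ltn_double.
rewrite ltn_Sdouble; apply: IH; rewrite ltn_subLR; last by rewrite leqNgt.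
by move: hk; rewrite expnS mul2n addnn.
Qed.

Lemma bitrev_inj n k l : (k < 2 ^ n)%N -> (l < 2 ^ n)%N -> bitrev n k = bitrev n l -> k = l.
Proof.
elim: n k l => [|n IH] k l //=.
have sub m : (m < 2 ^ n.+1)%N -> (m < 2 ^ n)%N = false -> (m - 2 ^ n < 2 ^ n)%N.
  by rewrite expnS mul2n -addnn => h /negbT; rewrite -leqNgt => h2; rewrite ltn_subLR.
case: ifP => hk; case: ifP => hl kn ln.
- by move/double_inj; exact: IH.
- by move/(congr1 odd); rewrite /= !odd_double.
- by move/(congr1 odd); rewrite /= !odd_double.
- move=> [/double_inj/(IH _ _ (sub _ kn hk) (sub _ ln hl))].
  move/(congr1 (fun i => (i + 2 ^ n)%N)); rewrite !subnK// leqNgt ?hk ?hl//.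
Qed.

End FourierTransform.

Section GaussianFourier.
Context {R : realType} {X : completeNormedModType R[i]}.
Context {d : measure_display} {Omega : measurableType d} (P : probability Omega R).
Variables (g : nat -> {RV P >-> (R * R)%type}) (hg : gaussian_sequence g).
Local Notation Psi := (Psi (X := X) g).
Let q : R := (Num.sqrt 2)^-1.
Let q2 : q ^+ 2 + q ^+ 2 = 1.
Proof. by rewrite /q exprVn sqr_sqrtr//; lra. Qed.

(** A normalized butterfly is a phase on [b], a rotation by pi/4 and a change of sign on [b], all of
    which preserve [Psi]. *)
Lemma Psi_butterfly m a b z x : (a < m)%N -> (b < m)%N -> a != b -> cabs z = 1 ->
  exists x', [/\ Psi m x' = Psi m x, x' a = q%:C *: (x a + z *: x b),
    x' b = q%:C *: (x a - z *: x b) & forall j, j != a -> j != b -> x' j = x j].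
Proof.
move=> am bm ab z1.
have c1 : cabs (-1 : R[i]) = 1 by rewrite cabsN cabs1.
have ba : b == a = false by rewrite eq_sym (negbTE ab).
pose x1 j := if j == b then z *: x b else x j.
pose x2 j := if j == a then q%:C *: x1 a + q%:C *: x1 b
  else if j == b then - q%:C *: x1 a + q%:C *: x1 b else x1 j.
pose x3 j := if j == b then -1 *: x2 b else x2 j.
exists x3; split.
- rewrite (Psi_phase hg x2 bm c1) (Psi_givens hg x1 am bm ab q2).
  exact: Psi_phase.
- by rewrite /x3 /x2 /x1 !eqxx (negbTE ab) scalerDr.
- by rewrite /x3 /x2 /x1 !eqxx ba (negbTE ab); lin_ring.
- by move=> j /negbTE ja /negbTE jb; rewrite /x3 /x2 /x1 ja jb.
Qed.

Lemma Psi_swap m a b x : (a < m)%N -> (b < m)%N -> a != b ->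
  Psi m (fun j => if j == a then x b else if j == b then x a else x j) = Psi m x.
Proof.
move=> am bm ab; have c1 : cabs (-1 : R[i]) = 1 by rewrite cabsN cabs1.
have ba : b == a = false by rewrite eq_sym (negbTE ab).
have cs : (0 : R) ^+ 2 + 1 ^+ 2 = 1 by rewrite expr0n expr1n add0r.
rewrite -(Psi_givens hg x am bm ab cs) -[RHS](Psi_phase hg _ bm c1).
apply: Psi_ext => j _; case: eqP => [->|ja].
  by rewrite (negbTE ab) scale0r add0r scale1r.
by have [_|//] := eqVneq j b; rewrite eqxx ba scale0r addr0 scalerA mulN1r opprK scale1r.
Qed.

Lemma Psi_perm m (s : {perm 'I_m}) (x : 'I_m -> X) :
  Esum P (@rnorm R X) (fun t => t ^+ 2) (fun j : 'I_m => g j) (fun j => x (s j)) =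
  Esum P (@rnorm R X) (fun t => t ^+ 2) (fun j : 'I_m => g j) x.
Proof.
have [ts -> _] := prod_tpermP s; elim: ts x => [|[a b] ts IH] x.
  by rewrite big_nil; congr Esum; apply/funext => j; rewrite perm1.
rewrite big_cons /=; have -> : (fun j => x ((tperm a b * \prod_(t <- ts) tperm t.1 t.2)%g j)) =
    (fun j => (fun i => x ((\prod_(t <- ts) tperm t.1 t.2)%g i)) (tperm a b j)).
  by apply/funext => j; rewrite permM.
rewrite -[RHS]IH; set y := fun i => x ((\prod_(t <- ts) tperm t.1 t.2)%g i).
have [->|ab] := eqVneq a b; first by congr Esum; apply/funext => j; rewrite tperm1 perm1.
pose y' (j : nat) := if insub j is Some i then y i else 0.
have y'E (j : 'I_m) : y' j = y j by rewrite /y' valK.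
have := @Psi_swap m a b y' (ltn_ord a) (ltn_ord b) ab; rewrite /Psi.
have -> : (fun j : 'I_m => y' j) = y by apply/funext => j; rewrite y'E.
move=> <-; congr Esum; apply/funext => j; rewrite !y'E !val_eqE.
by case: tpermP => [->|->|/eqP/negbTE -> /eqP/negbTE ->]; rewrite ?eqxx// eq_sym (negbTE ab).
Qed.

Lemma Psi_butterflies m n (A B : nat -> nat) (z : nat -> R[i]) x :
  (forall k, (k < n)%N -> [/\ (A k < m)%N, (B k < m)%N & cabs (z k) = 1]) ->
  (forall k l, (k < n)%N -> (l < n)%N -> [/\ A k != B l, (A k = A l -> k = l) & (B k = B l -> k = l)]) ->
  exists x', [/\ Psi m x' = Psi m x,
    forall k, (k < n)%N -> x' (A k) = q%:C *: (x (A k) + z k *: x (B k)) /\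
      x' (B k) = q%:C *: (x (A k) - z k *: x (B k)) &
    forall j, (forall k, (k < n)%N -> j != A k /\ j != B k) -> x' j = x j].
Proof.
elim: n => [|n IH] hm hi; first by exists x.
have [||x1 [E1 v1 o1]] := IH.
- by move=> k kn; apply: hm; exact: ltnW.
- by move=> k l kn ln; apply: hi; exact: ltnW.
have [An Bn zn] := hm n (ltnSn n).
have [ABn _ _] := hi n n (ltnSn n) (ltnSn n).
have [x2 [E2 va vb o2]] := Psi_butterfly x1 An Bn ABn zn.
have fresh k : (k < n)%N -> [/\ A n != A k, A n != B k, B n != A k & B n != B k].
  move=> kn; have [h1 h2 h3] := hi n k (ltnSn n) (ltnW kn).
  have [h4 _ _] := hi k n (ltnW kn) (ltnSn n).
  split=> //; last by apply: contraTneq kn => e; rewrite -(h3 e) ltnn.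
    by apply: contraTneq kn => e; rewrite -(h2 e) ltnn.
  by rewrite eq_sym.
have xA : x1 (A n) = x (A n) by apply: o1 => k /fresh[].
have xB : x1 (B n) = x (B n) by apply: o1 => k /fresh[].
exists x2; split.
- by rewrite E2.
- move=> k; rewrite ltnS leq_eqVlt => /orP[/eqP ->|kn]; first by rewrite va vb xA xB.
  have [f1 f2 f3 f4] := fresh k kn; have [e1 e2] := v1 k kn.
  by rewrite !o2 ?e1 ?e2// eq_sym.
- move=> j hj; have [ja jb] := hj n (ltnSn n).
  by rewrite o2// o1// => k kn; apply: hj; exact: ltnW.
Qed.

(** Invariance under the whole unitary matrix is obtained by running the fast transform in place:
    the even and odd halves first, then butterflies on disjoint pairs. The addresses [e] and the
    statement about untouched entries let the recursion act on a sub-array. *)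
Lemma Psi_fft m n (e : nat -> nat) x : (forall k, (k < 2 ^ n)%N -> (e k < m)%N) ->
  (forall k l, (k < 2 ^ n)%N -> (l < 2 ^ n)%N -> e k = e l -> k = l) ->
  exists x', [/\ Psi m x' = Psi m x,
    forall k, (k < 2 ^ n)%N -> x' (e (bitrev n k)) = (q ^+ n)%:C *: dft n (x \o e) k &
    forall j, (forall k, (k < 2 ^ n)%N -> j != e k) -> x' j = x j].
Proof.
elim: n e x => [|n IH] e x em ei.
  exists x; split => // -[|//] _ /=; rewrite expr0 scale1r /dft big_ord1 mul0n.
  by rewrite /uroot mulr0 mul0r mulr0 cexp0 scale1r.
have lt0 k : (k < 2 ^ n -> k.*2 < 2 ^ n.+1)%N by rewrite expnS mul2n ltn_double.
have lt1 k : (k < 2 ^ n -> k.*2.+1 < 2 ^ n.+1)%N by rewrite expnS mul2n ltn_Sdouble.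
have [||x1 [E1 v1 o1]] := IH (fun k => e k.*2) x.
- by move=> k /lt0/em.
- by move=> k l /lt0 k1 /lt0 l1 /(ei _ _ k1 l1)/double_inj.
have [||x2 [E2 v2 o2]] := IH (fun k => e k.*2.+1) x1.
- by move=> k /lt1/em.
- by move=> k l /lt1 k1 /lt1 l1 /(ei _ _ k1 l1)[/double_inj].
have eo k l : (k < 2 ^ n)%N -> (l < 2 ^ n)%N -> e k.*2 != e l.*2.+1.
  move=> /lt0 k1 /lt1 l1; apply/eqP => /(ei _ _ k1 l1)/(congr1 odd).
  by rewrite /= !odd_double.
pose A k := e (bitrev n k).*2; pose B k := e (bitrev n k).*2.+1.
have [||x3 [E3 v3 o3]] := @Psi_butterflies m (2 ^ n) A B (uroot n.+1) x2.
- by move=> k /bitrev_lt kn; rewrite /A /B cabs_root; split => //; apply: em; [exact: lt0|exact: lt1].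
- move=> k l kn ln; have k1 := bitrev_lt kn; have l1 := bitrev_lt ln.
  split; first exact: eo.
    by move/(ei _ _ (lt0 _ k1) (lt0 _ l1))/double_inj; exact: bitrev_inj.
  by move/(ei _ _ (lt1 _ k1) (lt1 _ l1)) => -[/double_inj]; exact: bitrev_inj.
have xA k : (k < 2 ^ n)%N -> x2 (A k) = (q ^+ n)%:C *: dft n (fun j => x (e j.*2)) k.
  move=> kn; rewrite o2; first exact: v1.
  by move=> l ln; apply: eo => //; exact: bitrev_lt.
have xB k : (k < 2 ^ n)%N -> x2 (B k) = (q ^+ n)%:C *: dft n (fun j => x (e j.*2.+1)) k.
  move=> kn; rewrite v2//; congr (_ *: _); apply: eq_bigr => j _ /=; congr (_ *: _).
  by apply: o1 => l ln; rewrite eq_sym; exact: eo.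
exists x3; split; first by rewrite E3 E2.
- move=> k; rewrite expnS mul2n -addnn => kn; rewrite /=; case: ifP => h.
    have [-> _] := v3 k h; rewrite xA// xB// dft_low exprS rmorphM -!/(dft _ _ _).
    by rewrite /comp; lin_ring.
  have h2 : (2 ^ n <= k)%N by rewrite leqNgt h.
  have kn' : (k - 2 ^ n < 2 ^ n)%N by rewrite ltn_subLR.
  have [_ ->] := v3 _ kn'; rewrite xA// xB// -[in RHS](subnK h2) dft_high exprS rmorphM.
  by rewrite /comp; lin_ring.
- move=> j hj; rewrite o3 => [|k kn]; last first.
    by have k1 := bitrev_lt kn; split; apply: hj; [exact: lt0|exact: lt1].
  rewrite o2 => [|k /lt1 kn]; last exact: hj.
  by rewrite o1 => // k /lt0 kn; exact: hj.
Qed.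

Lemma Psi_dft n x : Psi (2 ^ n) (fun k => (q ^+ n)%:C *: dft n x k) = Psi (2 ^ n) x.
Proof.
have [||x' [E v _]] := @Psi_fft (2 ^ n) n id x => //.
pose f (k : 'I_(2 ^ n)) : 'I_(2 ^ n) := Ordinal (bitrev_lt (ltn_ord k)).
have fI : injective f.
  move=> k l e; apply: ord_inj; apply: (bitrev_inj (ltn_ord k) (ltn_ord l)).
  exact: (congr1 val e).
(* A permutation of the vectors undoes the bit reversal. *)
rewrite -[RHS]E -[RHS](Psi_perm (perm fI) (fun j => x' j)).
by congr Esum; apply/funext => j; rewrite permE /= v.
Qed.

End GaussianFourier.

(** * Fourier multipliers on blocks *)

Section ComplexMeasurability.
Context {R : realType} {d : measure_display} {T : measurableType d}.
Implicit Types f g : T -> R[i].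

Definition cmeas f := measurable_fun setT (fun t => (complex.Re (f t), complex.Im (f t))).

Lemma cmeasP f : measurable_fun setT (fun t => complex.Re (f t)) -> measurable_fun setT (fun t => complex.Im (f t)) ->
  cmeas f.
Proof. by move=> h k; exact: measurable_fun_pair. Qed.

Lemma cmeas_Re f : cmeas f -> measurable_fun setT (fun t => complex.Re (f t)).
Proof. by move=> h; exact: (measurableT_comp measurable_fst h). Qed.

Lemma cmeas_Im f : cmeas f -> measurable_fun setT (fun t => complex.Im (f t)).
Proof. by move=> h; exact: (measurableT_comp measurable_snd h). Qed.

Lemma cmeasM f g : cmeas f -> cmeas g -> cmeas (fun t => f t * g t).
Proof.
move=> hf hg; have rf := cmeas_Re hf; have mf := cmeas_Im hf.
have rg := cmeas_Re hg; have mg := cmeas_Im hg.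
apply: cmeasP.
  rewrite (_ : (fun t => _) = (fun t => complex.Re (f t)) \* (fun t => complex.Re (g t)) \- (fun t => complex.Im (f t)) \* (fun t => complex.Im (g t))).
    by apply: measurable_funB; exact: measurable_funM.
  by apply/funext => t /=; case: (f t) (g t) => a b [].
rewrite (_ : (fun t => _) = (fun t => complex.Re (f t)) \* (fun t => complex.Im (g t)) \+ (fun t => complex.Im (f t)) \* (fun t => complex.Re (g t))).
  by apply: measurable_funD; exact: measurable_funM.
by apply/funext => t /=; case: (f t) (g t) => a b [] c e /=; rewrite addrC.
Qed.

Lemma cmeas_cst c : cmeas (fun=> c).
Proof. exact: measurable_cst. Qed.

Lemma cmeas_toC (Z : T -> R * R) : measurable_fun setT Z -> cmeas (fun t => toC (Z t)).
Proof.
move=> mZ; rewrite /cmeas (_ : (fun t => _) = Z)//.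
by apply/funext => t; rewrite /toC /=; case: (Z t).
Qed.

Lemma measurable_csum {X : lmodType R[i]} (rho : X -> R) (I : finType) (c : I -> T -> R[i]) (x : I -> X) :
  snorm rho -> (forall k, cmeas (c k)) -> measurable_fun setT (fun t => rho (\sum_k c k t *: x k)).
Proof.
move=> hr mc.
have := measurable_snorm_sum (c := fun k t => (complex.Re (c k t), complex.Im (c k t))) x hr mc.
rewrite (_ : (fun t => _) = (fun t => rho (\sum_k c k t *: x k)))//.
apply/funext => t; congr rho; apply: eq_bigr => k _; congr (_ *: _).
by rewrite /toC /=; case: (c k t).
Qed.

End ComplexMeasurability.

Section SecondMoments.
Context {R : realType} {d : measure_display} {Omega : measurableType d} (P : probability Omega R).
Implicit Types f : Omega -> R.
Local Open Scope ereal_scope.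

Definition moment2 f : \bar R := \int[P]_w (f w ^+ 2)%:E.

Lemma moment2_ge0 f : 0 <= moment2 f.
Proof. by apply: integral_ge0 => w _; rewrite lee_fin sqr_ge0. Qed.

Lemma Lnorm_moment2 f : (forall w, (0 <= f w)%R) ->
  'N[P]_2%:E[(fun w => (f w)%:E)] = moment2 f `^ 2^-1.
Proof.
move=> f0; rewrite unlock; congr (_ `^ _); apply: eq_integral => w _.
by rewrite poweR_EFin ger0_norm// powR_mulrn.
Qed.

Lemma moment2_Lnorm f : (forall w, (0 <= f w)%R) ->
  moment2 f = 'N[P]_2%:E[(fun w => (f w)%:E)] * 'N[P]_2%:E[(fun w => (f w)%:E)].
Proof.
move=> f0; rewrite Lnorm_moment2//; have := moment2_ge0 f.
case: (moment2 f) => [a|_|]; rewrite ?lee_fin//.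
- move=> a0; rewrite poweR_EFin -EFinM -powRD.
    by rewrite (_ : (2^-1 + 2^-1 = 1)%R) ?powRr1//; lra.
  by rewrite gt_eqF//; lra.
- by rewrite poweRyr ?invr_eq0// mulyy.
Qed.

Lemma Lnorm_le_moment2 f g (C : R) : (0 <= C)%R -> (forall w, (0 <= f w)%R) -> (forall w, (0 <= g w)%R) ->
  'N[P]_2%:E[(fun w => (f w)%:E)] <= C%:E * 'N[P]_2%:E[(fun w => (g w)%:E)] ->
  moment2 f <= (C ^+ 2)%:E * moment2 g.
Proof.
move=> C0 f0 g0 h; rewrite !moment2_Lnorm// expr2 EFinM muleACA.
by apply: lee_pmul => //; exact: Lnorm_ge0.
Qed.

Lemma moment2_le f g : measurable_fun setT f -> measurable_fun setT g ->
  {ae P, forall w, (0 <= f w <= g w)%R} -> moment2 f <= moment2 g.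
Proof.
move=> mf mg h; apply: ae_ge0_le_integral => //.
- by move=> w _; rewrite lee_fin sqr_ge0.
- by apply/measurable_EFinP; exact: measurable_funX.
- by move=> w _; rewrite lee_fin sqr_ge0.
- by apply/measurable_EFinP; exact: measurable_funX.
apply: filterS h => w /andP[f0 fg] _.
by rewrite lee_fin lerXn2r ?nnegrE// (le_trans f0).
Qed.

Lemma moment2_scale (C : R) f : measurable_fun setT f ->
  moment2 (fun w => C * f w)%R = (C ^+ 2)%:E * moment2 f.
Proof.
move=> mf; rewrite /moment2 -ge0_integralZl//.
- by apply: eq_integral => w _; rewrite exprMn EFinM.
- by apply/measurable_EFinP; exact: measurable_funX.
- by move=> w _; rewrite lee_fin sqr_ge0.
- by rewrite lee_fin sqr_ge0.
Qed.

Lemma moment2_cst (C : R) : moment2 (fun=> C) = (C ^+ 2)%:E.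
Proof.
transitivity ((C ^+ 2)%:E * P setT); first exact: integral_cst.
by rewrite probability_setT mule1.
Qed.

End SecondMoments.

Lemma sum_divmod (V : nmodType) N K (F : nat -> nat -> V) :
  \sum_(i < N * K) F (i %/ K)%N (i %% K)%N = \sum_(j < N) \sum_(k < K) F j k.
Proof.
case: K => [|K]; first by rewrite muln0 big_ord0 big1// => j _; rewrite big_ord0.
elim: N => [|N IH]; first by rewrite mul0n !big_ord0.
rewrite mulSnr big_split_ord /= IH [RHS]big_ord_recr /=; congr (_ + _).
apply: eq_bigr => k _; congr F; first by rewrite divnMDl// divn_small ?addn0.
by rewrite modnMDl modn_small.
Qed.

Section DoubleRandomization.
Context {R : realType} {X : completeNormedModType R[i]}.
Context {d : measure_display} {Omega : measurableType d} (P : probability Omega R).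
Variables (r r' : nat -> {RV P >-> (R * R)%type}) (hr : rademacher_pair r r').
Local Open Scope ereal_scope.
Let hn := @snorm_rnorm R X.

Lemma rademacher_fst : rademacher r.
Proof.
have [ih uh] := hr; split=> [s B us mB|k]; last exact: (uh (inl k)).
have us' : uniq [seq inl k : nat + nat | k <- s] by rewrite map_inj_uniq// => i j [].
have := ih _ (fun t => if t is inl k then B k else setT) us'.
rewrite !big_map; apply => -[k|k]; [exact: mB|exact: measurableT].
Qed.

Lemma ae_unimodular : {ae P, forall w, forall k, cabs (toC (r k w)) = 1%R /\ cabs (toC (r' k w)) = 1%R}.
Proof.
apply: ae_foralln => k; have [_ u] := hr.
have h := circle_cabs (u (inl k)); have h' := circle_cabs (u (inr k)).
by apply: filterS2 h h'.
Qed.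

Lemma cmeas_RV {d1} {T : measurableType d1} (Z : {RV P >-> (R * R)%type}) (h : T -> Omega) :
  measurable_fun setT h -> cmeas (fun t => toC (Z (h t))).
Proof. by move=> mh; apply: cmeas_toC; exact: (measurableT_comp _ mh). Qed.

Definition dsum (N K : nat) (a : nat -> nat -> R[i]) (v : nat -> nat -> X) w : X :=
  (\sum_(j < N) \sum_(k < K) (toC (r k w) * toC (r' j w) * a j k) *: v j k)%R.

Lemma alpha_rect : property_alpha X r r' -> exists2 C : R, (0 <= C)%R &
  forall N K v a, (forall j k, cabs (a j k) <= 1)%R ->
    moment2 P (fun w => rnorm (dsum N K a v w)) <= (C ^+ 2)%:E * moment2 P (fun w => rnorm (dsum N K (fun _ _ => 1%R) v w)).
Proof.
move=> [C hC]; exists (Num.max C 0%R); first by rewrite le_max lexx orbT.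
move=> N K v a ha; pose m := maxn N K.
pose v' (j k : 'I_m) : X := if (j < N)%N && (k < K)%N then v j k else 0%R.
pose a' (j k : 'I_m) := a j k.
have ha' (j k : 'I_m) : (`|a' j k| <= 1)%R.
  by rewrite normC_cabs -[1%R](rmorph1 (real_complex R)) lecR; exact: ha.
have E (b : nat -> nat -> R[i]) w : (\sum_(j < m) \sum_(k < m) (toC (r k w) * toC (r' j w) * b j k) *: v' j k)%R = dsum N K b v w.
  rewrite /dsum (big_ord_widen m (fun j => \sum_(k < K) (toC (r k w) * toC (r' j w) * b j k) *: v j k)%R (leq_maxl N K)).
  rewrite [RHS]big_mkcond; apply: eq_bigr => j _; rewrite /v'.
  case: ltnP => jN /=; last by apply: big1 => k _; rewrite scaler0.
  rewrite (big_ord_widen m (fun k => (toC (r k w) * toC (r' j w) * b j k) *: v j k)%R (leq_maxr N K)).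
  rewrite [RHS]big_mkcond; apply: eq_bigr => k _.
  by case: ltnP => //; rewrite scaler0.
have := hC m v' a' ha'.
under [X in 'N[P]_2%:E[X] <= _]boolp.eq_fun do rewrite E.
under [X in _ <= _ * 'N[P]_2%:E[X]]boolp.eq_fun => w.
  under eq_bigr do under eq_bigr do rewrite -[(toC _ * _)%R]mulr1.
  rewrite (E (fun _ _ => 1%R)); over.
move=> h; apply: Lnorm_le_moment2; rewrite ?le_max ?lexx ?orbT//; try by move=> w; exact: rnorm_ge0.
by apply: le_trans h _; apply: lee_wpmul2r; rewrite ?Lnorm_ge0// lee_fin le_max lexx.
Qed.

Lemma measurable_dsum {d1} {T : measurableType d1} (h : T -> Omega) N K (a : T -> nat -> nat -> R[i]) v :
  measurable_fun setT h -> (forall j k, cmeas (fun t => a t j k)) ->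
  measurable_fun setT (fun t => rnorm (dsum N K (a t) v (h t))).
Proof.
move=> mh ma; rewrite /dsum.
have := @measurable_csum _ _ T X (@rnorm R X) ('I_N * 'I_K)%type
  (fun p t => toC (r p.2 (h t)) * toC (r' p.1 (h t)) * a t p.1 p.2)%R (fun p => v p.1 p.2) hn.
rewrite (_ : (fun t => rnorm (\sum_p _)%R) = (fun t => rnorm (dsum N K (a t) v (h t)))).
  by apply => -[j k] /=; apply: cmeasM => //; apply: cmeasM; exact: cmeas_RV.
apply/funext => t; congr rnorm; rewrite /dsum.
by rewrite (pair_bigA _ (fun (j : 'I_N) (k : 'I_K) => (toC (r k (h t)) * toC (r' j (h t)) * a t j k) *: v j k)%R).
Qed.

Lemma measurable_sum_r {d1} {T : measurableType d1} (h : T -> Omega) K (x : 'I_K -> X) :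
  measurable_fun setT h -> measurable_fun setT (fun t => rnorm (\sum_(k < K) toC (r k (h t)) *: x k)%R).
Proof.
by move=> mh; apply: (measurable_csum (c := fun (k : 'I_K) t => toC (r k (h t)))) => // k; exact: cmeas_RV.
Qed.

Lemma tonelli_moment2 {d1} {O1 : measurableType d1} (Q : probability O1 R) (f : O1 -> Omega -> R) :
  measurable_fun setT (fun z : O1 * Omega => f z.1 z.2) ->
  \int[Q]_u moment2 P (f u) = \int[P]_w moment2 Q (f ^~ w).
Proof.
move=> mf; apply: (fubini_tonelli (fun z : O1 * Omega => ((f z.1 z.2) ^+ 2)%:E)).
  by apply/measurable_EFinP; exact: measurable_funX.
by move=> z; rewrite lee_fin sqr_ge0.
Qed.

Lemma measurable_moment2 {d1} {O1 : measurableType d1} (f : O1 -> Omega -> R) :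
  measurable_fun setT (fun z : O1 * Omega => f z.1 z.2) ->
  measurable_fun setT (fun u => moment2 P (f u)).
Proof.
move=> mf; apply: (measurable_fun_fubini_tonelli_F (m2 := P) (fun z : O1 * Omega => ((f z.1 z.2) ^+ 2)%:E)).
  by apply/measurable_EFinP; exact: measurable_funX.
by move=> z; rewrite lee_fin sqr_ge0.
Qed.

(** R-boundedness speaks of one Rademacher sequence, while the sums here carry the products of [r k]
    and [r' j]. Property (alpha) inserts an independent doubly indexed array of unimodular
    coefficients and absorbs [b]; for fixed [r] and [r'] the array is a Rademacher sequence of
    length [N * K], to which R-boundedness applies; property (alpha) then removes it. Hence two
    factors [C] and one [c]. *)
Lemma double_randomization C : (0 <= C)%R ->
  (forall N K v a, (forall j k, cabs (a j k) <= 1)%R ->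
    moment2 P (fun w => rnorm (dsum N K a v w)) <= (C ^+ 2)%:E * moment2 P (fun w => rnorm (dsum N K (fun _ _ => 1%R) v w))) ->
  forall (T : set (X -> X)) (c c0 : R), R_bound_const r enorm T c -> (0 <= c)%R -> (0 < c0)%R ->
  forall N K (S : nat -> nat -> X -> X) (b : nat -> R[i]) (u : nat -> nat -> X),
  (forall j k, (j < N)%N -> (k < K)%N -> T (S j k) /\ linear (S j k)) -> (forall j, cabs (b j) <= c0)%R ->
  moment2 P (fun w => rnorm (dsum N K (fun j _ => b j) (fun j k => S j k (u j k)) w)) <=
  ((C ^+ 2 * c * c0) ^+ 2)%:E * moment2 P (fun w => rnorm (dsum N K (fun _ _ => 1%R) u w)).
Proof.
move=> C0 alpha T c c0 hT cc0 c00 N K S b u hS hb.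
pose v j k := S j k (u j k).
pose enc j k : nat := (j * K + k)%N.
(* The sequence [r] at a second, independent point of the probability space supplies the array; the
   two integrals are exchanged by Tonelli. *)
pose a w j k := toC (r (enc j k) w).
have ma : forall j k, cmeas (fun z : Omega * Omega => a z.2 j k).
  by move=> j k; apply: cmeas_RV; exact: measurable_snd.
have ma1 : forall j k, cmeas (fun z : Omega * Omega => a z.1 j k).
  by move=> j k; apply: cmeas_RV; exact: measurable_fst.
pose m1 (x : nat -> nat -> X) (A : nat -> nat -> R[i]) := moment2 P (fun w => rnorm (dsum N K A x w)).
have m1a_meas x : measurable_fun setT (fun w => m1 x (a w)).
  apply: measurable_moment2.
  exact: (measurable_dsum (h := snd) N K (a := fun z : Omega * Omega => a z.1) x measurable_snd).
have cst_int (y : \bar R) : \int[P]_w y = y.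
  by transitivity (y * P setT); [exact: integral_cst|rewrite probability_setT mule1].
have step1 : m1 v (fun j _ => b j) <= ((C * c0) ^+ 2)%:E * \int[P]_w m1 v (a w).
  rewrite -ge0_integralZl//; first last.
  - by rewrite lee_fin sqr_ge0.
  - by move=> w _; exact: moment2_ge0.
  rewrite -[leLHS]cst_int; apply: ae_ge0_le_integral => //.
  - by move=> w _; exact: moment2_ge0.
  - by move=> w _; apply: mule_ge0; [rewrite lee_fin sqr_ge0|exact: moment2_ge0].
  - by apply: emeasurable_funM => //.
  apply: filterS ae_unimodular => w hw _.
  have cz : c0%:C != (0 : R[i])%R by rewrite (inj_eq (@complexI R)) gt_eqF.
  have az j k : a w j k != (0 : R[i])%R by rewrite -cabs_eq0 /a (hw _).1 oner_eq0.
  have := alpha N K (fun j k => (c0%:C * a w j k) *: v j k)%R (fun j k => b j / (c0%:C * a w j k))%R _.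
  have E1 : (fun w0 => rnorm (dsum N K (fun j k => b j / (c0%:C * a w j k))%R (fun j k => (c0%:C * a w j k) *: v j k)%R w0))
     = (fun w0 => rnorm (dsum N K (fun j _ => b j) v w0)).
    apply/funext => w0; congr rnorm; apply: eq_bigr => j _; apply: eq_bigr => k _.
    by rewrite scalerA -mulrA divfK// mulf_neq0.
  have E2 : (fun w0 => rnorm (dsum N K (fun _ _ => 1%R) (fun j k => (c0%:C * a w j k) *: v j k)%R w0))
     = (fun w0 => c0 * rnorm (dsum N K (a w) v w0))%R.
    apply/funext => w0; rewrite -[c0 in RHS](gtr0_norm c00) -cabs_real -rnormZ; congr rnorm.
    rewrite scaler_sumr; apply: eq_bigr => j _; rewrite scaler_sumr; apply: eq_bigr => k _.
    by rewrite !scalerA mulr1; congr (_ *: _); ring.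
  rewrite E1 E2 moment2_scale; last by apply: (measurable_dsum (h := id)) => // j k; exact: cmeas_cst.
  rewrite muleA -EFinM -exprMn; apply => j k.
  by rewrite cabsM cabsV cabsM cabs_real (hw _).1 mulr1 gtr0_norm// ler_pdivrMr// mul1r.
have toFlat (x : nat -> nat -> X) w0 w : dsum N K (a w) x w0 =
    (\sum_(i < N * K) toC (r i w) *: ((toC (r (i %% K)%N w0) * toC (r' (i %/ K)%N w0)) *: x (i %/ K)%N (i %% K)%N))%R.
  rewrite /dsum -(sum_divmod N K (fun j k => (toC (r k w0) * toC (r' j w0) * a w j k) *: x j k)%R).
  apply: eq_bigr => i _.
  by rewrite scalerA mulrC /a /enc -divn_eq.
have step2 : \int[P]_w m1 v (a w) <= (c ^+ 2)%:E * \int[P]_w m1 u (a w).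
  have md x : measurable_fun setT (fun z : Omega * Omega => rnorm (dsum N K (a z.1) x z.2)).
    exact: (measurable_dsum (h := snd) N K (a := fun z : Omega * Omega => a z.1) x measurable_snd).
  have md2 x : measurable_fun setT (fun z : Omega * Omega => rnorm (dsum N K (a z.2) x z.1)).
    exact: (measurable_dsum (h := fst) N K (a := fun z : Omega * Omega => a z.2) x measurable_fst).
  rewrite /m1 (tonelli_moment2 P (f := fun w w0 => rnorm (dsum N K (a w) v w0)) (md v)).
  rewrite (tonelli_moment2 P (f := fun w w0 => rnorm (dsum N K (a w) u w0)) (md u)) -ge0_integralZl//; first last.
  - by rewrite lee_fin sqr_ge0.
  - by move=> w _; exact: moment2_ge0.
  - exact: (measurable_moment2 (f := fun w0 w => rnorm (dsum N K (a w) u w0)) (md2 u)).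
  apply: ge0_le_integral => //.
  - by move=> w _; exact: moment2_ge0.
  - exact: (measurable_moment2 (f := fun w0 w => rnorm (dsum N K (a w) v w0)) (md2 v)).
  - apply: emeasurable_funM => //.
    exact: (measurable_moment2 (f := fun w0 w => rnorm (dsum N K (a w) u w0)) (md2 u)).
  move=> w0 _; pose y (i : 'I_(N * K)) : X := ((toC (r (i %% K)%N w0) * toC (r' (i %/ K)%N w0)) *: u (i %/ K)%N (i %% K)%N)%R.
  pose Si (i : 'I_(N * K)) := S (i %/ K)%N (i %% K)%N.
  have hi (i : 'I_(N * K)) : T (Si i) /\ linear (Si i).
    have K0 : (0 < K)%N by case: (K) i => // -[]; rewrite muln0.
    by apply: hS; [rewrite ltn_divLR|rewrite ltn_mod].
  have := hT _ Si y (fun i => (hi i).1) (fun i => ltry _).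
  move/(Lnorm_le_moment2 cc0 (fun=> rnorm_ge0 _) (fun=> rnorm_ge0 _)).
  congr (moment2 P _ <= _ * moment2 P _); apply/funext => w; rewrite toFlat; congr rnorm.
  by apply: eq_bigr => i _; rewrite /y (linear_mapZ (hi i).2).
have step3 : \int[P]_w m1 u (a w) <= (C ^+ 2)%:E * m1 u (fun _ _ => 1%R).
  rewrite -[leRHS]cst_int; apply: ae_ge0_le_integral => //.
  - by move=> w _; exact: moment2_ge0.
  - by move=> w _; apply: mule_ge0; [rewrite lee_fin sqr_ge0|exact: moment2_ge0].
  - apply: filterS ae_unimodular => w hw _; apply: alpha => j k.
    by rewrite /a (hw _).1.
apply: le_trans step1 _.
apply: (@le_trans _ _ (((C * c0) ^+ 2)%:E * ((c ^+ 2)%:E * ((C ^+ 2)%:E * m1 u (fun _ _ => 1%R))))).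
  apply: lee_wpmul2l; first by rewrite lee_fin sqr_ge0.
  apply: le_trans step2 _; apply: lee_wpmul2l; first by rewrite lee_fin sqr_ge0.
  exact: step3.
by rewrite !muleA -!EFinM le_eqVlt; apply/orP; left; apply/eqP; congr (_%:E * _); ring.
Qed.

End DoubleRandomization.

(** Hölder against the constant 1, from Young's inequality applied to [a b / m], where [m] is the
    mean of order [q]. *)
Lemma power_mean {R : realType} (q : R) N (a : nat -> R) : 2 <= q -> (forall b, 0 <= a b) ->
  \sum_(b < N) a b <= N%:R `^ (1 - q^-1) * (\sum_(b < N) a b `^ q) `^ q^-1.
Proof.
move=> q2 a0; have q0 : 0 < q by lra.
have qn : q != 0 by rewrite gt_eqF.
have S0 : 0 <= \sum_(b < N) a b `^ q by apply: sumr_ge0 => b _; exact: powR_ge0.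
have [Sz|Sn] := eqVneq (\sum_(b < N) a b `^ q) 0.
  have az (b : 'I_N) : a b = 0.
    have /eqP := Sz; rewrite psumr_eq0; last by move=> i _; exact: powR_ge0.
    by move=> /allP/(_ b (mem_index_enum _)) /= /eqP/powR_eq0_eq0.
  rewrite big1 => [|b _]; last exact: az.
  by rewrite mulr_ge0 ?powR_ge0.
have Sp : 0 < \sum_(b < N) a b `^ q by rewrite lt_def Sn.
have N0 : (0 < N)%N by case: (N) Sp => //; rewrite big_ord0 ltxx.
have NR : (0 : R) < N%:R by rewrite ltr0n.
set S := \sum_(b < N) a b `^ q in S0 Sn Sp *.
pose m := S `^ q^-1 * N%:R `^ (- q^-1).
have m0 : 0 < m by rewrite mulr_gt0 ?powR_gt0.
have -> : N%:R `^ (1 - q^-1) * S `^ q^-1 = N%:R * m.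
  rewrite /m powRD; last by rewrite (gt_eqF NR) implybT.
  by rewrite powRr1 ?ler0n//; ring.
have young t : 0 <= t -> t <= t `^ q / q + (1 - q^-1).
  move=> t0; have p0 : 0 < (1 - q^-1)^-1.
    by rewrite invr_gt0 subr_gt0 invf_lt1//; lra.
  have := @conjugate_powR R t 1 q (1 - q^-1)^-1 t0 ler01 q0 p0.
  rewrite invrK mulr1 powR1 mul1r; apply; ring.
have mq : m `^ q = S / N%:R.
  rewrite /m powRM ?powR_ge0// -!powRrM mulVf// mulNr mulVf// powRr1// powRN powRr1 ?ler0n//.
have sum1 : \sum_(b < N) (a b / m) `^ q = N%:R.
  transitivity (\sum_(b < N) (a b `^ q) * (m `^ q)^-1).
    apply: eq_bigr => b _; apply: (canRL (mulfK _)); first by rewrite gt_eqF// powR_gt0.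
    by rewrite -powRM ?divfK ?(gt_eqF m0)// ?divr_ge0 ?(ltW m0).
  by rewrite -mulr_suml -/S mq invf_div mulrCA divff// mulr1.
have : \sum_(b < N) a b / m <= N%:R.
  apply: (@le_trans _ _ (\sum_(b < N) ((a b / m) `^ q / q + (1 - q^-1)))).
    by apply: ler_sum => b _; apply: young; rewrite divr_ge0// ltW.
  rewrite big_split /= -mulr_suml sum1 sumr_const card_ord -mulr_natl; lra.
by rewrite -mulr_suml ler_pdivrMr.
Qed.

(** * Type, cotype and the discrete multiplier *)

Section TypeCotype.
Context {R : realType} {X : completeNormedModType R[i]}.
Context {d : measure_display} {Omega : measurableType d} (P : probability Omega R).
Variables (g : nat -> {RV P >-> (R * R)%type}) (hg : gaussian_sequence g).
Local Notation Psi := (Psi (X := X) g).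
Local Open Scope ereal_scope.

Lemma PsiE m x : Psi m x = moment2 P (fun w => rnorm (\sum_(j < m) toC (g j w) *: x j)%R).
Proof. by []. Qed.

Lemma measurable_gsum m (x : nat -> X) :
  measurable_fun setT (fun w => rnorm (\sum_(j < m) toC (g j w) *: x j)%R).
Proof.
apply: (measurable_csum (c := fun (k : 'I_m) w => toC (g k w))); first exact: snorm_rnorm.
by move=> k; apply: cmeas_toC.
Qed.

Lemma Psi_scale m c (x : nat -> X) : Psi m (fun j => c *: x j)%R = (cabs c ^+ 2)%:E * Psi m x.
Proof.
rewrite !PsiE -moment2_scale; last exact: measurable_gsum.
congr moment2; apply/funext => w; rewrite -rnormZ scaler_sumr; congr rnorm.
by apply: eq_bigr => j _; rewrite !scalerA mulrC.
Qed.

Lemma Psi_dftN n x : Psi (2 ^ n) (dft n x) = (2 ^ n)%:R%:E * Psi (2 ^ n) x.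
Proof.
have := Psi_dft hg n x; rewrite Psi_scale => <-.
rewrite muleA -EFinM cabs_real ger0_norm ?exprn_ge0 ?invr_ge0//.
by rewrite exprVn !exprVn -exprM mulnC exprM sqr_sqrtr// natrX mulfV ?mul1e.
Qed.

Lemma Psi_phases m (z : nat -> R[i]) x : (forall j, cabs (z j) = 1)%R ->
  Psi m (fun j => z j *: x j)%R = Psi m x.
Proof.
move=> z1; have H k : (k <= m)%N -> Psi m (fun j => if (j < k)%N then z j *: x j else x j)%R = Psi m x.
  elim: k => [|k IH] km; first by apply: Psi_ext.
  rewrite -(IH (ltnW km)) -[RHS](Psi_phase hg _ km (z1 k)).
  apply: Psi_ext => j _; have [->|jk] := eqVneq j k; first by rewrite ltnSn ltnn.
  by rewrite ltnS leq_eqVlt (negbTE jk).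
by rewrite -(H m (leqnn m)); apply: Psi_ext => j ->.
Qed.

Lemma type_Psi p : has_type X g p -> exists2 C : R, (0 <= C)%R & forall m x,
  Psi m x <= ((C * (\sum_(k < m) rnorm (x k) `^ p) `^ p^-1) ^+ 2)%:E.
Proof.
move=> [C hC]; exists (Num.max C 0%R); first by rewrite le_max lexx orbT.
move=> m x; rewrite PsiE moment2_Lnorm; last by move=> w; exact: rnorm_ge0.
have h := hC m (fun k => x k); set N := 'N[P]_ _[_] in h *.
have h2 : N <= (Num.max C 0%R * (\sum_(k < m) rnorm (x k) `^ p) `^ p^-1)%:E.
  by apply: le_trans h _; rewrite lee_fin ler_wpM2r ?powR_ge0// le_max lexx.
by rewrite expr2 EFinM; apply: lee_pmul => //; exact: Lnorm_ge0.
Qed.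

Lemma cotype_Psi q : has_cotype X g q -> exists2 C : R, (0 <= C)%R & forall m (x : nat -> X),
  (((\sum_(k < m) rnorm (x k) `^ q) `^ q^-1) ^+ 2)%:E <= (C ^+ 2)%:E * Psi m x.
Proof.
move=> [C hC]; exists (Num.max C 0%R); first by rewrite le_max lexx orbT.
move=> m x; rewrite PsiE moment2_Lnorm; last by move=> w; exact: rnorm_ge0.
have h := hC m (fun k => x k); set N := 'N[P]_ _[_] in h *.
have N0 : 0 <= N by exact: Lnorm_ge0.
have h2 : ((\sum_(k < m) rnorm (x k) `^ q) `^ q^-1)%:E <= (Num.max C 0%R)%:E * N.
  by apply: le_trans h _; apply: lee_wpmul2r => //; rewrite lee_fin le_max lexx.
rewrite !expr2 !EFinM muleACA; apply: lee_pmul => //; by rewrite lee_fin powR_ge0.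
Qed.

End TypeCotype.

Section DiscreteBound.
Context {R : realType} {X : completeNormedModType R[i]}.
Context {d : measure_display} {Omega : measurableType d} (P : probability Omega R).
Variables (g : nat -> {RV P >-> (R * R)%type}) (hg : gaussian_sequence g).
Context {d' : measure_display} {Omega' : measurableType d'} (P' : probability Omega' R).
Variables (r r' : nat -> {RV P' >-> (R * R)%type}) (hr : rademacher_pair r r').
Hypothesis halpha : property_alpha X r r'.
Variables (p q : R) (hp : 1 <= p) (hq : 2 <= q).
Hypotheses (htype : has_type X g p) (hcotype : has_cotype X g q).
Local Notation Psi := (Psi (X := X) g).
Local Notation rsum K x := (fun w => rnorm (\sum_(k < K) toC (r k w) *: x k)%R).
Local Open Scope ereal_scope.
Let hn := @snorm_rnorm R X.

Let measurable_double N K (c : nat -> nat -> Omega' * Omega -> R[i]) (v : nat -> nat -> X) :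
  (forall j k, cmeas (c j k)) ->
  measurable_fun setT (fun t => rnorm (\sum_(j < N) \sum_(k < K) c j k t *: v j k)%R).
Proof.
move=> hc.
have := measurable_csum (c := fun (p : 'I_N * 'I_K) t => c p.1 p.2 t) (fun p => v p.1 p.2) hn (fun p => hc _ _).
congr measurable_fun; apply/funext => t; congr rnorm.
by rewrite (pair_bigA _ (fun (j : 'I_N) (k : 'I_K) => c j k t *: v j k)%R).
Qed.

(** Pointwise in the Rademacher variables, Hölder and cotype lead from the outer sum to a Gaussian
    sum, at the cost N^(1-1/q). Each of the two transforms costs N^(1/2) by invariance of the
    Gaussian law, and type costs N^(1/p). In between, [double_randomization] removes the operators.
    The outer sequence [r] is kept throughout, so the result is an estimate of R-bounds. *)
Lemma discrete_bound : exists2 D : R, (0 <= D)%R & forall (T : set (X -> X)) (c : R),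
  R_bound_const r enorm T c -> (0 <= c)%R ->
  forall n K (M1 M2 c0 : R) (U V : nat -> X -> X) (b : nat -> R[i]) (S : nat -> nat -> X -> X) (x : nat -> X),
  (0 <= M1)%R -> (0 <= M2)%R -> (0 < c0)%R ->
  (forall a, (a < 2 ^ n)%N -> linear (U a) /\ forall y, (rnorm (U a y) <= M1 * rnorm y)%R) ->
  (forall a, (a < 2 ^ n)%N -> linear (V a) /\ forall y, (rnorm (V a y) <= M2 * rnorm y)%R) ->
  (forall j k, (j < 2 ^ n)%N -> (k < K)%N -> T (S j k) /\ linear (S j k)) ->
  (forall j, cabs (b j) <= c0)%R ->
  moment2 P' (rsum K (fun k => \sum_(i < 2 ^ n) V i (dft n (fun j => b j *: S j k (dft n (fun a => U a (x k)) j)) i))%R)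
  <= ((D * c * c0 * M1 * M2 * (2 ^ n)%:R `^ (2 + (p^-1 - q^-1))) ^+ 2)%:E * moment2 P' (rsum K x).
Proof.
have [Ca Ca0 hCa] := alpha_rect halpha.
have [Cp Cp0 hCp] := type_Psi htype.
have [Cq Cq0 hCq] := cotype_Psi hcotype.
exists (Ca ^+ 2 * Cp * Cq)%R; first by rewrite !mulr_ge0// exprn_ge0.
move=> T c hT cc0 n K M1 M2 c0 U V b S x M10 M20 c00 hU hV hS hb.
set N := (2 ^ n)%N; have N0 : (0 < N)%N by rewrite expn_gt0.
pose z j k := dft n (fun a => U a (x k)) j.
pose u w j : X := (\sum_(k < K) toC (r k w) *: (b j *: S j k (z j k)))%R.
pose Xw w : X := (\sum_(k < K) toC (r k w) *: x k)%R.
pose f1 w := rnorm (\sum_(i < N) V i (dft n (u w) i))%R.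
have E1 : rsum K (fun k => \sum_(i < N) V i (dft n (fun j => b j *: S j k (z j k)) i))%R = f1.
  apply/funext => w; congr rnorm; under eq_bigr do rewrite scaler_sumr.
  rewrite exchange_big; apply: eq_bigr => i _; have [lV _] := hV i (ltn_ord i).
  under eq_bigr do rewrite -(linear_mapZ lV).
  rewrite -(linear_map_sum _ _ _ lV); congr (V i _); rewrite /dft.
  under eq_bigr do rewrite scaler_sumr.
  rewrite exchange_big; apply: eq_bigr => j _; rewrite /u scaler_sumr.
  by apply: eq_bigr => k _; rewrite !scalerA; congr (_ *: _); ring.
pose A1 : R := ((M2 * N%:R `^ (1 - q^-1) * Cq) ^+ 2 * N%:R)%R.
have A10 : (0 <= A1)%R by rewrite mulr_ge0 ?sqr_ge0.
have bound1 w : (f1 w ^+ 2)%:E <= A1%:E * Psi N (u w).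
  have l1 : (f1 w <= M2 * (N%:R `^ (1 - q^-1) * (\sum_(i < N) rnorm (dft n (u w) i) `^ q) `^ q^-1))%R.
    apply: (@le_trans _ _ (M2 * \sum_(i < N) rnorm (dft n (u w) i))%R).
      apply: le_trans (snorm_sum hn _ _ _) _; rewrite mulr_sumr.
      by apply: ler_sum => i _; have [_] := hV i (ltn_ord i); apply.
    apply: ler_wpM2l => //; apply: (@power_mean _ _ _ (fun i => rnorm (dft n (u w) i)) hq) => i; exact: rnorm_ge0.
  have := hCq N (dft n (u w)); rewrite Psi_dftN// => l2.
  apply: (@le_trans _ _ (((M2 * N%:R `^ (1 - q^-1)) ^+ 2)%:E * (((\sum_(i < N) rnorm (dft n (u w) i) `^ q) `^ q^-1) ^+ 2)%:E)).
    rewrite -EFinM -exprMn lee_fin lerXn2r ?nnegrE ?rnorm_ge0//.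
      by rewrite !mulr_ge0 ?powR_ge0.
    by rewrite -mulrA.
  have -> : A1%:E * Psi N (u w) = ((M2 * N%:R `^ (1 - q^-1)) ^+ 2)%:E * ((Cq ^+ 2)%:E * (N%:R%:E * Psi N (u w))).
    by rewrite !muleA -!EFinM; congr (_%:E * _); rewrite /A1; ring.
  by apply: lee_wpmul2l => //; rewrite lee_fin sqr_ge0.
have uE w j : (toC (r' j w) *: u w j)%R = (\sum_(k < K) (toC (r k w) * toC (r' j w) * b j) *: S j k (z j k))%R.
  by rewrite scaler_sumr; apply: eq_bigr => k _; rewrite !scalerA; congr (_ *: _); ring.
pose f2 w w0 := rnorm (dsum r r' N K (fun j _ => b j) (fun j k => S j k (toC (g j w0) *: z j k)) w).
pose f3 w w0 := rnorm (dsum r r' N K (fun _ _ => 1%R) (fun j k => toC (g j w0) *: z j k)%R w).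
pose f0 w w0 := rnorm (\sum_(j < N) toC (g j w0) *: u w j)%R.
have mr k : cmeas (fun t : Omega' * Omega => toC (r k t.1)) by apply: cmeas_RV; exact: measurable_fst.
have mr' k : cmeas (fun t : Omega' * Omega => toC (r' k t.1)) by apply: cmeas_RV; exact: measurable_fst.
have mg j : cmeas (fun t : Omega' * Omega => toC (g j t.2)) by apply: cmeas_RV; exact: measurable_snd.
have lS (j : 'I_N) (k : 'I_K) (t : R[i]) y : S j k (t *: y)%R = (t *: S j k y)%R.
  by have [_ /linear_mapZ ->] := hS j k (ltn_ord j) (ltn_ord k).
have m0 : measurable_fun setT (fun t : Omega' * Omega => f0 t.1 t.2).
  have := @measurable_double N K (fun j k t => toC (g j t.2) * toC (r k t.1))%R (fun j k => b j *: S j k (z j k))%R.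
  rewrite (_ : (fun t => _) = (fun t => f0 t.1 t.2)); first by apply=> j k; exact: cmeasM.
  apply/funext => t; congr rnorm; apply: eq_bigr => j _.
  by rewrite /u scaler_sumr; apply: eq_bigr => k _; rewrite !scalerA.
have m2 : measurable_fun setT (fun t : Omega' * Omega => f2 t.1 t.2).
  have := @measurable_double N K (fun j k t => toC (r k t.1) * toC (r' j t.1) * b j * toC (g j t.2))%R (fun j k => S j k (z j k)).
  rewrite (_ : (fun t => _) = (fun t => f2 t.1 t.2)).
    by apply=> j k; apply: (cmeasM _ (mg j)); apply: (cmeasM _ (cmeas_cst _)); exact: cmeasM.
  apply/funext => t; congr rnorm; apply: eq_bigr => j _.
  by apply: eq_bigr => k _; rewrite lS scalerA.
have m3 : measurable_fun setT (fun t : Omega' * Omega => f3 t.1 t.2).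
  have := @measurable_double N K (fun j k t => toC (r k t.1) * toC (r' j t.1) * 1 * toC (g j t.2))%R (fun j k => z j k).
  rewrite (_ : (fun t => _) = (fun t => f3 t.1 t.2)).
    by apply=> j k; apply: (cmeasM _ (mg j)); apply: (cmeasM _ (cmeas_cst _)); exact: cmeasM.
  apply/funext => t; congr rnorm; apply: eq_bigr => j _.
  by apply: eq_bigr => k _; rewrite scalerA.
have mf1 : measurable_fun setT f1.
  by rewrite -E1; exact: (measurable_sum_r r _ (@measurable_id _ _ setT)).
rewrite E1.
apply: (@le_trans _ _ (A1%:E * \int[P']_w moment2 P (f0 w))).
  rewrite -ge0_integralZl//; first last.
  - by move=> w _; exact: moment2_ge0.
  - exact: measurable_moment2.
  apply: ge0_le_integral => //.
  - by move=> w _; rewrite lee_fin sqr_ge0.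
  - by apply/measurable_EFinP; exact: measurable_funX.
  - by apply: emeasurable_funM => //; exact: measurable_moment2.
have ae1 := ae_unimodular hr.
(* Unimodular phases leave the Gaussian law unchanged, so the [r' j] demanded by property (alpha)
   enter for free. *)
have -> : \int[P']_w moment2 P (f0 w) = \int[P']_w moment2 P (f2 w).
  apply: ae_eq_integral => //; [exact: measurable_moment2|exact: measurable_moment2|].
  apply: filterS ae1 => w hw _.
  rewrite -[LHS]/(Psi N (u w)) -(Psi_phases (z := fun j => toC (r' j w)) hg N (u w) (fun j => (hw j).2)) PsiE.
  congr moment2; apply/funext => w0; congr rnorm; apply: eq_bigr => j _.
  rewrite uE scaler_sumr; apply: eq_bigr => k _.
  by rewrite lS !scalerA mulrC.
pose A2 := ((Ca ^+ 2 * c * c0) ^+ 2)%R.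
apply: (@le_trans _ _ (A1%:E * (A2%:E * \int[P']_w moment2 P (f3 w)))).
  apply: lee_wpmul2l; first by rewrite lee_fin.
  rewrite (tonelli_moment2 P P' (f := f2) m2) (tonelli_moment2 P P' (f := f3) m3) -ge0_integralZl//; first last.
  - by rewrite lee_fin sqr_ge0.
  - by move=> w _; exact: moment2_ge0.
  - by apply: (@measurable_moment2 _ _ _ P' _ _ (fun w0 w => f3 w w0)); exact: (measurableT_comp m3 (@measurable_swap _ _ _ _)).
  apply: ge0_le_integral => //.
  - by move=> w _; exact: moment2_ge0.
  - by apply: (@measurable_moment2 _ _ _ P' _ _ (fun w0 w => f2 w w0)); exact: (measurableT_comp m2 (@measurable_swap _ _ _ _)).
  - apply: emeasurable_funM => //.
    by apply: (@measurable_moment2 _ _ _ P' _ _ (fun w0 w => f3 w w0)); exact: (measurableT_comp m3 (@measurable_swap _ _ _ _)).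
  move=> w0 _; exact: (double_randomization hr Ca0 hCa hT cc0 c00 (fun j k => toC (g j w0) *: z j k)%R hS hb).
pose A3 : R := (N%:R * (Cp * N%:R `^ p^-1 * M1) ^+ 2)%R.
have A30 : (0 <= A3)%R by rewrite mulr_ge0// sqr_ge0.
apply: (@le_trans _ _ (A1%:E * (A2%:E * (A3%:E * moment2 P' (rsum K x))))).
  apply: lee_wpmul2l; first by rewrite lee_fin.
  apply: lee_wpmul2l; first by rewrite lee_fin sqr_ge0.
  have mX : measurable_fun setT (rsum K x) by exact: (measurable_sum_r r _ (@measurable_id _ _ setT)).
  rewrite [moment2 P' _]/moment2 -ge0_integralZl//; first last.
  - by move=> w _; rewrite lee_fin sqr_ge0.
  - by apply/measurable_EFinP; exact: measurable_funX.
  apply: ae_ge0_le_integral => //.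
  - by move=> w _; exact: moment2_ge0.
  - exact: measurable_moment2.
  - by move=> w _; rewrite mule_ge0// lee_fin sqr_ge0.
  - by apply: emeasurable_funM => //; apply/measurable_EFinP; exact: measurable_funX.
  apply: filterS ae1 => w hw _.
  (* The operators [U a] do not depend on [k], so the sum over [k] collapses into the single vector
     [Xw w] under each of them. Type then sees N vectors of norm at most [M1 * rnorm (Xw w)]. *)
  pose y a := U a (Xw w); rewrite -/(Xw w).
  rewrite -[leLHS]/(moment2 P (f3 w)) (_ : moment2 P (f3 w) = Psi N (dft n y)); last first.
    rewrite -(Psi_phases (z := fun j => toC (r' j w)) hg N (dft n y) (fun j => (hw j).2)) PsiE.
    congr moment2; apply/funext => w0; congr rnorm; apply: eq_bigr => j _.
    rewrite scalerA /dft scaler_sumr.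
    under eq_bigr => k _ do rewrite /z /dft scaler_sumr scaler_sumr.
    rewrite exchange_big; apply: eq_bigr => a _.
    have [lU _] := hU a (ltn_ord a).
    rewrite /y /Xw (linear_map_sum _ _ _ lU) !scaler_sumr; apply: eq_bigr => k _.
    by rewrite (linear_mapZ lU) !scalerA; congr (_ *: _); ring.
  rewrite (Psi_dftN hg) /A3 EFinM -muleA; apply: lee_wpmul2l; first by rewrite lee_fin.
  apply: le_trans (hCp N y) _; rewrite -EFinM -exprMn lee_fin.
  have p0 : (0 < p)%R by exact: lt_le_trans ltr01 hp.
  have s1 : (\sum_(a < N) rnorm (y a) `^ p <= N%:R * (M1 * rnorm (Xw w)) `^ p)%R.
    apply: (@le_trans _ _ (\sum_(a < N) (M1 * rnorm (Xw w)) `^ p)%R); last first.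
      by rewrite sumr_const card_ord mulr_natl.
    apply: ler_sum => a _; apply: ge0_ler_powR; rewrite ?nnegrE ?rnorm_ge0 ?mulr_ge0 ?rnorm_ge0//; first exact: ltW.
    by have [_] := hU a (ltn_ord a); apply.
  have s2 : ((\sum_(a < N) rnorm (y a) `^ p) `^ p^-1 <= N%:R `^ p^-1 * (M1 * rnorm (Xw w)))%R.
    apply: le_trans (_ : ((N%:R * (M1 * rnorm (Xw w)) `^ p) `^ p^-1 <= _)%R).
      apply: ge0_ler_powR => //; rewrite ?nnegrE ?invr_ge0 ?(ltW p0)//.
        by apply: sumr_ge0 => a _; exact: powR_ge0.
      by rewrite mulr_ge0// powR_ge0.
    by rewrite powRM ?powR_ge0// -powRrM mulfV ?gt_eqF// powRr1// mulr_ge0// rnorm_ge0.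
  rewrite lerXn2r ?nnegrE ?mulr_ge0 ?powR_ge0 ?rnorm_ge0//.
  by rewrite -!mulrA ler_wpM2l.
rewrite !muleA -!EFinM; apply: lee_wpmul2r; first exact: moment2_ge0.
rewrite lee_fin le_eqVlt; apply/orP; left; apply/eqP.
have NR : (0 < N%:R :> R)%R by rewrite ltr0n.
rewrite /A1 /A2 /A3 [(2 + _)%R](_ : _ = (1 - q^-1) + p^-1 + 1)%R; last by ring.
rewrite !powRD ?(gt_eqF NR) ?implybT//= powRr1; last exact: ltW.
by move: (N%:R `^ (- q^-1))%R (N%:R `^ p^-1)%R => e1 e2; ring.
Qed.

End DiscreteBound.

Section RademacherNorm.
Context {R : realType} {X : completeNormedModType R[i]}.
Context {d : measure_display} {Omega : measurableType d} (P : probability Omega R).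
Variables (r r' : nat -> {RV P >-> (R * R)%type}) (hr : rademacher_pair r r').
Local Open Scope ereal_scope.
Let hn := @snorm_rnorm R X.

Definition rsum K (x : 'I_K -> X) w : R := rnorm (\sum_(k < K) toC (r k w) *: x k)%R.

Definition rnrm K (x : 'I_K -> X) : R := Num.sqrt (fine (moment2 P (rsum x))).

Lemma measurable_rsum K (x : 'I_K -> X) : measurable_fun setT (rsum x).
Proof. exact: (measurable_sum_r r _ (@measurable_id _ _ setT)). Qed.

Lemma rsum_ge0 K (x : 'I_K -> X) w : (0 <= rsum x w)%R.
Proof. exact: rnorm_ge0. Qed.

Lemma moment2_rsum_le K (x : 'I_K -> X) : moment2 P (rsum x) <= ((\sum_k rnorm (x k)) ^+ 2)%:E.
Proof.
rewrite -(moment2_cst P); apply: moment2_le; [exact: measurable_rsum|exact: measurable_cst|].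
apply: filterS (ae_unimodular hr) => w hw; rewrite rsum_ge0 /=.
apply: le_trans (snorm_sum hn _ _ _) _; apply: ler_sum => k _.
by rewrite rnormZ (hw k).1 mul1r.
Qed.

Lemma moment2_rsum K (x : 'I_K -> X) : moment2 P (rsum x) = (rnrm x ^+ 2)%:E.
Proof.
have h0 : 0 <= moment2 P (rsum x) by exact: moment2_ge0.
have hf : moment2 P (rsum x) \is a fin_num.
  by rewrite ge0_fin_numE//; apply: le_lt_trans (moment2_rsum_le x) _; exact: ltry.
by rewrite /rnrm sqr_sqrtr ?fine_ge0// fineK.
Qed.

Lemma rnrm_ge0 K (x : 'I_K -> X) : (0 <= rnrm x)%R.
Proof. exact: sqrtr_ge0. Qed.

Lemma rnrm_le K (x : 'I_K -> X) B : (0 <= B)%R -> (moment2 P (rsum x) <= (B ^+ 2)%:E) = (rnrm x <= B)%R.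
Proof. by move=> B0; rewrite moment2_rsum lee_fin ler_pXn2r ?nnegrE ?rnrm_ge0. Qed.

Lemma Lnorm_rsum K (x : 'I_K -> X) : 'N[P]_2%:E[(fun w => (rsum x w)%:E)] = (rnrm x)%:E.
Proof.
rewrite Lnorm_moment2; last exact: rsum_ge0.
by rewrite moment2_rsum poweR_EFin -powR_mulrn ?rnrm_ge0// -powRrM mulfV// powRr1// rnrm_ge0.
Qed.

Lemma rnrm_bound K (x : 'I_K -> X) : (rnrm x <= 1 * \sum_k rnorm (x k))%R.
Proof.
rewrite mul1r -rnrm_le ?moment2_rsum_le//; apply: sumr_ge0 => k _; exact: rnorm_ge0.
Qed.

Lemma snorm_rnrm K : snorm (@rnrm K).
Proof.
split=> [x y|a x]; last first.
  have := moment2_rsum (a *: x)%R.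
  have -> : rsum (a *: x)%R = (fun w => cabs a * rsum x w)%R.
    apply/funext => w; rewrite /rsum -rnormZ; congr rnorm; rewrite scaler_sumr.
    by apply: eq_bigr => k _; rewrite !scalerA mulrC.
  rewrite moment2_scale; last exact: measurable_rsum.
  rewrite moment2_rsum -EFinM -exprMn => -[] /eqP.
  by rewrite eqrXn2 ?mulr_ge0 ?rnrm_ge0 ?cabs_ge0// => /eqP.
rewrite -lee_fin EFinD -!Lnorm_rsum.
apply: (@le_trans _ _ ('N[P]_2%:E[(fun w => (rsum x w + rsum y w)%:E)])).
  rewrite !Lnorm_moment2; [|by move=> w /=; rewrite addr_ge0 ?rsum_ge0|exact: rsum_ge0].
  apply: gt0_ler_poweR; rewrite ?invr_ge0 ?in_itv /= ?moment2_ge0 ?leey//.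
  apply: moment2_le; [exact: measurable_rsum|by apply: measurable_funD; exact: measurable_rsum|].
  apply: aeW => w; rewrite rsum_ge0 /=; apply: le_trans _ (rnormD _ _).
  rewrite le_eqVlt; apply/orP; left; apply/eqP; congr rnorm; rewrite -big_split /=.
  by apply: eq_bigr => k _; rewrite scalerDr.
by apply: (@minkowski_EFin _ _ _ P (rsum x) (rsum y) 2); [exact: measurable_rsum|exact: measurable_rsum|exact: ler1n].
Qed.

Lemma rnrmD K (x y : 'I_K -> X) : (rnrm (fun k => x k + y k) <= rnrm x + rnrm y)%R.
Proof. exact: (snormD (snorm_rnrm K) x y). Qed.

Lemma rnrmZ K a (x : 'I_K -> X) : (rnrm (fun k => a *: x k) = cabs a * rnrm x)%R.
Proof. exact: (snormZ (snorm_rnrm K) a x). Qed.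

Lemma rnrm_sum K L (F : nat -> 'I_K -> X) :
  (rnrm (fun k => \sum_(l < L) F l k) <= \sum_(l < L) rnrm (F l))%R.
Proof.
have -> : (fun k => \sum_(l < L) F l k)%R = (\sum_(l < L) F l)%R by apply/funext => k; rewrite fct_sumE.
exact: (snorm_sum (snorm_rnrm K)).
Qed.

End RademacherNorm.

(** * Sampling of the functional calculus *)

Section FourierPhases.
Context {R : realType}.

Lemma cexp_2pi_int (m : int) : cexp ('i * (2 * pi * m%:~R)%:C) = 1 :> R[i].
Proof.
have nat_case (k : nat) : cexp ('i * (2 * pi * k%:R)%:C) = 1 :> R[i].
  by have := @root_full R 0 k; rewrite mul1n /uroot expn0 divr1.
case: m => k; first exact: nat_case.
rewrite NegzE rmorphN /= mulrN; have := nat_case k.+1; set z := (2 * pi * _)%:C => h.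
have : cexp ('i * z) * cexp ('i * - z) = 1 by rewrite -cexpD mulrN subrr cexp0.
by rewrite h mul1r /z rmorphN.
Qed.

Lemma ce_real (s t : R) : ce s t%:C = cexp ('i * (s * t)%:C).
Proof. by rewrite /ce rmorphM mulrA. Qed.

(** Of the four products of phases only [a / N] with [2 pi j] fails to be a multiple of [2 pi]. This
    dictates blocks of length [2 pi N] in frequency, cells of length [2 pi], and times with
    denominator N. *)
Lemma ce_sample n (m l : int) (a j : nat) :
  ce (l%:~R + a%:R / (2 ^ n)%:R) (2 * pi * (2 ^ n)%:R * m%:~R + 2 * pi * j%:R)%:C = uroot n (a * j) :> R[i].
Proof.
have N0 : (2 ^ n)%:R != 0 :> R by rewrite pnatr_eq0 expn_eq0.
rewrite ce_real.
have -> : (l%:~R + a%:R / (2 ^ n)%:R) * (2 * pi * (2 ^ n)%:R * m%:~R + 2 * pi * j%:R) =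
  2 * pi * (l * (2 ^ n)%:Z * m + l * j%:Z + a%:Z * m)%:~R + 2 * pi * (a * j)%:R / (2 ^ n)%:R :> R.
  by rewrite !intrD !intrM !natrM -!pmulrn; field.
by rewrite rmorphD mulrDr cexpD cexp_2pi_int mul1r.
Qed.

End FourierPhases.

Lemma sum_inv_square {R : realType} (a : R) L : 0 < a ->
  \sum_(m < L) (m%:R ^+ 2 + a ^+ 2)^-1 <= a ^- 2 + 2.
Proof.
move=> a0; have a2 : 0 < a ^- 2 by rewrite invr_gt0 exprn_gt0.
case: L => [|[|L]]; first by rewrite big_ord0 addr_ge0// ltW.
  by rewrite big_ord1 expr0n add0r lerDl.
suff : \sum_(m < L.+2) (m%:R ^+ 2 + a ^+ 2)^-1 <= a ^- 2 + 2 - L.+1%:R^-1.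
  by move=> h; apply: le_trans h _; rewrite gerBl invr_ge0.
have drop_a (m : nat) : (m.+1%:R ^+ 2 + a ^+ 2)^-1 <= (m.+1%:R ^+ 2)^-1 :> R.
  rewrite lef_pV2 ?posrE ?exprn_gt0 ?ltr0n// ?lerDl ?sqr_ge0//.
  by rewrite addr_gt0 ?exprn_gt0 ?ltr0n.
elim: L => [|L IH].
  have := drop_a 0%N; rewrite big_ord_recr big_ord1 /= expr0n add0r expr1n invr1 => h; lra.
rewrite big_ord_recr /=; apply: le_trans (lerD IH (drop_a _)) _.
have L0 : (0 : R) < L.+1%:R by rewrite ltr0n.
rewrite -[L.+2%:R]natr1; move: (L.+1%:R : R) L0 => u u0.
rewrite -subr_ge0 (_ : _ - _ = (u * (u + 1) ^+ 2)^-1); last by field; lra.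
by rewrite invr_ge0 mulr_ge0 ?sqr_ge0// ltW.
Qed.

(** The conclusion of [discrete_bound] for one [T], [n] and [K]. It is all that the block estimates
    use of type, cotype and property (alpha). *)
Definition discrete_estimate {R : realType} {X : completeNormedModType R[i]}
    {d : measure_display} {Omega : measurableType d} {P : probability Omega R}
    (r : nat -> {RV P >-> (R * R)%type}) (T : set (X -> X)) (n K : nat) (D : R) : Prop :=
  forall (M1 M2 c0 : R) (U V : nat -> X -> X) (b : nat -> R[i]) (S : nat -> nat -> X -> X) (x : nat -> X),
  0 <= M1 -> 0 <= M2 -> 0 < c0 ->
  (forall a, (a < 2 ^ n)%N -> linear (U a) /\ forall y, rnorm (U a y) <= M1 * rnorm y) ->
  (forall a, (a < 2 ^ n)%N -> linear (V a) /\ forall y, rnorm (V a y) <= M2 * rnorm y) ->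
  (forall j k, (j < 2 ^ n)%N -> (k < K)%N -> T (S j k) /\ linear (S j k)) ->
  (forall j, cabs (b j) <= c0) ->
  rnrm r (fun k : 'I_K => \sum_(i < 2 ^ n) V i (dft n (fun j => b j *: S j k (dft n (fun a => U a (x k)) j)) i))
  <= D * c0 * M1 * M2 * rnrm r (fun k : 'I_K => x k).

Section MultiplierEstimate.
Context {R : realType} {X : completeNormedModType R[i]}.
Context {d : measure_display} {Omega : measurableType d} (P : probability Omega R).
Variables (r r' : nat -> {RV P >-> (R * R)%type}) (hr : rademacher_pair r r').
Variable U : R -> X -> X.
Hypothesis hU : C0_group U.
Variable A : set (X * X).
Hypothesis hA : forall x y : X, A (x, y) <-> generator U (x, - 'i *: y).
Variables (th M : R).
Hypotheses (th0 : 0 <= th) (M1 : 1 <= M).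
Hypothesis hM : forall s x, rnorm (U s x) <= M * expR (th * `|s|) * rnorm x.
Variables (w' w : R).
Hypotheses (thw : th < w') (ww : w' < w).
Section Block.
Variables (T : set (X -> X)) (n K : nat).
Local Notation N := (2 ^ n)%N.
Variable D : R.
Hypotheses (D0 : 0 <= D).
Hypothesis hD : discrete_estimate r T n K D.
Variables (k0 : R) (wk : w' < k0) (f : nat -> R[i] -> X -> X) (Kf : nat -> R).
Hypothesis gf : forall k, (k < K)%N -> good A w (Kf k) (f k) /\ forall z, strip w z -> T (f k z).
Variables (l : int) (y M2 : R) (hy : `|y| <= w') (M20 : 0 <= M2).
Hypothesis hV : forall b z v, (b < N)%N -> complex.Im z = y ->
  rnorm (qop U (l%:~R + b%:R / N%:R) z v) <= M2 * rnorm v.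
Let hn := @snorm_rnorm R X.
Let N0 : (0 < N)%N. Proof. by rewrite expn_gt0. Qed.
Let NR : (0 : R) < N%:R. Proof. by rewrite ltr0n. Qed.

Let integrand k x s := reg k0 (s +i* y) *: f k (s +i* y) (Wker U N l%:~R (s +i* y) x).

Let integrand_vcont (k : 'I_K) x s : vcont (@rnorm R X) (integrand k x) s.
Proof.
have [g _] := gf (ltn_ord k).
by have [] := Lker_lint hU th0 M1 hM thw ww wk g N0 l%:~R x hy.
Qed.

Let qop_split s (b z : R[i]) v : qop U s (b + z) v = ce s b *: qop U s z v.
Proof. by rewrite /qop ceDz scalerA. Qed.

(** Two integrations stay outside: over the position [zeta] in a frequency cell of length [2 pi] and
    over the position [s] in a time cell of length [1 / N]. For fixed [zeta] and [s] the integrand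
    is exactly a discrete multiplier, with the window [Phi] giving the inner transform and [avg] the
    outer one. The length of the time cell and the average account for [N ^- 2]. *)
Lemma block_bound (m : int) (c0 : R) (x : nat -> X) : 0 < c0 ->
  (forall s, 2 * pi * N%:R * m%:~R <= s <= 2 * pi * N%:R * m%:~R + 2 * pi * N%:R -> cabs (reg k0 (s +i* y)) <= c0) ->
  rnrm r (fun k : 'I_K => vint (integrand k (x k)) (2 * pi * N%:R * m%:~R) (2 * pi * N%:R * m%:~R + 2 * pi * N%:R))
  <= 2 * pi * (D * c0 * (M * expR (th + w')) * M2 / N%:R ^+ 2) * rnrm r (fun k : 'I_K => x k).
Proof.
move=> c00 hc0; set beta := 2 * pi * N%:R * m%:~R.
have pi0 := @pi_gt0 R.
have split_block k : vint (integrand k (x k)) beta (beta + 2 * pi * N%:R) =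
   \sum_(j < N) vint (integrand k (x k)) (beta + 2 * pi * j%:R) (beta + 2 * pi * j%:R + 2 * pi).
  have H J : vint (integrand k (x k)) beta (beta + 2 * pi * J%:R) =
     \sum_(j < J) vint (integrand k (x k)) (beta + 2 * pi * j%:R) (beta + 2 * pi * j%:R + 2 * pi).
    elim: J => [|J IH]; first by rewrite big_ord0 mulr0 addr0 vint_id.
    rewrite big_ord_recr /= -IH vint_add; congr vint; rewrite -natr1; ring.
  exact: H.
have NB : forall x0 : 'I_K -> X, rnrm r x0 <= 1 * \sum_k rnorm (x0 k) by move=> x0; exact: (rnrm_bound hr).
(* The N cells of the block are superposed on one. *)
pose G k zeta := \sum_(j < N) integrand k (x k) (zeta + (beta + 2 * pi * j%:R)).
have Gc (k : 'I_K) s : vcont (@rnorm R X) (G k) s.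
  apply: (vcont_sum hn) => j; apply: (@vcont_shift _ _ _ (integrand k (x k))).
  exact: integrand_vcont.
have -> : (fun k : 'I_K => vint (integrand k (x k)) beta (beta + 2 * pi * N%:R)) = (fun k : 'I_K => vint (G k) 0 (2 * pi)).
  apply/funext => k; rewrite split_block vint_sum; last first.
    by move=> j s; apply: (@vcont_shift _ _ _ (integrand k (x k))); exact: integrand_vcont.
  apply: eq_bigr => j _; rewrite vint_shift; last exact: integrand_vcont.
  by rewrite add0r [2 * pi + _]addrC.
set B := D * _ * _ * _ / _.
rewrite (_ : 2 * pi * B * _ = B * rnrm r (fun k : 'I_K => x k) * (2 * pi - 0)); last by ring.
apply: (tuple_vint_le (snorm_rnrm hr K) NB (g := fun k : 'I_K => G k)) => //.
  by rewrite mulr_ge0// ltW.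
move=> zeta hz; pose z j : R[i] := (zeta + (beta + 2 * pi * j%:R)) +i* y.
pose u : R[i] := zeta +i* y.
have zE j : z j = (beta + 2 * pi * j%:R)%:C + u.
  by apply/eqP; rewrite eq_complex /=; apply/andP; split; apply/eqP; rewrite ?add0r// addrC.
have strip_z j : strip w (z j) by apply: (line_strip ww).
pose ph s j := ce s (beta + 2 * pi * j%:R)%:C : R[i].
have ph_root (l' : int) (a j : nat) : ph (l'%:~R + a%:R / N%:R) j = uroot n (a * j) by exact: ce_sample.
have ph1 s j : cabs (ph s j) = 1 by rewrite cabs_ce /= mulr0 oppr0 expR0.
(* Zero beyond the block, since the discrete estimate asks for a bound on [b j] at every [j]. *)
pose b s j := if (j < N)%N then reg k0 (z j) * ph s j else 0.
pose Va a := qop U (l%:~R + a%:R / N%:R) u.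
pose Ua s a := qop U (s + a%:R / N%:R) u.
pose Tj k j v := reg k0 (z j) *: f k (z j) (avg U N l%:~R (z j) (\sum_(a < N) qop U (a%:R / N%:R) (z j) v)).
have linV a : linear (Va a) by have [] := qopB hU (l%:~R + a%:R / N%:R) u.
have linU s a : linear (Ua s a) by have [] := qopB hU (s + a%:R / N%:R) u.
(* Here the values must commute with the group: [Va] is moved out through [f], which is thereby
   applied on the frequency side, between the two transforms. *)
have comm (k : 'I_K) j a v : f k (z j) (Va a v) = Va a (f k (z j) v).
  have [[_ /(_ _ (strip_z j)) [cf _ _]] _] := gf (ltn_ord k).
  have [[lf _] _] := cf.
  by rewrite /Va /qop (linear_mapZ lf) (commutant_group hU hA th0 M1 hM _ _ cf).
have bTj (k : 'I_K) j : bounded_op (Tj k j).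
  have [[_ /(_ _ (strip_z j)) [[bf _] _ _]] _] := gf (ltn_ord k).
  apply: bounded_opZ; apply: (bounded_op_comp bf); apply: bounded_op_comp.
    apply: bounded_opZ; apply: bounded_op_sum => a; exact: qopB.
  apply: bounded_op_sum => a; exact: qopB.
(* The unit window is the sum of the translates by [a / N] of the window of length [1 / N]. The sum
   over [a] is part of [Tj] and becomes the inner transform. *)
have GE (k : 'I_K) : G k zeta = vint (fun s => \sum_(j < N) Tj k j (qop U s (z j) (x k))) 0 N%:R^-1.
  rewrite vint_sum; last by move=> j s; apply: (vcont_op (bTj k j)); exact: qop_vcont.
  apply: eq_bigr => j _; rewrite (vint_op _ _ (bTj k j)); last by move=> s; exact: qop_vcont.
  rewrite /integrand /Tj -/(z j); congr (_ *: f k _ (avg _ _ _ _ _)).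
  by have := Phi_sum hU N N%:R^-1 (z j) (x k); rewrite mulfV ?lt0r_neq0// => ->.
have -> : (fun k : 'I_K => G k zeta) = (fun k : 'I_K => vint (fun s => \sum_(j < N) Tj k j (qop U s (z j) (x k))) 0 N%:R^-1).
  by apply/funext => k; exact: GE.
rewrite (_ : B * _ = D * c0 * (M * expR (th + w')) * M2 / N%:R * rnrm r (fun k : 'I_K => x k) * (N%:R^-1 - 0)); last first.
  by rewrite /B subr0; field; rewrite lt0r_neq0.
apply: (tuple_vint_le (snorm_rnrm hr K) NB (g := fun (k : 'I_K) s => \sum_(j < N) Tj k j (qop U s (z j) (x k)))).
- by move=> k s; apply: (vcont_sum hn) => j; apply: (vcont_op (bTj k j)); exact: qop_vcont.
- by rewrite invr_ge0 ltW.
move=> s /andP[s0 s1].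
have -> : (fun k : 'I_K => \sum_(j < N) Tj k j (qop U s (z j) (x k))) =
  (fun k : 'I_K => (N%:R^-1)%:C *: \sum_(i < N) Va i (dft n (fun j => b s j *: f k (z j) (dft n (fun a => Ua s a (x k)) j)) i)).
  apply/funext => k.
  have inner j : \sum_(a < N) qop U (a%:R / N%:R) (z j) (qop U s (z j) (x k)) = ph s j *: dft n (fun a => Ua s a (x k)) j.
    rewrite scaler_sumr; apply: eq_bigr => a _.
    rewrite -(qop_add hU) addrC zE qop_split ceD -/(ph s j) scalerA; congr (_ * _ *: _).
    by have := ph_root 0 a j; rewrite /ph add0r.
  have outer j v : avg U N l%:~R (z j) v = (N%:R^-1)%:C *: \sum_(i < N) uroot n (j * i) *: Va i v.
    congr (_ *: _); apply: eq_bigr => i _; rewrite zE qop_split; congr (_ *: _).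
    by have := ph_root l i j; rewrite mulnC.
  transitivity (\sum_(j < N) (N%:R^-1)%:C *: \sum_(i < N) uroot n (j * i) *: Va i (b s j *: f k (z j) (dft n (fun a => Ua s a (x k)) j))).
    apply: eq_bigr => j _; rewrite /Tj inner outer /b ltn_ord.
    have [[_ /(_ _ (strip_z j)) [[[lf _] _] _ _]] _] := gf (ltn_ord k).
    rewrite (linear_mapZ lf) scalerA [X in X *: _]mulrC -[LHS]scalerA; congr (_ *: _).
    rewrite (linear_map_sum _ _ _ lf) scaler_sumr; apply: eq_bigr => i _.
    rewrite (linear_mapZ lf) comm (linear_mapZ lf) !(linear_mapZ (linV _)) !scalerA.
    by congr (_ *: _); ring.
  rewrite -scaler_sumr exchange_big; congr (_ *: _); apply: eq_bigr => i _.
  rewrite (linear_map_sum _ _ _ (linV i)); apply: eq_bigr => j _.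
  by rewrite !(linear_mapZ (linV i)).
have rZ c (X0 : 'I_K -> X) : rnrm r (fun k => c *: X0 k) = cabs c * rnrm r X0 by exact: (snormZ (snorm_rnrm hr K)).
rewrite rZ cabs_real ger0_norm ?invr_ge0 ?(ltW NR)//.
rewrite (_ : D * _ * _ * _ / _ * _ = N%:R^-1 * (D * c0 * (M * expR (th + w')) * M2 * rnrm r (fun k : 'I_K => x k))); last by ring.
apply: ler_wpM2l; first by rewrite invr_ge0 (ltW NR).
refine (@hD (M * expR (th + w')) M2 c0 (Ua s) Va (b s) (fun j k => f k (z j)) x _ _ _ _ _ _ _) => //.
- by rewrite mulr_ge0 ?expR_ge0// (le_trans ler01).
- move=> a aN; split=> // v.
  have := qop_strip_le th0 M1 hM thw (s := s + a%:R / N%:R) (z := u) v (c := 1) hy.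
  rewrite mulr1; apply; rewrite ger0_norm ?addr_ge0 ?divr_ge0//.
  apply: (@le_trans _ _ (N%:R^-1 + a%:R / N%:R)); first by rewrite lerD2r.
  by rewrite -[X in X + _]mul1r -mulrDl ler_pdivrMr// mul1r nat1r ler_nat.
- by move=> a aN; split=> // v; exact: hV.
- move=> j k jN kK; have [[_ /(_ _ (strip_z j)) [[[lf _] _] _ _]] Tf] := gf kK.
  by split=> //; exact: Tf.
move=> j; rewrite /b; case: ifP => [jN|_]; last by rewrite cabs0 ltW.
rewrite cabsM ph1 mulr1; apply: hc0; move: hz => /andP[z0 z1].
have j0 : 0 <= 2 * pi * j%:R :> R by rewrite !mulr_ge0// ltW.
have j1 : 2 * pi * j%:R + 2 * pi <= 2 * pi * N%:R :> R.
  by rewrite -[X in _ + X]mulr1 -mulrDr natr1 ler_wpM2l ?ler_nat// mulr_ge0// ltW.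
by apply/andP; split; rewrite -/beta; lra.
Qed.

Variables (a : R) (a0 : 0 < a) (ha : a * N%:R <= `|k0 - y|).

Let reg_block (m : nat) s : N%:R * m%:R <= `|s| -> cabs (reg k0 (s +i* y)) <= (N%:R ^+ 2)^-1 * (m%:R ^+ 2 + a ^+ 2)^-1.
Proof.
move=> hs; have aN : 0 < a * N%:R by rewrite mulr_gt0.
apply: le_trans (@cabs_reg_le _ k0 _ (s +i* y) aN ha) _; rewrite /= -invfM lef_pV2 ?posrE.
- rewrite mulrDr -!exprMn [a * _]mulrC lerD2r -(real_normK (num_real s)).
  by rewrite lerXn2r ?nnegrE ?mulr_ge0.
- by rewrite ltr_wpDl ?sqr_ge0 ?exprn_gt0.
- by rewrite mulr_gt0 ?exprn_gt0// ltr_wpDl ?sqr_ge0 ?exprn_gt0.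
Qed.

(** The blocks [m] and [- (m + 1)] both lie at distance at least [N m] from 0, and the pole of the
    regularizer at distance at least [a N] from the line. So the regularizer is at most
    [N ^- 2 / (m ^+ 2 + a ^+ 2)] there, which sums over [m] to a bound free of N. *)
Lemma symmetric_bound (x : nat -> X) L :
  rnrm r (fun k : 'I_K => vint (integrand k (x k)) (- (2 * pi * N%:R * L%:R)) (2 * pi * N%:R * L%:R))
  <= 4 * pi * (a ^- 2 + 2) * (D * (M * expR (th + w')) * M2 / N%:R ^+ 4) * rnrm r (fun k : 'I_K => x k).
Proof.
pose nx := rnrm r (fun k : 'I_K => x k).
have nx0 : 0 <= nx by exact: rnrm_ge0.
have pi0 := @pi_gt0 R.
have Mp : 0 <= M * expR (th + w') by rewrite mulr_ge0 ?expR_ge0// (le_trans ler01).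
pose C := 2 * pi * (D * (N%:R ^+ 2)^-1 * (M * expR (th + w')) * M2 / N%:R ^+ 2) * nx.
pose c0 m : R := (N%:R ^+ 2)^-1 * (m%:R ^+ 2 + a ^+ 2)^-1.
have c00 m : 0 < c0 m by rewrite mulr_gt0 ?invr_gt0 ?exprn_gt0// ltr_wpDl ?sqr_ge0 ?exprn_gt0.
pose bl (m : int) (k : nat) := vint (integrand k (x k)) (2 * pi * N%:R * m%:~R) (2 * pi * N%:R * m%:~R + 2 * pi * N%:R).
have cE m : 2 * pi * (D * c0 m * (M * expR (th + w')) * M2 / N%:R ^+ 2) * nx = (m%:R ^+ 2 + a ^+ 2)^-1 * C.
  by rewrite /C /c0; ring.
have two_pi_le (m : nat) : N%:R * m%:R <= 2 * pi * N%:R * m%:R :> R.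
  by rewrite -mulrA ler_peMl ?mulr_ge0//; have := @pi_ge2 R; lra.
have blP (m : nat) : rnrm r (fun k : 'I_K => bl m%:Z k) <= (m%:R ^+ 2 + a ^+ 2)^-1 * C.
  rewrite -(cE m); apply: block_bound => // s /andP[s0 _]; apply: reg_block.
  by apply: le_trans (ler_norm _); apply: le_trans s0; rewrite -pmulrn.
have blN (m : nat) : rnrm r (fun k : 'I_K => bl (- m.+1%:Z) k) <= (m%:R ^+ 2 + a ^+ 2)^-1 * C.
  rewrite -(cE m); apply: block_bound => // s /andP[_ s1]; apply: reg_block.
  apply: le_trans (two_pi_le m) _; rewrite -normrN; apply: le_trans (ler_norm _).
  move: s1; rewrite rmorphN /= -pmulrn -natr1; move: (2 * pi * N%:R) => c; lra.
have -> : (fun k : 'I_K => vint (integrand k (x k)) (- (2 * pi * N%:R * L%:R)) (2 * pi * N%:R * L%:R)) =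
  \sum_(m < L) ((fun k : 'I_K => bl m%:Z k) + (fun k : 'I_K => bl (- m.+1%:Z) k)) :> ('I_K -> X).
  apply/funext => k; rewrite fct_sumE; elim: L => [|L IH]; first by rewrite mulr0 oppr0 vint_id big_ord0.
  rewrite big_ord_recr /= -IH [RHS]addrC [X in X + _]addrC -addrA [X in _ + X]addrC addrA /bl !mulrNz -!pmulrn.
  set c := 2 * pi * N%:R; rewrite -!natr1.
  rewrite (_ : c * - (L%:R + 1) + c = - (c * L%:R)); last by ring.
  rewrite (_ : c * L%:R + c = c * (L%:R + 1)); last by ring.
  by rewrite mulrN vint_add vint_add.
apply: le_trans (snorm_sum (snorm_rnrm hr K) _ _ _) _.
apply: (@le_trans _ _ (\sum_(m < L) (m%:R ^+ 2 + a ^+ 2)^-1 * (2 * C))).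
  apply: ler_sum => m _; apply: le_trans (snormD (snorm_rnrm hr K) _ _) _.
  by have := lerD (blP m) (blN m); rewrite -mulrDr -mulr2n mulr_natl.
rewrite -mulr_suml; apply: (@le_trans _ _ ((a ^- 2 + 2) * (2 * C))).
  apply: ler_wpM2r; last exact: sum_inv_square.
  have Mp0 : 0 <= M by exact: le_trans ler01 M1.
  by rewrite mulr_ge0// /C; rewrite !mulr_ge0 ?invr_ge0 ?exprn_ge0 ?expR_ge0 ?(ltW pi0).
rewrite le_eqVlt; apply/orP; left; apply/eqP; rewrite /C -/nx; field.
by rewrite !gt_eqF.
Qed.

Lemma Lker_rnrm (x : nat -> X) :
  rnrm r (fun k : 'I_K => Lker U k0 (f k) N y l%:~R (x k))
  <= 4 * pi * (a ^- 2 + 2) * (D * (M * expR (th + w')) * M2 / N%:R ^+ 4) * rnrm r (fun k : 'I_K => x k).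
Proof.
apply/ler_addgt0Pr => e e0.
have eK : 0 < e / K.+1%:R by rewrite divr_gt0.
have lim (k : 'I_K) : exists L0 : R, forall L, L0 <= L ->
    rnorm (vint (integrand k (x k)) (- L) L - Lker U k0 (f k) N y l%:~R (x k)) <= e / K.+1%:R.
  have [g _] := gf (ltn_ord k).
  have [_ /(_ _ eK)] := Lker_lint hU th0 M1 hM thw ww wk g N0 l%:~R (x k) hy.
  by [].
have [L0 hL0] := choice lim.
pose L := Num.bound (\sum_k `|L0 k|).
have NL k : L0 k <= 2 * pi * N%:R * L%:R.
  have h1 : L0 k <= \sum_k `|L0 k|.
    apply: le_trans (ler_norm _) _; rewrite (bigD1 k)//= lerDl.
    by apply: sumr_ge0 => ? _; exact: normr_ge0.
  apply: le_trans h1 _; apply: le_trans (ltW (archi_boundP _)) _; first by apply: sumr_ge0 => ? _; exact: normr_ge0.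
  rewrite -/L ler_peMl//; have := @pi_ge2 R; have : (1 : R) <= N%:R by rewrite ler1n.
  by move=> n1 p2; rewrite -[1]mulr1 ler_pM//; lra.
pose I : 'I_K -> X := fun k => vint (integrand k (x k)) (- (2 * pi * N%:R * L%:R)) (2 * pi * N%:R * L%:R).
apply: le_trans (snorm_le_add (snorm_rnrm hr K) _ I) _; apply: lerD; first exact: symmetric_bound.
apply: le_trans (rnrm_bound hr _) _; rewrite mul1r.
apply: (@le_trans _ _ (\sum_(k < K) e / K.+1%:R)).
  by apply: ler_sum => k _; rewrite rnormBC; exact: hL0.
rewrite sumr_const card_ord -[leLHS]mulr_natr -mulrA; apply: ler_piMr; first exact: ltW.
by rewrite ler_pdivrMl// mulr1 ler_nat.
Qed.

End Block.

(** The window at time distance [l] carries a factor [q ^+ l], and the geometric series is summed by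
    the triangle inequality. As the pole is at height [mu * N], its distance from the lines is at
    least [(mu - w') * N], which keeps [E] independent of [n]. The truncation error has a constant
    that depends on [f], but it vanishes as [L] grows. *)
Lemma multiplier_bound (mu : R) : w' < mu -> exists2 E, 0 <= E &
  forall (T : set (X -> X)) n K D (f : nat -> R[i] -> X -> X) (Kf : nat -> R) (x : nat -> X), 0 <= D -> discrete_estimate r T n K D ->
  (forall k, (k < K)%N -> good A w (Kf k) (f k) /\ forall z, strip w z -> T (f k z)) ->
  rnrm r (fun k : 'I_K => Dc A w' (mu * (2 ^ n)%:R) (f k) (x k)) <=
  E * (D / (2 ^ n)%:R ^+ 4) * rnrm r (fun k : 'I_K => x k).
Proof.
move=> hmu; pose a := mu - w'; have a0 : 0 < a by rewrite subr_gt0.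
have pi0 := @pi_gt0 R; have M0 : 0 <= M by exact: le_trans ler01 M1.
pose delta := w' - th; have delta0 : 0 < delta by rewrite subr_gt0.
pose q := expR (- delta); have q1 : q < 1 by rewrite /q expR_lt1 oppr_lt0.
have q0 : 0 < q by exact: expR_gt0.
have qL (l : nat) : expR (- delta * l%:R) = q ^+ l by rewrite mulrC expRM_natl.
pose E0 := 4 * pi * (a ^- 2 + 2) * (M * expR (th + w') * M).
have E00 : 0 <= E0.
  by rewrite !mulr_ge0 ?expR_ge0 ?(ltW pi0)// addr_ge0// invr_ge0 exprn_ge0// ltW.
exists (2 * E0 / (1 - q)).
  by rewrite divr_ge0 ?subr_ge0 ?(ltW q1)// mulr_ge0.
move=> T n K D f Kf x D0 hD gf; set N := (2 ^ n)%N.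
have N0 : (0 < N)%N by rewrite expn_gt0.
have NR : (1 : R) <= N%:R by rewrite ler1n.
have NR0 : (0 : R) < N%:R by rewrite ltr0n.
have w'0 : 0 < w' by exact: le_lt_trans th0 thw.
have mu0 : 0 < mu by exact: lt_trans w'0 hmu.
have muN : mu <= mu * N%:R by rewrite ler_peMr// ltW.
have wk : w' < mu * N%:R by exact: lt_le_trans hmu muN.
have ha y : `|y| <= w' -> a * N%:R <= `|mu * N%:R - y|.
  move=> hy; apply: le_trans (ler_norm _); have := ler_norm y; rewrite /a mulrBl.
  have : w' <= w' * N%:R by rewrite ler_peMr// ltW.
  by move=> h1 h2; lra.
set nx := rnrm r (fun k : 'I_K => x k); have nx0 : 0 <= nx by exact: rnrm_ge0.
pose B := E0 * (D / N%:R ^+ 4) * nx.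
have B0 : 0 <= B.
  by rewrite /B; apply: mulr_ge0 => //; apply: mulr_ge0 => //; rewrite divr_ge0// exprn_ge0// ltW.
have BE l : 4 * pi * (a ^- 2 + 2) * (D * (M * expR (th + w')) * (M * q ^+ l) / N%:R ^+ 4) * nx = q ^+ l * B.
  by rewrite /B /E0; ring.
have up (l : nat) : rnrm r (fun k : 'I_K => Lker U (mu * N%:R) (f k) N w' l%:R (x k)) <= q ^+ l * B.
  rewrite -BE; have := @Lker_rnrm T n K D D0 hD (mu * N%:R) wk f Kf gf l%:Z w' (M * q ^+ l).
  rewrite -pmulrn; apply => //.
  - by rewrite ger0_norm// ltW.
  - by rewrite mulr_ge0// exprn_ge0// ltW.
  - move=> b z v bN zy; apply: le_trans (qop_le hM _ _ _) _.
    rewrite ler_wpM2r ?rnorm_ge0// ler_wpM2l// -qL ler_expR zy.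
    have h0 : 0 <= b%:R / N%:R :> R by rewrite divr_ge0.
    rewrite ger0_norm ?addr_ge0// /delta.
    have : 0 <= (w' - th) * (b%:R / N%:R) by rewrite mulr_ge0// ltW.
    lra.
  - by apply: ha; rewrite ger0_norm// ltW.
(* The sampling times of the window at [- (l + 1)] end before [- l], so the factor is again
   [q ^+ l]. *)
have low (l : nat) : rnrm r (fun k : 'I_K => Lker U (mu * N%:R) (f k) N (- w') (- l.+1%:R) (x k)) <= q ^+ l * B.
  rewrite -BE; have := @Lker_rnrm T n K D D0 hD (mu * N%:R) wk f Kf gf (- l.+1%:Z) (- w') (M * q ^+ l).
  rewrite mulrNz -pmulrn; apply => //.
  - by rewrite normrN ger0_norm// ltW.
  - by rewrite mulr_ge0// exprn_ge0// ltW.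
  - move=> b z v bN zy; apply: le_trans (qop_le hM _ _ _) _.
    rewrite ler_wpM2r ?rnorm_ge0// ler_wpM2l// -qL ler_expR zy.
    have h0 : b%:R / N%:R <= 1 :> R by rewrite ler_pdivrMr// mul1r ler_nat ltnW.
    have l0 : 0 <= l%:R :> R by [].
    rewrite ler0_norm; last by rewrite -natr1; lra.
    rewrite /delta -natr1.
    have : 0 <= (w' - th) * (1 - b%:R / N%:R) by rewrite mulr_ge0 ?subr_ge0// ltW.
    lra.
  - by apply: ha; rewrite normrN ger0_norm// ltW.
have geo L : \sum_(l < L) q ^+ l <= (1 - q)^-1.
  rewrite -[leRHS]mul1r ler_pdivlMr ?subr_gt0// mulrC.
  have := subrX1 q L; rewrite -[q - 1]opprB mulNr => e.
  by rewrite -[leLHS]opprK -e opprB gerBl exprn_ge0// ltW.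
have rep (k : 'I_K) : exists C, 0 <= C /\ forall x L,
  rnorm (((2 * pi)%:C * 'i) *: Dc A w' (mu * N%:R) (f k) x
    - ('i *: (\sum_(l < L.+1) Lker U (mu * N%:R) (f k) N w' l%:R x) + 'i *: \sum_(l < L.+1) Lker U (mu * N%:R) (f k) N (- w') (- l.+1%:R) x))
    <= C * expR ((th-w')*L%:R) * rnorm x.
  have [g _] := gf _ (ltn_ord k).
  by have [C C0 hC] := represent hU hA th0 M1 hM thw ww wk g N0; exists C.
have [C hC] := choice rep.
suff H : 2 * pi * rnrm r (fun k : 'I_K => Dc A w' (mu * N%:R) (f k) (x k)) <= 2 * B / (1 - q).
  rewrite (_ : 2 * E0 / (1 - q) * _ * _ = 2 * B / (1 - q)); last by rewrite /B; ring.
  apply: le_trans H; rewrite ler_peMl ?rnrm_ge0//; have := @pi_ge2 R; lra.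
pose Y : 'I_K -> X := fun k => ((2 * pi)%:C * 'i) *: Dc A w' (mu * N%:R) (f k) (x k).
have -> : 2 * pi * rnrm r (fun k : 'I_K => Dc A w' (mu * N%:R) (f k) (x k)) = rnrm r Y.
  rewrite [RHS](snormZ (snorm_rnrm hr K) _ (fun k : 'I_K => Dc A w' (mu * N%:R) (f k) (x k))).
  by rewrite cabsM cabs_i mulr1 cabs_real ger0_norm// mulr_ge0// ltW.
pose S1 L : 'I_K -> X := fun k => \sum_(l < L.+1) Lker U (mu * N%:R) (f k) N w' l%:R (x k).
pose S2 L : 'I_K -> X := fun k => \sum_(l < L.+1) Lker U (mu * N%:R) (f k) N (- w') (- l.+1%:R) (x k).
pose Z L : 'I_K -> X := fun k => 'i *: S1 L k + 'i *: S2 L k.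
have iD (F1 F2 : 'I_K -> X) : rnrm r (fun k => 'i *: F1 k + 'i *: F2 k) <= rnrm r F1 + rnrm r F2.
  apply: le_trans (rnrmD hr (fun k => 'i *: F1 k) (fun k => 'i *: F2 k)) _.
  by rewrite (rnrmZ hr 'i F1) (rnrmZ hr 'i F2) cabs_i !mul1r.
have ZL L : rnrm r (Z L) <= 2 * B / (1 - q).
  apply: le_trans (iD (S1 L) (S2 L)) _.
  have s0 := lerD (rnrm_sum hr L.+1 (fun l (k : 'I_K) => Lker U (mu * N%:R) (f k) N w' l%:R (x k)))
    (rnrm_sum hr L.+1 (fun l (k : 'I_K) => Lker U (mu * N%:R) (f k) N (- w') (- l.+1%:R) (x k))).
  apply: le_trans s0 _; rewrite -big_split /=.
  apply: (@le_trans _ _ (\sum_(l < L.+1) q ^+ l * (2 * B))).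
    apply: ler_sum => l _; have e : q ^+ l * (2 * B) = q ^+ l * B + q ^+ l * B by ring.
    by rewrite e; exact: lerD (up l) (low l).
  by rewrite -mulr_suml mulrC ler_wpM2l// mulr_ge0.
pose c := \sum_(k < K) C k * rnorm (x k).
have c0 : 0 <= c by apply: sumr_ge0 => k _; rewrite mulr_ge0 ?rnorm_ge0//; have [] := hC k.
have YZ L : rnrm r Y <= 2 * B / (1 - q) + c * expR (- (delta * L%:R)).
  apply: le_trans (snorm_le_add (snorm_rnrm hr K) _ (Z L)) _; apply: lerD => //.
  apply: le_trans (rnrm_bound hr _) _; rewrite mul1r mulr_suml; apply: ler_sum => k _.
  have e : - (delta * L%:R) = (th - w') * L%:R by rewrite /delta; ring.
  by rewrite e mulrAC; have [_ h] := hC k; exact: h.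
apply/ler_addgt0Pr => e e0; pose L := Num.bound (c / (e * delta)).
apply: le_trans (YZ L) _; rewrite lerD2l expRN ler_pdivrMr ?expR_gt0//.
apply: (@le_trans _ _ (e * (delta * L%:R))).
  rewrite mulrA -ler_pdivrMl ?mulr_gt0// mulrC ltW//; apply: archi_boundP.
  by rewrite divr_ge0// ltW// mulr_gt0.
apply: ler_wpM2l; first exact: ltW.
by apply: le_trans (expR_ge1Dx _); rewrite lerDr.
Qed.

End MultiplierEstimate.

(** * Kahane's inequality *)

Section SignCube.
Context {R : realType}.
Implicit Types f g : seq bool -> R.

Fixpoint cube_mean n f : R :=
  if n is m.+1 then (cube_mean m (f \o cons true) + cube_mean m (f \o cons false)) / 2
  else f [::].

Lemma cube_mean_lin n f g a b :
  cube_mean n (fun s => a * f s + b * g s) = a * cube_mean n f + b * cube_mean n g.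
Proof. by elim: n f g => [|n IH] f g //=; rewrite /comp !IH; field. Qed.

Lemma cube_meanD n f g : cube_mean n (fun s => f s + g s) = cube_mean n f + cube_mean n g.
Proof.
have := cube_mean_lin n f g 1 1; rewrite !mul1r => <-; congr cube_mean.
by apply/funext => s; rewrite !mul1r.
Qed.

Lemma cube_meanZ n f a : cube_mean n (fun s => a * f s) = a * cube_mean n f.
Proof.
have := cube_mean_lin n f f a 0; rewrite mul0r addr0 => <-; congr cube_mean.
by apply/funext => s; rewrite mul0r addr0.
Qed.

Lemma cube_mean_cst n a : cube_mean n (fun=> a) = a.
Proof. by elim: n => [|n IH] //=; rewrite /comp IH; field. Qed.

Lemma cube_mean_le n f g : (forall s, size s = n -> f s <= g s) -> cube_mean n f <= cube_mean n g.
Proof.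
elim: n f g => [|n IH] f g h /=; first exact: h.
rewrite ler_pM2r ?invr_gt0//; apply: lerD; apply: IH => s sn; apply: h; by rewrite /= sn.
Qed.

Lemma cube_mean_eq n f g : (forall s, size s = n -> f s = g s) -> cube_mean n f = cube_mean n g.
Proof. by move=> h; apply/le_anti; rewrite !cube_mean_le// => s /h ->. Qed.

Lemma cube_mean_ge0 n f : (forall s, size s = n -> 0 <= f s) -> 0 <= cube_mean n f.
Proof. by move=> h; rewrite -(cube_mean_cst n 0); exact: cube_mean_le. Qed.

(* Up to the multiple n f, the generator of the flip semigroup. *)
Fixpoint flip_sum n f s : R :=
  if n is m.+1 then
    if s is b :: s' then f (~~ b :: s') + flip_sum m (f \o cons b) s' else 0
  else 0.

Definition flip_form n f : R := cube_mean n (fun s => f s * (n%:R * f s - flip_sum n f s)).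

Lemma flip_sum_lin n f g a b s :
  flip_sum n (fun s => a * f s + b * g s) s = a * flip_sum n f s + b * flip_sum n g s.
Proof.
elim: n f g s => [|n IH] f g [|c s] /=; rewrite ?mulr0 ?addr0//.
have := IH (f \o cons c) (g \o cons c) s; rewrite /comp => ->; ring.
Qed.

Definition antipodal f s := f (map negb s).
(** Mean and half-difference in the first sign: the two parts of the Walsh expansion with respect to
    that coordinate. All quadratic quantities below split along them, and the antipodal map changes
    the sign of [dp]. *)
Let mp f s := 2^-1 * f (true :: s) + 2^-1 * f (false :: s).
Let dp f s := 2^-1 * f (true :: s) + (- 2^-1) * f (false :: s).
Let trueE f s : f (true :: s) = mp f s + dp f s. Proof. by rewrite /mp /dp; field. Qed.
Let falseE f s : f (false :: s) = mp f s - dp f s. Proof. by rewrite /mp /dp; field. Qed.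

Let flip_form_split n f : flip_form n.+1 f =
  flip_form n (mp f) + flip_form n (dp f) + 2 * cube_mean n (fun s => dp f s ^+ 2).
Proof.
rewrite /flip_form /= -!cube_meanD mulrC -!cube_meanZ -cube_meanD; congr cube_mean; apply/funext => s /=.
rewrite /mp /dp !flip_sum_lin -natr1 /comp.
move: (flip_sum n _ s) (flip_sum n _ s) (f _) (f _) => a b c e; by field.
Qed.

Let sqr_split n f : cube_mean n.+1 (fun s => f s ^+ 2) =
  cube_mean n (fun s => mp f s ^+ 2) + cube_mean n (fun s => dp f s ^+ 2).
Proof.
rewrite /= -!cube_meanD mulrC -!cube_meanZ; congr cube_mean; apply/funext => s /=.
by rewrite trueE falseE; field.
Qed.

Let antipodal_split n f : cube_mean n.+1 (fun s => f s * antipodal f s) =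
  cube_mean n (fun s => mp f s * antipodal (mp f) s) - cube_mean n (fun s => dp f s * antipodal (dp f) s).
Proof.
rewrite -[X in _ - X]mul1r -mulNr -cube_meanZ.
rewrite /= -!cube_meanD mulrC -!cube_meanZ; congr cube_mean; apply/funext => s /=.
by rewrite /antipodal /= !trueE !falseE; field.
Qed.

Let mean_split n f : cube_mean n.+1 f = cube_mean n (mp f).
Proof. by rewrite /= -cube_meanD mulrC -cube_meanZ; congr cube_mean; apply/funext => s; rewrite mulrDr. Qed.

Lemma cube_mean_neg n f : cube_mean n (antipodal f) = cube_mean n f.
Proof.
elim: n f => [|n IH] f //=; rewrite -(IH (f \o cons true)) -(IH (f \o cons false)) addrC.
by [].
Qed.

Lemma cube_mean_antipodal_le n f :
  cube_mean n (fun s => f s * antipodal f s) <= cube_mean n (fun s => f s ^+ 2).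
Proof.
have h := cube_mean_neg n (fun s => f s ^+ 2).
have : 0 <= cube_mean n (fun s => (f s + - antipodal f s) ^+ 2) by apply: cube_mean_ge0 => s _; exact: sqr_ge0.
have -> : (fun s => (f s + - antipodal f s) ^+ 2) =
    (fun s => (f s ^+ 2 + antipodal (fun s => f s ^+ 2) s) + (- 2) * (f s * antipodal f s)).
  by apply/funext => s; rewrite /antipodal; ring.
rewrite cube_meanD cube_meanZ cube_meanD h; lra.
Qed.

(** A Walsh function of level k has eigenvalue 2k for the form and [(-1)^k] for the antipodal map.
    The left side is twice the mass on odd levels, where 2k is at least 2. The induction on
    coordinates proves this without introducing Walsh functions. *)
Lemma flip_form_odd n f :
  cube_mean n (fun s => f s ^+ 2) - cube_mean n (fun s => f s * antipodal f s) <= flip_form n f.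
Proof.
elim: n f => [|n IH] f.
  by rewrite /flip_form /= /antipodal /= mul0r subr0 mulr0 expr2 subrr.
rewrite sqr_split antipodal_split flip_form_split.
have := IH (mp f); have := IH (dp f); have := cube_mean_antipodal_le n (dp f); lra.
Qed.

(** In terms of Walsh levels the left side weighs odd levels by 2, even levels from 2 on by 4 and
    the constant by 0, never more than 2k. *)
Lemma flip_form_even n f :
  4 * (cube_mean n (fun s => f s ^+ 2) - cube_mean n f ^+ 2)
  - (cube_mean n (fun s => f s ^+ 2) - cube_mean n (fun s => f s * antipodal f s)) <= flip_form n f.
Proof.
elim: n f => [|n IH] f.
  by rewrite /flip_form /= /antipodal /= !expr2 !subrr mulr0 mul0r !subr0 mulr0.
rewrite sqr_split antipodal_split flip_form_split mean_split.
have := IH (mp f); have := flip_form_odd n (dp f); lra.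
Qed.

(* Latala and Oleszkiewicz: even functions have no component on the first
   Walsh level, which doubles their spectral gap. *)
Lemma cube_reverse_holder n f : (forall s, 0 <= f s) -> (forall s, size s = n -> antipodal f s = f s) ->
  (forall s, size s = n -> (n%:R - 2) * f s <= flip_sum n f s) ->
  cube_mean n (fun s => f s ^+ 2) <= 2 * cube_mean n f ^+ 2.
Proof.
move=> f0 ev h.
have h1 : flip_form n f <= 2 * cube_mean n (fun s => f s ^+ 2).
  rewrite -cube_meanZ; apply: cube_mean_le => s /h hs.
  have : f s * ((n%:R - 2) * f s) <= f s * flip_sum n f s by rewrite ler_wpM2l.
  by rewrite mulrBr expr2; lra.
have := flip_form_even n f.
rewrite (@cube_mean_eq n (fun s => f s * antipodal f s) (fun s => f s ^+ 2)); first lra.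
by move=> s /ev ->.
Qed.

End SignCube.

Section SignSums.
Context {R : realType} {V : lmodType R[i]} (rho : V -> R) (hr : snorm rho).

Definition sgn (b : bool) : R[i] := if b then 1 else -1.

Definition sign_sum n (x : nat -> V) s : V := \sum_(k < n) sgn (nth false s k) *: x k.

Lemma sign_sum_cons n x b s :
  sign_sum n.+1 x (b :: s) = sgn b *: x 0%N + sign_sum n (fun k => x k.+1) s.
Proof. by rewrite /sign_sum big_ord_recl. Qed.

Lemma sgnN b : sgn (~~ b) = - sgn b.
Proof. by case: b; rewrite /= ?opprK. Qed.

(** Triangle inequality for the n vectors with one sign flipped: each term of the sign sum is
    flipped once and kept n - 1 times. The vector [y] collects the coordinates already treated by
    the induction. *)
Lemma flip_sum_ge n y x s : size s = n ->
  rho (n%:R *: y + (n%:R - 2) *: sign_sum n x s) <= flip_sum n (fun s => rho (y + sign_sum n x s)) s.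
Proof.
elim: n y x s => [|n IH] y x [|b s] //= => [_|[sn]].
  by rewrite /sign_sum big_ord0 scale0r scaler0 addr0 (snorm0 hr).
rewrite [X in _ <= _ + flip_sum _ X _](_ : _ = (fun s => rho ((y + sgn b *: x 0%N) + sign_sum n (fun k => x k.+1) s))); last first.
  by apply/funext => t; rewrite /= sign_sum_cons addrA.
apply: le_trans (lerD (lexx _) (IH _ _ _ sn)); apply: le_trans (snormD hr _ _).
rewrite !sign_sum_cons sgnN -natr1 le_eqVlt; apply/orP; left; apply/eqP; congr rho; lin_ring.
Qed.

Lemma sign_reverse_holder n x :
  cube_mean n (fun s => rho (sign_sum n x s) ^+ 2) <= 2 * cube_mean n (fun s => rho (sign_sum n x s)) ^+ 2.
Proof.
apply: cube_reverse_holder => [s|s sn|s sn]; first exact: snorm_ge0.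
  rewrite /antipodal -(snormN hr); congr rho; rewrite /sign_sum -sumrN; apply: eq_bigr => k _.
  by rewrite (nth_map false) ?sn// sgnN scaleNr opprK.
have := flip_sum_ge 0 x sn; rewrite scaler0 add0r (snormZ hr).
rewrite (_ : (fun s => rho (0 + sign_sum n x s)) = (fun s => rho (sign_sum n x s))); last first.
  by apply/funext => t; rewrite add0r.
apply: le_trans; rewrite ler_wpM2r ?(snorm_ge0 hr)//.
(* For [n < 2] this factor is negative, and its modulus is only larger. *)
have -> : (n%:R - 2 : R[i]) = (n%:R - 2 : R)%:C by rewrite rmorphB !rmorph_nat.
by rewrite cabs_real ler_norm.
Qed.

(** What the contraction principle uses in each coordinate; both a norm and its square have it. *)
Definition convex_gauge (F : V -> R) := forall y x (a : R), `|a| <= 1 ->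
  F (y + a%:C *: x) + F (y - a%:C *: x) <= F (y + x) + F (y - x).

Let segment y x (a : R) : -1 <= a <= 1 ->
  rho (y + a%:C *: x) <= (1 + a) / 2 * rho (y + x) + (1 - a) / 2 * rho (y - x).
Proof.
move=> /andP[a1 a2].
have l0 : 0 <= (1 + a) / 2 by lra.
have l1 : 0 <= (1 - a) / 2 by lra.
have -> : y + a%:C *: x = ((1 + a) / 2)%:C *: (y + x) + ((1 - a) / 2)%:C *: (y - x).
  have e1 : ((1 + a) / 2)%:C + ((1 - a) / 2)%:C = 1 :> R[i].
    by rewrite -rmorphD -[RHS](rmorph1 (real_complex R)); congr (_%:C); field.
  have e2 : ((1 + a) / 2)%:C - ((1 - a) / 2)%:C = a%:C :> R[i].
    by rewrite -rmorphB; congr (_%:C); field.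
  rewrite -[X in X + _ = _]scale1r -e1 -e2; lin_ring.
apply: le_trans (snormD hr _ _) _.
by rewrite !(snormZ hr) !cabs_real !ger0_norm.
Qed.

Lemma convex_gauge_snorm : convex_gauge rho.
Proof.
move=> y x a; rewrite ler_norml => ha; have := segment y x ha.
have /(segment y x) : -1 <= - a <= 1 by lra.
rewrite rmorphN scaleNr; lra.
Qed.

Lemma convex_gauge_sqr : convex_gauge (fun v => rho v ^+ 2).
Proof.
move=> y x a; rewrite ler_norml => ha; have := segment y x ha.
have /(segment y x) : -1 <= - a <= 1 by lra.
rewrite rmorphN scaleNr; have := snorm_ge0 hr (y + x); have := snorm_ge0 hr (y - x).
have := snorm_ge0 hr (y + a%:C *: x); have := snorm_ge0 hr (y - a%:C *: x).
move: (rho _) (rho _) (rho _) (rho _) => u v b c c0 b0 v0 u0 h1 h2.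
have k1 : c ^+ 2 <= ((1 - a) / 2 * u + (1 + a) / 2 * v) ^+ 2.
  by rewrite !expr2; apply: ler_pM => //; move: h1; rewrite opprK.
have k2 : b ^+ 2 <= ((1 + a) / 2 * u + (1 - a) / 2 * v) ^+ 2.
  by rewrite !expr2; apply: ler_pM.
have k3 : 0 <= (1 - a) * (1 + a) * (u - v) ^+ 2.
  by rewrite mulr_ge0 ?sqr_ge0//; have /andP[a1 a2] := ha; rewrite mulr_ge0//; lra.
move: k1 k2 k3; rewrite !expr2; lra.
Qed.

Lemma sign_contraction F n y x (a : nat -> R) : convex_gauge F -> (forall k, `|a k| <= 1) ->
  cube_mean n (fun s => F (y + sign_sum n (fun k => (a k)%:C *: x k) s)) <= cube_mean n (fun s => F (y + sign_sum n x s)).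
Proof.
move=> cF; elim: n y x a => [|n IH] y x a ha /=; first by rewrite /sign_sum !big_ord0.
rewrite ler_pM2r ?invr_gt0// -!cube_meanD /comp.
pose y1 s := sign_sum n (fun k => x k.+1) s.
apply: (@le_trans _ _ (cube_mean n (fun s => F (y + (a 0%N)%:C *: x 0%N + y1 s) + F (y - (a 0%N)%:C *: x 0%N + y1 s)))).
  rewrite !cube_meanD; apply: lerD.
    have := IH (y + (a 0%N)%:C *: x 0%N) (fun k => x k.+1) (fun k => a k.+1) (fun k => ha k.+1).
    apply: le_trans; rewrite le_eqVlt; apply/orP; left; apply/eqP; apply: cube_mean_eq => s _.
    by rewrite sign_sum_cons scale1r addrA.
  have := IH (y - (a 0%N)%:C *: x 0%N) (fun k => x k.+1) (fun k => a k.+1) (fun k => ha k.+1).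
  apply: le_trans; rewrite le_eqVlt; apply/orP; left; apply/eqP; apply: cube_mean_eq => s _.
  by rewrite sign_sum_cons scaleN1r addrA.
apply: cube_mean_le => s _; rewrite !sign_sum_cons scale1r scaleN1r !addrA.
have := cF (y + y1 s) (x 0%N) (a 0%N) (ha 0%N).
by rewrite -![y + y1 s + _]addrA ![y1 s + _]addrC !addrA.
Qed.

Let sign_sum_ReIm n x (z : nat -> R[i]) s : sign_sum n (fun k => z k *: x k) s =
  sign_sum n (fun k => (complex.Re (z k))%:C *: x k) s + 'i *: sign_sum n (fun k => (complex.Im (z k))%:C *: x k) s.
Proof.
rewrite /sign_sum scaler_sumr -big_split /=; apply: eq_bigr => k _.
rewrite !scalerA -scalerDl; congr (_ *: _).
rewrite mulrCA -mulrDr; congr (_ * _).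
by case: (z k) => u v; apply/eqP; rewrite eq_complex /=; apply/andP; split; apply/eqP; ring.
Qed.

Let sign_contraction0 F n x (a : nat -> R) : convex_gauge F -> (forall k, `|a k| <= 1) ->
  cube_mean n (fun s => F (sign_sum n (fun k => (a k)%:C *: x k) s)) <= cube_mean n (fun s => F (sign_sum n x s)).
Proof.
move=> cF ha; have := sign_contraction n 0 x cF ha.
by under eq_fun do rewrite add0r; under [X in _ <= cube_mean _ X]eq_fun do rewrite add0r.
Qed.

Lemma complex_sign_contraction n x (z : nat -> R[i]) : (forall k, cabs (z k) <= 1) ->
  cube_mean n (fun s => rho (sign_sum n (fun k => z k *: x k) s)) <= 2 * cube_mean n (fun s => rho (sign_sum n x s)).
Proof.
move=> hz; have hRe k := le_trans (le_Re_cabs (z k)) (hz k); have hIm k := le_trans (le_Im_cabs (z k)) (hz k).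
have := lerD (sign_contraction0 n x convex_gauge_snorm hRe) (sign_contraction0 n x convex_gauge_snorm hIm).
rewrite -cube_meanD => h; rewrite mulr_natl mulr2n; apply: le_trans h; apply: cube_mean_le => s _.
rewrite sign_sum_ReIm; apply: le_trans (snormD hr _ _) _.
by rewrite (snormZ hr) cabs_i mul1r.
Qed.

Lemma complex_sign_contraction_sqr n x (z : nat -> R[i]) : (forall k, cabs (z k) <= 1) ->
  cube_mean n (fun s => rho (sign_sum n (fun k => z k *: x k) s) ^+ 2) <= 4 * cube_mean n (fun s => rho (sign_sum n x s) ^+ 2).
Proof.
move=> hz; have hRe k := le_trans (le_Re_cabs (z k)) (hz k); have hIm k := le_trans (le_Im_cabs (z k)) (hz k).
have := lerD (sign_contraction0 n x convex_gauge_sqr hRe) (sign_contraction0 n x convex_gauge_sqr hIm).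
rewrite -cube_meanD => h.
apply: (@le_trans _ _ (2 * (cube_mean n (fun s => rho (sign_sum n x s) ^+ 2) + cube_mean n (fun s => rho (sign_sum n x s) ^+ 2)))); last lra.
apply: (le_trans _ (ler_wpM2l _ h)) => //; rewrite -cube_meanZ; apply: cube_mean_le => s _.
rewrite sign_sum_ReIm; set u := sign_sum _ _ _; set v := sign_sum _ _ _.
have : rho (u + 'i *: v) <= rho u + rho v.
  by apply: le_trans (snormD hr _ _) _; rewrite (snormZ hr) cabs_i mul1r.
have := snorm_ge0 hr (u + 'i *: v); move: (rho _) (rho _) (rho _) => a b c c0 abc.
have : c ^+ 2 <= (b + a) ^+ 2 by rewrite !expr2; apply: ler_pM.
have := sqr_ge0 (b - a); rewrite !expr2; lra.
Qed.

(* Averages over signs see unimodular coefficients only through constants. *)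
Lemma unimodular_reverse_holder n x (z : nat -> R[i]) : (forall k, cabs (z k) = 1) ->
  cube_mean n (fun s => rho (sign_sum n (fun k => z k *: x k) s) ^+ 2)
    <= 8 * cube_mean n (fun s => rho (sign_sum n x s)) ^+ 2 /\
  cube_mean n (fun s => rho (sign_sum n x s)) <= 2 * cube_mean n (fun s => rho (sign_sum n (fun k => z k *: x k) s)).
Proof.
move=> hz; split.
  apply: le_trans (complex_sign_contraction_sqr _ _ _) _; first by move=> k; rewrite hz.
  have := sign_reverse_holder n x; lra.
have := @complex_sign_contraction n (fun k => z k *: x k) (fun k => (z k)^-1).
rewrite (_ : (fun k => (z k)^-1 *: (z k *: x k)) = x); first by apply => k; rewrite cabsV hz invr1.
by apply/funext => k; rewrite scalerA mulVf ?scale1r// -cabs_eq0 hz oner_eq0.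
Qed.

End SignSums.

(** * From signs to variables on the circle *)

Section Kahane.
Context {R : realType} {X : completeNormedModType R[i]}.
Context {d : measure_display} {Omega : measurableType d} (P : probability Omega R).
Variables (r r' : nat -> {RV P >-> (R * R)%type}) (hr : rademacher_pair r r').
Local Open Scope ereal_scope.
Let hn := @snorm_rnorm R X.

Lemma rademacher_signs K (phi : R -> R) (e : nat -> R[i]) (x : nat -> X) : measurable_fun setT phi ->
  (forall t, (0 <= phi t)%R) -> (forall k, e k = 1 \/ e k = -1)%R ->
  \int[P]_w (phi (rnorm (\sum_(k < K) toC (r k w) *: (e k *: x k))%R))%:E =
  \int[P]_w (phi (rnorm (\sum_(k < K) toC (r k w) *: x k)%R))%:E.
Proof.
move=> mphi phi0 he; have [ir ur] := rademacher_fst hr.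
pose F (y : 'I_K -> X) := Esum P (@rnorm R X) phi (fun k : 'I_K => r k) y.
rewrite -[LHS]/(F (fun k : 'I_K => e k *: x k)%R) -[RHS]/(F (fun k : 'I_K => x k)).
have flip (a : 'I_K) y : F (fun i => if i == a then (- y i)%R else y i) = F y.
  apply: (Esum_flip (phi := phi) (P := P) hn mphi phi0 (Z := fun k : 'I_K => r k)) => //.
  apply: (independent_iid (@ord_inj K) ir) => i B mB.
  exact: etrans (ur i B mB) (esym (ur a B mB)).
have H m : (m <= K)%N -> F (fun k : 'I_K => if (k < m)%N then e k *: x k else x k)%R = F (fun k : 'I_K => x k).
  elim: m => [|m IH] mK; first by [].
  rewrite -(IH (ltnW mK)); pose a := Ordinal mK.
  have [em|em] := he m.
    congr F; apply/funext => k; rewrite ltnS leq_eqVlt; case: eqVneq => [->|//].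
    by rewrite ltnn em scale1r.
  rewrite -[RHS](flip a); congr F; apply/funext => k; rewrite -val_eqE /= ltnS leq_eqVlt.
  by case: eqVneq => [->|//]; rewrite ltnn em scaleN1r.
by rewrite -(H K (leqnn K)); congr F; apply/funext => k; rewrite ltn_ord.
Qed.

Lemma integral_cube_mean n (F : seq bool -> Omega -> R) (c : R) :
  (forall s, size s = n -> [/\ measurable_fun setT (F s), forall w, (0 <= F s w)%R & \int[P]_w (F s w)%:E = c%:E]) ->
  [/\ measurable_fun setT (fun w => cube_mean n (F ^~ w)), forall w, (0 <= cube_mean n (F ^~ w))%R &
    \int[P]_w (cube_mean n (F ^~ w))%:E = c%:E].
Proof.
elim: n F => [|n IH] F h; first exact: (h [::]).
have [m1 p1 i1] : [/\ measurable_fun setT (fun w => cube_mean n (fun s => F (true :: s) w)),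
   forall w, (0 <= cube_mean n (fun s => F (true :: s) w))%R & \int[P]_w (cube_mean n (fun s => F (true :: s) w))%:E = c%:E].
  by apply: (IH (fun s => F (true :: s))) => s sn; apply: h; rewrite /= sn.
have [m2 p2 i2] : [/\ measurable_fun setT (fun w => cube_mean n (fun s => F (false :: s) w)),
   forall w, (0 <= cube_mean n (fun s => F (false :: s) w))%R & \int[P]_w (cube_mean n (fun s => F (false :: s) w))%:E = c%:E].
  by apply: (IH (fun s => F (false :: s))) => s sn; apply: h; rewrite /= sn.
split.
- by apply: measurable_funM => //; exact: measurable_funD.
- by move=> w /=; rewrite divr_ge0// addr_ge0//; [exact: p1|exact: p2].
transitivity (\int[P]_w (2^-1%:E * ((cube_mean n (fun s => F (true :: s) w))%:E + (cube_mean n (fun s => F (false :: s) w))%:E))).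
  by apply: eq_integral => w _; rewrite -EFinD -EFinM mulrC.
rewrite ge0_integralZl//; first last.
- by move=> w _; rewrite -EFinD lee_fin addr_ge0.
- by apply: emeasurable_funD; exact/measurable_EFinP.
rewrite ge0_integralD//; try exact/measurable_EFinP; try by move=> w _; rewrite lee_fin.
by rewrite i1 i2 -EFinD -EFinM; congr (_%:E); field.
Qed.

(** Inserting deterministic signs does not change the law of the sum, so its first and second
    moments are averages over the sign cube as well. For almost every [w] the coefficients are
    unimodular, and [unimodular_reverse_holder] compares both cube averages with the number [c1], in
    which no [w] occurs. *)
Lemma kahane K (x : nat -> X) :
  exists2 m : R, \int[P]_w (rsum r (fun k : 'I_K => x k) w)%:E = m%:E & (rnrm r (fun k : 'I_K => x k) <= 6 * m)%R.
Proof.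
set xx := fun k : 'I_K => x k.
have mr := @measurable_rsum _ _ _ _ P r K.
have sum_ge0 : (0 <= \sum_(k < K) rnorm (x k))%R by apply: sumr_ge0 => k _; exact: rnorm_ge0.
have fin : \int[P]_w (rsum r xx w)%:E \is a fin_num.
  rewrite ge0_fin_numE; last by apply: integral_ge0 => w _; rewrite lee_fin rsum_ge0.
  apply: (@le_lt_trans _ _ (\int[P]_w (\sum_(k < K) rnorm (x k))%R%:E)).
    apply: ae_ge0_le_integral => //.
    - by move=> w _; rewrite lee_fin rsum_ge0.
    - exact/measurable_EFinP.
    apply: filterS (ae_unimodular hr) => w hw _; rewrite lee_fin.
    apply: le_trans (snorm_sum hn _ _ _) _; apply: ler_sum => k _.
    by rewrite rnormZ (hw k).1 mul1r.
  rewrite (_ : \int[P]_w _ = (\sum_(k < K) rnorm (x k))%R%:E * P setT); last exact: integral_cst.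
  by rewrite probability_setT mule1 ltry.
pose m := fine (\int[P]_w (rsum r xx w)%:E).
have mE : \int[P]_w (rsum r xx w)%:E = m%:E by rewrite /m fineK.
exists m => //.
pose V w s := sign_sum K (fun k => toC (r k w) *: x k)%R s.
have VE w s : V w s = (\sum_(k < K) toC (r k w) *: (sgn (nth false s k) *: x k))%R.
  by apply: eq_bigr => k _; rewrite !scalerA mulrC.
have sgnP (s : seq bool) k : (sgn (nth false s k) = 1 :> R[i] \/ sgn (nth false s k) = -1 :> R[i])%R.
  by case: (nth false s k); [left|right].
have mV s : measurable_fun setT (fun w => rnorm (V w s)).
  by rewrite (_ : (fun w => _) = rsum r (fun k : 'I_K => sgn (nth false s k) *: x k)%R)//; apply/funext => w; rewrite VE.
have signs (phi : R -> R) s : measurable_fun setT phi -> (forall t, (0 <= phi t)%R) ->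
    \int[P]_w (phi (rnorm (V w s)))%:E = \int[P]_w (phi (rsum r xx w))%:E.
  move=> mphi phi0; rewrite -[RHS](rademacher_signs K x mphi phi0 (sgnP s)).
  by apply: eq_integral => w _; rewrite VE.
have [|m1 p1 i1] := @integral_cube_mean K (fun s w => rnorm (V w s)) m.
  move=> s _; split=> //; first by move=> w; exact: rnorm_ge0.
  have := signs (fun t => `|t|%R) s (@normr_measurable R setT) (fun t => normr_ge0 t).
  under eq_integral do rewrite (ger0_norm (rnorm_ge0 _)).
  by under [X in _ = X -> _]eq_integral do rewrite (ger0_norm (rsum_ge0 _ _ _)); rewrite mE.
have [|m2 p2 i2] := @integral_cube_mean K (fun s w => rnorm (V w s) ^+ 2)%R (rnrm r xx ^+ 2)%R.
  move=> s _; split; [exact: measurable_funX|by move=> w; exact: sqr_ge0|].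
  rewrite -(moment2_rsum hr xx).
  exact: (signs (fun t => t ^+ 2)%R s (@exprn_measurable R setT 2) (fun t => sqr_ge0 t)).
have aem := ae_unimodular hr.
pose c1 := cube_mean K (fun s => rnorm (sign_sum K x s)).
have c10 : (0 <= c1)%R by apply: cube_mean_ge0 => s _; exact: rnorm_ge0.
have cst_int (y : \bar R) : \int[P]_w y = y.
  by transitivity (y * P setT); [exact: integral_cst|rewrite probability_setT mule1].
have h1 : (rnrm r xx ^+ 2 <= 8 * c1 ^+ 2)%R.
  rewrite -lee_fin -i2 -[leRHS]cst_int; apply: ae_ge0_le_integral => //.
  - by move=> w _; rewrite lee_fin.
  - exact/measurable_EFinP.
  - by move=> w _; rewrite lee_fin mulr_ge0// sqr_ge0.
  apply: filterS aem => w hw _; rewrite lee_fin.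
  by have [] := unimodular_reverse_holder hn K x (fun k => (hw k).1).
have h2 : (c1 <= 2 * m)%R.
  rewrite -lee_fin -[leLHS]cst_int EFinM -i1 -ge0_integralZl//; first last.
  - by move=> w _; rewrite lee_fin.
  - exact/measurable_EFinP.
  apply: ae_ge0_le_integral => //.
  - by move=> w _; rewrite -EFinM lee_fin mulr_ge0.
  - by apply: emeasurable_funM => //; exact/measurable_EFinP.
  apply: filterS aem => w hw _; rewrite -EFinM lee_fin.
  by have [] := unimodular_reverse_holder hn K x (fun k => (hw k).1).
have r0 := rnrm_ge0 r xx.
(* From [8 * c1 ^+ 2] and [c1 <= 2 * m] comes [32 * m ^+ 2], rounded up to a square. *)
have : (rnrm r xx ^+ 2 <= (6 * m) ^+ 2)%R.
  have : (c1 ^+ 2 <= (2 * m) ^+ 2)%R by rewrite !expr2; apply: ler_pM.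
  by rewrite !exprMn; have := sqr_ge0 m; lra.
by rewrite ler_pXn2r// nnegrE; lra.
Qed.

End Kahane.

(* The integral of a nonnegative function is a supremum over simple functions,
   hence monotone even when the majorant is not measurable. *)
Lemma le_integral_nonmeasurable {d} {T : measurableType d} {R : realType}
    (mu : {measure set T -> \bar R}) (D : set T) (f g : T -> \bar R) :
  (forall t, D t -> (0 <= f t)%E) -> (forall t, D t -> (f t <= g t)%E) ->
  (\int[mu]_(t in D) f t <= \int[mu]_(t in D) g t)%E.
Proof.
move=> f0 fg; have g0 t : D t -> (0 <= g t)%E by move=> Dt; exact: le_trans (f0 t Dt) (fg t Dt).
rewrite !ge0_integralE//; apply: ereal_sup_le => _ [h hf <-].
exists h => // t; apply: le_trans (hf t) _.
by rewrite !patchE; case: ifPn => // /set_mem; exact: fg.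
Qed.

Lemma Lnorm2_nonmeasurable_le {d} {T : measurableType d} {R : realType}
    (mu : {measure set T -> \bar R}) (f g : T -> \bar R) : (forall t, (0 <= f t <= g t)%E) ->
  ('N[mu]_2%:E[f] <= 'N[mu]_2%:E[g])%E.
Proof.
move=> h; have f0 t : (0 <= f t)%E by have /andP[] := h t.
have fg t : (f t <= g t)%E by have /andP[] := h t.
have g0 t : (0 <= g t)%E by exact: le_trans (f0 t) (fg t).
rewrite unlock; apply: gt0_ler_poweR; rewrite ?invr_ge0// ?in_itv /= ?leey ?andbT//.
- by apply: integral_ge0 => t _; exact: poweR_ge0.
- by apply: integral_ge0 => t _; exact: poweR_ge0.
apply: le_integral_nonmeasurable => t _; first exact: poweR_ge0.
by rewrite !gee0_abs//; apply: gt0_ler_poweR; rewrite ?in_itv /= ?leey ?andbT.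
Qed.

Section StepBound.
Context {R : realType}.

(** Only a step function below [f] is integrated, and monotonicity of the integral asks for no
    measurability of [f]. *)
Lemma dyadic_step_bound (f : R -> R) (v : nat -> R) L : (forall n, 0 <= v n) -> (forall t, 0 < t -> 0 <= f t) ->
  (forall n t, (2 ^ n)%:R^-1 <= t < 2 * (2 ^ n)%:R^-1 -> v n <= f t) ->
  ((\sum_(n < L) v n / (2 ^ n)%:R)%:E <= \int[lebesgue_measure]_(t in `]0%R, +oo[) (f t)%:E)%E.
Proof.
move=> v0 f0 hv; pose I n : set R := `[(2 ^ n)%:R^-1, 2 * (2 ^ n)%:R^-1[%classic.
have mI n : measurable (I n) by exact: measurable_itv.
have pw n : 0 < (2 ^ n)%:R^-1 :> R by rewrite invr_gt0 ltr0n expn_gt0.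
pose h L t : R := \sum_(n < L) v n * \1_(I n) t.
have h0 L' t : 0 <= h L' t by apply: sumr_ge0 => n _; rewrite mulr_ge0// indicE; case: (_ \in _).
(* Disjointness of the dyadic intervals: the first [L'] of them lie in [t >= 2 * 2 ^- L']. *)
have low L' t : t < 2 * (2 ^ L')%:R^-1 -> h L' t = 0.
  elim: L' => [|L' IH] ht; first by rewrite /h big_ord0.
  rewrite /h big_ord_recr /= -/(h L' t) IH ?add0r.
    rewrite indicE memNset ?mulr0// /I /= in_itv /= => /andP[/le_lt_trans/(_ ht)].
    by rewrite expnS natrM invfM mulVKf// ltxx.
  apply: lt_le_trans ht _; rewrite ler_pM2l// lef_pV2 ?posrE ?ltr0n ?expn_gt0// ler_nat.
  by rewrite leq_exp2l.
have hf L' t : 0 < t -> h L' t <= f t.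
  elim: L' => [|L' IH] t0; first by rewrite /h big_ord0 f0.
  rewrite /h big_ord_recr /= -/(h L' t) indicE.
  have [/set_mem|_] := boolP (t \in I L'); last by rewrite mulr0 addr0 IH.
  rewrite /I /= in_itv /= => /andP[t1 t2]; rewrite low// add0r mulr1.
  by apply: hv; rewrite t1.
apply: (@le_trans _ _ (\int[lebesgue_measure]_(t in `]0%R, +oo[) (h L t)%:E)%E); last first.
  apply: le_integral_nonmeasurable => t; rewrite /= in_itv /= andbT => t0; rewrite lee_fin//.
  exact: hf.
have -> : (fun t => (h L t)%:E) = (fun t => (\sum_(n < L) (v n)%:E * (\1_(I n) t)%:E)%E).
  by apply/funext => t; rewrite -sumEFin; apply: eq_bigr => n _; rewrite EFinM.
rewrite ge0_integral_sum//; last 2 first.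
- move=> n; apply/measurable_EFinP.
  apply: measurable_funM; first exact: measurable_cst.
  by apply: measurable_indic; exact: measurable_itv.
- by move=> n t _; rewrite -EFinM lee_fin mulr_ge0// indicE; case: (_ \in _).
rewrite -sumEFin; apply: lee_sum => n _.
rewrite ge0_integralZl//; [|by apply/measurable_EFinP; apply: measurable_indic; exact: measurable_itv|by rewrite lee_fin].
rewrite integral_indic; try exact: measurable_itv.
rewrite EFinM; apply: lee_wpmul2l; first by rewrite lee_fin.
rewrite (_ : I n `&` `]0%R, +oo[ = I n); last first.
  apply/seteqP; split=> [t []//|t It]; split=> //; move: It; rewrite /I /= !in_itv /= andbT => /andP[h1 _].
  exact: lt_le_trans (pw n) h1.
suff H : (((2 ^ n)%:R^-1)%:E <= lebesgue_measure (I n))%E by exact: H.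
rewrite /I lebesgue_measure_itv /= lte_fin ifT; last by have := pw n; lra.
by rewrite -EFinD lee_fin; lra.
Qed.

End StepBound.

(** * Summation over the resolvent scale *)

Section ResolventScale.
Context {R : realType} {X : completeNormedModType R[i]}.
Variable U : R -> X -> X.
Hypothesis hU : C0_group U.
Variable A : set (X * X).
Hypothesis hA : forall x y : X, A (x, y) <-> generator U (x, - 'i *: y).
Variables (th M : R).
Hypotheses (th0 : 0 <= th) (M1 : 1 <= M).
Hypothesis hM : forall s x, rnorm (U s x) <= M * expR (th * `|s|) * rnorm x.
Let hn := @snorm_rnorm R X.
Local Notation res := (resolvent A).
Local Notation ik k := ((k : R)%:C * 'i : R[i]).

(** The decay in [k] is what makes the operators [smooth] uniformly bounded. It comes from [res_qop]
    at a time of order [1 / (k - th)], where the transported resolvent is absorbed into the left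
    side. *)
Lemma resolvent_imaginary k x : th < k -> rnorm (res (ik k) x) <= 4 * M ^+ 2 / (k - th) * rnorm x.
Proof.
move=> thk; have M0 : 0 < M by exact: lt_le_trans ltr01 M1.
have kth : 0 < k - th by rewrite subr_gt0.
have Ik : complex.Im (ik k) = k by rewrite /=; ring.
(* Then [qop] has norm at most [M exp (- 2 M)], which is below 1/2 because
   [exp (2 M) >= 1 + 2 M]. *)
pose t := 2 * M / (k - th); have t0 : 0 <= t by rewrite divr_ge0 ?mulr_ge0 ?ltW.
set v := res (ik k) x.
have kpos : th < `|complex.Im (ik k)| by rewrite Ik; apply: lt_le_trans thk (ler_norm _).
have small s : 0 <= s -> rnorm (qop U s (ik k) x) <= M * rnorm x.
  move=> s0; apply: le_trans (qop_le hM _ _ _) _; rewrite Ik ger0_norm//.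
  rewrite ler_wpM2r ?rnorm_ge0// ler_piMr ?(ltW M0)// -expR0 ler_expR.
  have : 0 <= s * (k - th) by rewrite mulr_ge0// ltW.
  by rewrite mulrBr; lra.
have q1 : rnorm (qop U t (ik k) v) <= 2^-1 * rnorm v.
  apply: le_trans (qop_le hM _ _ _) _; rewrite Ik ger0_norm// ler_wpM2r ?rnorm_ge0//.
  have -> : th * t - t * k = - (2 * M) by rewrite /t; field; lra.
  rewrite expRN ler_pdivrMr ?expR_gt0//; have := expR_ge1Dx (2 * M); lra.
have p1 : rnorm (Phi U t (ik k) x) <= M * rnorm x * t.
  have -> : M * rnorm x * t = M * rnorm x * (t - 0) by rewrite subr0.
  apply: vint_le => //; first by move=> s; exact: qop_vcont.
  by move=> s /andP[s0 _]; exact: small.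
have e := res_qop hU hA M1 hM t x kpos.
have : rnorm v <= 2^-1 * rnorm v + M * rnorm x * t.
  rewrite [X in rnorm X <= _](_ : v = qop U t (ik k) v - 'i *: Phi U t (ik k) x); last by rewrite e addrK.
  apply: le_trans (rnormB _ _) _; rewrite (rnormZ 'i) cabs_i mul1r; exact: lerD.
have -> : 4 * M ^+ 2 / (k - th) * rnorm x = 2 * (M * rnorm x * t).
  by rewrite /t; field; lra.
lra.
Qed.

Variables (mu : R) (thmu : th < mu) (mu0 : 0 < mu).
Definition scale n : R := mu * (2 ^ n)%:R.
Local Notation kap := scale.
Definition smooth n x : X := ik (kap n) *: res (ik (kap n)) x.
Definition rough n x : X := x - smooth n x.
Let CS := 4 * M ^+ 2 * mu / (mu - th).
Let Mge0 : 0 <= M. Proof. exact: le_trans ler01 M1. Qed.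
Let CS0 : 0 <= CS.
Proof.
rewrite /CS; apply: divr_ge0; last by rewrite subr_ge0 ltW.
by rewrite !mulr_ge0 ?Mge0 ?(ltW mu0).
Qed.

Lemma scale_ge n : mu <= kap n.
Proof. by rewrite /scale ler_peMr ?(ltW mu0)// ler1n expn_gt0. Qed.

Lemma scale_gt0 n : 0 < kap n.
Proof. exact: lt_le_trans mu0 (scale_ge n). Qed.

Let th_scale n : th < kap n. Proof. exact: lt_le_trans thmu (scale_ge n). Qed.

Lemma Im_scale n : complex.Im (ik (kap n)) = kap n.
Proof. by rewrite /=; ring. Qed.

Lemma th_Im_scale n : th < `|complex.Im (ik (kap n))|.
Proof. by rewrite Im_scale; apply: lt_le_trans (th_scale n) (ler_norm _). Qed.

Lemma res_scale_le n x : rnorm (res (ik (kap n)) x) <= CS / kap n * rnorm x.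
Proof.
apply: le_trans (resolvent_imaginary x (th_scale n)) _; rewrite ler_wpM2r ?rnorm_ge0// /CS.
have k0 := scale_gt0 n; have muk := scale_ge n.
have thk := th_scale n.
rewrite -subr_ge0 (_ : _ - _ = 4 * M ^+ 2 * (th * (kap n - mu)) / ((mu - th) * kap n * (kap n - th))).
  have n1 : 0 <= 4 * M ^+ 2 by rewrite mulr_ge0// sqr_ge0.
  have n2 : 0 <= th * (kap n - mu) by rewrite mulr_ge0// subr_ge0.
  have n3 : 0 <= (mu - th) * kap n * (kap n - th).
    by apply: mulr_ge0; [apply: mulr_ge0; [rewrite subr_ge0 ltW|exact: ltW]|rewrite subr_ge0 ltW].
  by apply: divr_ge0 => //; exact: mulr_ge0.
by field; move: thmu; lra.
Qed.

Lemma smooth_lin n : linear (smooth n).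
Proof.
have [l _] := bounded_opZ (ik (kap n)) (resolventB hU hA M1 hM (th_Im_scale n)).
exact: l.
Qed.

Lemma smooth_le n x : rnorm (smooth n x) <= CS * rnorm x.
Proof.
rewrite /smooth rnormZ cabsM cabs_i mulr1 cabs_real gtr0_norm ?scale_gt0//.
apply: le_trans (ler_wpM2l _ (res_scale_le n x)) _; first by rewrite ltW// scale_gt0.
by rewrite mulrA mulrCA divff ?mulr1// gt_eqF// scale_gt0.
Qed.

Lemma rough_lin n : linear (rough n).
Proof. by move=> a x y; rewrite /rough (smooth_lin n); lin_ring. Qed.

Lemma rough_le n x : rnorm (rough n x) <= (1 + CS) * rnorm x.
Proof. by apply: le_trans (rnormB _ _) _; rewrite mulrDl mul1r lerD2l smooth_le. Qed.

Lemma rough_domain n x y : A (x, y) -> rnorm (rough n x) <= CS / kap n * rnorm y.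
Proof.
move=> Axy; have e := resolvent_A hU hA M1 hM (th_Im_scale n) Axy.
have -> : rough n x = - res (ik (kap n)) y.
  have lr := resolvent_lin hU hA M1 hM (th_Im_scale n).
  have {e} : ik (kap n) *: res (ik (kap n)) x - res (ik (kap n)) y = x.
    by rewrite -(linear_mapZ lr) -(linear_mapB lr).
  by rewrite /rough /smooth => e; rewrite -[X in X - _]e; lin_ring.
by rewrite rnormN; exact: res_scale_le.
Qed.

(** The resolvent identity between [a] and [2 a]; this is why the scales double. *)
Lemma smooth_double n x : smooth n.+1 x = smooth n (2 *: x - smooth n.+1 x).
Proof.
have h := resolvent_id hU hA M1 hM x (th_Im_scale n.+1) (th_Im_scale n).
have lr := resolvent_lin hU hA M1 hM (th_Im_scale n).
have k2 : ik (kap n.+1) = 2 * ik (kap n).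
  by rewrite /scale expnS natrM !rmorphM /= rmorph_nat; ring.
rewrite /smooth (linear_mapB lr) !(linear_mapZ lr); move: h; rewrite k2.
set a := ik (kap n); set p := res a x; set q := res (2 * a) x; set t := res a q => h.
have e : q = p + (a - 2 * a) *: t by rewrite -h addrC subrK.
rewrite [in LHS]e; clearbody t; lin_ring.
Qed.

(** With [S = smooth n.+1] and [T = 2 - S], [smooth_double] gives [S^2 = smooth n ^2 T^2], and
    [T^2 - 1 = (3 - S)(1 - S)] is this operator. The factor [1 - S = rough n.+1] links it to the
    K-functional. *)
Definition increment n x : X := 3 *: rough n.+1 x - smooth n.+1 (rough n.+1 x).

Lemma smooth_telescope n x : smooth n.+1 (smooth n.+1 x) = smooth n (smooth n x) + smooth n (smooth n (increment n x)).
Proof.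
have lS := smooth_lin n; have lS1 := smooth_lin n.+1.
pose T v := 2 *: v - smooth n.+1 v.
have e v : smooth n.+1 v = smooth n (T v) by exact: smooth_double.
have comm v : smooth n.+1 (smooth n v) = smooth n (smooth n.+1 v).
  rewrite /smooth (linear_mapZ (resolvent_lin hU hA M1 hM (th_Im_scale n.+1))) (linear_mapZ (resolvent_lin hU hA M1 hM (th_Im_scale n))).
  rewrite (resolventC hU hA M1 hM _ (th_Im_scale n.+1) (th_Im_scale n)) !scalerA.
  by rewrite mulrC.
have eT : smooth n.+1 (smooth n.+1 x) = smooth n (smooth n (T (T x))).
  have TS v : T (smooth n v) = smooth n (T v) by rewrite /T comm (linear_mapB lS) (linear_mapZ lS).
  by rewrite (e (smooth n.+1 x)) (e x) TS.
rewrite eT -!(linear_mapD lS); congr (smooth n (smooth n _)).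
rewrite /increment /rough /T !(linear_mapB lS1) (linear_mapZ lS1); lin_ring.
Qed.

Lemma le_K_functional (L t : R) x :
  (forall a b, A (a, b) -> L <= rnorm (x - a) + t * (rnorm a + rnorm b)) -> L <= K_functional A t x.
Proof.
move=> h; apply: lb_le_inf => [|_ [[a b] Aab <-]]; last exact: h.
by exists (rnorm (x - 0) + t * (rnorm (0 : X) + rnorm (0 : X))); exists (0, 0) => //; exact: (A_0 hU hA).
Qed.

Lemma K_functional_ge0 (t : R) x : 0 < t -> 0 <= K_functional A t x.
Proof.
by move=> t0; apply: le_K_functional => a b _; rewrite addr_ge0 ?mulr_ge0 ?addr_ge0 ?rnorm_ge0// ltW.
Qed.

Lemma K_functional_norm (t : R) x : 1 <= t -> rnorm x <= K_functional A t x.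
Proof.
move=> t1; apply: le_K_functional => a b _.
have h1 : rnorm x <= rnorm (x - a) + rnorm a by apply: le_trans (rnormD _ _); rewrite subrK.
have h2 : rnorm a <= t * (rnorm a + rnorm b).
  apply: (@le_trans _ _ (rnorm a + rnorm b)); first by rewrite lerDl rnorm_ge0.
  by rewrite ler_peMl// addr_ge0 ?rnorm_ge0.
lra.
Qed.

Let C1 := 1 + CS + CS / mu.
Let C10 : 0 <= C1. Proof. by rewrite /C1 !addr_ge0// divr_ge0// ltW. Qed.

(** For a competitor [a] of the K-functional, [rough n] is bounded on [x - a] and gains [1 / kap n],
    at most [t / mu], on [a] in the domain. *)
Lemma K_functional_rough n (t : R) x : (2 ^ n)%:R^-1 <= t -> rnorm (rough n x) <= C1 * K_functional A t x.
Proof.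
move=> nt; have N0 : 0 < (2 ^ n)%:R :> R by rewrite ltr0n expn_gt0.
have t0 : 0 < t by apply: lt_le_trans nt; rewrite invr_gt0.
have C1p : 0 < C1 by rewrite /C1 -addrA ltr_pwDl// addr_ge0// divr_ge0// ltW.
rewrite -ler_pdivrMl//; apply: le_K_functional => a b Aab; rewrite ler_pdivrMl//.
have -> : rough n x = rough n (x - a) + rough n a by rewrite -(linear_mapD (rough_lin n)) subrK.
apply: le_trans (rnormD _ _) _.
apply: le_trans (lerD (rough_le n _) (rough_domain n Aab)) _.
have c0 : 0 <= CS / mu by rewrite divr_ge0// ltW.
have h1 : CS / kap n * rnorm b <= CS / mu * (t * rnorm b).
  have -> : CS / kap n * rnorm b = CS / mu * ((2 ^ n)%:R^-1 * rnorm b).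
    by rewrite /scale invfM !mulrA.
  by apply: ler_wpM2l => //; apply: ler_wpM2r; rewrite ?rnorm_ge0.
have h2 : 0 <= t * rnorm a by rewrite mulr_ge0 ?rnorm_ge0// ltW.
have h3 : 0 <= t * rnorm b by rewrite mulr_ge0 ?rnorm_ge0// ltW.
have h4 := rnorm_ge0 (x - a).
have h5 : 0 <= C1 * (t * rnorm a) by rewrite mulr_ge0.
have h6 : 0 <= (1 + CS) * (t * rnorm b) by rewrite mulr_ge0// addr_ge0.
have h7 : 0 <= CS / mu * rnorm (x - a) by rewrite mulr_ge0.
rewrite !mulrDr; move: h5 h6 h7 h1; rewrite /C1 !mulrDl; lra.
Qed.

(** On [[2 ^- n, 2 * 2 ^- n[] the weight [t ^- th1 / t] is at least its value at the right end,
    which explains the factor [2 * 2 ^ th1]; the length of the interval cancels one power of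
    [2 ^ n]. *)
Lemma interp_norm_dyadic (th1 : R) (v : nat -> R) L x : 0 <= th1 -> (forall n, 0 <= v n) ->
  (forall n t, (2 ^ n)%:R^-1 <= t -> v n <= K_functional A t x) ->
  ((\sum_(n < L) (2 ^ n)%:R `^ th1 * v n)%:E <= (2 * 2 `^ th1)%:E * interp_norm A th1 1 x)%E.
Proof.
move=> th10 v0 hv; rewrite /interp_norm invr1 poweRe1; last first.
  apply: integral_ge0 => t; rewrite /= in_itv /= andbT => t0.
  by rewrite lee_fin divr_ge0 ?powR_ge0// ltW.
pose w n : R := (2 ^ n)%:R * ((2 ^ n)%:R `^ th1 * v n) / (2 * 2 `^ th1).
have c0 : 0 < 2 * 2 `^ th1 :> R by rewrite mulr_gt0// powR_gt0.
have N0 n : 0 < (2 ^ n)%:R :> R by rewrite ltr0n expn_gt0.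
have w0 n : 0 <= w n by rewrite /w divr_ge0 ?(ltW c0)// !mulr_ge0// powR_ge0.
have H := @dyadic_step_bound R (fun t => (t `^ (- th1) * K_functional A t x) `^ 1 / t) w L w0.
have -> : \sum_(n < L) (2 ^ n)%:R `^ th1 * v n = 2 * 2 `^ th1 * \sum_(n < L) w n / (2 ^ n)%:R.
  rewrite mulr_sumr; apply: eq_bigr => n _; rewrite /w; field.
  by rewrite !gt_eqF// powR_gt0.
rewrite EFinM; apply: lee_wpmul2l; first by rewrite lee_fin ltW.
apply: H => [t t0|n t /andP[t1 t2]]; first by rewrite divr_ge0 ?powR_ge0// ltW.
have t0 : 0 < t by apply: lt_le_trans t1; rewrite invr_gt0.
rewrite powRr1; last by rewrite mulr_ge0 ?powR_ge0// K_functional_ge0.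
have h1 := hv n t t1.
have h2 : (2 ^ n)%:R / 2 <= t^-1.
  by rewrite -[X in X <= _]invrK invf_div lef_pV2 ?posrE ?divr_gt0//; rewrite ltW.
have h3 : (2 ^ n)%:R `^ th1 / 2 `^ th1 <= t `^ (- th1).
  rewrite powRN -[X in X <= _]invrK invf_div lef_pV2 ?posrE ?divr_gt0 ?powR_gt0//.
  rewrite ler_pdivlMr ?powR_gt0// -powRM ?(ltW t0) ?(ltW (N0 n))//.
  apply: ge0_ler_powR; rewrite ?nnegrE ?mulr_ge0 ?(ltW t0) ?(ltW (N0 n))//.
  by rewrite -ler_pdivlMr// ltW.
have -> : w n = ((2 ^ n)%:R `^ th1 / 2 `^ th1) * v n * ((2 ^ n)%:R / 2).
  by rewrite /w; field; rewrite gt_eqF// powR_gt0.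
apply: ler_pM => //; first by rewrite mulr_ge0// divr_ge0// powR_ge0.
by apply: ler_pM => //; rewrite divr_ge0// powR_ge0.
Qed.

Lemma interp_norm_rough (th1 : R) : 0 <= th1 -> exists2 C, 0 < C & forall L x,
  ((rnorm x + \sum_(n < L) (2 ^ n)%:R `^ th1 * rnorm (rough n x))%:E <= C%:E * interp_norm A th1 1 x)%E.
Proof.
move=> th10; have cp : 0 < 1 + C1 by rewrite ltr_pwDl.
exists ((1 + C1) * (2 * 2 `^ th1)) => [|L x]; first by rewrite !mulr_gt0// powR_gt0.
(* The norm of [x] itself is charged to the scale [n = 0], where [t >= 1] and the K-functional
   dominates it. *)
pose v (n : nat) : R := ((n == 0%N)%:R * rnorm x + rnorm (rough n x)) / (1 + C1).
have v0 n : 0 <= v n by rewrite /v divr_ge0 ?(ltW cp)// addr_ge0 ?mulr_ge0 ?rnorm_ge0.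
have hv n t : (2 ^ n)%:R^-1 <= t -> v n <= K_functional A t x.
  move=> nt; rewrite /v ler_pdivrMr// [leRHS]mulrDr mulr1 [X in _ <= _ + X]mulrC.
  have N0 : 0 < (2 ^ n)%:R :> R by rewrite ltr0n expn_gt0.
  have t0 : 0 < t by apply: lt_le_trans nt; rewrite invr_gt0.
  apply: lerD; last exact: K_functional_rough.
  case: n nt {N0} => [|n] nt /=; last by rewrite mul0r K_functional_ge0.
  by rewrite mul1r; apply: K_functional_norm; move: nt; rewrite expn0 invr1.
have h := interp_norm_dyadic L.+1 th10 v0 hv.
rewrite EFinM -muleA; apply: (le_trans _ (lee_wpmul2l _ h)); last by rewrite lee_fin ltW.
rewrite -EFinM lee_fin mulr_sumr.
have e n : (1 + C1) * ((2 ^ n)%:R `^ th1 * v n) = (2 ^ n)%:R `^ th1 * ((n == 0%N)%:R * rnorm x + rnorm (rough n x)).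
  by rewrite /v mulrCA [X in _ * X]mulrC divfK// gt_eqF.
have -> : \sum_(n < L.+1) (1 + C1) * ((2 ^ n)%:R `^ th1 * v n) =
    \sum_(n < L.+1) (2 ^ n)%:R `^ th1 * (((n : nat) == 0%N)%:R * rnorm x) + \sum_(n < L.+1) (2 ^ n)%:R `^ th1 * rnorm (rough n x).
  by rewrite -big_split; apply: eq_bigr => n _; rewrite e mulrDr.
apply: lerD.
  rewrite big_ord_recl /= expn0 powR1 !mul1r lerDl; apply: sumr_ge0 => n _.
  by rewrite !mulr_ge0 ?powR_ge0 ?rnorm_ge0.
by rewrite big_ord_recr /= lerDl mulr_ge0 ?powR_ge0 ?rnorm_ge0.
Qed.

End ResolventScale.

Lemma bounded_monotone_cauchy {R : realType} (G : nat -> R) (B : R) :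
  (forall n, G n <= G n.+1) -> (forall n, G n <= B) ->
  forall e, 0 < e -> exists N, forall m n, (N <= m)%N -> (N <= n)%N -> `|G m - G n| <= e.
Proof.
move=> inc bnd e e0; have mono m n : (m <= n)%N -> G m <= G n.
  move=> /subnK <-; elim: (n - m)%N => [|k IH]; first by rewrite add0n.
  by apply: le_trans IH _; rewrite addSn.
pose S := range G; have Sne : S !=set0 by exists (G 0%N); exists 0%N.
have Ssup : has_sup S by split=> //; exists B => _ [n _ <-].
have [_ [N _ <-] hN] := sup_adherent e0 Ssup.
exists N => m n Nm Nn.
have ub k : G k <= sup S by apply: (sup_upper_bound Ssup); exists k.
have := mono _ _ Nm; have := mono _ _ Nn; have := ub m; have := ub n.
by rewrite ler_norml; lra.
Qed.

Section SmoothApproximation.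
Context {R : realType} {X : completeNormedModType R[i]}.
Variable U : R -> X -> X.
Hypothesis hU : C0_group U.
Variable A : set (X * X).
Hypothesis hA : forall x y : X, A (x, y) <-> generator U (x, - 'i *: y).
Variables (th M : R).
Hypotheses (th0 : 0 <= th) (M1 : 1 <= M).
Hypothesis hM : forall s x, rnorm (U s x) <= M * expR (th * `|s|) * rnorm x.
Variables (w' w mu : R).
Hypotheses (thw : th < w') (ww : w' < w) (wmu : w' < mu).
Let hn := @snorm_rnorm R X.
Local Notation res := (resolvent A).
Local Notation ik k := ((k : R)%:C * 'i : R[i]).
Let thmu : th < mu. Proof. exact: lt_trans thw wmu. Qed.
Let mu0 : 0 < mu. Proof. exact: le_lt_trans th0 thmu. Qed.
Let wk n : w' < scale mu n. Proof. exact: lt_le_trans wmu (scale_ge mu0 n). Qed.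
Local Notation S n := (smooth A mu n).
Local Notation inc n := (increment A mu n).
Variables (f : R[i] -> X -> X) (Kf : R) (gf : good A w Kf f).

(** f(A) S_n^2 y, as an absolutely convergent integral. *)
Definition calc_term n y : X := Dc A w' (scale mu n) f (ik (scale mu n) ^+ 2 *: y).

Lemma smooth_calc n y : op_calc A w' mu f (S n (S n y), calc_term n y).
Proof.
have h := op_calc_val hU hA th0 M1 hM thw ww (ik (scale mu n) ^+ 2 *: y) (wk n) wmu gf.
have lr := resolvent_lin hU hA M1 hM (th_Im_scale thmu mu0 n).
move: h; rewrite !(linear_mapZ lr) /smooth (linear_mapZ lr) scalerA -expr2; exact.
Qed.

Lemma op_calcD x y x' y' : op_calc A w' mu f (x, y) -> op_calc A w' mu f (x', y') ->
  op_calc A w' mu f (x + x', y + y').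
Proof.
have [l1 _] := Dc_bounded hU hA th0 M1 hM thw ww wmu (good_id A w).
have [l2 _] := Dc_bounded hU hA th0 M1 hM thw ww wmu gf.
move=> e e'; rewrite /op_calc /=.
rewrite -[LHS]/(Dc A w' mu (fun _ v => v) (y + y')) -[RHS]/(Dc A w' mu f (x + x')).
by rewrite (linear_mapD l1) (linear_mapD l2); congr (_ + _).
Qed.

Definition calc_sum L x : X := calc_term 0 x + \sum_(m < L) calc_term m (inc m x).

Lemma calc_sum_op_calc L x : op_calc A w' mu f (S L (S L x), calc_sum L x).
Proof.
elim: L => [|L IH]; first by rewrite /calc_sum big_ord0 addr0; exact: smooth_calc.
rewrite (smooth_telescope hU hA M1 hM thmu mu0) /calc_sum big_ord_recr /= addrA.
by apply: op_calcD; [exact: IH|exact: smooth_calc].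
Qed.

Variables (th1 C : R) (th10 : 0 <= th1) (C0 : 0 <= C).
Hypothesis hC : forall n y, rnorm (calc_term n y) <= C * (2 ^ n)%:R `^ th1 * rnorm y.

Lemma increment_le : exists2 B, 0 <= B & forall n x, rnorm (inc n x) <= B * rnorm (rough A mu n.+1 x).
Proof.
pose CS := 4 * M ^+ 2 * mu / (mu - th).
have CS0 : 0 <= CS.
  rewrite /CS; apply: divr_ge0; last by rewrite subr_ge0 ltW.
  have M0 := le_trans ler01 M1; by rewrite !mulr_ge0 ?(ltW mu0).
exists (3 + CS) => [|n x]; first by rewrite addr_ge0.
apply: le_trans (rnormB _ _) _; rewrite (rnormZ 3) mulrDl; apply: lerD.
  by have := @cabs_real R 3; rewrite rmorph_nat ger0_norm// => ->.
exact: (smooth_le hU hA th0 M1 hM thmu mu0).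
Qed.

(** The interpolation norm dominates the series of increments, so [calc_sum L x], which is f(A)
    S_L^2 x, converges. As S_L^2 x tends to [x] and the two operators in the definition of [op_calc]
    are bounded, the graph relation passes to the limit. *)
Lemma calc_sum_cvg x : interp_space A th1 1 x -> exists z, op_calc A w' mu f (x, z) /\
  forall e, 0 < e -> exists L0, forall L, (L0 <= L)%N -> rnorm (calc_sum L x - z) <= e.
Proof.
move=> hx; have [B B0 hB] := increment_le.
have [C1 C10 hC1] := interp_norm_rough hU hA th0 M1 hM thmu mu0 th10.
pose u n := (2 ^ n)%:R `^ th1 * rnorm (rough A mu n x).
have u0 n : 0 <= u n by rewrite mulr_ge0 ?powR_ge0 ?rnorm_ge0.
pose G L := \sum_(n < L) u n.
have Ginc L : G L <= G L.+1 by rewrite /G big_ord_recr /= lerDl.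
have [I hI] : exists I : R, interp_norm A th1 1 x = I%:E.
  have i0 : (0 <= interp_norm A th1 1 x)%E by exact: poweR_ge0.
  by exists (fine (interp_norm A th1 1 x)); rewrite fineK// ge0_fin_numE.
have Gbnd L : G L <= C1 * I.
  have := hC1 L x; rewrite hI -EFinM lee_fin; apply: le_trans.
  by rewrite lerDr rnorm_ge0.
have Gcau := bounded_monotone_cauchy Ginc Gbnd.
have term_le m : rnorm (calc_term m (inc m x)) <= C * B * u m.+1.
  apply: le_trans (hC _ _) _.
  have h1 : (2 ^ m)%:R `^ th1 <= (2 ^ m.+1)%:R `^ th1 :> R.
    apply: ge0_ler_powR => //; rewrite ?nnegrE ?ler0n// ler_nat leq_exp2l//.
  rewrite -!mulrA; apply: ler_wpM2l => //; rewrite /u mulrCA.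
  by apply: ler_pM => //; rewrite ?powR_ge0 ?rnorm_ge0.
have CB0 : 0 <= C * B by rewrite mulr_ge0.
have diff m k : rnorm (calc_sum (m + k) x - calc_sum m x) <= C * B * (G (m + k).+1 - G m.+1).
  elim: k => [|k IH]; first by rewrite addn0 !subrr mulr0 rnorm0.
  have -> : calc_sum (m + k.+1) x - calc_sum m x = (calc_sum (m + k) x - calc_sum m x) + calc_term (m + k) (inc (m + k) x).
    have -> : calc_sum (m + k.+1) x = calc_sum (m + k) x + calc_term (m + k) (inc (m + k) x).
      by rewrite addnS /calc_sum big_ord_recr /= addrA.
    by rewrite addrAC.
  apply: le_trans (rnormD _ _) _; apply: le_trans (lerD IH (term_le _)) _.
  by rewrite addnS [G (m + k).+2]/G big_ord_recr /= -/(G _) -mulrDr addrAC.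
have cau e : 0 < e -> exists N, forall m n, (N <= m)%N -> (N <= n)%N -> rnorm (calc_sum m x - calc_sum n x) < e.
  move=> e0; have e1 : 0 < e / (C * B + 1) / 2 by rewrite !divr_gt0// ltr_wpDl.
  have [N hN] := Gcau _ e1; exists N => m n Nm Nn.
  have small a b : (N <= a)%N -> (a <= b)%N -> rnorm (calc_sum b x - calc_sum a x) < e.
    move=> Na ab; have := diff a (b - a)%N; rewrite subnKC// => h; apply: le_lt_trans h _.
    have := hN b.+1 a.+1 (leqW (leq_trans Na ab)) (leqW Na); move/(le_trans (ler_norm _)) => h.
    apply: (@le_lt_trans _ _ (C * B * (e / (C * B + 1) / 2))); first exact: ler_wpM2l.
    rewrite -subr_gt0 (_ : _ - _ = e * (C * B + 2) / (2 * (C * B + 1))).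
      by rewrite divr_gt0 ?mulr_gt0// ltr_wpDl.
    by field; rewrite gt_eqF// ltr_wpDl.
  have [mn|/ltnW nm] := leqP m n; last exact: small.
  by rewrite rnormBC; exact: small.
have [z hz] := rnorm_complete cau.
exists z; split; last by move=> e e0; have [N hN] := hz e e0; exists N => L NL; exact: ltW (hN L NL).
pose CS := 4 * M ^+ 2 * mu / (mu - th).
have CS0 : 0 <= CS.
  rewrite /CS; apply: divr_ge0; last by rewrite subr_ge0 ltW.
  have M0 := le_trans ler01 M1; by rewrite !mulr_ge0 ?(ltW mu0).
(* [1 - S^2 = (1 + S)(1 - S)], and [rough L x] tends to 0 because the terms of a convergent series
   with weights at least 1 do. *)
have Sx e : 0 < e -> exists N, forall L, (N <= L)%N -> rnorm (x - S L (S L x)) <= e.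
  move=> e0; have e1 : 0 < e / (1 + CS) by rewrite divr_gt0// ltr_pwDl.
  have [N hN] := Gcau _ e1; exists N => L NL.
  have := hN L.+1 L (leqW NL) NL; rewrite /G big_ord_recr /= addrAC subrr add0r ger0_norm// => uL.
  have -> : x - S L (S L x) = rough A mu L x + S L (rough A mu L x).
    by rewrite {2}/rough (linear_mapB (smooth_lin hU hA M1 hM thmu mu0 L)) /rough; lin_ring.
  apply: le_trans (rnormD _ _) _.
  apply: le_trans (lerD (lexx _) (smooth_le hU hA th0 M1 hM thmu mu0 L _)) _.
  rewrite -/CS -[X in X + _]mul1r -mulrDl -ler_pdivlMl ?ltr_pwDl// mulrC; apply: le_trans uL.
  rewrite /u ler_peMl ?rnorm_ge0//.
  have n1 : (1 : R) <= (2 ^ L)%:R by rewrite ler1n expn_gt0.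
  by have := ler_powR n1 th10; rewrite powRr0.
have [B1 B10 hB1] := bounded_opP (Dc_bounded hU hA th0 M1 hM thw ww wmu (good_id A w)).
have [B2 B20 hB2] := bounded_opP (Dc_bounded hU hA th0 M1 hM thw ww wmu gf).
have [l1 _] := Dc_bounded hU hA th0 M1 hM thw ww wmu (good_id A w).
have [l2 _] := Dc_bounded hU hA th0 M1 hM thw ww wmu gf.
rewrite /op_calc /=; apply/eqP; rewrite -subr_eq0; apply/eqP; apply: rnorm_small => e e0.
rewrite -[decay_calc _ _ _ z]/(Dc A w' mu (fun _ v => v) z) -[decay_calc _ _ _ x]/(Dc A w' mu f x).
have e1 : 0 < e / (B1 + B2 + 1) by rewrite divr_gt0// ltr_wpDl// addr_ge0.
have [N1 hN1] := hz _ e1; have [N2 hN2] := Sx _ e1.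
pose L := maxn N1 N2.
have hL : Dc A w' mu (fun _ v => v) (calc_sum L x) = Dc A w' mu f (S L (S L x)) by exact: calc_sum_op_calc.
have -> : Dc A w' mu (fun _ v => v) z - Dc A w' mu f x =
   Dc A w' mu (fun _ v => v) (z - calc_sum L x) - Dc A w' mu f (x - S L (S L x)).
  by rewrite (linear_mapB l1) (linear_mapB l2) hL; lin_ring.
apply: le_trans (rnormB _ _) _; apply: le_trans (lerD (hB1 _) (hB2 _)) _.
have h1 : rnorm (z - calc_sum L x) <= e / (B1 + B2 + 1) by rewrite rnormBC; exact: ltW (hN1 _ (leq_maxl _ _)).
have h2 := hN2 L (leq_maxr _ _).
apply: le_trans (lerD (ler_wpM2l B10 h1) (ler_wpM2l B20 h2)) _.
rewrite -mulrDl mulrA ler_pdivrMr ?ltr_wpDl ?addr_ge0// mulrC ler_wpM2l ?(ltW e0)//; lra.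
Qed.

End SmoothApproximation.

Section RademacherOperators.
Context {R : realType} {X : completeNormedModType R[i]}.
Context {d : measure_display} {Omega : measurableType d} (P : probability Omega R).
Variables (r r' : nat -> {RV P >-> (R * R)%type}) (hr : rademacher_pair r r').

Lemma rnrm_single (v : X) : rnrm r (fun _ : 'I_1 => v) = rnorm v.
Proof.
have h : moment2 P (rsum r (fun _ : 'I_1 => v)) = (rnorm v ^+ 2)%:E.
  rewrite -(moment2_cst P); apply: ae_eq_integral => //.
  - by apply/measurable_EFinP; apply: measurable_funX; exact: measurable_rsum.
  apply: filterS (ae_unimodular hr) => w hw _.
  by rewrite /rsum big_ord1 rnormZ (hw _).1 mul1r.
move: h; rewrite (moment2_rsum hr) => -[] /eqP.
by rewrite eqrXn2 ?rnrm_ge0 ?rnorm_ge0// => /eqP.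
Qed.

Lemma rsum_op K (T : X -> X) (x : 'I_K -> X) w : linear T ->
  rsum r (fun k => T (x k)) w = rnorm (T (\sum_(k < K) toC (r k w) *: x k)).
Proof.
move=> lT; rewrite /rsum (linear_map_sum _ _ _ lT); congr rnorm.
by apply: eq_bigr => k _; rewrite (linear_mapZ lT).
Qed.

Lemma rnrm_dominated K (S T : X -> X) (C : R) (x : 'I_K -> X) : linear S -> linear T -> 0 <= C ->
  (forall v, rnorm (S v) <= C * rnorm (T v)) -> rnrm r (fun k => S (x k)) <= C * rnrm r (fun k => T (x k)).
Proof.
move=> lS lT C0 h; rewrite -(rnrm_le hr); last by rewrite mulr_ge0// rnrm_ge0.
rewrite exprMn EFinM -(moment2_rsum hr) -moment2_scale; last exact: measurable_rsum.
apply: moment2_le; [exact: measurable_rsum|by apply: measurable_funM => //; exact: measurable_rsum|].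
by apply: aeW => w; rewrite rsum_ge0 /= (rsum_op _ _ lS) (rsum_op _ _ lT).
Qed.

(* Jensen's inequality, through 2 t g <= g^2 + t^2 *)
Lemma mean_le_Lnorm2 (h : Omega -> R) (m : R) : measurable_fun setT h -> (forall w, 0 <= h w) ->
  (\int[P]_w (h w)%:E = m%:E)%E -> (m%:E <= 'N[P]_2%:E[(fun w => (h w)%:E)])%E.
Proof.
move=> mh h0 hm; rewrite Lnorm_moment2//; have q0 := moment2_ge0 P h.
have key (t : R) : 0 < t -> ((2 * t * m)%:E <= moment2 P h + (t ^+ 2)%:E)%E.
  move=> t0; rewrite -(moment2_cst P t) /moment2 -ge0_integralD//; first last.
  - by move=> w _; rewrite lee_fin sqr_ge0.
  - by apply/measurable_EFinP; exact: measurable_funX.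
  - by move=> w _; rewrite lee_fin sqr_ge0.
  rewrite EFinM -hm -ge0_integralZl//; first last.
  - by rewrite lee_fin mulr_ge0// ltW.
  - by move=> w _; rewrite lee_fin.
  - exact/measurable_EFinP.
  apply: ge0_le_integral => //.
  - by move=> w _; rewrite -EFinM lee_fin !mulr_ge0// ltW.
  - by apply: emeasurable_funM => //; exact/measurable_EFinP.
  - by apply: emeasurable_funD => //; apply/measurable_EFinP; exact: measurable_funX.
  move=> w _; rewrite -EFinM -EFinD lee_fin; have := sqr_ge0 (h w - t); rewrite !expr2; lra.
have m0 : 0 <= m by rewrite -lee_fin -hm; apply: integral_ge0 => w _; rewrite lee_fin.
case: (moment2 P h) q0 key => [a| |] q0 key //; last by rewrite poweRyr ?leey// invr_eq0.
rewrite poweR_EFin lee_fin; rewrite lee_fin in q0.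
have [->|mn] := eqVneq m 0; first exact: powR_ge0.
have mp : 0 < m by rewrite lt_def mn.
have := key m mp; rewrite -EFinD lee_fin => k.
have h1 : m ^+ 2 <= a by move: k; rewrite !expr2; lra.
have -> : m = (m ^+ 2) `^ 2^-1 by rewrite -powR_mulrn// -powRrM mulfV// powRr1.
by apply: ge0_ler_powR; rewrite ?nnegrE ?sqr_ge0.
Qed.

End RademacherOperators.

(** * Combination of the estimates *)

Section Assembly.
Context {R : realType} {X : completeNormedModType R[i]}.
Context {d : measure_display} {Omega : measurableType d} (P : probability Omega R).
Variables (g : nat -> {RV P >-> (R * R)%type}) (hg : gaussian_sequence g).
Context {d' : measure_display} {Omega' : measurableType d'} (P' : probability Omega' R).
Variables (r r' : nat -> {RV P' >-> (R * R)%type}) (hr : rademacher_pair r r').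
Hypothesis halpha : property_alpha X r r'.
Variables (p q : R) (hp : 1 <= p <= 2) (hq : 2 <= q).
Hypotheses (htype : has_type X g p) (hcotype : has_cotype X g q).
Variable U : R -> X -> X.
Hypothesis hU : C0_group U.
Variable A : set (X * X).
Hypothesis hA : forall x y : X, A (x, y) <-> generator U (x, - 'i *: y).
Variables (th M : R).
Hypotheses (th0 : 0 <= th) (M1 : 1 <= M).
Hypothesis hM : forall s x, rnorm (U s x) <= M * expR (th * `|s|) * rnorm x.
Variables (w' w mu : R).
Hypotheses (thw : th < w') (ww : w' < w) (wmu : w' < mu).
Let hn := @snorm_rnorm R X.
Let theta := p^-1 - q^-1.
Let thmu : th < mu. Proof. exact: lt_trans thw wmu. Qed.
Let mu0 : 0 < mu. Proof. exact: le_lt_trans th0 thmu. Qed.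

Let theta0 : 0 <= theta.
Proof.
move: hp hq => /andP[p1 p2] q2; rewrite /theta subr_ge0 lef_pV2 ?posrE; lra.
Qed.

(** The powers of N meet: [2 + theta] from the discrete estimate, -4 from [multiplier_bound], and 2
    from the factor [(mu * N) ^+ 2] in [calc_term]. *)
Lemma calc_term_rnrm : exists2 E, 0 <= E & forall (T : set (X -> X)) c, R_bound_const r enorm T c -> 0 <= c ->
  forall n K (f : nat -> R[i] -> X -> X) (x : nat -> X),
  (forall k, (k < K)%N -> (exists Kf, good A w Kf (f k)) /\ forall z, strip w z -> T (f k z)) ->
  rnrm r (fun k : 'I_K => calc_term A w' mu (f k) n (x k)) <= E * c * (2 ^ n)%:R `^ theta * rnrm r (fun k : 'I_K => x k).
Proof.
have /andP[p1 p2] := hp.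
have [D D0 hD] := discrete_bound hg hr halpha p1 hq htype hcotype.
have [E E0 hE] := multiplier_bound hr hU hA th0 M1 hM thw ww wmu.
exists (E * D * mu ^+ 2) => [|T c hT c0 n K f x hf]; first exact: mulr_ge0 (mulr_ge0 E0 D0) (sqr_ge0 _).
pose N := (2 ^ n)%N; have N0 : 0 < N%:R :> R by rewrite ltr0n expn_gt0.
pose Dn := D * c * N%:R `^ (2 + theta).
have Dn0 : 0 <= Dn by rewrite !mulr_ge0// powR_ge0.
have hest : discrete_estimate r T n K Dn.
  move=> m1 m2 c0' V W b S y m10 m20 c00 hV hW hS hb.
  have h := hD T c hT c0 n K m1 m2 c0' V W b S y m10 m20 c00 hV hW hS hb.
  rewrite -(rnrm_le hr); last by rewrite !mulr_ge0 ?rnrm_ge0// ltW.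
  apply: le_trans h _; rewrite [X in (_ <= X%:E)%E]exprMn [X in (_ <= X)%E]EFinM -(moment2_rsum hr).
  rewrite (_ : D * c * c0' * m1 * m2 * _ = Dn * c0' * m1 * m2)//.
  by rewrite /Dn -/theta; ring.
pose Kf k := get [set Kk : R | good A w Kk (f k)].
have gf k : (k < K)%N -> good A w (Kf k) (f k) /\ forall z, strip w z -> T (f k z).
  by move=> /hf[ex Tf]; split=> //; exact: (getPex (P := [set Kk : R | good A w Kk (f k)]) ex).
pose a : R[i] := ((scale mu n)%:C * 'i) ^+ 2.
have := hE T n K Dn f Kf (fun k => a *: x k) Dn0 hest gf.
rewrite (rnrmZ hr a (fun k : 'I_K => x k)) => h; apply: le_trans h _.
rewrite le_eqVlt; apply/orP; left; apply/eqP.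
have -> : cabs a = (mu * N%:R) ^+ 2.
  by rewrite /a cabsX cabsM cabs_i mulr1 cabs_real ger0_norm// mulr_ge0// ltW.
rewrite /Dn powRD; last by rewrite (gt_eqF N0) implybT.
have -> : N%:R `^ 2 = N%:R ^+ 2 :> R by rewrite -powR_mulrn// ltW.
rewrite -/N; field; by rewrite gt_eqF.
Qed.

Let S_lin n := smooth_lin hU hA M1 hM thmu mu0 n.
Let rough_linear n := rough_lin hU hA M1 hM thmu mu0 n.

Lemma increment_lin n : linear (increment A mu n).
Proof.
move=> a x y; rewrite /increment (rough_linear n.+1) (S_lin n.+1); lin_ring.
Qed.

Lemma op_calc_limit (f : R[i] -> X -> X) (Kf C : R) : good A w Kf f -> 0 <= C ->
  (forall n y, rnorm (calc_term A w' mu f n y) <= C * (2 ^ n)%:R `^ theta * rnorm y) ->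
  forall x, interp_space A theta 1 x ->
  op_calc A w' mu f (x, op_fun (op_calc A w' mu f) x) /\
  forall e, 0 < e -> exists L0, forall L, (L0 <= L)%N ->
    rnorm (calc_sum A w' mu f L x - op_fun (op_calc A w' mu f) x) <= e.
Proof.
move=> gf C0 hC x hx.
have [z [hz lz]] := calc_sum_cvg hU hA th0 M1 hM thw ww wmu gf theta0 C0 hC hx.
have hop : op_calc A w' mu f (x, op_fun (op_calc A w' mu f) x).
  by apply: (getPex (P := [set y | op_calc A w' mu f (x, y)])); exists z.
split=> //; rewrite (op_calc_uniq hU hA th0 M1 hM thw wmu hop hz).
exact: lz.
Qed.

(** The triangle inequality over scales yields a sum of L2 norms of [rough] pieces. Kahane's
    inequality replaces each of them by an L1 norm; these sum to the L1 norm of one random variable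
    [h], which lies below the interpolation norm of the random sum, and Jensen returns to L2. *)
Lemma calculus_bound : exists2 C, 0 < C & forall (T : set (X -> X)) c, R_bound_const r enorm T c -> 0 <= c ->
  forall K (f : nat -> R[i] -> X -> X) (x : nat -> X),
  (forall k, (k < K)%N -> (exists Kf, good A w Kf (f k)) /\ forall z, strip w z -> T (f k z)) ->
  (forall k, (k < K)%N -> interp_space A theta 1 (x k)) ->
  (forall k, (k < K)%N -> op_calc A w' mu (f k) (x k, op_fun (op_calc A w' mu (f k)) (x k))) /\
  ((rnrm r (fun k : 'I_K => op_fun (op_calc A w' mu (f k)) (x k)))%:E <=
   (C * c)%:E * 'N[P']_2%:E[(fun o => interp_norm A theta 1 (\sum_(k < K) toC (r k o) *: x k)%R)])%E.
Proof.
have [E E0 hE] := calc_term_rnrm.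
have [B B0 hB] := increment_le hU hA th0 M1 hM thw wmu.
have [C1 C10 hC1] := interp_norm_rough hU hA th0 M1 hM thmu mu0 theta0.
(* Adding 1 makes the constant positive, so that the theorem can divide by it. *)
exists (6 * E * (1 + B) * C1 + 1) => [|T c hT c0 K f x hf hx].
  by rewrite ltr_wpDl// !mulr_ge0 ?addr_ge0// ltW.
have Ec0 : 0 <= E * c by rewrite mulr_ge0.
have lim k : (k < K)%N -> op_calc A w' mu (f k) (x k, op_fun (op_calc A w' mu (f k)) (x k)) /\
  forall e, 0 < e -> exists L0, forall L, (L0 <= L)%N ->
    rnorm (calc_sum A w' mu (f k) L (x k) - op_fun (op_calc A w' mu (f k)) (x k)) <= e.
  move=> kK; have [[Kf gf] Tf] := hf k kK.
  (* The estimate for a family of one element is the operator bound that convergence requires. *)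
  apply: (@op_calc_limit (f k) Kf (E * c) gf Ec0 _ (x k) (hx k kK)) => n y.
  have := hE T c hT c0 n 1%N (fun _ => f k) (fun _ => y) (fun _ _ => hf k kK).
  by rewrite !(rnrm_single hr).
split=> [k /lim[]//|].
set NI := ('N[P']_2%:E[_])%E; have NI0 : (0 <= NI)%E by exact: Lnorm_ge0.
apply/lee_addgt0Pr => e e0.
have eK : 0 < e / K.+1%:R by rewrite divr_gt0.
have lim' (k : 'I_K) : exists L0, forall L, (L0 <= L)%N ->
    rnorm (calc_sum A w' mu (f k) L (x k) - op_fun (op_calc A w' mu (f k)) (x k)) <= e / K.+1%:R.
  by have [_] := lim k (ltn_ord k); apply.
have [L0 hL0] := choice lim'.
(* One truncation beyond all the thresholds [L0 k]; the limits for the individual [k] are taken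
   together. *)
pose L := (\sum_k L0 k)%N.
have LL k : (L0 k <= L)%N by rewrite /L (bigD1 k)//= leq_addr.
pose Z : 'I_K -> X := fun k => op_fun (op_calc A w' mu (f k)) (x k).
pose ZL : 'I_K -> X := fun k => calc_sum A w' mu (f k) L (x k).
have close : rnrm r Z <= rnrm r ZL + e.
  apply: le_trans (snorm_le_add (snorm_rnrm hr K) _ ZL) _; rewrite lerD2l.
  apply: le_trans (rnrm_bound hr _) _; rewrite mul1r.
  apply: (@le_trans _ _ (\sum_(k < K) e / K.+1%:R)).
    by apply: ler_sum => k _; rewrite rnormBC; exact: hL0.
  rewrite sumr_const card_ord -[leLHS]mulr_natr -mulrA; apply: ler_piMr; first exact: ltW.
  by rewrite ler_pdivrMl// mulr1 ler_nat.
pose pw n : R := (2 ^ n)%:R `^ theta.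
have pw0 n : 0 <= pw n by exact: powR_ge0.
have pwS n : pw n <= pw n.+1.
  by apply: ge0_ler_powR => //; rewrite ?nnegrE ?ler0n// ler_nat leq_exp2l.
pose rx n : 'I_K -> X := fun k => rough A mu n (x k).
have [m0 m0E m0K] := kahane hr K x.
have [m mE] : exists m : nat -> R, forall n,
    (\int[P']_o (rsum r (rx n) o)%:E = (m n)%:E)%E /\ rnrm r (rx n) <= 6 * m n.
  have [] := @choice nat R (fun n m => (\int[P']_o (rsum r (rx n) o)%:E = m%:E)%E /\ rnrm r (rx n) <= 6 * m).
    by move=> n; have [m1 h1 h2] := kahane hr K (fun k => rough A mu n (x k)); exists m1.
  by move=> m hm; exists m.
pose V := m0 + \sum_(n < L.+1) pw n * m n.
have m00 : 0 <= m0 by rewrite -lee_fin -m0E; apply: integral_ge0 => o _; rewrite lee_fin rsum_ge0.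
have mn0 n : 0 <= m n by rewrite -lee_fin -(mE n).1; apply: integral_ge0 => o _; rewrite lee_fin rsum_ge0.
have ZLV : rnrm r ZL <= 6 * E * (1 + B) * c * V.
  pose F m : 'I_K -> X := fun k => calc_term A w' mu (f k) m (increment A mu m (x k)).
  apply: le_trans (rnrmD hr (fun k : 'I_K => calc_term A w' mu (f k) 0 (x k)) (fun k => \sum_(m < L) F m k)) _.
  apply: le_trans (lerD (lexx _) (rnrm_sum hr L F)) _.
  have t0 : rnrm r (fun k : 'I_K => calc_term A w' mu (f k) 0 (x k)) <= E * c * (6 * m0).
    have := hE T c hT c0 0%N K f x hf; rewrite expn0 powR1 mulr1 => h; apply: le_trans h _.
    exact: ler_wpM2l.
  (* The increment at scale [n] is controlled by [rough n.+1], and the weight is raised to match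
     that index. *)
  have tF n : rnrm r (F n) <= E * c * (6 * (B * (pw n.+1 * m n.+1))).
    apply: le_trans (hE T c hT c0 n K f (fun k => increment A mu n (x k)) hf) _.
    rewrite -mulrA; apply: ler_wpM2l => //.
    have h1 := rnrm_dominated hr (fun k : 'I_K => x k) (increment_lin n) (rough_linear n.+1) B0 (hB n).
    have h2 : rnrm r (fun k : 'I_K => increment A mu n (x k)) <= B * (6 * m n.+1).
      by apply: le_trans h1 _; apply: ler_wpM2l => //; exact: (mE n.+1).2.
    rewrite (_ : 6 * _ = pw n.+1 * (B * (6 * m n.+1))); last by ring.
    by apply: (ler_pM (pw0 n) (rnrm_ge0 _ _) (pwS n) h2).
  apply: le_trans (lerD t0 (ler_sum _ (fun (n : 'I_L) _ => tF n))) _.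
  rewrite -mulr_sumr -mulr_sumr -mulr_sumr.
  have hS : \sum_(n < L) pw n.+1 * m n.+1 <= \sum_(n < L.+1) pw n * m n.
    by rewrite big_ord_recl /= lerDr mulr_ge0.
  have S0 : 0 <= \sum_(n < L) pw n.+1 * m n.+1 by apply: sumr_ge0 => n _; rewrite mulr_ge0.
  rewrite -mulrDr -mulrDr (_ : 6 * E * (1 + B) * c * V = E * c * (6 * ((1 + B) * V))); last by ring.
  apply: ler_wpM2l => //; apply: ler_wpM2l => //; rewrite mulrDl mul1r /V.
  have h1 : B * \sum_(n < L) pw n.+1 * m n.+1 <= B * \sum_(n < L.+1) pw n * m n by apply: ler_wpM2l.
  have h2 : 0 <= B * m0 by rewrite mulr_ge0.
  have h3 : 0 <= \sum_(n < L.+1) pw n * m n by exact: le_trans S0 hS.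
  rewrite mulrDr; lra.
(* A measurable minorant of the interpolation norm of the random sum, with integral [C1^-1 * V]. The
   interpolation norm itself is compared only through monotonicity of the integral. *)
pose h o := C1^-1 * (rsum r (fun k : 'I_K => x k) o + \sum_(n < L.+1) pw n * rsum r (rx n) o).
have mr (y : 'I_K -> X) : measurable_fun setT (rsum r y) by exact: measurable_rsum.
have msum : measurable_fun setT (fun o => \sum_(n < L.+1) pw n * rsum r (rx n) o).
  by apply: measurable_sum => n; exact: measurable_funM.
have mh : measurable_fun setT h.
  by apply: measurable_funM => //; exact: measurable_funD.
have sum0 o : 0 <= \sum_(n < L.+1) pw n * rsum r (rx n) o.
  by apply: sumr_ge0 => n _; rewrite mulr_ge0// rsum_ge0.
have h0 o : 0 <= h o by rewrite mulr_ge0 ?invr_ge0 ?(ltW C10)// addr_ge0// rsum_ge0.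
have hV : (\int[P']_o (h o)%:E = (C1^-1 * V)%:E)%E.
  under eq_integral do rewrite EFinM EFinD.
  rewrite ge0_integralZl//; first last.
  - by rewrite lee_fin invr_ge0 ltW.
  - by move=> o _; rewrite -EFinD lee_fin addr_ge0// rsum_ge0.
  - by apply: emeasurable_funD; exact/measurable_EFinP.
  rewrite ge0_integralD//; try exact/measurable_EFinP; first last.
  - by move=> o _; rewrite lee_fin.
  - by move=> o _; rewrite lee_fin rsum_ge0.
  rewrite m0E /V EFinM EFinD; congr (_ * (_ + _))%E.
  under eq_integral do rewrite -sumEFin.
  rewrite ge0_integral_sum//; first last.
  - by move=> n o _; rewrite lee_fin mulr_ge0// rsum_ge0.
  - by move=> n; apply/measurable_EFinP; exact: measurable_funM.
  rewrite -sumEFin; apply: eq_bigr => n _.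
  under eq_integral do rewrite EFinM.
  rewrite ge0_integralZl ?lee_fin// ?(mE n).1 ?EFinM//; first exact/measurable_EFinP.
  by move=> o _; rewrite lee_fin rsum_ge0.
have hN : ((C1^-1 * V)%:E <= NI)%E.
  apply: le_trans (mean_le_Lnorm2 mh h0 hV) _.
  apply: Lnorm2_nonmeasurable_le => o; rewrite lee_fin h0 /= /h EFinM lee_pdivrMl//.
  apply: le_trans (hC1 L.+1 _); rewrite lee_fin le_eqVlt; apply/orP; left; apply/eqP.
  congr (_ + _); apply: eq_bigr => n _; congr (_ * _).
  by rewrite /rx (rsum_op r _ _ (rough_linear n)).
apply: (@le_trans _ _ ((6 * E * (1 + B) * c * V)%:E + e%:E)%E).
  by rewrite -EFinD lee_fin; apply: le_trans close _; rewrite lerD2r.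
apply: leeD => //.
have -> : 6 * E * (1 + B) * c * V = 6 * E * (1 + B) * C1 * c * (C1^-1 * V).
  by field; rewrite gt_eqF.
rewrite EFinM; apply: (@le_trans _ _ ((6 * E * (1 + B) * C1 * c)%:E * NI)%E).
  apply: lee_wpmul2l => //; rewrite lee_fin !mulr_ge0 ?addr_ge0// ltW//.
by apply: lee_wpmul2r => //; rewrite lee_fin [leRHS]mulrDl mul1r lerDl.
Qed.

End Assembly.

Theorem theorem6p2 (R : realType) (X : completeNormedModType R[i])
    (hX : exists x : X, x != 0)
    (d : measure_display) (Omega : measurableType d) (P : probability Omega R)
    (g : nat -> {RV P >-> (R * R)%type}) (hg : gaussian_sequence g)
    (d' : measure_display) (Omega' : measurableType d')
    (P' : probability Omega' R)
    (r r' : nat -> {RV P' >-> (R * R)%type}) (hr : rademacher_pair r r')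
    (halpha : property_alpha X r r')
    (p q : R) (hp : 1 <= p <= 2) (hq : 2 <= q)
    (htype : has_type X g p) (hcotype : has_cotype X g q)
    (A : set (X * X)) (U : R -> X -> X) (hU : C0_group U)
    (hA : forall x y : X, A (x, y) <-> generator U (x, - 'i *: y))
    (w : R) (hw : group_type U < w)
    (w' : R) (hw' : group_type U < w' < w) (mu : R) (hmu : w < mu) :
  exists C : R, 0 <= C /\
    forall T : set (X -> X), R_bounded r T ->
      let fA f := op_calc A w' mu f in
      let F := RHinf r w (commutant A `&` T) in
      (forall f, F f -> interp_space A (p^-1 - q^-1) 1 `<=` op_dom (fA f)) /\
      (R_bound r (interp_norm A (p^-1 - q^-1) 1) [set op_fun (fA f) | f in F]
         <= C%:E * R_bound r enorm T)%E.
Proof.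
have /andP[tw' w'w] := hw'.
(* The infimum [group_type U] may fail to be attained; an admissible exponent strictly below [w']
   takes its place. *)
have [th [M [th0 thw M1 hM]]] := group_type_lt hU tw'.
have wmu : w' < mu by exact: lt_trans w'w hmu.
have [C C0 hC] := calculus_bound hg hr halpha hp hq htype hcotype hU hA th0 M1 hM thw w'w wmu.
exists C; split=> [|T [_ [c hc]] fA F]; first exact: ltW.
have goodF f : F f -> (exists Kf, good A w Kf f) /\ forall z, strip w z -> T (f z).
  move=> Ff; split; first exact: (good_of_RH Ff).
  by move=> z sz; have [/(_ z sz) [_ [_ Tf]] _ _ _] := Ff.
split=> [f Ff x hx|].
  (* [R_bounded] does not fix the sign of its constant. *)
  pose c' := Num.max c 0.
  have hc' : R_bound_const r enorm T c'.
    move=> n S y hS hy; apply: le_trans (hc n S y hS hy) _.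
    by apply: lee_wpmul2r; rewrite ?Lnorm_ge0// lee_fin le_max lexx.
  have c'0 : 0 <= c' by rewrite le_max lexx orbT.
  have [h _] := hC T c' hc' c'0 1%N (fun _ => f) (fun _ => x) (fun _ _ => goodF f Ff) (fun _ _ => hx).
  by exists (op_fun (fA f) x); exact: (h 0%N).
(* After division by [C > 0] the right side is an infimum, so each admissible constant [c'] of [T]
   is treated separately and the attainment of the infimum is never at stake. *)
rewrite -lee_pdivrMl//; apply: le_ereal_inf_tmp => _ [c' [c'0 hc'] <-].
rewrite lee_pdivrMl// -EFinM; apply: ereal_inf_lbound; exists (C * c') => //.
split=> [|n S x hS hx]; first by rewrite mulr_ge0// ltW.
have hS' k : exists h, F h /\ op_fun (fA h) = S k by have [h Fh e] := hS k; exists h.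
have [fk hfk] := choice hS'.
pose f (k : nat) : R[i] -> X -> X := if insub k is Some i then fk i else fun _ v => v.
pose y (k : nat) : X := if insub k is Some i then x i else 0.
have fE (k : 'I_n) : f k = fk k by rewrite /f valK.
have yE (k : 'I_n) : y k = x k by rewrite /y valK.
have hf k : (k < n)%N -> (exists Kf, good A w Kf (f k)) /\ forall z, strip w z -> T (f k z).
  by move=> kn; rewrite (fE (Ordinal kn)); apply: goodF; have [] := hfk (Ordinal kn).
have hy k : (k < n)%N -> interp_space A (p^-1 - q^-1) 1 (y k).
  by move=> kn; rewrite (yE (Ordinal kn)); exact: hx.
have [_] := hC T c' hc' c'0 n f y hf hy.
have -> : (fun k : 'I_n => op_fun (op_calc A w' mu (f k)) (y k)) = (fun k => S k (x k)).
  by apply/funext => k; rewrite fE yE; have [_ <-] := hfk k.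
pose NI (v : Omega' -> X) := ('N[P']_2%:E[(fun o => interp_norm A (p^-1 - q^-1) 1 (v o))])%E.
have ye : (fun o => \sum_(k < n) toC (r k o) *: y k) = (fun o => \sum_(k < n) toC (r k o) *: x k).
  by apply/funext => o; apply: eq_bigr => k _; rewrite yE.
rewrite -[X in (_ <= _ * X)%E -> _]/(NI (fun o => \sum_(k < n) toC (r k o) *: y k)) ye => h.
apply: le_trans _ h; rewrite le_eqVlt; apply/orP; left; apply/eqP.
exact: (Lnorm_rsum hr (fun k => S k (x k))).
Qed.
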